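(* Let $W\subset\mathbb{R}^{d}$ be an unbounded set and let $\omega$ be a positive measurable function on $\mathbb{R}^{d}$ such that $$\sup_{x\in\mathbb{R}^{d}}\frac{\omega(\,\cdot\,+x)}{\omega(x)}\in L^{\infty}_{loc}(\mathbb{R}^{d}).$$ Suppose that the weight sequence $\{M_p\}_{p\in\mathbb{N}}$ satisfies $(M.1)$, $(M.2)'$, and $(M.3)'$. Let $\ast$ stand for $(M_p)$ (Beurling case) or $\{M_p\}$ (Roumieu case). Then an ultradistribution $f\in\mathcal{D}'^{\ast}(\mathbb{R}^{d})$ satisfies $$f(x+h)=O(\omega(h)),\quad h\in W,\quad\text{in }\mathcal{D}'^{\ast}(\mathbb{R}^{d}),$$ if and only if for each $R>0$ there are continuous functions $\{f_\alpha\}_{\alpha\in\mathbb{N}^{d}}$ defined on $W_R$ such that, for some $\ell>0$ in the Beurling case (for each $\ell>0$ in the Roumieu case), there exists $C_\ell>0$ for which the bounds $$|f_\alpha(x)|\le C_\ell\frac{\ell^{|\alpha|}}{M_\alpha}\,\omega(x),\qquad x\in W_R,\ \alpha\in\mathbb{N}^{d},$$ hold, and $$f=\sum_{\alpha\in\mathbb{N}^{d}}f_\alpha^{(\alpha)}\qquad\text{in }W_R .$$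
   Context: $\{M_p\}_{p\in\mathbb{N}}$ is a sequence of positive real numbers ($0\in\mathbb{N}$) and $M_\alpha:=M_{|\alpha|}$ for multi-indices $\alpha\in\mathbb{N}^d$. Conditions: - $(M.1)$: $M_p^2\le M_{p-1}M_{p+1}$ for $p\ge1$. - $(M.2)'$: $M_{p+1}\le AH^pM_p$, $p\in\mathbb{N}$, for certain constants $A,H$. - $(M.3)'$: $\sum_{p=1}^\infty M_{p-1}/M_p<\infty$. Ultradistribution spaces. Let $\Omega\subseteq\mathbb{R}^d$ be open. For $K$ a (regular) compact set and $\ell>0$, $\mathcal{E}^{M_p,\ell}(K)$ is the space of smooth $\varphi$ with $\|\varphi\|_{\mathcal{E}^{M_p,\ell}(K)}=\sup_{\alpha\in\mathbb{N}^d}\sup_{x\in K}\frac{|\varphi^{(\alpha)}(x)|}{\ell^{|\alpha|}M_\alpha}<\infty$. Put $\mathcal{D}^{M_p,\ell}_K=\mathcal{E}^{M_p,\ell}(K)\cap\mathcal{D}_K$, where $\mathcal{D}_K$ is the space of smooth functions supported in $K$. Then $\mathcal{D}^{(M_p)}(\Omega)=\varinjlim_{K\Subset\Omega}\varprojlim_{\ell\to0^+}\mathcal{D}^{M_p,\ell}_K$ and $\mathcal{D}^{\{M_p\}}(\Omega)=\varinjlim_{K\Subset\Omega}\varinjlim_{\ell\to\infty}\mathcal{D}^{M_p,\ell}_K$. The strong dual of $\mathcal{D}^{\ast}(\Omega)$ is $\mathcal{D}'^{\ast}(\Omega)$. The relation $f(x+h)=O(\omega(h))$, $h\in W$, in $\mathcal{D}'^{\ast}(\mathbb{R}^d)$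 means that for each $\varphi\in\mathcal{D}^{\ast}(\mathbb{R}^d)$, $\sup_{h\in W}\frac{|\langle f(x+h),\varphi(x)\rangle|}{\omega(h)}<\infty$, where $\langle f(x+h),\varphi(x)\rangle=\langle f(x),\varphi(x-h)\rangle$. $W_R:=W+B(0,R)$ is the open $R$-neighborhood of $W$. Equality ''in $W_R$'' means equality in $\mathcal{D}'^{\ast}(W_R)$. *)

(* Defs.v *)
From HB Require Import structures.
From mathcomp Require Import all_boot all_order all_algebra.
From mathcomp Require Import all_classical all_reals all_analysis measurable_realfun.
From mathcomp Require Import complex.
From mathcomp.analysis.showcase Require summability.

Set Implicit Arguments.
Unset Strict Implicit.
Unset Printing Implicit Defensive.

Import Order.TTheory GRing.Theory Num.Theory.
Import numFieldNormedType.Exports.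

Local Open Scope classical_set_scope.
Local Open Scope ring_scope.

(** * Lebesgue measure on R^n

    The Borel measure is built on [n.-tuple R] by iterating the binary product
    measure; subsets and functions of ['rV[R]_n] are transported along
    [row_of_tuple]. *)

Definition row_of_tuple (R : Type) (n : nat) (t : n.-tuple R) : 'rV[R]_n :=
  \row_i tnth t i.

Lemma product_sigma_finite d1 d2 (T1 : measurableType d1)
    (T2 : measurableType d2) (R : realType)
    (m1 : {sigma_finite_measure set T1 -> \bar R})
    (m2 : {sigma_finite_measure set T2 -> \bar R}) :
  sigma_finite setT (m1 \x m2)%E.
Proof.
have /sigma_finiteP[F [TF ndF Foo]] := sigma_finiteT m1.
have /sigma_finiteP[G [TG ndG Goo]] := sigma_finiteT m2.
exists (fun k => F k `*` G k).
  rewrite -setXTT TF TG; apply/seteqP; split => -[x y].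
    move=> [/= [i _ Fix] [j _ Gjy]]; exists (maxn i j) => //; split.
    - by move: x Fix; exact/subsetPset/ndF/leq_maxl.
    - by move: y Gjy; exact/subsetPset/ndG/leq_maxr.
  by move=> [k _ []/= ? ?]; split; exists k.
move=> k; have [? ?] := Foo k; have [? ?] := Goo k.
split; first exact: measurableX.
by rewrite product_measure1E// lte_mul_pinfty// ge0_fin_numE.
Qed.

Section tuple_measure.
Context {d} {T : measurableType d} {R : realType}.

Definition tuple_cons n (x : T * n.-tuple T) : n.+1.-tuple T :=
  [the n.+1.-tuple T of x.1 :: x.2].

Lemma measurable_tuple_cons n : measurable_fun [set: T * n.-tuple T] (@tuple_cons n).
Proof. exact: (measurable_cons measurable_fst measurable_snd). Qed.

Variable mu : {sigma_finite_measure set T -> \bar R}.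

Section step.
Variables (n : nat) (nu : {sigma_finite_measure set (n.-tuple T) -> \bar R}).

Definition tuple_measure_step : set (n.+1.-tuple T) -> \bar R :=
  pushforward (mu \x nu)%E (@tuple_cons n).

Let step0 : tuple_measure_step set0 = 0%E.
Proof. by rewrite /tuple_measure_step /pushforward preimage_set0 measure0. Qed.

Let step_ge0 A : (0 <= tuple_measure_step A)%E.
Proof. exact: (measure_ge0 (mu \x nu)%E). Qed.

Let step_sigma_additive : semi_sigma_additive tuple_measure_step.
Proof.
move=> F mF tF mUF; rewrite /tuple_measure_step /pushforward preimage_bigcup.
apply: measure_semi_sigma_additive.
- by move=> i; rewrite -[X in measurable X]setTI; exact: measurable_tuple_cons.
- apply/trivIsetP => i j _ _ ij; rewrite -preimage_setI.
  by move/trivIsetP : tF => -> //; rewrite preimage_set0.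
- rewrite -preimage_bigcup -[X in measurable X]setTI.
  exact: measurable_tuple_cons.
Qed.

HB.instance Definition _ := isMeasure.Build _ _ _ tuple_measure_step
  step0 step_ge0 step_sigma_additive.

Let step_sigma_finite : sigma_finite setT tuple_measure_step.
Proof.
have [F TF Foo] := product_sigma_finite mu nu.
pose g (t : n.+1.-tuple T) := (thead t, [tuple of behead t]).
have mg : measurable_fun setT g.
  by apply: measurable_fun_pair;
    [exact: measurable_tnth|exact: measurable_behead].
have gK x : g (tuple_cons x) = x.
  by case: x => x t; rewrite /g /thead; congr (_, _); exact/val_inj.
exists (fun k => g @^-1` F k).
  by rewrite -preimage_bigcup -TF preimage_setT.
move=> k; have [mFk Fkoo] := Foo k; split.
  by rewrite -[X in measurable X]setTI; exact: mg.
rewrite /tuple_measure_step /pushforward.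
suff -> : @tuple_cons n @^-1` (g @^-1` F k) = F k by [].
by apply/seteqP; split => x /=; rewrite gK.
Qed.

HB.instance Definition _ := Measure_isSigmaFinite.Build _ _ _ tuple_measure_step
  step_sigma_finite.

End step.

Definition tuple_measure0 : set (0.-tuple T) -> \bar R := @dirac _ _ [tuple] R.
HB.instance Definition _ := Measure.on tuple_measure0.

Let tuple_measure0_sigma_finite : sigma_finite setT tuple_measure0.
Proof.
exists (fun=> setT); first by rewrite bigcup_const.
by move=> _; split => //; rewrite /tuple_measure0 /dirac /= indicE in_setT ltry.
Qed.

HB.instance Definition _ := Measure_isSigmaFinite.Build _ _ _ tuple_measure0
  tuple_measure0_sigma_finite.

Fixpoint tuple_measure n : {sigma_finite_measure set (n.-tuple T) -> \bar R} :=
  match n with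
  | 0 => tuple_measure0
  | n'.+1 => tuple_measure_step (tuple_measure n')
  end.

End tuple_measure.

Section lebesgue.
Context {R : realType} (n : nat).
Local Notation Rn := 'rV[R]_n.
Local Notation row := (@row_of_tuple R n).

Definition lebesgue_tuple :
    {sigma_finite_measure set (n.-tuple (measurableTypeR R)) -> \bar R} :=
  tuple_measure (@lebesgue_measure R) n.

(** Lebesgue (as opposed to Borel) measurability: a Borel set up to a
    negligible set. *)
Definition lebesgue_measurable (A : set Rn) : Prop :=
  completed_algebra_gen lebesgue_tuple (row @^-1` A).

Definition lebesgue_measurable_fun (g : Rn -> \bar R) : Prop :=
  forall B : set (\bar R), measurable B -> lebesgue_measurable (g @^-1` B).

Definition Linfty_loc (g : Rn -> \bar R) : Prop :=
  lebesgue_measurable_fun g /\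
  forall K : set Rn, compact K -> exists C : R,
    {ae lebesgue_tuple, forall t, K (row t) -> (`|g (row t)| <= C%:E)%E}.

Definition integral_Rn (A : set Rn) (g : Rn -> R[i]) : R[i] :=
  Complex
    (\int[lebesgue_tuple]_(t in row @^-1` A) complex.Re (g (row t)))
    (\int[lebesgue_tuple]_(t in row @^-1` A) complex.Im (g (row t))).

End lebesgue.

(** * Locally convex topologies on subspaces

    A locally convex space is given by its carrier, a subspace of an ambient
    vector space [E], and the sets [U] of [E] such that the trace of [U] on the
    carrier is a neighbourhood of the origin. *)

Record lcs (K : numFieldType) (E : lmodType K) := Lcs {
  lcs_carrier : set E ;
  lcs_nbhs0 : set (set E) }.

Section lcs_constructions.
Context {K : numFieldType}.

Definition absolutely_convex (E : lmodType K) (V : set E) : Prop :=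
  forall (x y : E) (a b : K), V x -> V y -> `|a| + `|b| <= 1 ->
    V (a *: x + b *: y).

Definition normed_lcs (R : realType) (E : lmodType K) (S : set E)
    (N : E -> \bar R) : lcs E :=
  Lcs S [set U | exists2 e : R, 0 < e & [set x | S x /\ (N x < e%:E)%E] `<=` U].

(** Topology generated by the traces of the topologies of the [X i]. *)
Definition proj_lim (E : lmodType K) (I : Type) (D : set I) (X : I -> lcs E) :
    lcs E :=
  let S := \bigcap_(i in D) lcs_carrier (X i) in
  Lcs S [set U | exists (m : nat) (i : 'I_m -> I) (V : 'I_m -> set E),
    (forall k, D (i k) /\ lcs_nbhs0 (X (i k)) (V k)) /\
    S `&` (\bigcap_k V k) `<=` U].

(** Finest locally convex topology making all the inclusions of the [X i]
    continuous (the [X i] being directed, the union is a subspace). *)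
Definition ind_lim (E : lmodType K) (I : Type) (D : set I) (X : I -> lcs E) :
    lcs E :=
  Lcs (\bigcup_(i in D) lcs_carrier (X i))
      [set U | exists V : set E, [/\ absolutely_convex V, V `<=` U &
        forall i, D i -> lcs_nbhs0 (X i) V]].

Section dual.
Context {E : lmodType K} (X : lcs E).

Definition continuous_functional (u : E -> K^o) : Prop :=
  (forall (a : K) (x y : E), lcs_carrier X x -> lcs_carrier X y ->
    u (a *: x + y) = a * u x + u y) /\
  (forall e : K, 0 < e -> lcs_nbhs0 X [set x | `|u x| < e]).

Definition lcs_bounded (B : set E) : Prop :=
  B `<=` lcs_carrier X /\
  forall U, lcs_nbhs0 X U -> exists2 t : K, 0 < t & B `<=` [set t *: y | y in U].

(** Functionals are total functions on [E]; only their values on the carrier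
    of [X] matter. *)
Definition strong_dual : lcs (E -> K^o) :=
  Lcs continuous_functional
      [set U | exists (B : set E) (e : K), [/\ lcs_bounded B, 0 < e &
        [set u | continuous_functional u /\ forall x, B x -> `|u x| <= e]
          `<=` U]].

End dual.

(** Unconditional convergence: the net of the finite partial sums converges. *)
Definition lcs_sums_to (E : lmodType K) (X : lcs E) (I : choiceType)
    (u : I -> E) (s : E) : Prop :=
  [/\ lcs_carrier X s, forall i, lcs_carrier X (u i) &
    forall U, lcs_nbhs0 X U ->
      \forall A \near summability.totally, U (s - summability.partial_sum u A)].

End lcs_constructions.

Section smooth.
Context {R : realType} {n : nat}.
Local Notation Rn := 'rV[R]_n.
Local Notation C := (R[i]).

Definition multi_index (n : nat) := {ffun 'I_n -> nat}.

Definition mi_size (a : multi_index n) : nat := (\sum_(i < n) a i)%N.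

Definition basis_vec (i : 'I_n) : Rn := delta_mx 0 i.

Definition partial_seq (s : seq 'I_n) (g : Rn -> R) : Rn -> R :=
  foldr (fun i h => 'D_(basis_vec i) h) g s.

Definition smooth_real (g : Rn -> R) : Prop :=
  forall s : seq 'I_n, continuous (partial_seq s g) /\
    forall i x, derivable (partial_seq s g) x (basis_vec i).

(** Coordinates are differentiated in a fixed order, which is immaterial for
    smooth functions. *)
Definition mi_partial_real (a : multi_index n) : (Rn -> R) -> Rn -> R :=
  partial_seq (flatten [seq nseq (a i) i | i <- enum 'I_n]).

Definition smooth (phi : Rn -> C^o) : Prop :=
  smooth_real (fun x => complex.Re (phi x)) /\
  smooth_real (fun x => complex.Im (phi x)).

Definition mi_partial (a : multi_index n) (phi : Rn -> C^o) : Rn -> C^o :=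
  fun x => Complex (mi_partial_real a (fun y => complex.Re (phi y)) x)
                   (mi_partial_real a (fun y => complex.Im (phi y)) x).

Definition supported_in (K : set Rn) (phi : Rn -> C^o) : Prop :=
  closure [set x | phi x != 0] `<=` K.

Definition cmod (z : C) : R := Normc.normc z.

(** The sup norm of ['rV[R]_n] is not the Euclidean one. *)
Definition eucl_norm (x : Rn) : R := Num.sqrt (\sum_(i < n) x 0 i ^+ 2).

Definition nbhd_of (W : set Rn) (r : R) : set Rn :=
  [set w + b | w in W & b in [set b | eucl_norm b < r]].

End smooth.

Inductive ultra_class := Beurling | Roumieu.

Section ultra.
Context {R : realType} {n : nat}.
Local Notation Rn := 'rV[R]_n.
Local Notation C := (R[i]).
Implicit Types (M : nat -> R) (K Omega : set Rn) (l : R).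

Definition ultra_norm M l K (phi : Rn -> C^o) : \bar R :=
  ereal_sup [set (cmod (mi_partial p.1 phi p.2) /
                    (l ^+ mi_size p.1 * M (mi_size p.1)))%:E
            | p in [set p : multi_index n * Rn | K p.2]].

Definition D_step M K l : lcs (Rn -> C^o) :=
  normed_lcs
    [set phi | [/\ smooth phi, supported_in K phi &
                   (ultra_norm M l K phi < +oo)%E]]
    (ultra_norm M l K).

(** Test functions on [Omega] are identified with their extension by zero. All
    compact subsets of [Omega] are used; the regular ones are cofinal among
    them. *)
Definition test_space (c : ultra_class) M Omega : lcs (Rn -> C^o) :=
  ind_lim [set K | compact K /\ K `<=` Omega]
    (fun K => match c with
              | Beurling => proj_lim [set l | 0 < l] (D_step M K)
              | Roumieu => ind_lim [set l | 0 < l] (D_step M K)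
              end).

Definition ultradistributions (c : ultra_class) M Omega :
    lcs ((Rn -> C^o) -> C^o) :=
  strong_dual (test_space c M Omega).

(** Derivative of order [a], in the sense of ultradistributions on [Omega], of
    a function [g] defined on [Omega]. *)
Definition ultra_derivative Omega (a : multi_index n) (g : Rn -> C^o) :
    (Rn -> C^o) -> C^o :=
  fun phi => (-1) ^+ mi_size a *
    integral_Rn Omega (fun x => g x * mi_partial a phi x : C).

(** [f(x + h) = O(omega(h)), h \in W], where
    [<f(x + h), phi(x)> = <f(x), phi(x - h)>]. *)
Definition translate_bigO (c : ultra_class) M (f : (Rn -> C^o) -> C^o)
    (W : set Rn) (omega : Rn -> R) : Prop :=
  forall phi, lcs_carrier (test_space c M setT) phi ->
    (ereal_sup [set (cmod (f (fun x => phi (x - h))) / omega h)%:E | h in W]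
      < +oo)%E.

Definition for_class_l (c : ultra_class) (P : R -> Prop) : Prop :=
  match c with
  | Beurling => exists2 l : R, 0 < l & P l
  | Roumieu => forall l : R, 0 < l -> P l
  end.

Definition M1 M : Prop := forall p : nat, (1 <= p)%N ->
  M p ^+ 2 <= M p.-1 * M p.+1.

Definition M2' M : Prop := exists A H : R, forall p : nat,
  M p.+1 <= A * H ^+ p * M p.

Definition M3' M : Prop :=
  (\sum_(1 <= p <oo) (M p.-1 / M p)%:E < +oo)%E.

End ultra.

(* Main.v *)
Require Import Defs.
From mathcomp Require Import all_boot all_order all_algebra.
From mathcomp Require Import finmap.
From mathcomp Require Import all_classical all_reals all_analysis.
From mathcomp Require Import measurable_realfun.
From mathcomp Require Import complex.
From mathcomp Require Import ring lra zify.
From mathcomp.analysis.showcase Require summability.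
Set Implicit Arguments.
Unset Strict Implicit.
Unset Printing Implicit Defensive.
Import Order.TTheory GRing.Theory Num.Theory.
Import numFieldNormedType.Exports.
Local Open Scope classical_set_scope.
Local Open Scope ring_scope.

(* Sufficiency: if [phi] is supported in a ball of radius less than [r], each
   [F_a^(a)] tested on [phi (. - h)] is at most a multiple of
   [omega h * 2 ^- |a|], by the choice of the class parameters and since
   [omega (x + h) <= C * omega h] for bounded [x].

   Necessity is explicit, without duality of Banach spaces. A smooth step
   function of the class, an infinite convolution of averages, gives a partition
   of unity [chi_z] over the integer lattice and a cutoff [theta]; put
   [phi_k x = theta x * exp (i pi k.x / L)]. A gliding hump argument turns the
   pointwise hypothesis into
     [|<f (x + h), phi_k>| <= C * omega h * E (l * |k|)],  h in W,
   where [ln E] is the associated function of the weight sequence. Expand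
   [chi_z psi] in a Fourier series on a cube around some [h_z] in [W], apply
   [f], and integrate the [k]-th coefficient by parts [p_k] times in the
   direction of the largest coordinate of [k], where [p_k] is chosen so that
   [E (l * |k|)] is absorbed with room for summability in [k]. By Leibniz' rule
   the only derivatives of [psi] that occur are pure ones, of order at most
   [p_k]; collecting the terms carrying the same derivative defines [F_a]. *)

(** * Complex series *)

(** The hypothesis bounds [f] on the translates of each test function separately, while a
    representation needs one estimate for all frequencies; the gliding hump supplies that
    uniformity. Only translates by points of [W] are controlled, so a cell is expanded around a
    nearby point of [W] and not around its own centre, and the comparison of [omega] at bounded
    distance moves the bound back to the cell. (M.1) lets products of derivative bounds recombine up
    to powers of [M 0]; (M.2)' turns a polynomial factor in [|k|] into a dilation of the argument of
    [E], which pays for summability over the lattice; (M.3)' makes the steps of the convolution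
    summable. The order [p_k] attains the maximum that defines [E], at a rescaled radius. In the
    Beurling case one scale suffices. In the Roumieu case there is an estimate for each [l], with
    uncontrolled constants, and [p_k] must not depend on [l]: the radius is divided by a factor
    growing so slowly that these constants stay below a power of [|k|]. Since the largest coordinate
    of [k] controls all the others, integrating by parts along it alone yields the whole decay. *)

Section complex_modulus.
Context {R : realType}.
Implicit Types (z w : R[i]) (x : R).

Lemma cmodE z : `|z| = (cmod z)%:C%C.
Proof. by rewrite normc_def; case: z => a b /=. Qed.

Lemma cmod_ge0 z : 0 <= cmod z.
Proof. by case: z => a b; exact: sqrtr_ge0. Qed.

Lemma cmodD z w : cmod (z + w) <= cmod z + cmod w.
Proof. exact: le_normcD. Qed.

Lemma cmodM z w : cmod (z * w) = cmod z * cmod w.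
Proof. exact: Normc.normcM. Qed.

Lemma cmodV z : cmod z^-1 = (cmod z)^-1.
Proof. exact: Normc.normcV. Qed.

Lemma cmodN z : cmod (- z) = cmod z.
Proof. exact: normcN. Qed.

Lemma cmod_eq0 z : cmod z = 0 -> z = 0.
Proof. exact: Normc.eq0_normc. Qed.

Lemma cmod0 : cmod (0 : R[i]) = 0.
Proof. exact: Normc.normc0. Qed.

Lemma cmod1 : cmod (1 : R[i]) = 1.
Proof. exact: Normc.normc1. Qed.

Lemma cmodX z m : cmod (z ^+ m) = cmod z ^+ m.
Proof. by elim: m => [|m IH]; rewrite ?expr0 ?cmod1// !exprS cmodM IH. Qed.

Lemma cmod_real x : cmod x%:C%C = `|x|.
Proof. by rewrite /cmod /Normc.normc /= expr0n/= addr0 sqrtr_sqr. Qed.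

Lemma cmod_sum (I : Type) (r : seq I) (P : pred I) (F : I -> R[i]) :
  cmod (\sum_(i <- r | P i) F i) <= \sum_(i <- r | P i) cmod (F i).
Proof.
elim/big_ind2 : _ => //; first by rewrite cmod0.
by move=> x1 x2 y1 y2 h1 h2; rewrite (le_trans (cmodD _ _))// lerD.
Qed.

Lemma cmod_prod (I : Type) (r : seq I) (P : pred I) (F : I -> R[i]) :
  cmod (\prod_(i <- r | P i) F i) = \prod_(i <- r | P i) cmod (F i).
Proof.
elim/big_ind2 : _ => //; first by rewrite cmod1.
by move=> x1 x2 y1 y2 <- <-; rewrite cmodM.
Qed.

Lemma cReD z w : complex.Re (z + w) = complex.Re z + complex.Re w.
Proof. by case: z; case: w. Qed.

Lemma cImD z w : complex.Im (z + w) = complex.Im z + complex.Im w.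
Proof. by case: z; case: w. Qed.

Lemma cReN z : complex.Re (- z) = - complex.Re z.
Proof. by case: z. Qed.

Lemma cImN z : complex.Im (- z) = - complex.Im z.
Proof. by case: z. Qed.

Lemma cReM z w : complex.Re (z * w) =
  complex.Re z * complex.Re w - complex.Im z * complex.Im w.
Proof. by case: z; case: w. Qed.

Lemma cImM z w : complex.Im (z * w) =
  complex.Re z * complex.Im w + complex.Im z * complex.Re w.
Proof. by case: z; case: w => /= a b c d. Qed.

Lemma cRe_sum (I : Type) (r : seq I) (P : pred I) (F : I -> R[i]) :
  complex.Re (\sum_(i <- r | P i) F i) = \sum_(i <- r | P i) complex.Re (F i).
Proof. by elim/big_ind2 : _ => // x1 x2 y1 y2 <- <-; rewrite cReD. Qed.

Lemma cIm_sum (I : Type) (r : seq I) (P : pred I) (F : I -> R[i]) :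
  complex.Im (\sum_(i <- r | P i) F i) = \sum_(i <- r | P i) complex.Im (F i).
Proof. by elim/big_ind2 : _ => // x1 x2 y1 y2 <- <-; rewrite cImD. Qed.

Lemma Re_le_cmod z : `|complex.Re z| <= cmod z.
Proof.
by case: z => a b /=; rewrite -sqrtr_sqr ler_wsqrtr// lerDl sqr_ge0.
Qed.

Lemma Im_le_cmod z : `|complex.Im z| <= cmod z.
Proof.
by case: z => a b /=; rewrite -sqrtr_sqr ler_wsqrtr// lerDr sqr_ge0.
Qed.

Lemma cmod_le_ReIm z : cmod z <= `|complex.Re z| + `|complex.Im z|.
Proof.
case: z => a b.
have E : Complex a b = a%:C%C + Complex 0 b.
  by apply/eqP; rewrite eq_complex/= addr0 add0r !eqxx.
rewrite {1}E (le_trans (cmodD _ _))// cmod_real; apply: lerD; first exact: lexx.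
by rewrite /cmod /Normc.normc /= expr0n /= add0r sqrtr_sqr.
Qed.

Lemma complex_ext z w : complex.Re z = complex.Re w ->
  complex.Im z = complex.Im w -> z = w.
Proof. by case: z; case: w => /= ? ? ? ? -> ->. Qed.

End complex_modulus.

(** * Complex series dominated by a summable majorant *)

Section summable_sequences.
Context {R : realType}.
Implicit Types (v : nat -> R) (a : nat -> R[i]).

Definition summ v := (forall i, 0 <= v i) /\
  exists V : R, forall m, \sum_(i < m) v i <= V.

Definition tsum v : R := limn (fun m => \sum_(i < m) v i).

Definition tail v m : R := tsum v - \sum_(i < m) v i.

Lemma summ_cvg v : summ v -> cvgn (fun m => \sum_(i < m) v i).
Proof.
move=> [v0 [V vV]]; apply: nondecreasing_is_cvgn.
  by apply/nondecreasing_seqP => m; rewrite big_ord_recr/= lerDl.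
by exists V => _ [m _ <-].
Qed.

Lemma psum_le_tsum v m : summ v -> \sum_(i < m) v i <= tsum v.
Proof.
move=> sv; have := nondecreasing_cvgn_le _ (summ_cvg sv).
apply; apply/nondecreasing_seqP => k; rewrite big_ord_recr/= lerDl.
by case: sv.
Qed.

Lemma tsum_le v V : summ v -> (forall m, \sum_(i < m) v i <= V) ->
  tsum v <= V.
Proof.
by move=> sv vV; apply: limr_le; [exact: summ_cvg|near=> m; exact: vV].
Unshelve. all: by end_near. Qed.

Lemma tsum_ge0 v : summ v -> 0 <= tsum v.
Proof. by move=> sv; rewrite (le_trans _ (psum_le_tsum 0 sv))// big_ord0. Qed.

Lemma tail_ge0 v m : summ v -> 0 <= tail v m.
Proof. by move=> sv; rewrite /tail subr_ge0 psum_le_tsum. Qed.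

Lemma tail0 v : tail v 0 = tsum v.
Proof. by rewrite /tail big_ord0 subr0. Qed.

Lemma tailS v m : tail v m = v m + tail v m.+1.
Proof. by rewrite /tail big_ord_recr/=; ring. Qed.

Lemma tail_cvg0 v : summ v -> tail v @ \oo --> 0.
Proof.
move=> sv; rewrite -[X in _ --> X](subrr (tsum v)).
by apply: cvgB; [exact: cvg_cst|exact: summ_cvg].
Qed.

Lemma psumB_le_tail v m k : summ v -> (m <= k)%N ->
  \sum_(m <= i < k) v i <= tail v m.
Proof.
move=> sv mk; rewrite /tail lerBrDl; apply: le_trans (psum_le_tsum k sv).
by rewrite -!(big_mkord xpredT) -big_cat_nat.
Qed.

Lemma le_summ v w : summ w -> (forall i, 0 <= v i <= w i) -> summ v.
Proof.
move=> [_ [V wV]] vw; split=> [i|]; first by case/andP: (vw i).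
exists V => m; apply: le_trans (wV m); apply: ler_sum => i _.
by case/andP: (vw i).
Qed.

Lemma summZ c v : 0 <= c -> summ v -> summ (fun i => c * v i).
Proof.
move=> c0 [v0 [V vV]]; split=> [i|]; first by rewrite mulr_ge0.
by exists (c * V) => m; rewrite -mulr_sumr ler_wpM2l.
Qed.

Lemma tsumZ c v : 0 <= c -> summ v -> tsum (fun i => c * v i) = c * tsum v.
Proof.
move=> c0 sv; rewrite /tsum; apply/cvg_lim => //.
under eq_fun do rewrite -mulr_sumr.
by apply: cvgMr; exact: summ_cvg.
Qed.

(** The limit is a default value when the partial sums diverge, hence the summable majorants in the
    rules below. *)
Definition csum a : R[i] :=
  Complex (limn (fun m => \sum_(i < m) complex.Re (a i)))
          (limn (fun m => \sum_(i < m) complex.Im (a i))).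

Let cvg_real (v b : nat -> R) : summ v -> (forall i, `|b i| <= v i) ->
  cvgn (fun m => \sum_(i < m) b i).
Proof.
move=> sv bv.
have -> : (fun m => \sum_(i < m) b i) = series b.
  by rewrite seriesEord.
apply: normed_cvg => /=.
have /summ_cvg : summ (fun i => `|b i|).
  by apply: le_summ sv _ => i; rewrite bv normr_ge0.
suff -> : (fun m => \sum_(i < m) `|b i|) = [normed series b] by [].
by apply/funext => m; rewrite -(big_mkord xpredT (fun i => `|b i|)).
Qed.

(** The rate depends on the majorant alone, so it is uniform over families: continuity,
    differentiation, integration and the action of a functional are all passed through a series by
    means of it. *)
Lemma csum_tail v a m : summ v -> (forall i, cmod (a i) <= v i) ->
  cmod (csum a - \sum_(i < m) a i) <= tail v m.
Proof.
move=> sv av.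
have cR := cvg_real sv (fun i => le_trans (Re_le_cmod (a i)) (av i)).
have cI := cvg_real sv (fun i => le_trans (Im_le_cmod (a i)) (av i)).
apply/ler_addgt0Pr => e e0.
have e20 : 0 < e / 2 by rewrite divr_gt0.
move/cvgrPdist_lt/(_ _ e20) : cR => cR.
move/cvgrPdist_lt/(_ _ e20) : cI => cI.
near \oo => k.
have mk : (m <= k)%N by near: k; exact: nbhs_infty_ge.
have h : cmod (csum a - \sum_(i < k) a i) <= e.
  apply: le_trans (cmod_le_ReIm _) _.
  rewrite cReD cImD cReN cImN cRe_sum cIm_sum /=.
  rewrite [leRHS]splitr lerD// ltW//; near: k; [exact: cR|exact: cI].
have -> : csum a - \sum_(i < m) a i =
    (csum a - \sum_(i < k) a i) + \sum_(m <= i < k) a i.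
  rewrite -!(big_mkord xpredT) (big_cat_nat (n:=m) (p:=k))//=; ring.
rewrite addrC (le_trans (cmodD _ _))// lerD//.
apply: le_trans (psumB_le_tail sv mk).
by apply: le_trans (cmod_sum _ _ _) _; exact: ler_sum.
Unshelve. all: by end_near. Qed.

Lemma csum_bound v a : summ v -> (forall i, cmod (a i) <= v i) ->
  cmod (csum a) <= tsum v.
Proof.
by move=> sv av; have := csum_tail 0 sv av; rewrite big_ord0 subr0 tail0.
Qed.

(** Identities between series reduce to a null bound on the distance from the candidate value to the
    partial sums; [e] is any such bound, usually the tail of the majorant. *)
Lemma csum_unique v a s (e : nat -> R) : summ v ->
  (forall i, cmod (a i) <= v i) -> e @ \oo --> 0 ->
  (forall m, cmod (s - \sum_(i < m) a i) <= e m) -> s = csum a.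
Proof.
move=> sv av e0 se; apply/eqP; rewrite -subr_eq0; apply/eqP/cmod_eq0/eqP.
rewrite eq_le cmod_ge0 andbT; apply/ler_addgt0Pr => d d0; rewrite add0r.
have d20 : 0 < d / 2 by rewrite divr_gt0.
move/cvgr0Pnorm_le/(_ _ d20) : e0 => e0.
move/cvgr0Pnorm_le/(_ _ d20) : (tail_cvg0 sv) => t0.
near \oo => m.
have -> : s - csum a = (s - \sum_(i < m) a i) - (csum a - \sum_(i < m) a i).
  by ring.
rewrite (le_trans (cmodD _ _))// cmodN [leRHS]splitr lerD//.
- apply: le_trans (se m) _; apply: le_trans (ler_norm _) _; near: m; exact: e0.
- apply: le_trans (csum_tail m sv av) _; apply: le_trans (ler_norm _) _.
  by near: m; exact: t0.
Unshelve. all: by end_near. Qed.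

Lemma summD v w : summ v -> summ w -> summ (fun i => v i + w i).
Proof.
move=> [v0 [V vV]] [w0 [W wW]]; split=> [i|]; first by rewrite addr_ge0.
exists (V + W) => m; rewrite big_split/=.
by apply: lerD; [exact: vV|exact: wW].
Qed.

Lemma csumD v w a b : summ v -> summ w -> (forall i, cmod (a i) <= v i) ->
  (forall i, cmod (b i) <= w i) ->
  csum (fun i => a i + b i) = csum a + csum b.
Proof.
move=> sv sw av bw; apply/esym.
apply: (@csum_unique (fun i => v i + w i) _ _ (fun m => tail v m + tail w m)).
- exact: summD.
- by move=> i; rewrite (le_trans (cmodD _ _))// lerD.
- by rewrite -(addr0 0); apply: cvgD; exact: tail_cvg0.
- move=> m; rewrite big_split/=.
  have -> : csum a + csum b - (\sum_(i < m) a i + \sum_(i < m) b i) =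
    (csum a - \sum_(i < m) a i) + (csum b - \sum_(i < m) b i) by ring.
  by rewrite (le_trans (cmodD _ _))// lerD// csum_tail.
Qed.

Lemma csumZ v a z : summ v -> (forall i, cmod (a i) <= v i) ->
  csum (fun i => z * a i) = z * csum a.
Proof.
move=> sv av; apply/esym.
apply: (@csum_unique (fun i => cmod z * v i) _ _ (fun m => cmod z * tail v m)).
- exact: summZ (cmod_ge0 _) sv.
- by move=> i; rewrite cmodM ler_wpM2l// cmod_ge0.
- by rewrite -(mulr0 (cmod z)); apply: cvgMr; exact: tail_cvg0.
- by move=> m; rewrite -mulr_sumr -mulrBr cmodM ler_wpM2l ?cmod_ge0// csum_tail.
Qed.

Lemma csumB v w a b : summ v -> summ w -> (forall i, cmod (a i) <= v i) ->
  (forall i, cmod (b i) <= w i) ->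
  csum (fun i => a i - b i) = csum a - csum b.
Proof.
move=> sv sw av bw.
rewrite (csumD sv sw av) => [|i]; last by rewrite cmodN.
congr (_ + _); rewrite -[RHS]mulN1r -(csumZ (-1) sw bw).
by congr csum; apply/funext => i; rewrite mulN1r.
Qed.

Lemma csumZr v a z : summ v -> (forall i, cmod (a i) <= v i) ->
  csum (fun i => a i * z) = csum a * z.
Proof.
move=> sv av; rewrite mulrC -(csumZ z sv av).
by congr csum; apply/funext => i; rewrite mulrC.
Qed.

Lemma eq_csum a b : (forall i, a i = b i) -> csum a = csum b.
Proof. by move=> ab; congr csum; exact/funext. Qed.

Lemma csum0 : csum (fun=> 0) = 0 :> R[i].
Proof.
apply/esym; apply: (@csum_unique (fun=> 0) _ _ (fun=> 0)).
- by split=> //; exists 0 => m; rewrite big1.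
- by move=> i; rewrite cmod0.
- exact: cvg_cst.
- by move=> m; rewrite big1// subr0 cmod0.
Qed.

Lemma csum_sum (I : Type) (r : seq I) (F : I -> nat -> R[i]) (v : I -> nat -> R) :
  (forall j, summ (v j)) -> (forall j i, cmod (F j i) <= v j i) ->
  csum (fun i => \sum_(j <- r) F j i) = \sum_(j <- r) csum (F j).
Proof.
move=> sv Fv; elim: r => [|j r IH].
  by rewrite big_nil -[RHS]csum0; apply: eq_csum => i; rewrite big_nil.
rewrite big_cons -IH.
under eq_csum do rewrite big_cons.
apply: (@csumD (v j) (fun i => \sum_(j <- r) v j i)) => //.
- elim: r {IH} => [|k r IH].
    by split=> [i|]; rewrite ?big_nil//; exists 0 => m; rewrite big1// => i _; rewrite big_nil.
  rewrite (_ : (fun i => _) = fun i => v k i + \sum_(j <- r) v j i).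
    exact: summD.
  by apply/funext => i; rewrite big_cons.
- by move=> i; rewrite (le_trans (cmod_sum _ _ _))// ler_sum.
Qed.

End summable_sequences.

Section products_of_null_sequences.
Context {R : realType}.

(** Past the index where the factors drop below [l], the quotients of the product by [l ^+ p] no
    longer increase, so they are bounded by their first values. *)
Lemma prod_null_seq_le (y : nat -> R) (l : R) : (forall j, 0 <= y j) ->
  y @ \oo --> 0 -> 0 < l ->
  exists2 C : R, 0 < C & forall p, \prod_(j < p) y j <= C * l ^+ p.
Proof.
move=> y0 ycvg l0.
have [N _ yN] : \forall j \near \oo, `|y j| <= l.
  by move/cvgr0Pnorm_le : ycvg => /(_ _ l0).
pose u p := \prod_(j < p) (y j / l).
have u0 p : 0 <= u p by apply: prodr_ge0 => j _; rewrite divr_ge0// ltW.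
have uN k : u (N + k)%N <= u N.
  elim: k => [|k IH]; first by rewrite addn0.
  rewrite addnS /u big_ord_recr/= -/(u _) (le_trans _ IH)// ler_piMr//.
  rewrite ler_pdivrMr// mul1r (le_trans (ler_norm _))// yN//=.
  exact: leq_addr.
(* A sum of nonnegative values dominates each of them, and the added 1 keeps the constant
   positive. *)
exists (1 + \sum_(p < N.+1) u p) => [|p].
  by rewrite ltr_pwDl// sumr_ge0.
suff up : u p <= 1 + \sum_(p < N.+1) u p.
  have -> : \prod_(j < p) y j = u p * l ^+ p.
    rewrite -[in X in _ ^+ X](card_ord p) -prodr_const -big_split/=.
    by apply: eq_bigr => j _; rewrite divfK// gt_eqF.
  by rewrite ler_wpM2r// exprn_ge0// ltW.
have h k : (k <= N)%N -> u k <= 1 + \sum_(p < N.+1) u p.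
  rewrite -ltnS => kN; rewrite (bigD1 (Ordinal kN))//= addrCA lerDl.
  by rewrite addr_ge0// sumr_ge0.
have [pN|Np] := leqP p N; first exact: h.
by rewrite -(subnKC (ltnW Np)) (le_trans (uN _))// h.
Qed.

End products_of_null_sequences.

(** * Weight sequences *)

Section weights.
Context {R : realType} (M : nat -> R).
Hypothesis M_gt0 : forall p, 0 < M p.
Hypothesis HM1 : M1 M.
Hypothesis HM2 : M2' M.
Hypothesis HM3 : M3' M.

Let M_ge0 p : 0 <= M p. Proof. exact: ltW. Qed.
Let M_neq0 p : M p != 0. Proof. exact: lt0r_neq0. Qed.

(** (M.1) says that [M p.+1 / M p] is nondecreasing in [p]; the inequality is kept free of
    quotients. *)
Lemma weight_ratio_le p k : M p.+1 * M (p + k) <= M p * M (p + k).+1.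
Proof.
elim: k => [|k IH]; first by rewrite addn0 mulrC.
have h : M (p + k).+1 ^+ 2 <= M (p + k) * M (p + k).+2.
  by have := HM1 (ltn0Sn (p + k)).
rewrite addnS -(ler_pM2r (M_gt0 (p + k))).
have -> : M p.+1 * M (p + k).+1 * M (p + k) =
  M (p + k).+1 * (M p.+1 * M (p + k)) by ring.
apply: le_trans (_ : M (p + k).+1 * (M p * M (p + k).+1) <= _).
  by rewrite ler_wpM2l.
have -> : M (p + k).+1 * (M p * M (p + k).+1) = M p * M (p + k).+1 ^+ 2 by ring.
have -> : M p * M (p + k).+2 * M (p + k) = M p * (M (p + k) * M (p + k).+2) by ring.
by rewrite ler_wpM2l.
Qed.

(** Raising [p] by one multiplies the left side by the ratio of [M] at [p] and the right side by the
    larger ratio at [p + q]. The factor [M 0] appears because [M] is not normalised. *)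
Lemma weight_superM p q : M p * M q <= M 0 * M (p + q).
Proof.
elim: p => [|p IH]; first by rewrite add0n.
rewrite -(ler_pM2r (M_gt0 p)).
have -> : M p.+1 * M q * M p = M p.+1 * (M p * M q) by ring.
apply: le_trans (_ : M p.+1 * (M 0 * M (p + q)) <= _); first by rewrite ler_wpM2l.
have -> : M p.+1 * (M 0 * M (p + q)) = M 0 * (M p.+1 * M (p + q)) by ring.
have -> : M 0 * M (p.+1 + q) * M p = M 0 * (M p * M (p + q).+1).
  by rewrite addSn; ring.
by rewrite ler_wpM2l// weight_ratio_le.
Qed.

Lemma weight_prod_le n (q : 'I_n.+1 -> nat) :
  \prod_i M (q i) <= M 0 ^+ n * M (\sum_i q i)%N.
Proof.
elim: n q => [|n IH] q; first by rewrite !big_ord_recl !big_ord0 mulr1 addn0 expr0 mul1r.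
rewrite big_ord_recl [in leRHS]big_ord_recl.
apply: le_trans (_ : M (q ord0) * (M 0 ^+ n *
    M (\sum_i q (lift ord0 i))%N) <= _).
  by rewrite ler_wpM2l.
rewrite mulrCA exprSr -mulrA ler_wpM2l ?exprn_ge0//.
exact: weight_superM.
Qed.

(** The general term of (M.3)', with the index shifted to start at 0. *)
Definition weight_inv_ratio p : R := M p / M p.+1.

Lemma weight_inv_ratio_gt0 p : 0 < weight_inv_ratio p.
Proof. by rewrite divr_gt0. Qed.

Lemma weight_inv_ratio_summ : summ weight_inv_ratio.
Proof.
split=> [p|]; first exact/ltW/weight_inv_ratio_gt0.
exists (fine (\sum_(1 <= p <oo) (M p.-1 / M p)%:E)%E) => m.
have h0 p : (0 <= (M p.-1 / M p)%:E)%E by rewrite lee_fin divr_ge0.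
have fin : (\sum_(1 <= p <oo) (M p.-1 / M p)%:E)%E \is a fin_num.
  by rewrite ge0_fin_numE// nneseries_ge0.
rewrite -lee_fin fineK//.
apply: le_trans (nneseries_lim_ge m.+1 _); last by move=> *; exact: h0.
rewrite big_add1/= big_mkord sumEFin lee_fin.
by apply: ler_sum.
Qed.

Lemma weight_inv_ratio_cvg0 : weight_inv_ratio @ \oo --> 0.
Proof.
have s := weight_inv_ratio_summ.
have /= t0 := tail_cvg0 s.
have -> : weight_inv_ratio = fun m => tail weight_inv_ratio m -
    tail weight_inv_ratio (m + 1).
  by apply/funext => m; rewrite addn1 [in RHS]tailS addrK.
rewrite -(subr0 0); apply: cvgB => //.
by rewrite (cvg_shiftn 1).
Qed.

(** By (M.3)' the ratios [M p / M p.+1] tend to 0, so [rho ^+ q / M q] is eventually nonincreasing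
    in [q] and its supremum is attained among finitely many indices. *)
Lemma weight_argmax (rho : R) : 0 <= rho ->
  exists p, forall q, rho ^+ q / M q <= rho ^+ p / M p.
Proof.
move=> rho0.
have [N _ hN] : \forall p \near \oo, `|rho * weight_inv_ratio p| <= 1.
  have : (fun p => rho * weight_inv_ratio p) @ \oo --> 0.
    by rewrite -(mulr0 rho); apply: cvgMr; exact: weight_inv_ratio_cvg0.
  by move/cvgr0Pnorm_le => /(_ _ ltr01).
pose u p := rho ^+ p / M p.
have u0 p : 0 <= u p by rewrite divr_ge0// exprn_ge0.
have uN k : u (N + k)%N <= u N.
  elim: k => [|k IH]; first by rewrite addn0.
  rewrite addnS (le_trans _ IH)//.
  have -> : u (N + k).+1 = u (N + k)%N * (rho * weight_inv_ratio (N + k)).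
    rewrite /u exprS /weight_inv_ratio; field.
    by rewrite !M_neq0.
  by rewrite ler_piMr// (le_trans (ler_norm _))// hN//= leq_addr.
case: (@Order.TotalTheory.arg_maxP _ _ _ (@ord0 N) xpredT (fun i : 'I_N.+1 => u i)) => // i _ hi.
exists i => q; rewrite -/(u q) -/(u i).
have [qN|Nq] := leqP q N.
  by have := hi (Ordinal (qN : q < N.+1)%N) isT.
rewrite -(subnKC (ltnW Nq)) (le_trans (uN _))//.
by have := hi ord_max isT.
Qed.

(** An index where the supremum is attained; the default of [xget] does not intervene for
    nonnegative [rho]. *)
Definition pmax (rho : R) : nat :=
  xget 0%N [set p | forall q, rho ^+ q / M q <= rho ^+ p / M p].

(* [assoc_fun rho] is [exp] of Komatsu's associated function of [M] at [rho] (up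
   to a constant factor). *)
Definition assoc_fun (rho : R) : R := rho ^+ pmax rho / M (pmax rho).

Lemma assoc_ge (rho : R) q : 0 <= rho -> rho ^+ q <= M q * assoc_fun rho.
Proof.
move=> rho0; rewrite mulrC -ler_pdivrMr// /assoc_fun.
rewrite /pmax; case: xgetP => [p -> //|]; have [p hp] := weight_argmax rho0.
by move=> /(_ p hp).
Qed.

Lemma assoc_gt0 (rho : R) : 0 <= rho -> 0 < assoc_fun rho.
Proof.
move=> rho0; have := assoc_ge 0 rho0; rewrite expr0 => h.
by rewrite -(pmulr_rgt0 _ (M_gt0 0)) (lt_le_trans _ h).
Qed.

Lemma assoc_le (rho r : R) : 0 <= rho -> rho <= r -> assoc_fun rho <= assoc_fun r.
Proof.
move=> rho0 rhor; rewrite {1}/assoc_fun ler_pdivrMr// mulrC.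
rewrite (le_trans _ (assoc_ge _ _))//; last exact: le_trans rhor.
by rewrite lerXn2r// nnegrE// (le_trans rho0).
Qed.

(** (M.2)' bounds [rho ^+ p.+1 / M p] by a multiple of [(H1 * rho) ^+ p.+1 / M p.+1]: each factor
    [1 + rho] costs one dilation by [H1], whence the total dilation [H1 ^+ D]. *)
Lemma assoc_polyM (D : nat) : exists C H : R, [/\ 0 < C, 1 <= H &
  forall rho : R, 0 <= rho -> (1 + rho) ^+ D * assoc_fun rho <= C * assoc_fun (H * rho)].
Proof.
have [A [H AH]] := HM2.
(* The constants of (M.2)' may be negative or small. Being at least 1, these also allow the exponent
   [p] of [H] to be raised to [p.+1]. *)
pose H1 : R := 1 + `|H|; pose A1 : R := 1 + `|A|.
have H11 : 1 <= H1 by rewrite lerDl.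
have A11 : 1 <= A1 by rewrite lerDl.
have H10 : 0 < H1 by apply: lt_le_trans H11.
have A10 : 0 < A1 by apply: lt_le_trans A11.
have AH1 p : M p.+1 <= A1 * H1 ^+ p.+1 * M p.
  rewrite (le_trans (AH p))// ler_wpM2r// (le_trans (ler_norm _))// normrM.
  apply: ler_pM => //; first by rewrite /A1 lerDr.
  rewrite normrX exprS (le_trans _ (ler_peMl _ H11))//.
    by apply: lerXn2r; rewrite ?nnegrE ?(ltW H10)//; rewrite /H1 lerDr.
  by rewrite exprn_ge0// ltW.
have step (rho : R) : 0 <= rho -> (1 + rho) * assoc_fun rho <=
    (1 + A1) * assoc_fun (H1 * rho).
  move=> rho0; rewrite [leLHS]mulrDl [leRHS]mulrDl !mul1r; apply: lerD.
    by rewrite assoc_le// ler_peMl.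
  rewrite {1}/assoc_fun mulrA -exprS ler_pdivrMr//.
  set p := pmax rho.
  have H1p : 0 < H1 ^+ p.+1 by rewrite exprn_gt0.
  rewrite -(ler_pM2l H1p) -exprMn.
  have r0 : 0 <= H1 * rho by rewrite mulr_ge0// ltW.
  rewrite (le_trans (assoc_ge p.+1 r0))//.
  have -> : H1 ^+ p.+1 * (A1 * assoc_fun (H1 * rho) * M p) =
    A1 * H1 ^+ p.+1 * M p * assoc_fun (H1 * rho) by ring.
  by rewrite ler_wpM2r// ltW// assoc_gt0.
exists ((1 + A1) ^+ D), (H1 ^+ D); split.
- by rewrite exprn_gt0// addr_gt0.
- by rewrite exprn_ege1.
elim: D => [|D IH] rho rho0; first by rewrite !expr0 !mul1r.
rewrite exprS -mulrA mulrCA (le_trans (ler_wpM2l _ (step _ rho0)))//.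
  by rewrite exprn_ge0// addr_ge0.
rewrite mulrCA [in leRHS]exprS -mulrA ler_wpM2l//; first by rewrite addr_ge0// ltW.
apply: le_trans (_ : (1 + H1 * rho) ^+ D * assoc_fun (H1 * rho) <= _).
  rewrite ler_wpM2r//; first by rewrite ltW// assoc_gt0// mulr_ge0// ltW.
  apply: lerXn2r; rewrite ?nnegrE ?addr_ge0 ?(mulr_ge0 (ltW H10))//.
  by rewrite lerD2l ler_peMl.
rewrite (le_trans (IH _ _))//; first by rewrite mulr_ge0// ltW.
by rewrite [in leRHS]exprSr -mulrA.
Qed.

(* The steps [a j] of an infinite convolution of averages; they come from the
   telescoping of the square roots of the tails of [sum M_p / M_(p+1)]. *)
Lemma mollifier_steps : exists a : nat -> R, [/\ forall j, 0 < a j, summ a &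
  forall l : R, 0 < l -> exists2 C, 0 < C &
    forall p, \prod_(j < p) (2 / a j) <= C * l ^+ p * M p].
Proof.
have s := weight_inv_ratio_summ.
pose x := weight_inv_ratio; pose t := tail x.
have t0 j : 0 <= t j by exact: tail_ge0.
have tS j : t j = x j + t j.+1 by exact: tailS.
have tlt j : t j.+1 < t j by rewrite [t j]tS ltrDr weight_inv_ratio_gt0.
have tgt j : 0 < t j by apply: le_lt_trans (tlt j).
(* With [x j] written as a difference of squares of [sqrt (t j)] and [sqrt (t j.+1)], this choice
   has a telescoping sum and gives [x j <= a j * sqrt (t j)]. Thus [2 / a j] is at most
   [2 * sqrt (t j) / x j], and the null factor [sqrt (t j)] yields every [l]. *)
pose a j := 2 * (Num.sqrt (t j) - Num.sqrt (t j.+1)).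
have a0 j : 0 < a j by rewrite mulr_gt0// subr_gt0 ltr_sqrt.
have xa j : x j <= a j * Num.sqrt (t j).
  have -> : x j = Num.sqrt (t j) ^+ 2 - Num.sqrt (t j.+1) ^+ 2.
    by rewrite !sqr_sqrtr// [t j]tS; ring.
  rewrite subr_sqr /a.
  have le1 : Num.sqrt (t j.+1) <= Num.sqrt (t j) by rewrite ler_sqrt// ltW.
  have d0 : 0 <= Num.sqrt (t j) - Num.sqrt (t j.+1) by rewrite subr_ge0.
  have -> : 2 * (Num.sqrt (t j) - Num.sqrt (t j.+1)) * Num.sqrt (t j) =
    (Num.sqrt (t j) - Num.sqrt (t j.+1)) * (Num.sqrt (t j) + Num.sqrt (t j)) by ring.
  by rewrite ler_wpM2l// lerD2l.
have tcvg : (fun j => 2 * Num.sqrt (t j)) @ \oo --> 0.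
  rewrite -(mulr0 2) -[X in 2 * X]sqrtr0; apply: cvgMr.
  apply: (@cvg_comp _ _ _ t Num.sqrt) (tail_cvg0 s) _.
  exact: sqrt_continuous.
exists a; split => // [|l l0].
  split=> [j|]; first exact: ltW.
  exists (2 * Num.sqrt (t 0)) => m.
  have -> : \sum_(i < m) a i = 2 * (Num.sqrt (t 0) - Num.sqrt (t m)).
    elim: m => [|m IH]; first by rewrite big_ord0 subrr mulr0.
    by rewrite big_ord_recr/= IH /a; ring.
  by rewrite ler_pM2l// lerBlDr lerDl.
have [|C C0 hC] := prod_null_seq_le _ tcvg l0; first by move=> j; rewrite mulr_ge0.
exists (C / M 0) => [|p]; first by rewrite divr_gt0.
apply: le_trans (_ : \prod_(j < p) (2 * Num.sqrt (t j)) * (M p / M 0) <= _).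
  elim: p => [|p IH]; first by rewrite !big_ord0 mul1r divff.
  rewrite !big_ord_recr/=.
  have -> : \prod_(i < p) (2 * Num.sqrt (t i)) * (2 * Num.sqrt (t p)) *
      (M p.+1 / M 0) =
    \prod_(i < p) (2 * Num.sqrt (t i)) * (M p / M 0) *
      (2 * Num.sqrt (t p) / x p).
    by rewrite /x /weight_inv_ratio; field; rewrite !M_neq0.
  apply: ler_pM => //.
  - by apply: prodr_ge0 => j _; rewrite divr_ge0// ltW.
  - by rewrite divr_ge0// ltW.
  - by rewrite ler_pdivlMr ?weight_inv_ratio_gt0// mulrAC ler_pdivrMr// -mulrA
      ler_pM2l// mulrC.
apply: le_trans (ler_wpM2r _ (hC p)) _; first by rewrite divr_ge0.
by rewrite le_eqVlt; apply/orP; left; apply/eqP; field.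
Qed.

End weights.

(** * Smooth step functions *)

Section directional_derivative.
Context {R : realType} {V : normedModType R}.
Implicit Types (f : V -> R) (x v : V).

(** Directional derivatives become derivatives in one real variable, where the mean value theorem
    applies. *)
Lemma is_derive_line f x v df :
  is_derive (0 : R) 1 (fun t : R => f (t *: v + x)) df <-> is_derive x v f df.
Proof.
have E : (fun h : R => h^-1 *: (((fun t : R => f (t *: v + x)) \o shift 0) (h *: 1)
    - (fun t : R => f (t *: v + x)) 0)) =
  (fun h : R => h^-1 *: ((f \o shift x) (h *: v) - f x)).
  apply/funext => h /=; rewrite scale0r add0r addr0.
  by rewrite [h *: 1]mulr1.
split=> -[]; rewrite /derivable /derive.
  by rewrite E => h1 h2; split.
by rewrite -E => h1 h2; split.
Qed.

Lemma is_derive_epsP f x v df : is_derive x v f df <->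
  forall e : R, 0 < e -> exists2 d : R, 0 < d & forall t : R, 0 < `|t| < d ->
    `|(f (t *: v + x) - f x) / t - df| <= e.
Proof.
split.
- move=> [cf <-] e e0.
  have /cvgrPdist_le/(_ e e0) : (fun h : R => h^-1 *: ((f \o shift x) (h *: v) - f x))
    h @[h --> 0^'] --> 'D_v f x by exact: cf.
  case=> d d0 hd; exists d => // t /andP[t0 td].
  have := hd t; rewrite /= sub0r normrN distrC => /(_ td).
  by rewrite -normr_gt0 mulrC; apply.
- move=> h.
  have c : (fun h : R => h^-1 *: ((f \o shift x) (h *: v) - f x))
    h @[h --> 0^'] --> df.
    apply/cvgrPdist_le => e e0; have [d d0 hd] := h e e0.
    exists d => // t; rewrite /= sub0r normrN distrC -normr_gt0 => td t0.
    by rewrite [X in `|X - _|]mulrC hd// t0.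
  split; first by apply/cvg_ex; exists df.
  exact/cvg_lim.
Qed.

End directional_derivative.

Section mean_value.
Context {R : realType}.

Lemma is_derive_continuous (f g : R -> R) :
  (forall x : R, is_derive x 1 f (g x)) -> continuous f.
Proof.
move=> fg x; apply: differentiable_continuous; apply/derivable1_diffP.
by case: (fg x).
Qed.

Lemma mean_value (f g : R -> R) (a b : R) : a <= b ->
  (forall x : R, is_derive x 1 f (g x)) ->
  exists2 c, a <= c <= b & f b - f a = g c * (b - a).
Proof.
move=> ab fg; have [|c] := MVT_segment ab (fun x _ => fg x).
  exact/continuous_subspaceT/is_derive_continuous.
by rewrite in_itv => cab fE; exists c.
Qed.

(** The mean value theorem is used twice, for [f] and then for [g]. The rate depends only on a bound
    of the second derivative: differentiation of series and the vanishing of the integral of a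
    derivative both rest on it. *)
Lemma diff_quotient_le (f g k : R -> R) (B t : R) :
  (forall x : R, is_derive x 1 f (g x)) -> (forall x : R, is_derive x 1 g (k x)) ->
  (forall x, `|k x| <= B) -> t != 0 ->
  `|(f t - f 0) / t - g 0| <= B * `|t|.
Proof.
move=> fg gk kB t0.
have lip a b : a <= b -> `|g b - g a| <= B * (b - a).
  move=> ab; have [c _ ->] := mean_value ab gk.
  by rewrite normrM (ger0_norm (_ : 0 <= b - a)) ?subr_ge0// ler_wpM2r// subr_ge0.
have B0 : 0 <= B by apply: le_trans (kB 0).
have [tp|tn] := leP 0 t.
  have [c /andP[c0 ct] ->] := mean_value tp fg.
  rewrite subr0 mulfK// (le_trans (lip _ _ c0))// subr0 ler_wpM2l//.
  by rewrite (le_trans ct)// ler_norm.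
have [c /andP[ct c0] E] := mean_value (ltW tn) fg.
have -> : (f t - f 0) / t = g c.
  by rewrite -opprB E sub0r mulrN opprK mulfK.
rewrite distrC (le_trans (lip _ _ c0))// sub0r ler_wpM2l//.
by rewrite (ltr0_norm tn) lerN2.
Qed.

(** Since [g] vanishes on the left of [c], integration from [c - 1] gives a primitive on the whole
    line: up to that point both the integral and [g] are 0. *)
Lemma primitive_exists (g : R -> R) (c : R) : continuous g ->
  (forall x, x <= c -> g x = 0) -> exists P : R -> R, forall x : R, is_derive x 1 P (g x).
Proof.
move=> gcont g0.
pose mu := @lebesgue_measure R.
exists (fun x => \int[mu]_(t in `[c - 1, x]) g t) => x.
have [cx|xc] := ltP (c - 1) x.
  have xx1 : x < x + 1 by rewrite ltrDl.
  have int : mu.-integrable `[c - 1, x + 1] (EFin \o g).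
    apply: continuous_compact_integrable; first exact: segment_compact.
    exact: continuous_subspaceT.
  have [d1 d2] := continuous_FTC1_closed xx1 int cx (gcont x).
  by split; [exact: d1|rewrite -d2 derive1E].
rewrite g0; last by rewrite (le_trans xc)// gerBl.
have h : is_derive x (1 : R) (cst (0 : R)) 0 by exact: is_derive_cst.
apply: near_eq_is_derive h.
have xc1 : x < c by rewrite (le_lt_trans xc)// gtrBl.
near=> y.
have yc : y < c by near: y; exact: lt_nbhsl.
rewrite /cst (_ : \int[mu]_(t in `[c - 1, y]) g t = \int[mu]_(t in `[c - 1, y]) (fun=> 0) t).
  by rewrite /Rintegral integral0.
apply: eq_Rintegral => t; rewrite inE/= in_itv/= => /andP[_ ty].
by rewrite g0// (le_trans ty)// ltW.
Unshelve. all: by end_near. Qed.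

End mean_value.

Section smooth_step.
Context {R : realType}.
Implicit Types (g k : R -> R) (a s e d x t : R).

(** A 1-Lipschitz transition from 0 to 1. Averaging over [[x, x + a]] only looks to the right, so it
    moves the left edge to [- (s + a)] and leaves the right edge at 1; hence the single
    parameter. *)
Definition step_like s g := [/\ forall x y, `|g x - g y| <= `|x - y|,
  forall x, 0 <= g x <= 1, forall x, x <= - s -> g x = 0 &
  forall x, 1 <= x -> g x = 1].

(** Any primitive does, since only differences of its values are used. *)
Definition primitive g : R -> R :=
  xget (fun=> 0) [set P | forall x : R, is_derive x 1 P (g x)].

Definition average a g x := (primitive g (x + a) - primitive g x) / a.

Definition diffq a g x := (g (x + a) - g x) / a.

Lemma step_like_continuous s g : step_like s g -> continuous g.
Proof.
move=> [lip _ _ _] x; apply/cvgrPdist_le => e e0.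
by exists e => //= y /ltW; apply: le_trans (lip _ _).
Qed.

Lemma primitiveP s g : step_like s g -> forall x : R, is_derive x 1 (primitive g) (g x).
Proof.
move=> sg; have [_ _ g0 _] := sg.
have [P hP] := primitive_exists (step_like_continuous sg) g0.
by rewrite /primitive; case: xgetP => [Q -> //|/(_ P)].
Qed.

Lemma is_derive_comp_shift g k a x : is_derive (x + a) 1 g (k (x + a)) ->
  is_derive x 1 (fun y => g (y + a)) (k (x + a)).
Proof.
move=> /is_derive_line h; apply/is_derive_line.
rewrite [X in is_derive _ _ X](_ : _ = fun t : R => g (t *: 1 + (x + a)))//.
by apply/funext => t; rewrite addrA.
Qed.

Lemma is_derive_diffq a g k : (forall x : R, is_derive x 1 g (k x)) ->
  forall x : R, is_derive x 1 (diffq a g) (diffq a k x).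
Proof.
move=> gk x; rewrite /diffq.
have h := is_derive_comp_shift (gk (x + a)).
have := is_deriveB h (gk x) => /(@is_deriveZ _ _ _ _ a^-1).
rewrite [_ *: (_ - _)]mulrC.
by rewrite [X in is_derive _ _ X](_ : _ = fun y : R => (g (y + a) - g y) / a)//;
  apply/funext => y /=; rewrite -[LHS]/(a^-1 * (g (y + a) - g y)) mulrC.
Qed.

Lemma is_derive_average s a g : step_like s g ->
  forall x : R, is_derive x 1 (average a g) (diffq a g x).
Proof. by move=> sg; exact: is_derive_diffq (primitiveP sg). Qed.

Lemma average_mean s a g x : 0 < a -> step_like s g ->
  exists2 c, x <= c <= x + a & average a g x = g c.
Proof.
move=> a0 sg.
have xxa : x <= x + a by rewrite lerDl ltW.
have [c cx E] := mean_value xxa (primitiveP sg).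
by exists c => //; rewrite /average E addrAC subrr add0r mulfK// gt_eqF.
Qed.

(** The difference of the two averages is a value of [g (t + d) - k t], by the mean value theorem
    for the difference of primitives. A shift [d] gives Lipschitz bounds, [d = 0] the comparison of
    averages. *)
Lemma average_dist s s' a g k e d x : 0 < a -> step_like s g -> step_like s' k ->
  (forall t, `|g (t + d) - k t| <= e) ->
  `|average a g (x + d) - average a k x| <= e.
Proof.
move=> a0 sg sk gke.
pose Q t := primitive g (t + d) - primitive k t.
have QE (t : R) : is_derive t 1 Q (g (t + d) - k t).
  apply: is_deriveB (primitiveP sk t).
  exact: is_derive_comp_shift (primitiveP sg (t + d)).
have xxa : x <= x + a by rewrite lerDl ltW.
have [c cx E] := mean_value xxa QE.
have -> : average a g (x + d) - average a k x = g (c + d) - k c.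
  rewrite /average -mulrBl.
  have -> : primitive g (x + d + a) - primitive g (x + d) -
     (primitive k (x + a) - primitive k x) = Q (x + a) - Q x.
    by rewrite /Q (addrAC x d a); ring.
  by rewrite E addrAC subrr add0r mulfK// gt_eqF.
exact: gke.
Qed.

Lemma average_dist0 s s' a g k e x : 0 < a -> step_like s g -> step_like s' k ->
  (forall t, `|g t - k t| <= e) -> `|average a g x - average a k x| <= e.
Proof.
move=> a0 sg sk gke; have := @average_dist _ _ a g k e 0 x a0 sg sk.
by rewrite addr0; apply => t; rewrite addr0.
Qed.

Lemma step_like_average s a g : 0 < a -> step_like s g ->
  step_like (s + a) (average a g).
Proof.
move=> a0 sg; have [lip g01 g0 g1] := sg; split.
- move=> x y; have := @average_dist _ _ a g g `|x - y| (x - y) y a0 sg sg.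
  rewrite (addrC y) subrK; apply => t.
  by rewrite (le_trans (lip _ _))// addrAC subrr add0r.
- by move=> x; have [c _ ->] := average_mean x a0 sg.
- move=> x xs; have [c /andP[_ cx] ->] := average_mean x a0 sg.
  by rewrite g0// (le_trans cx)// -lerBrDr -opprD.
- move=> x xs; have [c /andP[xc _] ->] := average_mean x a0 sg.
  by rewrite g1// (le_trans xs).
Qed.

Lemma average_near s a g x : 0 < a -> step_like s g ->
  `|average a g x - g x| <= a.
Proof.
move=> a0 sg; have [lip _ _ _] := sg.
have [c /andP[xc cx] ->] := average_mean x a0 sg.
by rewrite (le_trans (lip _ _))// ger0_norm ?subr_ge0// lerBlDl.
Qed.

Lemma step_like_weaken s s' g : s <= s' -> step_like s g -> step_like s' g.
Proof.
move=> ss [lip g01 g0 g1]; split => // x xs; apply: g0.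
by rewrite (le_trans xs)// lerN2.
Qed.

Definition ramp (x : R) : R := Num.max 0 (Num.min x 1).

Lemma step_like_ramp : step_like 0 ramp.
Proof.
rewrite /ramp; split.
- move=> x y; have n1 := ler_norm (x - y); have n0 := normr_ge0 (x - y).
  have := ler_norm (y - x); rewrite distrC => n2.
  set z := `|x - y| in n0 n1 n2 *; rewrite ler_norml /Num.max /Num.min.
  by case: (ltP x 1) => h1; case: (ltP y 1) => h2; do 2?case: ltP => ?;
    apply/andP; split; lra.
- by move=> x; rewrite le_max lexx/= ge_max ler01/= ge_min lexx orbT.
- move=> x; rewrite oppr0 => x0; apply/max_idPl.
  by rewrite ge_min x0.
- by move=> x x1; rewrite min_r// max_r.
Qed.

Lemma le_null_err (e : nat -> R) (u w : R) : e @ \oo --> 0 ->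
  (forall m, u <= w + e m) -> u <= w.
Proof.
move=> e0 h; apply/ler_addgt0Pr => d d0.
move/cvgr0Pnorm_le/(_ _ d0) : e0 => [N _ hN].
by rewrite (le_trans (h N))// lerD2l (le_trans (ler_norm _))// hN/=.
Qed.

Section infinite_convolution.
Variable a : nat -> R.
Hypothesis a_gt0 : forall j, 0 < a j.
Hypothesis a_summ : summ a.

(** The average of index [j] is the outermost one, so that in the limit the function of index [j] is
    an average of the one of index [j.+1] and its derivative a difference quotient of it. *)
Fixpoint conv_iter j m : R -> R :=
  if m is m'.+1 then average (a j) (conv_iter j.+1 m') else ramp.

Let S := tsum a.

Let step_iter' j m : step_like (\sum_(j <= i < j + m) a i) (conv_iter j m).
Proof.
elim: m j => [|m IH] j /=.
  by rewrite addn0 big_geq//; exact: step_like_ramp.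
rewrite big_ltn ?addnS ?ltnS ?leq_addr// addrC.
by apply: step_like_average => //; rewrite -addSn.
Qed.

Let step_iter j m : step_like S (conv_iter j m).
Proof.
apply: step_like_weaken (step_iter' j m).
apply: le_trans (psumB_le_tail a_summ (leq_addr m j)) _.
rewrite /tail lerBlDr lerDl sumr_ge0// => i _; exact: ltW.
Qed.

(** The two iterates differ only in the innermost function, by at most [a (j + m)], and averaging
    does not increase the distance. *)
Let iter_dist j m x : `|conv_iter j m.+1 x - conv_iter j m x| <= a (j + m).
Proof.
elim: m j x => [|m IH] j x.
  by rewrite addn0; apply: average_near => //; exact: step_like_ramp.
rewrite addnS -addSn.
apply: (average_dist0 _ (a_gt0 j) (step_iter j.+1 m.+1) (step_iter j.+1 m)).
by move=> t; exact: IH.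
Qed.

(** The uniform limit of [conv_iter j], written as a telescoping series in order to inherit the tail
    estimate. *)
Definition conv_lim j x : R := ramp x + complex.Re
  (csum (fun m => (conv_iter j m.+1 x - conv_iter j m x)%:C%C)).

Let shift_summ j : summ (fun m => a (j + m)).
Proof.
case: a_summ => _ [B hB]; split=> [m|]; first exact: ltW.
exists B => m; apply: le_trans (hB (j + m)%N).
rewrite -(big_mkord xpredT (fun i => a (j + i)%N)) -[X in _ <= X](big_mkord xpredT).
have -> : \sum_(0 <= i < m) a (j + i)%N = \sum_(0 + j <= i < j + m) a i.
  by rewrite big_addn addKn; apply: eq_bigr => i _; rewrite addnC.
rewrite [leRHS](big_cat_nat (n:=j)) ?leq_addr//= add0n lerDr.
by apply: sumr_ge0 => i _; exact: ltW.
Qed.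

Let err j m := tail (fun i => a (j + i)) m.

Let err0 j : err j @ \oo --> 0.
Proof. exact: tail_cvg0. Qed.

Let lim_dist j m x : `|conv_lim j x - conv_iter j m x| <= err j m.
Proof.
pose b m := (conv_iter j m.+1 x - conv_iter j m x)%:C%C.
have /(csum_tail m (shift_summ j)) h i : cmod (b i) <= a (j + i).
  by rewrite cmod_real.
apply: le_trans h; apply: le_trans (Re_le_cmod _).
rewrite cReD cReN cRe_sum le_eqVlt; apply/orP; left; apply/eqP; congr (`|_|).
have -> : \sum_(i < m) complex.Re (b i) = conv_iter j m x - ramp x.
  elim: m => [|m IH]; first by rewrite big_ord0 subrr.
  by rewrite big_ord_recr/= IH; ring.
by rewrite /conv_lim /b; ring.
Qed.

Let step_lim j : step_like S (conv_lim j).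
Proof.
have e0 := err0 j.
have e20 : (fun m => 2 * err j m) @ \oo --> 0.
  by rewrite -(mulr0 2); apply: cvgMr.
split.
- move=> x y; apply: le_null_err e20 _ => m.
  have [lip _ _ _] := step_iter j m.
  have h1 := lim_dist j m x; have := lim_dist j m y; rewrite distrC => h2.
  have -> : conv_lim j x - conv_lim j y = (conv_lim j x - conv_iter j m x) +
    (conv_iter j m x - conv_iter j m y) + (conv_iter j m y - conv_lim j y) by ring.
  rewrite (le_trans (ler_normD _ _))//.
  have := ler_normD (conv_lim j x - conv_iter j m x) (conv_iter j m x - conv_iter j m y).
  have := lip x y; lra.
- move=> x; apply/andP; split; apply: le_null_err e0 _ => m;
    have [_ /(_ x)/andP[h0 h1] _ _] := step_iter j m;
    have := lim_dist j m x; rewrite ler_norml => /andP[]; lra.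
- move=> x xS; apply/eqP; rewrite eq_le; apply/andP; split;
    apply: le_null_err e0 _ => m; have [_ _ /(_ x xS) h _] := step_iter j m;
    have := lim_dist j m x; rewrite h ler_norml => /andP[]; lra.
- move=> x xS; apply/eqP; rewrite eq_le; apply/andP; split;
    apply: le_null_err e0 _ => m; have [_ _ _ /(_ x xS) h] := step_iter j m;
    have := lim_dist j m x; rewrite h ler_norml => /andP[]; lra.
Qed.

Let limE j x : conv_lim j x = average (a j) (conv_lim j.+1) x.
Proof.
apply/eqP; rewrite -subr_eq0 -normr_le0.
have e0 : (fun m => err j.+1 m + err j (m + 1)) @ \oo --> 0.
  by rewrite -(addr0 0); apply: cvgD; [exact: err0|rewrite cvg_shiftn; exact: err0].
apply: le_null_err e0 _ => m; rewrite add0r addn1.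
have h1 := lim_dist j m.+1 x.
have h2 := average_dist0 x (a_gt0 j) (step_lim j.+1) (step_iter j.+1 m)
  (lim_dist j.+1 m).
have -> : conv_lim j x - average (a j) (conv_lim j.+1) x =
  (conv_lim j x - conv_iter j m.+1 x) -
  (average (a j) (conv_lim j.+1) x - average (a j) (conv_iter j.+1 m) x).
  by rewrite /=; ring.
by rewrite (le_trans (ler_normB _ _))// addrC lerD.
Qed.

(** Differentiating an average gives a difference quotient, and difference quotients commute with
    differentiation: each derivative uses up one step [a j], at the cost of a factor [2 / a j]. *)
Fixpoint conv_deriv j p : R -> R :=
  if p is p'.+1 then diffq (a j) (conv_deriv j.+1 p') else conv_lim j.

Let is_derive_conv j p x : is_derive x 1 (conv_deriv j p) (conv_deriv j p.+1 x).
Proof.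
elim: p j x => [|p IH] j x; last exact: is_derive_diffq (IH j.+1) x.
rewrite /= (_ : conv_lim j = average (a j) (conv_lim j.+1)).
  exact: is_derive_average (step_lim j.+1) x.
by apply/funext => y; exact: limE.
Qed.

Let conv_deriv_le j p x : `|conv_deriv j p x| <= \prod_(i < p) (2 / a (j + i)).
Proof.
elim: p j x => [|p IH] j x.
  have [_ /(_ x)/andP[h0 h1] _ _] := step_lim j.
  by rewrite big_ord0 ger0_norm.
rewrite big_ord_recl /= addn0 /diffq normrM normfV (gtr0_norm (a_gt0 j)).
rewrite mulrAC ler_wpM2r// ?invr_ge0 ?(ltW (a_gt0 j))//.
rewrite mulr_natl mulr2n (le_trans (ler_normB _ _))//.
have E : \prod_(i < p) (2 / a (j + bump 0 i)) = \prod_(i < p) (2 / a (j.+1 + i)).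
  by apply: eq_bigr => i _; rewrite /bump /= add1n addnS.
by rewrite E lerD.
Qed.

Lemma infinite_convolution : exists2 Phi : nat -> R -> R,
  step_like (tsum a) (Phi 0%N) & forall p x, is_derive x 1 (Phi p) (Phi p.+1 x) /\
    `|Phi p x| <= \prod_(i < p) (2 / a i).
Proof.
exists (conv_deriv 0) => [|p x]; first exact: step_lim.
by split; [exact: is_derive_conv|exact: conv_deriv_le].
Qed.

End infinite_convolution.

End smooth_step.

(** * Complex-valued calculus *)

Section complex_calculus.
Context {R : realType}.
Local Notation C := R[i].

(** The derivative is given as a function, so that chains of derivatives are exhibited by formulas
    rather than computed as limits. *)
Definition cderive {V : normedModType R} (v : V) (f g : V -> C) : Prop :=
  forall x : V, is_derive x v (fun y => complex.Re (f y)) (complex.Re (g x)) /\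
                is_derive x v (fun y => complex.Im (f y)) (complex.Im (g x)).

Definition ccont {T : topologicalType} (f : T -> C) : Prop :=
  continuous (fun x => complex.Re (f x)) /\ continuous (fun x => complex.Im (f x)).

Section cderive_theory.
Context {V : normedModType R} (v : V).
Implicit Types (f g h k : V -> C).

Lemma eq_cderive f f' g g' : f =1 f' -> g =1 g' -> cderive v f g -> cderive v f' g'.
Proof. by move=> /funext -> /funext ->. Qed.

Lemma cderive_cst (z : C) : cderive v (fun=> z) (fun=> 0).
Proof. by move=> x; split; exact: is_derive_cst. Qed.

Lemma cderiveD f f' g g' : cderive v f f' -> cderive v g g' ->
  cderive v (fun x => f x + g x) (fun x => f' x + g' x).
Proof.
move=> hf hg x; have [f1 f2] := hf x; have [g1 g2] := hg x; split.
  rewrite cReD; have h := is_deriveD f1 g1.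
  rewrite (_ : (fun y => complex.Re (f y + g y)) =
    (fun y => complex.Re (f y)) + (fun y => complex.Re (g y)))//.
  by apply/funext => y; rewrite cReD.
rewrite cImD; have h := is_deriveD f2 g2.
rewrite (_ : (fun y => complex.Im (f y + g y)) =
  (fun y => complex.Im (f y)) + (fun y => complex.Im (g y)))//.
by apply/funext => y; rewrite cImD.
Qed.

Lemma cderiveM f f' g g' : cderive v f f' -> cderive v g g' ->
  cderive v (fun x => f x * g x) (fun x => f' x * g x + f x * g' x).
Proof.
move=> hf hg x; have [f1 f2] := hf x; have [g1 g2] := hg x; split.
  have h := is_deriveB (is_deriveM f1 g1) (is_deriveM f2 g2).
  rewrite (_ : (fun y => complex.Re (f y * g y)) =
    (fun y => complex.Re (f y)) * (fun y => complex.Re (g y)) -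
    (fun y => complex.Im (f y)) * (fun y => complex.Im (g y))); last first.
    by apply/funext => y; rewrite cReM.
  apply: (is_derive_eq h); rewrite cReD !cReM /GRing.scale/=; ring.
have h := is_deriveD (is_deriveM f1 g2) (is_deriveM f2 g1).
rewrite (_ : (fun y => complex.Im (f y * g y)) =
  (fun y => complex.Re (f y)) * (fun y => complex.Im (g y)) +
  (fun y => complex.Im (f y)) * (fun y => complex.Re (g y))); last first.
  by apply/funext => y; rewrite cImM.
apply: (is_derive_eq h); rewrite cImD !cImM /GRing.scale/=; ring.
Qed.

Lemma cderiveZ z f f' : cderive v f f' ->
  cderive v (fun x => z * f x) (fun x => z * f' x).
Proof.
move=> hf; apply: eq_cderive (cderiveM (cderive_cst z) hf) => // x.
by rewrite mul0r add0r.
Qed.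

Lemma cderive_sum (I : Type) (r : seq I) (F F' : I -> V -> C) :
  (forall i, cderive v (F i) (F' i)) ->
  cderive v (fun x => \sum_(i <- r) F i x) (fun x => \sum_(i <- r) F' i x).
Proof.
move=> hF; elim: r => [|i r IH].
  by apply: eq_cderive (cderive_cst 0) => x; rewrite big_nil.
by apply: eq_cderive (cderiveD (hF i) IH) => x; rewrite big_cons.
Qed.

(** For chains of derivatives [A] and [B] along [v], the derivative of order [p] of the product of
    [A 0] and [B 0]. *)
Definition leibniz (A B : nat -> V -> C) p x : C :=
  \sum_(q < p.+1) 'C(p, q)%:R * (A (p - q)%N x * B q x).

Lemma pascal_sum p (T : nat -> C) :
  \sum_(q < p.+1) 'C(p, q)%:R * T q + \sum_(q < p.+1) 'C(p, q)%:R * T q.+1 =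
  \sum_(q < p.+2) 'C(p.+1, q)%:R * T q.
Proof.
rewrite [RHS]big_ord_recl /= bin0.
under [in RHS]eq_bigr => i _ do rewrite /bump /= add1n binS natrD mulrDl.
rewrite big_split/= addrA; congr (_ + _).
rewrite big_ord_recl bin0; congr (_ + _).
rewrite big_ord_recr /= bin_small// mul0r addr0.
by apply: eq_bigr => i _; rewrite /bump /= add1n.
Qed.

Lemma cderive_leibniz (A B : nat -> V -> C) p :
  (forall q, cderive v (A q) (A q.+1)) -> (forall q, cderive v (B q) (B q.+1)) ->
  cderive v (leibniz A B p) (leibniz A B p.+1).
Proof.
move=> hA hB.
have h := @cderive_sum _ (index_enum 'I_p.+1) _ _ (fun q : 'I_p.+1 =>
  cderiveZ 'C(p, q)%:R (cderiveM (hA (p - q)%N) (hB q))).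
apply: eq_cderive h => // x; rewrite /leibniz.
rewrite -(pascal_sum p (fun q => A (p.+1 - q)%N x * B q x)) -big_split/=.
apply: eq_bigr => q _; rewrite -mulrDr; congr (_ * _); congr (_ * _ + _).
by rewrite subSn// -ltnS.
Qed.

End cderive_theory.

Section ccont_theory.
Context {T : topologicalType}.
Implicit Types (f g : T -> C).

Lemma ccont_cst (z : C) : ccont (fun _ : T => z).
Proof. by split=> x; exact: cvg_cst. Qed.

Lemma ccontD f g : ccont f -> ccont g -> ccont (fun x => f x + g x).
Proof.
move=> [f1 f2] [g1 g2]; split => x.
  by under eq_fun do rewrite cReD; apply: cvgD; [exact: f1|exact: g1].
by under eq_fun do rewrite cImD; apply: cvgD; [exact: f2|exact: g2].
Qed.

Lemma ccontM f g : ccont f -> ccont g -> ccont (fun x => f x * g x).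
Proof.
move=> [f1 f2] [g1 g2]; split => x.
  under eq_fun do rewrite cReM.
  by apply: cvgB; apply: cvgM; [exact: f1|exact: g1|exact: f2|exact: g2].
under eq_fun do rewrite cImM.
by apply: cvgD; apply: cvgM; [exact: f1|exact: g2|exact: f2|exact: g1].
Qed.

Lemma ccont_sum (I : Type) (r : seq I) (F : I -> T -> C) :
  (forall i, ccont (F i)) -> ccont (fun x => \sum_(i <- r) F i x).
Proof.
move=> hF; elim: r => [|i r IH].
  by under eq_fun do rewrite big_nil; exact: ccont_cst.
by under eq_fun do rewrite big_cons; exact: ccontD.
Qed.

Lemma ccont_prod (I : Type) (r : seq I) (F : I -> T -> C) :
  (forall i, ccont (F i)) -> ccont (fun x => \prod_(i <- r) F i x).
Proof.
move=> hF; elim: r => [|i r IH].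
  by under eq_fun do rewrite big_nil; exact: ccont_cst.
by under eq_fun do rewrite big_cons; exact: ccontM.
Qed.

Lemma ccont_cmodP f : ccont f <-> forall (x : T) (e : R), 0 < e ->
  \forall y \near x, cmod (f x - f y) <= e.
Proof.
split=> [[f1 f2] x e e0|h].
  have e2 : 0 < e / 2 by rewrite divr_gt0.
  move/cvgrPdist_le/(_ _ e2) : (f1 x) => h1.
  move/cvgrPdist_le/(_ _ e2) : (f2 x) => h2.
  near=> y; rewrite (le_trans (cmod_le_ReIm _))// cReD cImD cReN cImN [leRHS]splitr.
  by apply: lerD; near: y; [exact: h1|exact: h2].
split=> x; apply/cvgrPdist_le => e e0; near=> y.
  rewrite -cReN -cReD (le_trans (Re_le_cmod _))//; near: y; exact: h.
rewrite -cImN -cImD (le_trans (Im_le_cmod _))//; near: y; exact: h.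
Unshelve. all: by end_near. Qed.

(** Passage to the norm topology of [R[i]^o], whose radii are complex numbers: a positive one equals
    its real part. *)
Lemma ccont_continuous f : ccont f -> continuous (f : T -> R[i]^o).
Proof.
move=> /ccont_cmodP h x; apply/cvgrPdist_le => e e0.
have eR : (complex.Re e)%:C%C = e by apply: RRe_real; exact: gtr0_real.
have e1 : 0 < complex.Re e by rewrite -ltcR eR.
near=> y; rewrite cmodE -eR lecR; near: y; exact: h.
Unshelve. all: by end_near. Qed.

Lemma ccont_csum (v : nat -> R) (F : nat -> T -> C) : summ v ->
  (forall i x, cmod (F i x) <= v i) -> (forall i, ccont (F i)) ->
  ccont (fun x => csum (F ^~ x)).
Proof.
move=> sv Fv cF; apply/ccont_cmodP => x e e0.
have e3 : 0 < e / 3 by rewrite divr_gt0.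
move/cvgr0Pnorm_le/(_ _ e3) : (tail_cvg0 sv) => [N _ /(_ N (leqnn N)) hN].
have /ccont_cmodP/(_ x _ e3) := ccont_sum (index_enum 'I_N) (fun i : 'I_N => cF i).
apply: filterS => y hy.
have -> : csum (F ^~ x) - csum (F ^~ y) =
  (csum (F ^~ x) - \sum_(i < N) F i x) - (csum (F ^~ y) - \sum_(i < N) F i y) +
  (\sum_(i < N) F i x - \sum_(i < N) F i y) by ring.
rewrite (le_trans (cmodD _ _))//.
have := cmodD (csum (F ^~ x) - \sum_(i < N) F i x)
  (- (csum (F ^~ y) - \sum_(i < N) F i y)); rewrite cmodN.
have h1 := csum_tail N sv (Fv ^~ x); have h2 := csum_tail N sv (Fv ^~ y).
move: hy hN h1 h2; have := ler_norm (tail v N); lra.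
Qed.

End ccont_theory.

Lemma cderive_ccont (f g : R -> C) : cderive (1 : R) f g -> ccont f.
Proof.
by move=> fg; split; apply: is_derive_continuous => x; have [h1 h2] := fg x;
  [exact: h1|exact: h2].
Qed.

(** The bound on the second derivatives controls the error of the [i]-th difference quotient by a
    multiple of [|t| * v i], and these errors are summable. *)
Lemma cderive_csum {V : normedModType R} (w : V) (v : nat -> R) (B0 B1 B2 : R)
    (F F' F'' : nat -> V -> C) : summ v ->
  (forall i, cderive w (F i) (F' i)) -> (forall i, cderive w (F' i) (F'' i)) ->
  (forall i x, cmod (F i x) <= B0 * v i) -> (forall i x, cmod (F' i x) <= B1 * v i) ->
  (forall i x, cmod (F'' i x) <= B2 * v i) ->
  cderive w (fun x => csum (F ^~ x)) (fun x => csum (F' ^~ x)).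
Proof.
move=> sv hF hF' F0 F1 F2 x; have v0 := sv.1.
(* The constants carry no sign; absolute values make the majorants nonnegative, as [summ]
   requires. *)
have pos (G : nat -> V -> C) B i y : (forall i y, cmod (G i y) <= B * v i) ->
    cmod (G i y) <= `|B| * v i.
  move=> h; rewrite (le_trans (h i y))//.
  by rewrite ler_wpM2r// ler_norm.
move: F0 F1 F2 => /pos F0 /pos F1 /pos F2.
have sB (B : R) : summ (fun i => `|B| * v i) by exact: summZ.
have key (t : R) : t != 0 -> cmod ((csum (F ^~ (t *: w + x)) - csum (F ^~ x)) / t%:C%C
    - csum (F' ^~ x)) <= `|t| * (2 * `|B2| * tsum v).
  move=> t0.
  have t0C : t%:C%C != 0 by rewrite eq_complex/= eqxx andbT.
  pose d i := (F i (t *: w + x) - F i x) / t%:C%C - F' i x.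
  have dE : (csum (F ^~ (t *: w + x)) - csum (F ^~ x)) / t%:C%C - csum (F' ^~ x) = csum d.
    have s00 : summ (fun i => `|B0| * v i + `|B0| * v i) by apply: summD; exact: sB.
    have b00 i : cmod (F i (t *: w + x) - F i x) <= `|B0| * v i + `|B0| * v i.
      by rewrite (le_trans (cmodD _ _))// cmodN lerD.
    rewrite (csumB (summZ (cmod_ge0 t%:C%C^-1) s00) (sB B1))//.
      by rewrite (csumZr _ s00)// (csumB (sB B0) (sB B0)).
    by move=> i; rewrite cmodM mulrC ler_wpM2l ?cmod_ge0.
  rewrite dE.
  have st : summ (fun i => (`|t| * (2 * `|B2|)) * v i).
    by apply: summZ => //; rewrite !mulr_ge0.
  rewrite [leRHS]mulrA -tsumZ ?mulr_ge0//; apply: csum_bound st _ => i.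
  have dRe : `|complex.Re (d i)| <= `|B2| * v i * `|t|.
    have := @diff_quotient_le R (fun t => complex.Re (F i (t *: w + x)))
      (fun t => complex.Re (F' i (t *: w + x)))
      (fun t => complex.Re (F'' i (t *: w + x))) (`|B2| * v i) t.
    rewrite scale0r add0r.
    have -> : (complex.Re (F i (t *: w + x)) - complex.Re (F i x)) / t - complex.Re (F' i x)
       = complex.Re (d i).
      rewrite /d cReD cReN; congr (_ - _).
      have -> : t%:C%C^-1 = (t^-1)%:C%C by rewrite fmorphV.
      by rewrite cReM cReD cReN /= mulr0 subr0.
    apply => //.
    + move=> y; apply/is_derive_line.
      have [+ _] := hF i (y *: w + x).
      move/is_derive_line; rewrite [X in is_derive _ _ X](_ : _ =
        (fun t0 => complex.Re (F i ((t0 *: 1 + y) *: w + x))))//.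
      by apply/funext => z; rewrite scalerDl addrA [z *: 1]mulr1.
    + move=> y; apply/is_derive_line.
      have [+ _] := hF' i (y *: w + x).
      move/is_derive_line; rewrite [X in is_derive _ _ X](_ : _ =
        (fun t0 => complex.Re (F' i ((t0 *: 1 + y) *: w + x))))//.
      by apply/funext => z; rewrite scalerDl addrA [z *: 1]mulr1.
    + by move=> y; rewrite (le_trans (Re_le_cmod _)).
  have dIm : `|complex.Im (d i)| <= `|B2| * v i * `|t|.
    have := @diff_quotient_le R (fun t => complex.Im (F i (t *: w + x)))
      (fun t => complex.Im (F' i (t *: w + x)))
      (fun t => complex.Im (F'' i (t *: w + x))) (`|B2| * v i) t.
    rewrite scale0r add0r.
    have -> : (complex.Im (F i (t *: w + x)) - complex.Im (F i x)) / t - complex.Im (F' i x)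
       = complex.Im (d i).
      rewrite /d cImD cImN; congr (_ - _).
      have -> : t%:C%C^-1 = (t^-1)%:C%C by rewrite fmorphV.
      by rewrite cImM cImD cImN /= mulr0 add0r.
    apply => //.
    + move=> y; apply/is_derive_line.
      have [_ +] := hF i (y *: w + x).
      move/is_derive_line; rewrite [X in is_derive _ _ X](_ : _ =
        (fun t0 => complex.Im (F i ((t0 *: 1 + y) *: w + x))))//.
      by apply/funext => z; rewrite scalerDl addrA [z *: 1]mulr1.
    + move=> y; apply/is_derive_line.
      have [_ +] := hF' i (y *: w + x).
      move/is_derive_line; rewrite [X in is_derive _ _ X](_ : _ =
        (fun t0 => complex.Im (F' i ((t0 *: 1 + y) *: w + x))))//.
      by apply/funext => z; rewrite scalerDl addrA [z *: 1]mulr1.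
    + by move=> y; rewrite (le_trans (Im_le_cmod _)).
  rewrite (le_trans (cmod_le_ReIm _))//.
  have -> : `|t| * (2 * `|B2|) * v i = `|B2| * v i * `|t| + `|B2| * v i * `|t| by ring.
  exact: lerD.
set K := 2 * `|B2| * tsum v in key.
have K0 : 0 <= K by rewrite !mulr_ge0// tsum_ge0.
have K1 : 0 < K + 1 by rewrite ltr_wpDl.
split; apply/is_derive_epsP => e e0; exists (e / (K + 1)); rewrite ?divr_gt0//;
    move=> t; rewrite normr_gt0 => /andP[t0 te]; have k := key t t0;
    have tK : `|t| * K <= e;
    do ?[by rewrite (@le_trans _ _ (e / (K + 1) * K))// ?ler_wpM2r ?(ltW te)//
      mulrAC ler_pdivrMr// ler_pM2l// lerDl];
    have tV : t%:C%C^-1 = (t^-1)%:C%C by rewrite fmorphV.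
- apply: le_trans tK; apply: le_trans k; apply: le_trans (Re_le_cmod _).
  by rewrite cReD cReN tV cReM cReD cReN /= mulr0 subr0.
- apply: le_trans tK; apply: le_trans k; apply: le_trans (Im_le_cmod _).
  by rewrite cImD cImN tV cImM cImD cImN /= mulr0 add0r.
Qed.

End complex_calculus.

(** * Integration on R^n *)

Section tuple_measure_invariance.
Context {R : realType}.
Local Notation mu := (@lebesgue_measure R).
Local Notation T := (measurableTypeR R).

(** A translation, preceded by a reflection when [sg] holds; the reflected form serves to write a
    point as a sum of two generic ones. *)
Definition affine1 (sg : bool) (b t : R) : R := (-1) ^+ sg * t + b.

Lemma measurable_affine1 sg b : measurable_fun [set: T] (affine1 sg b : T -> T).
Proof.
apply: continuous_measurable_fun => x; apply: cvgD; last exact: cvg_cst.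
by apply: cvgMr; exact: cvg_id.
Qed.

(** For translations, the pushforward agrees with Lebesgue measure on half-open intervals, which
    determines it. The reflection is then undone by the symmetry of the measure. *)
Lemma lebesgue_affine1 sg b (A : set T) : measurable A ->
  mu (affine1 sg b @^-1` A) = mu A.
Proof.
have trans (c : R) (B : set T) : measurable B -> mu (affine1 false c @^-1` B) = mu B.
  move=> mB.
  have h := @lebesgue_measure_unique R (pushforward mu (affine1 false c : T -> T)).
  apply/esym; apply: (h (measurable_affine1 false c) _ B mB) => {h}.
  move=> _ [[x y]] _ <-; rewrite /pushforward [(x, y).1]/= [(x, y).2]/=.
  transitivity (mu (affine1 false c @^-1` [set` `]x, y]])); last by [].
  have -> : affine1 false c @^-1` [set` `]x, y]] = [set` `]x - c, y - c]].
    by apply/seteqP; split => t /=; rewrite /affine1 !in_itv/= expr0 mul1r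
      ltrBlDr lerBrDr.
  rewrite [LHS]lebesgue_measure_itv [RHS]lebesgue_measure_itv/= !lte_fin ltrD2r.
  by case: ifPn => // _; rewrite -!EFinB; congr _%:E; ring.
case: sg => mA; last exact: trans.
rewrite -(trans b A mA).
have mB : measurable (affine1 false b @^-1` A : set T).
  by rewrite -[X in measurable X]setTI; exact: measurable_affine1.
rewrite -[RHS](lebesgue_measureN mB) /pushforward; congr (mu _).
by apply/seteqP; split => t; rewrite /= /affine1 expr1 expr0 mul1r mulN1r.
Qed.

(** The shifts are indexed by [nat], so that the induction on [n] can drop the first one without
    casting ordinals. *)
Definition affine_tuple sg (y : nat -> R) n (t : n.-tuple R) : n.-tuple R :=
  [tuple affine1 sg (y i) (tnth t i) | i < n].

Lemma affine_tuple_cons sg y n (x : T * n.-tuple T) :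
  affine_tuple sg y (tuple_cons x) =
  tuple_cons (affine1 sg (y 0%N) x.1, affine_tuple sg (fun i => y i.+1) x.2).
Proof.
apply/eq_from_tnth => i; rewrite /tuple_cons tnth_mktuple/=.
case: (unliftP ord0 i) => [j ->|->].
  by rewrite !tnthS tnth_mktuple.
by rewrite !tnth0.
Qed.

Lemma measurable_affine_tuple sg y n :
  measurable_fun [set: n.-tuple T] (@affine_tuple sg y n : n.-tuple T -> n.-tuple T).
Proof.
apply/measurable_fun_tnthP => i.
rewrite (_ : _ \o _ = (affine1 sg (y i) : T -> T) \o (fun t : n.-tuple T => tnth t i)).
  apply: measurableT_comp; first exact: measurable_affine1.
  exact: measurable_tnth.
by apply/funext => t /=; rewrite tnth_mktuple.
Qed.

(** Each section of the preimage is the affine preimage of a section, in one dimension less; the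
    outer integral is then a change of variable on the line. *)
Lemma lebesgue_affine_tuple sg n y (A : set (n.-tuple T)) : measurable A ->
  lebesgue_tuple n (@affine_tuple sg y n @^-1` A) = lebesgue_tuple n A :> \bar R.
Proof.
elim: n y A => [|n IH] y A mA.
  congr (lebesgue_tuple 0 _); apply/seteqP; split => t /=;
  by rewrite (tuple0 t) (tuple0 (affine_tuple _ _ _)).
rewrite /lebesgue_tuple /= /tuple_measure_step /pushforward.
set B := @tuple_cons _ _ n @^-1` A.
have mB : measurable B.
  by rewrite -[X in measurable X]setTI; exact: measurable_tuple_cons.
have -> : @tuple_cons _ _ n @^-1` (@affine_tuple sg y n.+1 @^-1` A) =
  [set x | B (affine1 sg (y 0%N) x.1, affine_tuple sg (fun i => y i.+1) x.2)].
  by apply/seteqP; split => x; rewrite /= affine_tuple_cons.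
rewrite /product_measure1.
pose G := (tuple_measure lebesgue_measure n : set (n.-tuple T) -> \bar R) \o xsection B.
have mG : measurable_fun [set: T] G by exact: measurable_fun_xsection.
transitivity (\int[mu]_x (G \o (affine1 sg (y 0%N) : T -> T)) x)%E.
  apply: eq_integral => x _ /=.
  have -> : xsection [set x0 | B (affine1 sg (y 0%N) x0.1,
      affine_tuple sg (fun i => y i.+1) x0.2)] x =
    @affine_tuple sg (fun i => y i.+1) n @^-1` (xsection B (affine1 sg (y 0%N) x)).
    by apply/seteqP; split => t; rewrite /xsection/= !inE.
  by apply: IH; exact: measurable_xsection.
have mphi := measurable_affine1 sg (y 0%N).
have := @ge0_integral_pushforward _ _ _ _ R _ mphi mu setT G measurableT mG.
rewrite preimage_setT => <-; last by move=> x _; exact: measure_ge0.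
apply: eq_measure_integral => C mC _.
exact: lebesgue_affine1.
Qed.

End tuple_measure_invariance.

Section euclidean_integral.
Context {R : realType} {n : nat}.
Local Notation Rn := 'rV[R]_n.
Local Notation C := R[i].
Local Notation T := (measurableTypeR R).
Local Notation row := (@row_of_tuple R n).
Local Notation mu := (@lebesgue_tuple R n).

(** The measurable sets of tuples are generated by the coordinates, so an open set is written as a
    countable union of cubes with rational centres and radii. *)
Lemma measurable_row_open (U : set Rn) : open U ->
  measurable (row @^-1` U : set (n.-tuple T)).
Proof.
move=> oU.
pose cell (p : {ffun 'I_n -> rat} * nat) : set Rn :=
  [set x | forall i, `|x 0 i - ratr (p.1 i)| < p.2.+1%:R^-1].
pose I := [set p | cell p `<=` U].
have -> : row @^-1` U = \bigcup_p (if `[< I p >] then row @^-1` cell p else set0).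
  apply/seteqP; split => t; last first.
    by move=> [p _] /=; case: asboolP => // h /h.
  move=> /= Ut; have /nbhs_ballP[e /= e0 he] : nbhs (row t) U by exact: open_nbhs_nbhs.
  have [N hN] : exists N, N.+1%:R^-1 < e / 2 :> R.
    have e20 : 0 < e / 2 by rewrite divr_gt0.
    have /cvgrPdist_lt/(_ _ e20)[N _ /(_ N (leqnn N))] := @cvg_harmonic R.
    by rewrite /harmonic/= sub0r normrN ger0_norm ?invr_ge0//; exists N.
  have d0 : 0 < N.+1%:R^-1 :> R by rewrite invr_gt0.
  have hq i : exists q : rat, `|row t 0 i - ratr q| < N.+1%:R^-1.
    have [|q] := @rat_in_itvoo R (row t 0 i - N.+1%:R^-1) (row t 0 i + N.+1%:R^-1).
      by rewrite ltrD2l gtrN.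
    rewrite in_itv/= => /andP[h1 h2]; exists q.
    by rewrite ltr_distl ltrBlDr h2 -ltrBlDr.
  pose q := [ffun i => projT1 (cid (hq i))].
  have hq' i : `|row t 0 i - ratr (q i)| < N.+1%:R^-1.
    by rewrite ffunE; exact: (projT2 (cid (hq i))).
  exists (q, N) => //=; case: asboolP => [_|[]]; first by move=> i; exact: hq'.
  move=> x hx; apply: he; split=> // i j; rewrite /ball /= ord1.
  have := hx j; have := hq' j; rewrite distrC => h1 h2 /=.
  rewrite (@le_lt_trans _ _ (`|row t 0 j - ratr (q j)| + `|ratr (q j) - x 0 j|))//.
    by rewrite (le_trans _ (ler_normD _ _))// addrA subrK.
  by rewrite distrC (distrC _ (x 0 j)) [ltRHS]splitr ltrD// (lt_trans _ hN).
apply: countable_bigcupT_measurable; first exact: countableP.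
move=> p; case: asboolP => // _.
have -> : row @^-1` cell p = \bigcap_(i in [set: 'I_n])
    ((fun t : n.-tuple T => tnth t i) @^-1` (ball (ratr (p.1 i) : R) (p.2.+1%:R^-1))).
  apply/seteqP; split => t h i => [_|].
    by have := h i; rewrite /ball/= mxE distrC.
  by have := h i Logic.I; rewrite /ball/= mxE distrC.
apply: fin_bigcap_measurable => // i _.
rewrite -[X in measurable X]setTI; apply: measurable_tnth => //.
exact: measurable_ball.
Qed.

Lemma measurable_row_closed (U : set Rn) : closed U ->
  measurable (row @^-1` U : set (n.-tuple T)).
Proof.
move=> cU; rewrite -[X in measurable X]setCK; apply: measurableC.
exact: measurable_row_open (closed_openC cU).
Qed.

Lemma measurable_row_within (D : set Rn) (g : Rn -> R) : open D ->
  {in D, continuous g} ->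
  measurable_fun (row @^-1` D : set (n.-tuple T)) (g \o row).
Proof.
move=> oD cg; apply: (measurability _ (RGenOpens.measurableE R)).
move=> _ [_ [a [b ->] <-]].
have -> : row @^-1` D `&` (g \o row) @^-1` `]a, b[ = row @^-1` (D `&` g @^-1` `]a, b[).
  by [].
apply: measurable_row_open.
rewrite openE => x [Dx gx]; apply: filterI; first exact: open_nbhs_nbhs.
apply: (cg x (mem_set Dx) [set` `]a, b[]).
by apply: open_nbhs_nbhs; split => //; exact: interval_open.
Qed.

End euclidean_integral.

Lemma bounded_support_integrable d (T : measurableType d) (R : realType)
    (mu : {measure set T -> \bar R}) (A : set T) (B : R) (f : T -> R) :
  measurable A -> (mu A < +oo)%E -> measurable_fun setT f ->
  (forall x, `|f x| <= B * \1_A x) -> mu.-integrable setT (EFin \o f).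
Proof.
move=> mA Afin mf fB.
have f0 x : ~ A x -> f x = 0.
  move=> nAx; apply/eqP; rewrite -normr_le0 (le_trans (fB x))// indicE.
  by rewrite memNset// mulr0.
have -> : EFin \o f = (EFin \o f) \_ A.
  apply/funext => x /=; rewrite patchE; case: ifPn => // /negP xA.
  by rewrite f0// => Ax; apply: xA; exact: mem_set.
apply/(integrable_mkcond _ mA).
apply: measurable_bounded_integrable => //; first exact: measurable_funTS.
exists B; split; first exact: num_real.
move=> r Br x Ax; apply: le_trans (fB x) _.
by rewrite indicE mem_set// mulr1 ltW.
Qed.

Lemma tuple_box_lty (R : realType) (m : R) n :
  (lebesgue_tuple n [set t : n.-tuple (measurableTypeR R) |
    forall i, (`|tnth t i| <= m)%R] < +oo)%E.
Proof.
set B := fun n => [set t : n.-tuple (measurableTypeR R) | forall i, `|tnth t i| <= m].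
rewrite -/(B n).
have BS k : @tuple_cons _ _ k @^-1` B k.+1 = [set` `[- m, m]] `*` B k.
  apply/seteqP; split => [[s t] h|[s t] [/= s0 h] i]; last first.
    case: (unliftP ord0 i) => [j ->|->]; first by rewrite tnthS; exact: h.
    by rewrite tnth0 ler_norml; move: s0; rewrite in_itv.
  split; first by have := h ord0; rewrite tnth0 /= in_itv/= ler_norml.
  by move=> j; have := h (lift ord0 j); rewrite tnthS.
have mB k : measurable (B k : set (k.-tuple (measurableTypeR R))).
  rewrite (_ : B k = \bigcap_(i in [set: 'I_k])
    ((fun t : k.-tuple (measurableTypeR R) => tnth t i) @^-1` [set` `[- m, m]])).
    apply: fin_bigcap_measurable => // i _.
    by rewrite -[X in measurable X]setTI; apply: measurable_tnth.
  apply/seteqP; split => t h i => [_|]; first by rewrite /= in_itv/= -ler_norml.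
  by rewrite ler_norml; have := h i Logic.I; rewrite /= in_itv.
elim: n => [|k IH].
  by rewrite /lebesgue_tuple/= /tuple_measure0 /dirac indicE; case: (_ \in _); rewrite ltry.
rewrite /lebesgue_tuple /= /tuple_measure_step /pushforward BS.
rewrite product_measure1E//; last exact: mB.
have fin : lebesgue_measure [set` `[- m, m]] \is a fin_num.
  by rewrite lebesgue_measure_itv/=; case: ifP.
by apply: lte_mul_pinfty; [exact: measure_ge0|exact: fin|exact: IH].
Qed.

Section box_integral.
Context {R : realType} {n : nat}.
Local Notation Rn := 'rV[R]_n.
Local Notation C := R[i].
Local Notation T := (measurableTypeR R).
Local Notation row := (@row_of_tuple R n).
Local Notation mu := (@lebesgue_tuple R n).
Implicit Types (g h : Rn -> R) (F G : Rn -> C) (m B : R).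

Definition meas g : Prop := measurable_fun [set: n.-tuple T] (g \o row).

Definition box m : set Rn := [set x | forall i, `|x 0 i| <= m].

(** Boundedness and support are recorded with their constants, because the integrals below are
    estimated through them. *)
Definition bsupp m B g : Prop :=
  [/\ meas g, forall x, `|g x| <= B & forall x, ~ box m x -> g x = 0].

Definition Rint g : R := \int[mu]_t g (row t).

Definition vol m : R := Rint \1_(box m).

Lemma continuous_meas g : continuous g -> meas g.
Proof.
move=> cg; have := @measurable_row_within R n setT g openT.
by rewrite preimage_setT; apply => x _; exact: cg.
Qed.

Lemma box_closed m : closed (box m).
Proof.
rewrite (_ : box m = \bigcap_(i in [set: 'I_n]) [set x : Rn | `|x 0 i| <= m]); last first.
  by apply/seteqP; split=> x h i; [move=> _; exact: h|exact: (h i Logic.I)].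
apply: closed_bigI => i _.
rewrite (_ : [set x : Rn | `|x 0 i| <= m] = (fun x : Rn => `|x 0 i|) @^-1` [set r | r <= m])//.
apply: closed_comp; last exact: closed_le.
move=> x _; apply: (@continuous_comp _ _ _ (fun x : Rn => x 0 i) (fun r : R => `|r|)).
  exact: coord_continuous.
exact: norm_continuous.
Qed.

Lemma measurable_box m : measurable (row @^-1` box m : set (n.-tuple T)).
Proof. by apply: measurable_row_closed; exact: box_closed. Qed.

Lemma box_compact m : compact (box m).
Proof.
apply: bounded_closed_compact; last exact: box_closed.
exists `|m|; split; first exact: num_real.
move=> r mr x bx; rewrite /Num.norm/= mx_normrE; apply: bigmax_le.
  by rewrite (le_trans (normr_ge0 m))// ltW.
move=> [i j] _ /=; rewrite ord1 (le_trans (bx j))//.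
by rewrite (le_trans (ler_norm m))// ltW.
Qed.

Lemma sub_box m m' : m <= m' -> box m `<=` box m'.
Proof. by move=> mm x bx i; rewrite (le_trans (bx i)). Qed.

Lemma box_lty m : (mu (row @^-1` box m) < +oo)%E.
Proof.
apply: le_lt_trans (tuple_box_lty m n); apply: le_measure; rewrite ?inE.
- exact: measurable_box.
- rewrite (_ : [set t | _] = row @^-1` box m); first exact: measurable_box.
  by apply/seteqP; split => t h i; have := h i; rewrite mxE.
- by move=> t h i; have := h i; rewrite mxE.
Qed.

Lemma bsupp_le m m' B B' g : m <= m' -> B <= B' -> bsupp m B g -> bsupp m' B' g.
Proof.
move=> mm BB [mg gB g0]; split => // x; first by rewrite (le_trans (gB x)).
by move=> nx; apply: g0 => bx; apply: nx; exact: sub_box bx.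
Qed.

Lemma bsupp_integrable m B g : bsupp m B g ->
  mu.-integrable setT (EFin \o (g \o row)).
Proof.
move=> [mg gB g0].
apply: (@bounded_support_integrable _ _ _ mu _ B _ (measurable_box m) (box_lty m) mg).
move=> t; rewrite /= indicE; case: (boolP (t \in _)) => [_|/negP nt].
  by rewrite mulr1 gB.
by rewrite g0 ?normr0 ?mulr0// => bt; apply: nt; exact: mem_set.
Qed.

Lemma bsuppD m B B' g h : bsupp m B g -> bsupp m B' h ->
  bsupp m (B + B') (fun x => g x + h x).
Proof.
move=> [mg gB g0] [mh hB h0]; split.
- exact: measurable_funD.
- by move=> x; rewrite (le_trans (ler_normD _ _))// lerD.
- by move=> x nx; rewrite g0// h0// addr0.
Qed.

Lemma bsuppZ m B (c : R) g : bsupp m B g -> bsupp m (`|c| * B) (fun x => c * g x).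
Proof.
move=> [mg gB g0]; split.
- exact: measurable_funM.
- by move=> x; rewrite normrM ler_wpM2l.
- by move=> x nx; rewrite g0// mulr0.
Qed.

Lemma RintD m B B' g h : bsupp m B g -> bsupp m B' h ->
  Rint (fun x => g x + h x) = Rint g + Rint h.
Proof.
by move=> bg bh; apply: RintegralD => //;
  [exact: bsupp_integrable bg|exact: bsupp_integrable bh].
Qed.

Lemma RintZ m B (c : R) g : bsupp m B g -> Rint (fun x => c * g x) = c * Rint g.
Proof. by move=> bg; apply: RintegralZl => //; exact: bsupp_integrable bg. Qed.

Lemma Rint_le m B B' g h : bsupp m B g -> bsupp m B' h ->
  (forall x, g x <= h x) -> Rint g <= Rint h.
Proof.
move=> bg bh gh; apply: le_Rintegral => //;
  [exact: bsupp_integrable bg|exact: bsupp_integrable bh].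
Qed.

Lemma bsupp_box m : bsupp m 1 \1_(box m).
Proof.
split.
- have /= := measurable_indic (R := R) (measurable_box m).
  by move=> h; exact: (h setT).
- by move=> x; rewrite indicE; case: (_ \in _); rewrite ?normr0 ?normr1.
- by move=> x nx; rewrite indicE memNset.
Qed.

Lemma vol_ge0 m : 0 <= vol m.
Proof. by apply: Rintegral_ge0 => t _; rewrite indicE. Qed.

Lemma Rint_bound m B g : bsupp m B g -> `|Rint g| <= B * vol m.
Proof.
move=> bg; have [mg gB g0] := bg; have bB := bsuppZ B (bsupp_box m).
have B0 : 0 <= B by rewrite (le_trans _ (gB 0)).
have le x : `|g x| <= B * \1_(box m) x.
  rewrite indicE; case: (boolP (x \in _)) => [_|/negP nx]; first by rewrite mulr1.
  by rewrite g0 ?normr0 ?mulr0// => bx; apply: nx; exact: mem_set.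
rewrite -(RintZ B (bsupp_box m)) ler_norml; apply/andP; split.
  have bN := bsuppZ (-1) bB.
  rewrite -mulN1r -(RintZ (-1) bB); apply: Rint_le bN bg _ => x.
  by rewrite mulN1r; have := le x; rewrite ler_norml => /andP[].
by apply: Rint_le bg bB _ => x; rewrite (le_trans (ler_norm _)).
Qed.

Definition abs_sum (y : Rn) : R := \sum_i `|y 0 i|.

Lemma abs_sum_ge0 y : 0 <= abs_sum y.
Proof. by apply: sumr_ge0. Qed.

Lemma coord_le_abs_sum (y : Rn) i : `|y 0 i| <= abs_sum y.
Proof. by rewrite /abs_sum (bigD1 i)//= lerDl sumr_ge0. Qed.

Let shift_tuple (y : Rn) :=
  @affine_tuple R false (fun i => if insub i is Some j then y 0 j else 0) n.

Let row_shift y t : row (shift_tuple y t) = row t + y.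
Proof.
apply/rowP => i; rewrite !mxE tnth_mktuple /affine1 expr0 mul1r; congr (_ + _).
by rewrite insubT// => ilt; congr (y 0 _); exact/val_inj.
Qed.

Lemma meas_shift g y : meas g -> meas (fun x => g (x + y)).
Proof.
move=> mg; rewrite /meas.
have -> : (fun x => g (x + y)) \o row = (g \o row) \o shift_tuple y.
  by apply/funext => t /=; rewrite row_shift.
apply: measurableT_comp => //; exact: measurable_affine_tuple.
Qed.

Lemma box_shift m (x y : Rn) : box m (x + y) -> box (m + abs_sum y) x.
Proof.
move=> bxy i; have := bxy i; rewrite mxE => h.
have -> : x 0 i = (x 0 i + y 0 i) - y 0 i by rewrite addrK.
by rewrite (le_trans (ler_normB _ _))// lerD// coord_le_abs_sum.
Qed.

Lemma bsupp_shift m B g y : bsupp m B g ->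
  bsupp (m + abs_sum y) B (fun x => g (x + y)).
Proof.
move=> [mg gB g0]; split; [exact: meas_shift|by move=> x; exact: gB|].
by move=> x nx; apply: g0 => /box_shift.
Qed.

Lemma Rint_shift m B g (y : Rn) : bsupp m B g -> Rint (fun x => g (x + y)) = Rint g.
Proof.
move=> bg; have [mg gB g0] := bg.
pose phi := shift_tuple y.
have mphi : measurable_fun setT (phi : n.-tuple T -> n.-tuple T).
  exact: measurable_affine_tuple.
rewrite /Rint; congr fine.
have mg' : measurable_fun setT (EFin \o (g \o row)) by exact/measurable_EFinP.
have H := @integral_pushforward _ _ _ _ R _ mphi mu setT _ mg' _ measurableT.
rewrite preimage_setT in H.
have E : (EFin \o (g \o row)) \o phi = EFin \o ((fun x => g (x + y)) \o row).
  by apply/funext => t /=; rewrite row_shift.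
rewrite E in H.
apply: etrans (esym (H (bsupp_integrable (bsupp_shift y bg)))) _.
apply: eq_measure_integral => A mA _; exact: lebesgue_affine_tuple.
Qed.

(* Translation invariance replaces Fubini's theorem here: the difference
   quotients have zero integral and converge uniformly to the derivative. *)
Lemma Rint_derive0 m B B' K g g' k (e : Rn) :
  (forall x, is_derive x e g (g' x)) -> (forall x, is_derive x e g' (k x)) ->
  (forall x, `|k x| <= K) -> bsupp m B g -> bsupp m B' g' -> Rint g' = 0.
Proof.
move=> dg dg' kK bg bg'; apply/eqP; rewrite -normr_le0.
have K0 : 0 <= K by rewrite (le_trans _ (kK 0)).
pose m' := m + abs_sum e; pose V := K * vol m'.
have cv : (fun j => V * @harmonic R j) @ \oo --> 0.
  by rewrite -(mulr0 V); apply: cvgMr; exact: cvg_harmonic.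
apply: (le_null_err cv) => j; rewrite add0r.
(* Steps of length at most 1 keep all the translated supports inside the fixed box [m']. *)
pose t : R := harmonic j.
have t0 : 0 < t by exact: harmonic_gt0.
have t1 : t <= 1 by rewrite /t /harmonic/= invf_le1// ler1n.
have mm' : m <= m' by rewrite lerDl abs_sum_ge0.
have bS := bsupp_shift (t *: e) bg.
have mm'' : m + abs_sum (t *: e) <= m'.
  rewrite lerD2l; apply: ler_sum => i _.
  by rewrite mxE normrM (gtr0_norm t0) ler_piMl.
have bS' := bsupp_le mm'' (lexx _) bS.
have bg1 := bsuppZ (-1) (bsupp_le mm' (lexx _) bg).
have bg2 := bsuppZ (-1) (bsupp_le mm' (lexx _) bg').
have bd := bsuppZ t^-1 (bsuppD bS' bg1).
have bD := bsuppD bd bg2.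
have : bsupp m' (K * t) (fun x => t^-1 * (g (x + t *: e) + -1 * g x) + -1 * g' x).
  case: bD => h1 _ h3; split => // x.
  rewrite !mulN1r.
  have := @diff_quotient_le R (fun s => g (s *: e + x)) (fun s => g' (s *: e + x))
    (fun s => k (s *: e + x)) K t.
  rewrite !scale0r !add0r (gtr0_norm t0) (mulrC t^-1) (addrC x); apply=> //.
  - move=> y; apply/is_derive_line; have /is_derive_line := dg (y *: e + x).
    rewrite [X in is_derive _ _ X](_ : _ = (fun s => g ((s *: 1 + y) *: e + x)))//.
    by apply/funext => z; rewrite scalerDl addrA [z *: 1]mulr1.
  - move=> y; apply/is_derive_line; have /is_derive_line := dg' (y *: e + x).
    rewrite [X in is_derive _ _ X](_ : _ = (fun s => g' ((s *: 1 + y) *: e + x)))//.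
    by apply/funext => z; rewrite scalerDl addrA [z *: 1]mulr1.
  - by rewrite gt_eqF.
move=> /Rint_bound; rewrite (RintD bd bg2) (RintZ _ (bsuppD bS' bg1)).
rewrite (RintD bS' bg1) (Rint_shift _ bg) !(RintZ (-1) bg) (RintZ (-1) bg').
by rewrite mulN1r subrr mulr0 add0r mulN1r normrN /V mulrAC.
Qed.

Definition cbs m B F : Prop :=
  [/\ meas (fun x => complex.Re (F x)), meas (fun x => complex.Im (F x)),
      forall x, cmod (F x) <= B & forall x, ~ box m x -> F x = 0].

Local Notation cI := (@integral_Rn R n setT).

Let cIE F : cI F = Complex (Rint (fun x => complex.Re (F x)))
                           (Rint (fun x => complex.Im (F x))).
Proof. by rewrite /integral_Rn preimage_setT. Qed.

Let cbs_Re m B F : cbs m B F -> bsupp m B (fun x => complex.Re (F x)).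
Proof.
move=> [h1 h2 h3 h4]; split=> // x; first exact: le_trans (Re_le_cmod _) (h3 x).
by move=> /h4 ->.
Qed.

Let cbs_Im m B F : cbs m B F -> bsupp m B (fun x => complex.Im (F x)).
Proof.
move=> [h1 h2 h3 h4]; split=> // x; first exact: le_trans (Im_le_cmod _) (h3 x).
by move=> /h4 ->.
Qed.

Lemma cbs_cont m B F : ccont F -> (forall x, cmod (F x) <= B) ->
  (forall x, ~ box m x -> F x = 0) -> cbs m B F.
Proof. by move=> [c1 c2] FB F0; split => //; exact: continuous_meas. Qed.

Lemma cbsD m B B' F G : cbs m B F -> cbs m B' G ->
  cbs m (B + B') (fun x => F x + G x).
Proof.
move=> [f1 f2 f3 f4] [g1 g2 g3 g4]; split.
- under eq_fun do rewrite cReD; exact: measurable_funD.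
- under eq_fun do rewrite cImD; exact: measurable_funD.
- by move=> x; rewrite (le_trans (cmodD _ _))// lerD.
- by move=> x nx; rewrite f4// g4// addr0.
Qed.

Lemma cbsM m B B' F G : cbs m B F -> meas (fun x => complex.Re (G x)) ->
  meas (fun x => complex.Im (G x)) -> (forall x, cmod (G x) <= B') ->
  cbs m (B * B') (fun x => F x * G x).
Proof.
move=> [f1 f2 f3 f4] g1 g2 g3; split.
- under eq_fun do rewrite cReM.
  by apply: measurable_funB; exact: measurable_funM.
- under eq_fun do rewrite cImM.
  by apply: measurable_funD; exact: measurable_funM.
- by move=> x; rewrite cmodM ler_pM// cmod_ge0.
- by move=> x nx; rewrite f4// mul0r.
Qed.

Lemma cbsZ m B (z : C) F : cbs m B F -> cbs m (cmod z * B) (fun x => z * F x).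
Proof.
move=> bF; have := @cbsM _ _ (cmod z) _ (fun=> z) bF.
rewrite mulrC; under [in X in _ -> _ -> _ -> X]eq_fun do rewrite mulrC.
by apply => //; exact: measurable_cst.
Qed.

Lemma cID m B B' F G : cbs m B F -> cbs m B' G ->
  cI (fun x => F x + G x) = cI F + cI G.
Proof.
move=> bF bG; rewrite !cIE; apply: complex_ext => /=.
  under [X in Rint X]eq_fun do rewrite cReD.
  exact: RintD (cbs_Re bF) (cbs_Re bG).
under [X in Rint X]eq_fun do rewrite cImD.
exact: RintD (cbs_Im bF) (cbs_Im bG).
Qed.

Lemma cIZ m B (z : C) F : cbs m B F -> cI (fun x => z * F x) = z * cI F.
Proof.
move=> bF; have bR := cbs_Re bF; have bI := cbs_Im bF.
case: z => a b; rewrite !cIE; apply: complex_ext => /=.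
  under [X in Rint X]eq_fun do rewrite cReM/= -mulNr.
  by rewrite (RintD (bsuppZ a bR) (bsuppZ (- b) bI)) (RintZ a bR) (RintZ (-b) bI) mulNr.
under [X in Rint X]eq_fun do rewrite cImM/=.
by rewrite (RintD (bsuppZ a bI) (bsuppZ b bR)) (RintZ a bI) (RintZ b bR).
Qed.

Lemma cbs0 m : cbs m 0 (fun=> 0).
Proof. by split => // [||x]; rewrite ?cmod0//; exact: measurable_cst. Qed.

Lemma cI0 : cI (fun=> 0) = 0.
Proof. by have := cIZ 0 (cbs0 0); under eq_fun do rewrite mul0r; rewrite mul0r. Qed.

Lemma cbs_sum (I : Type) (r : seq I) m (B : I -> R) (F : I -> Rn -> C) :
  (forall i, cbs m (B i) (F i)) ->
  cbs m (\sum_(i <- r) B i) (fun x => \sum_(i <- r) F i x).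
Proof.
move=> bF; elim: r => [|i r IH].
  rewrite big_nil (_ : (fun x => _) = fun=> 0); first exact: cbs0.
  by apply/funext => x; rewrite big_nil.
rewrite big_cons (_ : (fun x => _) = fun x => F i x + \sum_(j <- r) F j x).
  exact: cbsD.
by apply/funext => x; rewrite big_cons.
Qed.

Lemma cI_sum (I : Type) (r : seq I) m (B : I -> R) (F : I -> Rn -> C) :
  (forall i, cbs m (B i) (F i)) ->
  cI (fun x => \sum_(i <- r) F i x) = \sum_(i <- r) cI (F i).
Proof.
move=> bF; elim: r => [|i r IH].
  rewrite big_nil (_ : (fun x => _) = fun=> 0) ?cI0//.
  by apply/funext => x; rewrite big_nil.
rewrite (_ : (fun x => _) = fun x => F i x + \sum_(j <- r) F j x); last first.
  by apply/funext => x; rewrite big_cons.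
by rewrite (cID (bF i) (cbs_sum r bF)) IH big_cons.
Qed.

Lemma cI_bound m B F : cbs m B F -> cmod (cI F) <= 2 * vol m * B.
Proof.
move=> bF; rewrite cIE (le_trans (cmod_le_ReIm _))//=.
have -> : 2 * vol m * B = B * vol m + B * vol m by ring.
by apply: lerD; [exact: Rint_bound (cbs_Re bF)|exact: Rint_bound (cbs_Im bF)].
Qed.

Lemma cI_shift m B F (y : Rn) : cbs m B F -> cI (fun x => F (x + y)) = cI F.
Proof.
move=> bF; rewrite !cIE; apply: complex_ext => /=.
  exact: (Rint_shift _ (cbs_Re bF)).
exact: (Rint_shift _ (cbs_Im bF)).
Qed.

Lemma cbs_shift m B F y : cbs m B F -> cbs (m + abs_sum y) B (fun x => F (x + y)).
Proof.
move=> [h1 h2 h3 h4]; split.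
- exact: (@meas_shift (fun x => complex.Re (F x))).
- exact: (@meas_shift (fun x => complex.Im (F x))).
- by move=> x; exact: h3.
- by move=> x nx; apply: h4 => /box_shift.
Qed.

Lemma cI_derive0 m B B' K F F' F'' (e : Rn) :
  cderive e F F' -> cderive e F' F'' -> (forall x, cmod (F'' x) <= K) ->
  cbs m B F -> cbs m B' F' -> cI F' = 0.
Proof.
move=> dF dF' FK bF bF'; rewrite cIE; apply: complex_ext => /=.
  apply: (Rint_derive0 _ _ _ (cbs_Re bF) (cbs_Re bF')).
  - by move=> x; have [h _] := dF x; exact: h.
  - by move=> x; have [h _] := dF' x; exact: h.
  - by move=> x /=; exact: le_trans (Re_le_cmod _) (FK x).
apply: (Rint_derive0 _ _ _ (cbs_Im bF) (cbs_Im bF')).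
- by move=> x; have [_ h] := dF x; exact: h.
- by move=> x; have [_ h] := dF' x; exact: h.
- by move=> x /=; exact: le_trans (Im_le_cmod _) (FK x).
Qed.

(** The remainder after [k] terms is bounded by [tail v k] on one fixed box, so its integral is at
    most [2 * vol m * tail v k]. *)
Lemma cI_csum m (v : nat -> R) (F : nat -> Rn -> C) : summ v ->
  (forall i, cbs m (v i) (F i)) ->
  meas (fun x => complex.Re (csum (F ^~ x))) ->
  meas (fun x => complex.Im (csum (F ^~ x))) ->
  cI (fun x => csum (F ^~ x)) = csum (fun i => cI (F i)).
Proof.
move=> sv bF mR mI.
have Fv x i : cmod (F i x) <= v i by have [_ _ h _] := bF i.
have F0 x i : ~ box m x -> F i x = 0 by have [_ _ _ h] := bF i; exact: h.
have V0 : 0 <= 2 * vol m by rewrite mulr_ge0// vol_ge0.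
have csum_out x : ~ box m x -> csum (F ^~ x) = 0.
  by move=> nx; rewrite -[RHS]csum0; apply: eq_csum => i; exact: F0.
have bS : cbs m (tsum v) (fun x => csum (F ^~ x)).
  by split => // x; apply: csum_bound => // i; exact: Fv.
apply: (@csum_unique _ (fun i => 2 * vol m * v i) _ _ (fun k => 2 * vol m * tail v k)).
- exact: summZ.
- by move=> i; exact: cI_bound (bF i).
- by rewrite -(mulr0 (2 * vol m)); apply: cvgMr; exact: tail_cvg0.
- move=> k; rewrite -(cI_sum (index_enum 'I_k) (F := fun i : 'I_k => F i) bF).
  have bk := cbs_sum (index_enum 'I_k) (F := fun i : 'I_k => F i) bF.
  have bN := cbsZ (-1) bk.
  rewrite -mulN1r -(cIZ (-1) bk) -(cID bS bN).
  apply: cI_bound; have [h1 h2 _ h4] := cbsD bS bN; split => // x.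
  by rewrite mulN1r; apply: csum_tail => // i; exact: Fv.
Qed.

Lemma integral_Rn_supp (A : set Rn) F : (forall x, ~ A x -> F x = 0) ->
  integral_Rn A F = cI F.
Proof.
move=> F0; rewrite cIE /integral_Rn /Rint.
rewrite [X in Complex X _]Rintegral_mkcond [X in Complex _ X]Rintegral_mkcond.
congr (Complex _ _); congr fine; apply: eq_integral => t _; rewrite patchE;
  by case: ifPn => //; rewrite notin_setE => /F0 ->.
Qed.

End box_integral.

(** * Fubini's theorem for tensor products *)

Section tensor_integral.
Context {R : realType}.
Local Notation C := R[i].
Local Notation T := (measurableTypeR R).
Local Notation leb := (@lebesgue_measure R).

Definition row_rest n (x : 'rV[R]_n.+1) : 'rV[R]_n := \row_i x 0 (lift ord0 i).

Definition bsupp1 (m B : R) (a : R -> R) : Prop :=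
  [/\ measurable_fun [set: T] (a : T -> R), forall t, `|a t| <= B &
      forall t, m < `|t| -> a t = 0].

Lemma meas_coord0 n (h : R -> R) : measurable_fun [set: T] (h : T -> R) ->
  meas (fun x : 'rV[R]_n.+1 => h (x 0 ord0)).
Proof.
move=> mh; rewrite /meas (_ : _ \o _ = h \o (fun t : n.+1.-tuple T => tnth t ord0)).
  by apply: measurableT_comp => //; exact: measurable_tnth.
by apply/funext => t; rewrite /= mxE.
Qed.

Lemma meas_rest n (h : 'rV[R]_n -> R) : meas h ->
  meas (fun x : 'rV[R]_n.+1 => h (row_rest x)).
Proof.
move=> mh; rewrite /meas (_ : _ \o _ = (h \o @row_of_tuple R n) \o
  (fun t : n.+1.-tuple T => [tuple of behead t])).
  by apply: measurableT_comp => //; exact: measurable_behead.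
apply/funext => t /=; congr h; apply/rowP => i; rewrite !mxE.
by rewrite tnth_behead; congr (tnth t _); apply/val_inj; rewrite /= inordK// ltnS.
Qed.

(** Fubini's theorem for a function of the first coordinate times a function of the remaining
    ones. *)
Lemma Rint_cons n (m B B' : R) (a : R -> R) (b : 'rV[R]_n -> R) :
  bsupp1 m B a -> bsupp m B' b ->
  Rint (fun x : 'rV[R]_n.+1 => a (x 0 ord0) * b (row_rest x)) =
  (\int[leb]_t a t) * Rint b.
Proof.
move=> [ma aB a0] bb; have [mb bB b0] := bb.
have B0 : 0 <= B by rewrite (le_trans _ (aB 0)).
have B'0 : 0 <= B' by rewrite (le_trans _ (bB 0)).
pose H (x : 'rV[R]_n.+1) : R := a (x 0 ord0) * b (row_rest x).
have row_cons (s : T) (t : n.-tuple T) :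
    (row_of_tuple (tuple_cons (s, t)) 0 ord0 = s) *
    (row_rest (row_of_tuple (tuple_cons (s, t))) = row_of_tuple t).
  split; first by rewrite mxE tnth0.
  by apply/rowP => i; rewrite !mxE tnthS.
have HE (p : T * n.-tuple T) : H (row_of_tuple (tuple_cons p)) = a p.1 * b (row_of_tuple p.2).
  by case: p => s t; rewrite /H !row_cons.
have mHt : measurable_fun setT (H \o @row_of_tuple R n.+1 : n.+1.-tuple T -> R).
  by apply: measurable_funM; [exact: meas_coord0|exact: meas_rest].
pose nu : {sigma_finite_measure set (n.-tuple T) -> \bar R} := @lebesgue_tuple R n.
pose f (p : T * n.-tuple T) : R := a p.1 * b (row_of_tuple p.2).
have mf : measurable_fun setT f.
  apply: measurable_funM.
    by apply: measurableT_comp => //; exact: measurable_fst.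
  by apply: (@measurableT_comp _ _ _ _ _ _ (b \o @row_of_tuple R n)) => //; exact: measurable_snd.
have intf : (leb \x nu)%E.-integrable setT (EFin \o f).
  apply: (@bounded_support_integrable _ _ _ (leb \x nu)%E
    ([set` `[- m, m]] `*` (@row_of_tuple R n @^-1` box m)) (B * B') f) => //.
  - by apply: measurableX => //; exact: measurable_box.
  - have fin : leb [set` `[- m, m]] \is a fin_num.
      by rewrite lebesgue_measure_itv/=; case: ifP.
    have lt : (leb [set` `[(- m)%R, m]] * nu (@row_of_tuple R n @^-1` box m) < +oo)%E.
      by apply: lte_mul_pinfty; [exact: measure_ge0|exact: fin|exact: box_lty].
    rewrite -(@product_measure1E _ _ _ _ _ leb nu _ _ (measurable_itv `[- m, m])
      (measurable_box m)) in lt.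
    exact: lt.
  - move=> [s t]; rewrite indicE /f/=; case: (boolP (_ \in _)) => [_|/negP nst].
      by rewrite mulr1 normrM ler_pM.
    rewrite mulr0; suff -> : a s * b (row_of_tuple t) = 0 by rewrite normr0.
    have [sm|ms] := leP `|s| m; last by rewrite a0// mul0r.
    rewrite b0 ?mulr0// => bt; apply: nst; apply/mem_set; split => //=.
    by rewrite in_itv/= -ler_norml.
rewrite /Rint -/H.
have mE : measurable_fun setT (EFin \o (H \o @row_of_tuple R n.+1) : n.+1.-tuple T -> \bar R).
  exact/measurable_EFinP.
have P := @integral_pushforward _ _ _ _ R _ (@measurable_tuple_cons _ T n)
  (leb \x nu)%E setT _ mE _ measurableT.
rewrite preimage_setT in P.
have E : (EFin \o (H \o @row_of_tuple R n.+1)) \o @tuple_cons _ T n = EFin \o f.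
  by apply/funext => p /=; rewrite HE.
rewrite E in P.
rewrite /Rintegral.
transitivity (fine (\int[(leb \x nu)%E]_p (EFin \o f) p)%E).
  by congr fine; exact: P intf.
rewrite -(integral12_prod_meas1 intf) /fubini_F.
have inta : leb.-integrable setT (EFin \o a).
  apply: (@bounded_support_integrable _ _ _ leb [set` `[- m, m]] B a) => //.
    have : (lebesgue_measure [set` `[(- m)%R, m]] < +oo)%E.
      by rewrite lebesgue_measure_itv/=; case: ifP => _; rewrite ltry.
    exact.
  move=> t; rewrite indicE; case: (boolP (t \in _)) => [_|]; first by rewrite mulr1.
  rewrite notin_setE/= in_itv/= -ler_norml => /negP; rewrite -ltNge => mt.
  by rewrite a0// normr0 mulr0.
transitivity (fine (\int[leb]_s ((Rint b)%:E * (a s)%:E))%E).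
  congr fine; apply: eq_integral => s _.
  rewrite /f/= -[RHS]EFinM mulrC.
  transitivity (\int[nu]_y ((a s)%:E * (b (row_of_tuple y))%:E))%E.
    by apply: eq_integral => y _; rewrite EFinM.
  rewrite integralZl//; last exact: bsupp_integrable bb.
  by rewrite EFinM /Rint fineK//; apply: integrable_fin_num => //; exact: bsupp_integrable bb.
rewrite integralZl// fineM//=; last exact: integrable_fin_num.
by rewrite mulrC.
Qed.

Definition cint1 (a : R -> C) : C :=
  Complex (\int[leb]_t complex.Re (a t)) (\int[leb]_t complex.Im (a t)).

Definition cbs1 (m B : R) (a : R -> C) : Prop :=
  [/\ measurable_fun [set: T] (fun t : T => complex.Re (a t)),
      measurable_fun [set: T] (fun t : T => complex.Im (a t)),
      forall t, cmod (a t) <= B & forall t, m < `|t| -> a t = 0].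

(** Serves to integrate characters over a cube and to compute the volume of a box; one coordinate is
    split off at a time. *)
Lemma integral_tensor n (m B : R) (a : 'I_n -> R -> C) : 0 <= B ->
  (forall l, cbs1 m B (a l)) ->
  cbs m (B ^+ n) (fun x : 'rV[R]_n => \prod_l a l (x 0 l)) /\
  integral_Rn setT (fun x : 'rV[R]_n => \prod_l a l (x 0 l)) = \prod_l cint1 (a l).
Proof.
move=> B0; elim: n a => [|n IH] a ba.
  have E : (fun x : 'rV[R]_0 => \prod_l a l (x 0 l)) = (fun=> 1).
    by apply/funext => x; rewrite big_ord0.
  rewrite E big_ord0; split.
    split; [exact: measurable_cst|exact: measurable_cst|by move=> x; rewrite cmod1 expr0|].
    by move=> x []; case.
  rewrite /integral_Rn preimage_setT/=; congr (Complex _ _); rewrite Rintegral_cst//.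
    by rewrite /lebesgue_tuple/= /tuple_measure0 /dirac indicE in_setT mulr1.
  by rewrite mul0r.
have [IHb IHi] := IH (fun l => a (lift ord0 l)) (fun l => ba _).
pose G (y : 'rV[R]_n) : C := \prod_l a (lift ord0 l) (y 0 l).
have E (x : 'rV[R]_n.+1) : \prod_l a l (x 0 l) = a ord0 (x 0 ord0) * G (row_rest x).
  by rewrite big_ord_recl /G; congr (_ * _); apply: eq_bigr => l _; rewrite mxE.
have [m1 m2 aB a0] := ba ord0.
split.
  have [g1 g2 g3 g4] := IHb.
  rewrite (_ : (fun x => _) = fun x : 'rV[R]_n.+1 => a ord0 (x 0 ord0) * G (row_rest x)); last exact/funext.
  split.
  - under eq_fun do rewrite cReM.
    apply: measurable_funB; apply: measurable_funM.
    + exact: (@meas_coord0 n (fun t => complex.Re (a ord0 t))).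
    + exact: (@meas_rest n (fun y => complex.Re (G y))).
    + exact: (@meas_coord0 n (fun t => complex.Im (a ord0 t))).
    + exact: (@meas_rest n (fun y => complex.Im (G y))).
  - under eq_fun do rewrite cImM.
    apply: measurable_funD; apply: measurable_funM.
    + exact: (@meas_coord0 n (fun t => complex.Re (a ord0 t))).
    + exact: (@meas_rest n (fun y => complex.Im (G y))).
    + exact: (@meas_coord0 n (fun t => complex.Im (a ord0 t))).
    + exact: (@meas_rest n (fun y => complex.Re (G y))).
  - move=> x; rewrite exprS cmodM; apply: ler_pM; [exact: cmod_ge0|exact: cmod_ge0|exact: aB|exact: g3].
  - move=> x nx; have [xm|mx] := leP `|x 0 ord0| m; last by rewrite a0// mul0r.
    rewrite /G g4 ?mulr0// => br; apply: nx => i.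
    case: (unliftP ord0 i) => [j ->|->//].
    by have := br j; rewrite mxE.
rewrite (_ : (fun x => _) = fun x : 'rV[R]_n.+1 => a ord0 (x 0 ord0) * G (row_rest x)); last exact/funext.
rewrite big_ord_recl -IHi -/G /integral_Rn !preimage_setT.
have bR1 : bsupp1 m B (fun t => complex.Re (a ord0 t)).
  by split => // t; [exact: le_trans (Re_le_cmod _) (aB t)|move=> /a0 ->].
have bI1 : bsupp1 m B (fun t => complex.Im (a ord0 t)).
  by split => // t; [exact: le_trans (Im_le_cmod _) (aB t)|move=> /a0 ->].
have [g1 g2 g3 g4] := IHb.
have bR2 : bsupp m (B ^+ n) (fun y => complex.Re (G y)).
  by split => // y; [exact: le_trans (Re_le_cmod _) (g3 y)|move=> /g4; rewrite /G => ->].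
have bI2 : bsupp m (B ^+ n) (fun y => complex.Im (G y)).
  by split => // y; [exact: le_trans (Im_le_cmod _) (g3 y)|move=> /g4; rewrite /G => ->].
have bprod (h : R -> R) (k : 'rV[R]_n -> R) : bsupp1 m B h -> bsupp m (B ^+ n) k ->
    bsupp m (B * B ^+ n) (fun x : 'rV[R]_n.+1 => h (x 0 ord0) * k (row_rest x)).
  move=> [h1 h2 h3] [k1 k2 k3]; split.
  - by apply: measurable_funM; [exact: meas_coord0|exact: meas_rest].
  - by move=> x; rewrite normrM ler_pM.
  - move=> x nx; have [xm|mx] := leP `|x 0 ord0| m; last by rewrite h3// mul0r.
    rewrite k3 ?mulr0// => br; apply: nx => i.
    case: (unliftP ord0 i) => [j ->|->//].
    by have := br j; rewrite mxE.
apply: complex_ext.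
  rewrite cReM /=.
  transitivity (Rint (fun x : 'rV[R]_n.+1 =>
    complex.Re (a ord0 (x 0 ord0)) * complex.Re (G (row_rest x)) +
    -1 * (complex.Im (a ord0 (x 0 ord0)) * complex.Im (G (row_rest x))))).
    by apply: eq_Rintegral => t _; rewrite cReM mulN1r.
  rewrite (RintD (bprod _ _ bR1 bR2) (bsuppZ (-1) (bprod _ _ bI1 bI2))).
  by rewrite (RintZ (-1) (bprod _ _ bI1 bI2)) (Rint_cons bR1 bR2) (Rint_cons bI1 bI2) mulN1r.
rewrite cImM /=.
transitivity (Rint (fun x : 'rV[R]_n.+1 =>
  complex.Re (a ord0 (x 0 ord0)) * complex.Im (G (row_rest x)) +
  complex.Im (a ord0 (x 0 ord0)) * complex.Re (G (row_rest x)))).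
  by apply: eq_Rintegral => t _; rewrite cImM.
rewrite (RintD (bprod _ _ bR1 bI2) (bprod _ _ bI1 bR2)).
by rewrite (Rint_cons bR1 bI2) (Rint_cons bI1 bR2).
Qed.

End tensor_integral.

(** * Fourier inversion on a cube *)

Section characters.
Context {R : realType}.
Local Notation C := R[i].

Definition cis (t : R) : C := Complex (cos t) (sin t).

Lemma cis0 : cis 0 = 1.
Proof. by rewrite /cis cos0 sin0. Qed.

Lemma cisD s t : cis (s + t) = cis s * cis t.
Proof.
by rewrite /cis cosD sinD; apply: complex_ext => /=; rewrite // addrC.
Qed.

Lemma cmod_cis t : cmod (cis t) = 1.
Proof. by rewrite /cmod /Normc.normc /cis cos2Dsin2 sqrtr1. Qed.

Lemma cderive_cis (c : R) :
  cderive (1 : R) (fun t => cis (c * t)) (fun t => Complex 0 c * cis (c * t)).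
Proof.
move=> x; have hc : is_derive x (1 : R) (fun t => c * t) c.
  have := is_deriveZ c (is_derive_id x (1 : R)).
  by rewrite [X in is_derive _ _ _ X]mulr1.
split=> /=.
  have := @is_derive1_comp _ (@cos R) (fun t => c * t) x _ _ (is_derive_cos _) hc.
  by rewrite mul0r sub0r mulNr (mulrC (sin _) c).
have := @is_derive1_comp _ (@sin R) (fun t => c * t) x _ _ (is_derive_sin _) hc.
by rewrite mul0r add0r (mulrC (cos _) c).
Qed.

Lemma ccont_cis (c : R) : ccont (fun t => cis (c * t)).
Proof. exact: cderive_ccont (cderive_cis c). Qed.

Lemma csum_single (a : nat -> C) j : (forall i, i != j -> a i = 0) -> csum a = a j.
Proof.
move=> a0; pose v i := if i == j then cmod (a j) else 0.
apply/esym; apply: (@csum_unique _ v _ _ (fun m => if (m <= j)%N then cmod (a j) else 0)).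
- split=> [i|]; first by rewrite /v; case: ifP => _ //; exact: cmod_ge0.
  exists (cmod (a j)) => m; have [mj|jm] := leqP m j.
    rewrite big1 ?cmod_ge0// => i _; rewrite /v; case: eqP => // ij.
    by have := ltn_ord i; rewrite ij ltnNge mj.
  rewrite (bigD1 (Ordinal jm))//= /v eqxx big1 ?addr0// => i.
  by rewrite -val_eqE/= => /negPf ->.
- by move=> i; rewrite /v; case: eqP => [->//|/eqP /a0 ->]; rewrite cmod0.
- apply/cvgrPdist_le => e e0; exists j.+1 => // m /= jm.
  by rewrite leqNgt jm /= subrr normr0 ltW.
- move=> m; have [mj|jm] := leqP m j.
    rewrite big1 ?subr0// => i _; apply: a0; apply/eqP => ij.
    by have := ltn_ord i; rewrite ij ltnNge mj.
  rewrite (bigD1 (Ordinal jm))//= big1 ?addr0 ?subrr ?cmod0// => i.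
  by rewrite -val_eqE/= => /a0.
Qed.

End characters.

Section fourier.
Context {R : realType} {n : nat} (N : nat).
Hypothesis N_gt0 : (0 < N)%N.
Local Notation Rn := 'rV[R]_n.
Local Notation C := R[i].
Local Notation Zn := {ffun 'I_n -> int}.
Local Notation cI := (@integral_Rn R n setT).
Local Notation L := (pi * N%:R : R).

Let NR : 0 < N%:R :> R. Proof. by rewrite ltr0n. Qed.
Let L_gt0 : 0 < L. Proof. by rewrite mulr_gt0// pi_gt0. Qed.

(** With [L = pi * N], the characters of frequencies [k / N] have period [2 * L] in each coordinate,
    as a cube of half-side [L] requires. *)
Definition freq (k : int) : R := k%:~R / N%:R.

Definition echar (k : Zn) (x : Rn) : C := \prod_l cis (freq (k l) * x 0 l).

Lemma cmod_echar k x : cmod (echar k x) = 1.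
Proof. by rewrite /echar cmod_prod big1// => l _; exact: cmod_cis. Qed.

Lemma ccont_echar k : ccont (echar k).
Proof.
apply: ccont_prod => l; have [c1 c2] := ccont_cis (freq (k l)).
by split=> x; [have := @continuous_comp _ _ _ (fun x : Rn => x 0 l)
  (fun t => complex.Re (cis (freq (k l) * t))) x|have := @continuous_comp _ _ _ (fun x : Rn => x 0 l)
  (fun t => complex.Im (cis (freq (k l) * t))) x]; apply; [exact: coord_continuous|exact: c1|
  exact: coord_continuous|exact: c2].
Qed.

Lemma echarM k k' x : echar (k + k') x = echar k x * echar k' x.
Proof.
rewrite /echar -big_split/=; apply: eq_bigr => l _.
by rewrite ffunE /freq intrD !mulrDl cisD.
Qed.

Lemma echar0 x : echar 0 x = 1.
Proof. by rewrite /echar big1// => l _; rewrite ffunE /freq !mul0r cis0. Qed.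

(** The indicator of the cube is a product over the coordinates, which makes the truncated
    characters tensor products of these functions. *)
Let cube1 (k : int) (t : R) : C := if `|t| <= L then cis (freq k * t) else 0.

Let cbs_cube1 k : cbs1 L 1 (cube1 k).
Proof.
have mQ : measurable ([set` `[- L, L]] : set (measurableTypeR R)) by exact: measurable_itv.
have mg (g : R -> R) : continuous g ->
    measurable_fun [set: measurableTypeR R] (g \_ [set` `[- L, L]] : measurableTypeR R -> R).
  move=> cg; apply/(measurable_restrictT _ mQ); apply: measurable_funTS.
  exact: continuous_measurable_fun.
have E t : (`|t| <= L) = (t \in [set` `[- L, L]]).
  by apply/idP/idP; rewrite inE/= in_itv/= -ler_norml.
have [c1 c2] := ccont_cis (freq k).
split.
- rewrite (_ : (fun t => _) = (fun t => complex.Re (cis (freq k * t))) \_ [set` `[- L, L]]).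
    exact: mg.
  by apply/funext => t; rewrite patchE /cube1 E; case: ifP.
- rewrite (_ : (fun t => _) = (fun t => complex.Im (cis (freq k * t))) \_ [set` `[- L, L]]).
    exact: mg.
  by apply/funext => t; rewrite patchE /cube1 E; case: ifP.
- by move=> t; rewrite /cube1; case: ifP => _; rewrite ?cmod_cis// cmod0.
- by move=> t Lt; rewrite /cube1 leNgt Lt.
Qed.

Let Rint_itv (g G : R -> R) : (forall x, is_derive x (1 : R) G (g x)) -> continuous g ->
  \int[lebesgue_measure]_t (if `|t| <= L then g t else 0) = G L - G (- L).
Proof.
move=> dG cg.
have E : (fun t => if `|t| <= L then g t else 0) = g \_ [set` `[- L, L]].
  apply/funext => t; rewrite patchE; congr (if _ then _ else _).
  by apply/idP/idP; rewrite inE/= in_itv/= -ler_norml.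
rewrite E -Rintegral_mkcond /Rintegral.
have LL : - L < L by rewrite gtrN.
have cG := is_derive_continuous dG.
rewrite (@continuous_FTC2 _ g G _ _ LL)//.
- exact: continuous_subspaceT.
- split.
  + by move=> x _; case: (dG x).
  + by apply: cvg_at_right_filter; exact: cG.
  + by apply: cvg_at_left_filter; exact: cG.
- by move=> x _; rewrite derive1E; case: (dG x).
Qed.

Let sin_int_pi (k : int) : sin (k%:~R * pi) = 0 :> R.
Proof.
have nat_case (j : nat) : sin (j%:R * pi) = 0 :> R.
  elim: j => [|j IH]; first by rewrite mul0r sin0.
  by rewrite -addn1 natrD mulrDl mul1r sinDpi IH oppr0.
case: k => j; first exact: nat_case.
by rewrite NegzE mulrNz mulNr sinN nat_case oppr0.
Qed.

Let cint1_cube1 k : cint1 (cube1 k) = (if k == 0 then 2 * L else 0)%:C%C.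
Proof.
rewrite /cint1.
have ER t : complex.Re (cube1 k t) = if `|t| <= L then cos (freq k * t) else 0.
  by rewrite /cube1; case: ifP.
have EI t : complex.Im (cube1 k t) = if `|t| <= L then sin (freq k * t) else 0.
  by rewrite /cube1; case: ifP.
under eq_Rintegral do rewrite ER; under [X in Complex _ X]eq_Rintegral do rewrite EI.
have [cR cJ] := ccont_cis (freq k).
have [->|k0] := eqVneq k 0.
  rewrite /freq mul0r.
  have E1 : (fun t : R => if `|t| <= L then cos (0 * t) else 0) = (fun t => if `|t| <= L then (cst 1) t else 0).
    by apply/funext => t; rewrite mul0r cos0.
  have E2 : (fun t : R => if `|t| <= L then sin (0 * t) else 0) = (fun t => if `|t| <= L then (cst 0) t else 0).
    by apply/funext => t; rewrite mul0r sin0.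
  have I1 : \int[lebesgue_measure]_t (if `|t| <= L then (cst 1) t else 0) = L - - L.
    by apply: (@Rint_itv (cst 1) id) => x; exact: cvg_cst.
  have I2 : \int[lebesgue_measure]_t (if `|t| <= L then (cst 0) t else 0) = 0 - 0 :> R.
    by apply: (@Rint_itv (cst 0) (cst 0)) => x; exact: cvg_cst.
  by rewrite E1 E2 I1 I2 subrr opprK; congr Complex; ring.
have f0 : freq k != 0 by rewrite mulf_neq0 ?invr_eq0 ?(gt_eqF NR)// intr_eq0.
have d (x : R) := cderive_cis (freq k) x.
have fL : freq k * L = k%:~R * pi.
  by rewrite /freq; field; rewrite gt_eqF.
have dS (x : R) : is_derive x 1 (fun t => (freq k)^-1 * sin (freq k * t)) (cos (freq k * x)).
  have [_ ds] := d x.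
  have := is_deriveZ ((freq k)^-1) ds; rewrite [X in is_derive _ _ _ X](_ : _ = cos (freq k * x))//.
  by rewrite /GRing.scale/= mul0r add0r mulrA mulVf// mul1r.
have dC (x : R) : is_derive x 1 (fun t => - (freq k)^-1 * cos (freq k * t)) (sin (freq k * x)).
  have [dc _] := d x.
  have := is_deriveZ (- (freq k)^-1) dc; rewrite [X in is_derive _ _ _ X](_ : _ = sin (freq k * x))//.
  by rewrite /GRing.scale/= mul0r sub0r mulNr mulrN opprK mulrA mulVf// mul1r.
rewrite (Rint_itv dS cR) (Rint_itv dC cJ) mulrN fL sinN cosN sin_int_pi oppr0 mulr0.
by rewrite !subrr.
Qed.

Definition cube_ind (x : Rn) : C := (\1_(box L) x)%:C%C.

Let cube_tensor k x : cube_ind x * echar k x = \prod_l cube1 (k l) (x 0 l).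
Proof.
rewrite /cube_ind indicE; case: (boolP (x \in _)) => [|/negP nx].
  rewrite inE => bx; rewrite mul1r /echar; apply: eq_bigr => l _.
  by rewrite /cube1 (bx l).
rewrite mul0r; have [l Hl] : exists l, ~~ (`|x 0 l| <= L).
  have : ~ (forall l, `|x 0 l| <= L) by move=> h; apply: nx; exact/mem_set.
  by move/existsNP => [l /negP hl]; exists l.
by rewrite (bigD1 l)//= /cube1 (negPf Hl) mul0r.
Qed.

Lemma cbs_cube k : cbs L 1 (fun x => cube_ind x * echar k x).
Proof.
have [h _] := integral_tensor ler01 (fun l => cbs_cube1 (k l)).
have -> : (fun x => cube_ind x * echar k x) = (fun x : Rn => \prod_l cube1 (k l) (x 0 l)).
  by apply/funext => x; exact: cube_tensor.
by rewrite expr1n in h.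
Qed.

Lemma integral_cube k : cI (fun x => cube_ind x * echar k x) =
  (if k == 0 then (2 * L) ^+ n else 0)%:C%C.
Proof.
have [_ h] := integral_tensor ler01 (fun l => cbs_cube1 (k l)).
have -> : (fun x => cube_ind x * echar k x) = (fun x : Rn => \prod_l cube1 (k l) (x 0 l)).
  by apply/funext => x; exact: cube_tensor.
rewrite h; under eq_bigr do rewrite cint1_cube1.
rewrite -rmorph_prod; congr (_%:C)%C.
have [->|k0] := eqVneq k 0.
  by under eq_bigr do rewrite ffunE eqxx; rewrite prodr_const card_ord.
have [l kl] : exists l, k l != 0.
  have : ~ (forall l, k l = 0).
    by move=> hk; move/eqP : k0; apply; apply/ffunP => l; rewrite ffunE.
  by move/existsNP => [l /eqP hl]; exists l.
by rewrite (bigD1 l)//= (negPf kl) mul0r.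
Qed.

Lemma vol_gt0 (m : R) : 0 < m -> 0 < vol (n := n) m.
Proof.
move=> m0; pose a (t : R) : C := (\1_([set` `[- m, m]]) t)%:C%C.
have ba : cbs1 m 1 a.
  split.
  - exact: (@measurable_indic _ (measurableTypeR R) R [set: measurableTypeR R] _ (measurable_itv `[- m, m])).
  - exact: measurable_cst.
  - by move=> t; rewrite cmod_real indicE; case: (_ \in _); rewrite ?normr1 ?normr0.
  - move=> t mt; rewrite /a indicE memNset//= in_itv/= -ler_norml; apply/negP.
    by rewrite -ltNge.
have [_ h] := integral_tensor ler01 (fun _ : 'I_n => ba).
have E (x : Rn) : \prod_(l < n) a (x 0 l) = (\1_(box m) x)%:C%C.
  rewrite indicE; case: (boolP (x \in _)) => [|/negP nx].
    rewrite inE => bx; rewrite big1// => l _.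
    by rewrite /a indicE mem_set//= in_itv/= -ler_norml.
  have : ~ (forall l, `|x 0 l| <= m) by move=> hx; apply: nx; exact/mem_set.
  move/existsNP => [l hl]; rewrite (bigD1 l)//= /a indicE memNset ?mul0r//=.
  by rewrite in_itv/= -ler_norml.
move/(congr1 (@complex.Re R)) : h; rewrite /integral_Rn preimage_setT /=.
under eq_Rintegral do rewrite E /=.
rewrite /vol /Rint => ->; rewrite prodr_const card_ord.
have -> : cint1 a = (2 * m)%:C%C.
  rewrite /cint1 /a /= Rintegral_cst// mul0r.
  have -> : \int[lebesgue_measure]_t \1_([set` `[- m, m]]) t = 2 * m :> R.
    rewrite /Rintegral integral_indic//= setIT lebesgue_measure_itv/= lte_fin.
    by rewrite gtrN// -EFinB /= opprK; ring.
  by [].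
by rewrite -rmorphXn/= exprn_gt0// mulr_gt0.
Qed.

Lemma nbhs_boxP (x : Rn) (A : set Rn) : nbhs x A <->
  exists2 d : R, 0 < d & forall y : Rn, (forall l, `|y 0 l - x 0 l| <= d) -> A y.
Proof.
split=> [/nbhs_ballP[e /= e0 he]|[d d0 hd]].
  exists (e / 2); first by rewrite divr_gt0.
  move=> y hy; apply: he; split=> // i j; rewrite ord1 /ball/= distrC.
  by rewrite (le_lt_trans (hy j))// ltr_pdivrMr// ltr_pMr// ltr1n.
apply/nbhs_ballP; exists d => //= y [_ hy]; apply: hd => l.
by rewrite distrC ltW//; exact: hy.
Qed.

(** A trigonometric polynomial of degree one in the coordinate [l], equal to the square of the
    cosine of half the angle: it lies between 0 and 1 and, over one period, reaches 1 only at the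
    coordinate of [x0]. *)
Let fac (x0 x : Rn) l : R := (1 + cos ((x 0 l - x0 0 l) / N%:R)) / 2.

Let continuous_fac1 (a : R) : continuous (fun t : R => (1 + cos ((t - a) / N%:R)) / 2).
Proof.
move=> t; apply: cvgM; last exact: cvg_cst.
apply: cvgD; first exact: cvg_cst.
apply: (@continuous_comp _ _ _ (fun t : R => (t - a) / N%:R) (@cos R)).
  apply: cvgM; last exact: cvg_cst.
  by apply: cvgB; [exact: cvg_id|exact: cvg_cst].
exact: continuous_cos.
Qed.

Let continuous_fac x0 l : continuous (fun y : Rn => fac x0 y l).
Proof.
move=> x; apply: (@continuous_comp _ _ _ (fun y : Rn => y 0 l)
    (fun t : R => (1 + cos ((t - x0 0 l) / N%:R)) / 2)); first exact: coord_continuous.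
exact: continuous_fac1.
Qed.

Let fac01 x0 x l : 0 <= fac x0 x l <= 1.
Proof.
rewrite /fac; have := cos_geN1 ((x 0 l - x0 0 l) / N%:R).
by have := cos_le1 ((x 0 l - x0 0 l) / N%:R); lra.
Qed.

Definition peak (x0 x : Rn) : R := \prod_l fac x0 x l.

Let peak01 x0 x : 0 <= peak x0 x <= 1.
Proof.
rewrite /peak; elim/big_ind : _ => [|a b|l _]; rewrite ?ler01 ?lexx//.
by move=> /andP[a0 a1] /andP[b0 b1]; rewrite mulr_ge0// mulr_ile1.
Qed.

Let peak_le x0 x l : peak x0 x <= fac x0 x l.
Proof.
have /andP[f0 _] := fac01 x0 x l.
rewrite /peak (bigD1 l)//= ler_piMr//.
have : 0 <= \prod_(i | i != l) fac x0 x i <= 1.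
  elim/big_ind : _ => [|a b|i _]; rewrite ?ler01 ?lexx//.
  by move=> /andP[a0 a1] /andP[b0 b1]; rewrite mulr_ge0// mulr_ile1.
by case/andP.
Qed.

Let continuous_peak x0 : continuous (peak x0).
Proof.
have [c _] : ccont (fun x : Rn => \prod_l (fac x0 x l)%:C%C).
  by apply: ccont_prod => l; split=> x; [exact: continuous_fac|exact: (@cst_continuous Rn R 0 x)].
move=> x; rewrite (_ : peak x0 = fun y => complex.Re (\prod_l (fac x0 y l)%:C%C)); first exact: c.
by apply/funext => y; rewrite -rmorph_prod.
Qed.

Let cos_away (d t : R) : 0 < d <= pi -> d <= `|t| <= pi *+ 2 - d -> cos t <= cos d.
Proof.
move=> /andP[d0 dpi] /andP[dt tpi].
have mono (s : R) : d <= s -> s <= pi -> cos s <= cos d.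
  move=> ds spi; rewrite leNgt ltr_cos ?in_itv/= ?(ltW d0)//; last by rewrite (le_trans (ltW d0) ds).
  by rewrite -leNgt.
rewrite -cos_norm; have [tp|pt] := leP `|t| pi; first exact: mono.
have -> : cos `|t| = cos (pi *+ 2 - `|t|).
  by rewrite -[LHS]cosN -[LHS](cosD2pi) addrC.
apply: mono; first by rewrite lerBrDr addrC -lerBrDr.
by rewrite lerBlDr mulr2n lerD2l ltW.
Qed.

(* The powers of [peak + d] concentrate at [x0], as in Rudin's proof of the
   completeness of the trigonometric system. *)
Lemma peak_kernel (g : Rn -> R) (B : R) (x0 : Rn) : continuous g ->
  (forall x, `|g x| <= B) -> 0 < g x0 -> (forall l, `|x0 0 l| < L) ->
  exists d j, 0 < Rint (fun x => \1_(box L) x * (g x * (peak x0 x + d) ^+ j)).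
Proof.
move=> cg gB g0 x0L.
pose c := g x0 / 2; have c0 : 0 < c by rewrite divr_gt0.
have /nbhs_boxP[d1 d10 hd1] : nbhs x0 [set x | c <= g x].
  move/cvgrPdist_le/(_ _ c0) : (cg x0); apply: filterS => x /=.
  have E : g x0 = c + c by rewrite -splitr.
  by rewrite ler_norml => /andP[_]; rewrite E; lra.
have [d2 d20 hd2] : exists2 d : R, 0 < d & forall l, `|x0 0 l| + d <= L.
  exists (L - \big[Num.max/0]_l `|x0 0 l|).
    by rewrite subr_gt0; apply: bigmax_lt.
  move=> l; rewrite addrCA gerDl subr_le0.
  exact: (@le_bigmax _ _ _ 0 (fun l => `|x0 0 l|) l).
pose d := Num.min d1 d2; have d0 : 0 < d by rewrite lt_min d10.
have dd1 : d <= d1 by rewrite ge_min lexx.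
have dd2 : d <= d2 by rewrite ge_min lexx orbT.
(* A coordinate is used to bound [d] by [pi * N]. In dimension 0 the space is a point and the kernel
   is trivial. *)
have [n0|l0] : n = 0%N \/ exists l : 'I_n, True.
  by case: (n) => [|n']; [left|right; exists ord0].
  exists 0, 0%N.
  have -> : (fun x => \1_(box L) x * (g x * (peak x0 x + 0) ^+ 0)) =
      fun x => g x0 * \1_(box L) x.
    apply/funext => x; rewrite expr0 mulr1 mulrC; congr (g _ * _).
    by apply/rowP => l; have := ltn_ord l; rewrite {2}n0.
  by rewrite (RintZ _ (bsupp_box L)) mulr_gt0// vol_gt0.
have dL : d / N%:R <= pi.
  case: l0 => l _; rewrite ler_pdivrMr// (le_trans dd2)//.
  by apply: le_trans (hd2 l); rewrite lerDr.
have dN : 0 < d / N%:R by rewrite divr_gt0.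
(* Far from [x0] the peak is at most [1 - 2 * del], near it at least [1 - del / 2]; adding [del]
   puts the base of the power below 1 in the first region and at least at [1 + del / 2] in the
   second. *)
pose del := (1 - cos (d / N%:R)) / 4.
have del0 : 0 < del.
  rewrite divr_gt0// subr_gt0 -[ltRHS]cos0.
  by rewrite ltr_cos ?in_itv/= ?lexx ?pi_ge0 ?(ltW dN) ?dL.
have away x l : box L x -> d <= `|x 0 l - x0 0 l| -> peak x0 x <= 1 - 2 * del.
  move=> bx dx; rewrite (le_trans (peak_le _ _ l))// /fac /del.
  suff : cos ((x 0 l - x0 0 l) / N%:R) <= cos (d / N%:R) by lra.
  apply: cos_away; first by rewrite dN.
  have hx : `|x 0 l - x0 0 l| <= L + (L - d).
    rewrite (le_trans (ler_normB _ _))// lerD//.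
    by rewrite lerBrDr (le_trans _ (hd2 l))// lerD2l.
  have NV : `|N%:R^-1| = N%:R^-1 :> R by rewrite ger0_norm// invr_ge0 ltW.
  rewrite normrM NV ler_pM2r ?invr_gt0// dx/=.
  rewrite ler_pdivrMr// mulrBl divfK ?gt_eqF//.
  by rewrite mulr2n mulrDl -addrA.
have peak1 : peak x0 x0 = 1.
  by rewrite /peak big1// => l _; rewrite /fac subrr mul0r cos0; lra.
have /nbhs_boxP[d3 d30 hd3] : nbhs x0 [set x | 1 - del / 2 <= peak x0 x].
  have e0 : 0 < del / 2 by rewrite divr_gt0.
  move/cvgrPdist_le/(_ _ e0) : (@continuous_peak x0 x0); apply: filterS => x /=.
  by rewrite peak1 ler_norml => /andP[_]; lra.
pose r := Num.min d d3; have r0 : 0 < r by rewrite lt_min d0.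
have rd : r <= d by rewrite ge_min lexx.
have rd3 : r <= d3 by rewrite ge_min lexx orbT.
pose V (x : Rn) : R := \1_(box r) (x - x0).
have V1 x : V x = if x - x0 \in box r then 1 else 0.
  by rewrite /V indicE; case: (_ \in _).
have B0 : 0 < B by apply: lt_le_trans (gB x0); rewrite gtr0_norm.
have VQ x : x - x0 \in box r -> x \in box L.
  rewrite !inE => bx l; have := bx l; rewrite !mxE => h.
  have -> : x 0 l = (x 0 l - x0 0 l) + x0 0 l by rewrite subrK.
  rewrite (le_trans (ler_normD _ _))//; have := hd2 l; move: dd2 rd h; lra.
have bV := bsupp_shift (- x0) (bsupp_box r).
have VE : Rint V = vol (n := n) r by exact: (Rint_shift (- x0) (bsupp_box r)).
pose m := Num.max L (r + abs_sum (- x0)).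
have Lm : L <= m by rewrite le_max lexx.
have rm : r + abs_sum (- x0) <= m by rewrite le_max lexx orbT.
have bV' : bsupp m 1 V by exact: bsupp_le bV.
have bQ' : bsupp m 1 (\1_(box L) : Rn -> R) := bsupp_le Lm (lexx 1) (bsupp_box L).
(* By Bernoulli's inequality the contribution near [x0] grows at least linearly in [j], while the
   rest can subtract at most [B * vol L]. *)
have [j hj] : exists j : nat, B * vol (n := n) L < c * (1 + j%:R * (del / 2)) * vol (n := n) r.
  have vr := vol_gt0 r0.
  pose K := B * vol (n := n) L / (c * (del / 2) * vol (n := n) r).
  have den : 0 < c * (del / 2) * vol (n := n) r by apply: mulr_gt0 => //; apply: mulr_gt0 => //; exact: divr_gt0.
  exists (Num.truncn K).+1.
  have : K < (Num.truncn K).+1%:R by exact: truncnS_gt.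
  rewrite ltr_pdivrMr// => /lt_le_trans; apply.
  have -> : c * (1 + (Num.truncn K).+1%:R * (del / 2)) * vol (n := n) r =
    c * vol (n := n) r + (Num.truncn K).+1%:R * (c * (del / 2) * vol (n := n) r) by ring.
  by rewrite lerDr mulr_ge0// ltW.
exists del, j.
pose a := c * (1 + j%:R * (del / 2)).
have bl := bsuppD (bsuppZ a bV') (bsuppZ (- B) bQ').
apply: (@lt_le_trans _ _ (Rint (fun x => a * V x + - B * \1_(box L) x))).
  rewrite (RintD (bsuppZ a bV') (bsuppZ (- B) bQ')) (RintZ a bV') (RintZ (- B) bQ').
  by rewrite VE mulNr subr_gt0.
have K1 x : 0 <= (peak x0 x + del) ^+ j.
  by rewrite exprn_ge0// addr_ge0// ?(ltW del0)//; case/andP: (peak01 x0 x).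
have bF : bsupp m (B * (1 + del) ^+ j) (fun x => \1_(box L) x * (g x * (peak x0 x + del) ^+ j)).
  have [mQ _ Q0] := bQ'.
  split.
  - apply: (measurable_funM mQ); apply: measurable_funM; first exact: continuous_meas.
    apply: (@continuous_meas _ _ (fun x : Rn => (peak x0 x + del) ^+ j)) => x.
    apply: (@continuous_comp _ _ _ (peak x0) (fun t : R => (t + del) ^+ j)).
      exact: continuous_peak.
    apply: (@continuous_comp _ _ _ (fun t : R => t + del) (fun t : R => t ^+ j)).
      by apply: cvgD; [exact: cvg_id|exact: cvg_cst].
    exact: exprn_continuous.
  - move=> x; rewrite !normrM -[leRHS]mul1r ler_pM//.
      by rewrite indicE; case: (_ \in _); rewrite ?normr1 ?normr0.
    rewrite ler_pM// (ger0_norm (K1 x)) lerXn2r// ?nnegrE.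
    + by rewrite addr_ge0// ?(ltW del0)//; case/andP: (peak01 x0 x).
    + by rewrite addr_ge0// ltW.
    + by rewrite lerD2r; case/andP: (peak01 x0 x).
  - by move=> x nx; rewrite Q0// mul0r.
apply: (Rint_le bl bF) => x.
have /andP[p0 p1] := peak01 x0 x.
rewrite V1 indicE; case: ifPn => [xV|xV].
  rewrite (VQ _ xV) mulr1 mulr1 mul1r.
  have h l : `|x 0 l - x0 0 l| <= r by move: xV; rewrite inE => /(_ l); rewrite !mxE.
  have gx : c <= g x by apply: hd1 => l; rewrite (le_trans (h l))// (le_trans rd).
  have px : 1 - del / 2 <= peak x0 x by apply: hd3 => l; rewrite (le_trans (h l)).
  rewrite (@le_trans _ _ a)//; first by rewrite gerDl oppr_le0 ltW.
  apply: ler_pM => //; first exact: ltW.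
    by rewrite addr_ge0// mulr_ge0// divr_ge0// ltW.
  have bern : 1 + j%:R * (del / 2) <= (1 + del / 2) ^+ j.
    elim: (j) => [|i IH]; first by rewrite mul0r addr0 expr0.
    rewrite exprS -natr1 (le_trans _ (ler_wpM2l _ IH))//; last by rewrite addr_ge0// divr_ge0// ltW.
    have -> : (1 + del / 2) * (1 + i%:R * (del / 2)) =
      1 + (i%:R + 1) * (del / 2) + i%:R * (del / 2) ^+ 2 by ring.
    by rewrite lerDl mulr_ge0// exprn_ge0// divr_ge0// ltW.
  rewrite (le_trans bern)// lerXn2r// ?nnegrE.
  - by rewrite addr_ge0// divr_ge0// ltW.
  - by rewrite addr_ge0// ltW.
  - by move: px; lra.
rewrite mulr0 add0r; case: (boolP (x \in box L)) => [xQ|]; last by rewrite mulr0 mul0r.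
rewrite mulr1 mul1r.
(* Outside the box of radius [r] but within [d], the integrand is nonnegative since [g] is at least
   [c]; farther away the base of the power is at most 1. *)
have [near|far] := pselect (forall l, `|x 0 l - x0 0 l| <= d).
  apply: le_trans (_ : 0 <= _); first by rewrite oppr_le0 ltW.
  rewrite mulr_ge0// (le_trans (ltW c0))//; apply: hd1 => l.
  by rewrite (le_trans (near l)).
move/existsNP : far => [l /negP]; rewrite -ltNge => far.
have px : peak x0 x <= 1 - 2 * del.
  by move: xQ; rewrite inE => xQ; apply: (away x l xQ); exact: ltW.
suff : `|g x * (peak x0 x + del) ^+ j| <= B by rewrite ler_norml => /andP[].
rewrite normrM (ger0_norm (K1 x)) -[leRHS]mulr1 ler_pM// exprn_ile1//.
  by rewrite addr_ge0// ltW.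
by move: px del0; lra.
Qed.

Definition fourier_coef (u : Rn -> C) (k : Zn) : C :=
  (((2 * L) ^+ n)^-1)%:C%C * cI (fun x => u x * echar (- k) x).

Let cubeM (w : Rn -> C) (B : R) k : ccont w -> (forall x, cmod (w x) <= B) ->
  cbs L (1 * B) (fun x => cube_ind x * echar k x * w x).
Proof.
move=> [w1 w2] wB; apply: cbsM (cbs_cube k) _ _ wB; exact: continuous_meas.
Qed.

(** The product [v * w] has vanishing Fourier coefficients on the cube. For a given [v], the
    admissible [w] are stable under linear combinations and multiplication by characters, which
    leads to the powers of the peak. *)
Let cint_null (v w : Rn -> C) : Prop :=
  forall k, cI (fun x => cube_ind x * echar k x * (v x * w x)) = 0.

Let bdd (w : Rn -> C) : Prop := ccont w /\ exists B, forall x, cmod (w x) <= B.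

Let bddM w w' : bdd w -> bdd w' -> bdd (fun x => w x * w' x).
Proof.
move=> [c [B hB]] [c' [B' hB']]; split; first exact: ccontM.
exists (B * B') => x; rewrite cmodM; apply: ler_pM => //; exact: cmod_ge0.
Qed.

Let bddD w w' : bdd w -> bdd w' -> bdd (fun x => w x + w' x).
Proof.
move=> [c [B hB]] [c' [B' hB']]; split; first exact: ccontD.
by exists (B + B') => x; rewrite (le_trans (cmodD _ _))// lerD.
Qed.

Let bdd_cst z : bdd (fun=> z).
Proof. by split; [exact: ccont_cst|exists (cmod z)]. Qed.

Let bdd_echar k : bdd (echar k).
Proof. by split; [exact: ccont_echar|exists 1 => x; rewrite cmod_echar]. Qed.

Let cint_nullD v w w' : bdd v -> bdd w -> bdd w' -> cint_null v w -> cint_null v w' ->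
  cint_null v (fun x => w x + w' x).
Proof.
move=> bv bw bw' hw hw' k.
have [c1 [B1 h1]] := bddM bv bw; have [c2 [B2 h2]] := bddM bv bw'.
rewrite -[RHS]addr0 -{1}(hw k) -(hw' k) -(cID (cubeM k c1 h1) (cubeM k c2 h2)).
by congr cI; apply/funext => x; ring.
Qed.

Let cint_nullZ v w z : bdd v -> bdd w -> cint_null v w -> cint_null v (fun x => z * w x).
Proof.
move=> bv bw hw k; have [c1 [B1 h1]] := bddM bv bw.
rewrite -[RHS](mulr0 z) -(hw k) -(cIZ z (cubeM k c1 h1)).
by congr cI; apply/funext => x; ring.
Qed.

Let cint_null_echar v w k' : cint_null v w -> cint_null v (fun x => echar k' x * w x).
Proof.
move=> hw k; rewrite -(hw (k + k')); congr cI; apply/funext => x.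
by rewrite echarM; ring.
Qed.

Let bdd_facC x0 l : bdd (fun x => (fac x0 x l)%:C%C).
Proof.
split.
  by split=> x; [exact: continuous_fac|exact: (@cst_continuous Rn R 0 x)].
by exists 1 => x; rewrite cmod_real; have /andP[f0 f1] := fac01 x0 x l; rewrite ger0_norm.
Qed.

(** The factor is one half plus a combination of the two characters of frequency one in the
    coordinate [l]. *)
Let cint_null_fac v w x0 l : bdd v -> bdd w -> cint_null v w ->
  cint_null v (fun x => (fac x0 x l)%:C%C * w x).
Proof.
move=> bv bw hw.
pose e : Zn := [ffun i => if i == l then 1 else 0].
have eE x : echar e x = cis (x 0 l / N%:R).
  rewrite /echar (bigD1 l)//= big1 ?mulr1 => [|i il].
    by rewrite /e ffunE eqxx /freq mul1r mulrC.
  by rewrite /e ffunE (negPf il) /freq !mul0r cis0.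
have eNE x : echar (- e) x = cis (- (x 0 l / N%:R)).
  rewrite /echar (bigD1 l)//= big1 ?mulr1 => [|i il].
    by rewrite !ffunE eqxx /freq mulrNz mulr1z mulN1r mulNr mulrC.
  by rewrite !ffunE (negPf il) oppr0 /freq !mul0r cis0.
pose z1 : C := (4^-1)%:C%C * cis (- (x0 0 l / N%:R)).
pose z2 : C := (4^-1)%:C%C * cis (x0 0 l / N%:R).
have E x : (fac x0 x l)%:C%C * w x = (2^-1)%:C%C * w x +
    (z1 * (echar e x * w x) + z2 * (echar (- e) x * w x)).
  rewrite !mulrA -!mulrDl; congr (_ * _).
  rewrite /z1 /z2 eE eNE -!mulrA -!cisD /fac mulrBl.
  apply: complex_ext => /=.
    rewrite !mul0r !subr0 (addrC (- (x0 0 l / N%:R))).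
    rewrite (_ : x0 0 l / N%:R - x 0 l / N%:R = - (x 0 l / N%:R - x0 0 l / N%:R)); last by ring.
    by rewrite cosN; field.
  rewrite !mul0r !addr0 (addrC (- (x0 0 l / N%:R))).
  rewrite (_ : x0 0 l / N%:R - x 0 l / N%:R = - (x 0 l / N%:R - x0 0 l / N%:R)); last by ring.
  by rewrite sinN mulrN subrr addr0.
have be1 : bdd (fun x => echar e x * w x) by apply: bddM.
have be2 : bdd (fun x => echar (- e) x * w x) by apply: bddM.
rewrite (_ : (fun x => _) = fun x => (2^-1)%:C%C * w x +
    (z1 * (echar e x * w x) + z2 * (echar (- e) x * w x))); last exact/funext.
apply: cint_nullD => //.
- exact: bddM (bdd_cst _) bw.
- by apply: bddD; exact: bddM (bdd_cst _) _.
- exact: cint_nullZ.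
- apply: cint_nullD => //; try exact: bddM (bdd_cst _) _.
  + by apply: cint_nullZ => //; exact: cint_null_echar.
  + by apply: cint_nullZ => //; exact: cint_null_echar.
Qed.

Let cint_null_peak v w x0 : bdd v -> bdd w -> cint_null v w ->
  bdd (fun x => (peak x0 x)%:C%C * w x) /\ cint_null v (fun x => (peak x0 x)%:C%C * w x).
Proof.
move=> bv bw hw; rewrite /peak; elim: (index_enum 'I_n) => [|l r [IH1 IH2]].
  rewrite (_ : (fun x => _) = w) //.
  by apply/funext => x; rewrite big_nil rmorph1 mul1r.
rewrite (_ : (fun x => _) = fun x => (fac x0 x l)%:C%C * ((\prod_(l <- r) fac x0 x l)%:C%C * w x)).
  by split; [exact: bddM (bdd_facC x0 l) IH1|exact: cint_null_fac].
by apply/funext => x; rewrite big_cons rmorphM/= mulrA.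
Qed.

(** At a point where [v] does not vanish, multiplication by the conjugate value makes the real part
    positive, and a power of the peak gives a positive integral that should be 0. *)
Let uniqueness (v : Rn -> C) : bdd v -> cint_null v (fun=> 1) ->
  forall x0 : Rn, (forall l, `|x0 0 l| < L) -> v x0 = 0.
Proof.
move=> bv hv x0 x0L; apply: contrapT => /eqP vx0.
have [cv [B hB]] := bv.
pose a := conjc (v x0).
pose g x := complex.Re (a * v x).
have gx0 : 0 < g x0.
  rewrite /g /a; move: vx0; case: (v x0) => p q /=; rewrite eq_complex/= negb_and => h.
  rewrite mulNr opprK.
  by case/orP: h => h; [apply: ltr_pwDl; [rewrite -expr2 exprn_even_gt0|rewrite -expr2 sqr_ge0]|
    apply: ltr_wpDl; [rewrite -expr2 sqr_ge0|rewrite -expr2 exprn_even_gt0]].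
have [cav _] : ccont (fun x => a * v x) by apply: ccontM => //; exact: ccont_cst.
have gB x : `|g x| <= cmod a * B.
  by rewrite (le_trans (Re_le_cmod _))// cmodM ler_wpM2l// cmod_ge0.
have [d [j]] := peak_kernel cav gB gx0 x0L.
have : bdd (fun x => ((peak x0 x + d) ^+ j)%:C%C) /\ cint_null v (fun x => ((peak x0 x + d) ^+ j)%:C%C).
  elim: j => [|j [IH1 IH2]]; first by under eq_fun do rewrite expr0.
  have [k1 k2] := cint_null_peak x0 bv IH1 IH2.
  rewrite (_ : (fun x => _) = fun x => (peak x0 x)%:C%C * ((peak x0 x + d) ^+ j)%:C%C +
     d%:C%C * ((peak x0 x + d) ^+ j)%:C%C).
    split; first by apply: bddD => //; exact: bddM (bdd_cst _) _.
    by apply: cint_nullD => //; [exact: bddM (bdd_cst _) _|exact: cint_nullZ].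
  by apply/funext => x; rewrite exprS rmorphM/= rmorphD/= mulrDl.
move=> [bq hq].
have := cint_nullZ a bv bq hq 0 => /(congr1 (@complex.Re R)).
rewrite /integral_Rn preimage_setT /= => h0.
suff -> : Rint (fun x => \1_(box L) x * (g x * (peak x0 x + d) ^+ j)) = 0 by rewrite ltxx.
rewrite -h0 /Rint; apply: eq_Rintegral => t _.
set x := row_of_tuple t; rewrite echar0 mulr1 /cube_ind.
have -> : v x * (a * ((peak x0 x + d) ^+ j)%:C%C) = (a * v x) * ((peak x0 x + d) ^+ j)%:C%C by ring.
by rewrite [in RHS]cReM /= mul0r subr0 cReM /= mulr0 subr0.
Qed.

(** The summability of the coefficients makes the series continuous, so only uniqueness is at stake:
    the difference of [u] and its series has vanishing coefficients. *)
Theorem fourier_inversion (kap : nat -> Zn) (u : Rn -> C) (B m : R) (v : nat -> R) :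
  injective kap -> (forall k, exists i, kap i = k) ->
  ccont u -> (forall x, cmod (u x) <= B) -> (forall x, ~ box m x -> u x = 0) ->
  m <= L -> summ v -> (forall i, cmod (fourier_coef u (kap i)) <= v i) ->
  forall x : Rn, (forall l, `|x 0 l| < L) ->
    u x = csum (fun i => fourier_coef u (kap i) * echar (kap i) x).
Proof.
move=> kapI kapS cu uB u0 mL sv bv x xL.
pose b i := fourier_coef u (kap i).
pose S x := csum (fun i => b i * echar (kap i) x).
have bS i x' : cmod (b i * echar (kap i) x') <= v i by rewrite cmodM cmod_echar mulr1; exact: bv.
have cS : ccont S.
  apply: (ccont_csum sv bS) => i; apply: ccontM; first exact: ccont_cst.
  exact: ccont_echar.
have SB x' : cmod (S x') <= tsum v by exact: csum_bound.
pose w x' := u x' + -1 * S x'.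
have bw : bdd w.
  apply: bddD; first by split=> //; exists B.
  by apply: bddM; [exact: bdd_cst|split => //; exists (tsum v)].
apply/eqP; rewrite -subr_eq0; apply/eqP.
rewrite -mulN1r -/(w x); apply: uniqueness => // k.
have ub := cubeM k cu uB; have Sb := cubeM k cS SB.
transitivity (cI (fun x => cube_ind x * echar k x * u x) +
    -1 * cI (fun x => cube_ind x * echar k x * S x)).
  rewrite -(cIZ (-1) Sb) -(cID ub (cbsZ (-1) Sb)); congr cI; apply/funext => y.
  by rewrite mulr1 /w; ring.
have LN0 : ((2 * L) ^+ n)%:C%C != 0 :> C.
  by rewrite eq_complex/= eqxx andbT expf_neq0// mulf_neq0// ?gt_eqF.
have -> : cI (fun x => cube_ind x * echar k x * u x) =
    ((2 * L) ^+ n)%:C%C * fourier_coef u (- k).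
  rewrite /fourier_coef opprK mulrA -rmorphM/= divff ?mul1r; last first.
    by rewrite expf_neq0// mulf_neq0// ?gt_eqF.
  congr cI; apply/funext => y; rewrite /cube_ind indicE.
  case: (boolP (y \in _)) => [_|/negP ny]; first by rewrite mul1r mulrC.
  rewrite !mul0r u0 ?mul0r// => by_; apply: ny; apply/mem_set.
  exact: (sub_box mL).
have -> : cI (fun x => cube_ind x * echar k x * S x) =
    csum (fun i => cI (fun x => cube_ind x * echar k x * (b i * echar (kap i) x))).
  have E y : cube_ind y * echar k y * S y =
      csum (fun i => cube_ind y * echar k y * (b i * echar (kap i) y)).
    by rewrite (csumZ _ sv).
  have [mR mJ _ _] := Sb.
  have ER : (fun y => complex.Re (cube_ind y * echar k y * S y)) =
      fun y => complex.Re (csum (fun i => cube_ind y * echar k y * (b i * echar (kap i) y))).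
    by apply/funext => y; rewrite E.
  have EJ : (fun y => complex.Im (cube_ind y * echar k y * S y)) =
      fun y => complex.Im (csum (fun i => cube_ind y * echar k y * (b i * echar (kap i) y))).
    by apply/funext => y; rewrite E.
  rewrite ER in mR; rewrite EJ in mJ.
  transitivity (cI (fun y => csum (fun i => cube_ind y * echar k y * (b i * echar (kap i) y)))).
    by congr cI; apply/funext => y; rewrite E.
  apply: (@cI_csum _ _ L v (fun i y => cube_ind y * echar k y * (b i * echar (kap i) y))) => // i.
  have ce : ccont (fun y => b i * echar (kap i) y).
    by apply: ccontM; [exact: ccont_cst|exact: ccont_echar].
  by have := cubeM k ce (bS i); rewrite mul1r.
(* By orthogonality only the term of frequency [- k] survives. *)
have [j kj] := kapS (- k).
have termE i : cI (fun x => cube_ind x * echar k x * (b i * echar (kap i) x)) =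
    b i * (if i == j then (2 * L) ^+ n else 0)%:C%C.
  have -> : (i == j) = (k + kap i == 0).
    rewrite addrC addr_eq0 -kj; apply/eqP/eqP => [->//|]; exact: kapI.
  rewrite -integral_cube -(cIZ (b i) (cbs_cube (k + kap i))); congr cI; apply/funext => y.
  by rewrite echarM; ring.
rewrite (eq_csum termE) (@csum_single _ _ j) => [|i /negPf ->]; last by rewrite mulr0.
by rewrite eqxx /b kj mulN1r mulrC subrr.
Qed.

End fourier.

(** * Jets and multi-indices *)

Section affine_continuity.
Context {R : realType} {V : normedModType R}.

Lemma continuous_addr (h : V) : continuous (fun x : V => x + h).
Proof. by move=> x; apply: cvgD; [exact: cvg_id|exact: cvg_cst]. Qed.

Lemma continuous_line (v x : V) : (fun t : R => t *: v + x) @ (0 : R) --> x.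
Proof.
rewrite -[X in _ --> X]add0r -[X in _ --> X + _](scale0r v).
by apply: cvgD; [apply: cvgZr_tmp; exact: cvg_id|exact: cvg_cst].
Qed.

End affine_continuity.

Section jets.
Context {R : realType} {n : nat}.
Local Notation C := R[i].
Local Notation Rn := 'rV[R]_n.

(** A function with all its derivatives, indexed by words of coordinates as in [partial_seq]. Jets
    are combined termwise, which yields smoothness and the values of the derivatives together. *)
Definition cjet (D : seq 'I_n -> Rn -> C) : Prop :=
  forall s, ccont (D s) /\ forall i, cderive (basis_vec i) (D s) (D (i :: s)).

Definition partial_jet (phi : Rn -> C) (s : seq 'I_n) (x : Rn) : C :=
  Complex (partial_seq s (fun y => complex.Re (phi y)) x)
          (partial_seq s (fun y => complex.Im (phi y)) x).

Let cjet_seq D : cjet D -> forall s,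
  partial_seq s (fun y => complex.Re (D [::] y)) = (fun y => complex.Re (D s y)) /\
  partial_seq s (fun y => complex.Im (D [::] y)) = (fun y => complex.Im (D s y)).
Proof.
move=> jD; elim=> [//|i s [IH1 IH2]] /=; rewrite IH1 IH2.
by split; apply/funext => x; have [h1 h2] := (jD s).2 i x; exact: derive_val.
Qed.

Lemma cjet_partial D s : cjet D -> partial_jet (D [::]) s = D s.
Proof.
move=> jD; have [h1 h2] := cjet_seq jD s.
by apply/funext => x; rewrite /partial_jet h1 h2; case: (D s x).
Qed.

Lemma cjet_smooth D : cjet D -> smooth (D [::]).
Proof.
move=> jD; split=> s; have [h1 h2] := cjet_seq jD s; rewrite ?h1 ?h2.
  split; first by case: (jD s).1.
  by move=> i x; have [[hx _] _] := (jD s).2 i x.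
split; first by case: (jD s).1.
by move=> i x; have [_ [hx _]] := (jD s).2 i x.
Qed.

Lemma smooth_cjet phi : smooth phi -> cjet (partial_jet phi).
Proof.
move=> [h1 h2] s; split; first by split; [case: (h1 s)|case: (h2 s)].
by move=> i x; split; apply/derivableP; [case: (h1 s)|case: (h2 s)].
Qed.

Lemma cderive_shift (v h : Rn) (f g : Rn -> C) : cderive v f g ->
  cderive v (fun x => f (x + h)) (fun x => g (x + h)).
Proof.
move=> fg x; have [h1 h2] := fg (x + h).
split; apply/is_derive_line; [move/is_derive_line : h1|move/is_derive_line : h2];
  by under eq_fun do rewrite addrA.
Qed.

Lemma ccont_shift (h : Rn) (f : Rn -> C) : ccont f -> ccont (fun x : Rn => f (x + h)).
Proof.
move=> [f1 f2]; have ch := @continuous_addr R Rn h.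
by split=> x; [exact: (continuous_comp (ch x) (f1 _))|exact: (continuous_comp (ch x) (f2 _))].
Qed.

Lemma cjet_shift D (h : Rn) : cjet D -> cjet (fun s x => D s (x + h)).
Proof.
move=> jD s; have [c d] := jD s; split; first exact: ccont_shift.
by move=> i; exact: cderive_shift.
Qed.

Lemma cjetD D D' : cjet D -> cjet D' -> cjet (fun s x => D s x + D' s x).
Proof.
move=> jD jD' s; have [c d] := jD s; have [c' d'] := jD' s.
by split=> [|i]; [exact: ccontD|exact: cderiveD].
Qed.

Lemma cjetZ (z : C) D : cjet D -> cjet (fun s x => z * D s x).
Proof.
move=> jD s; have [c d] := jD s.
by split=> [|i]; [apply: ccontM => //; exact: ccont_cst|exact: cderiveZ].
Qed.

Lemma cjet0 : cjet (fun _ _ => 0).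
Proof. by move=> s; split=> [|i]; [exact: ccont_cst|exact: cderive_cst]. Qed.

Lemma cjet_sum (I : Type) (r : seq I) (D : I -> seq 'I_n -> Rn -> C) :
  (forall i, cjet (D i)) -> cjet (fun s x => \sum_(i <- r) D i s x).
Proof.
move=> jD s; split=> [|i]; first by apply: ccont_sum => i; exact: (jD i s).1.
by apply: cderive_sum => j; exact: (jD j s).2.
Qed.

Lemma cjet_csum (v : nat -> R) (D : nat -> seq 'I_n -> Rn -> C) : summ v ->
  (forall i, cjet (D i)) ->
  (forall s, exists B, forall i x, cmod (D i s x) <= B * v i) ->
  cjet (fun s x => csum (fun i => D i s x)).
Proof.
move=> sv jD bD s; split.
  have [B hB] := bD s.
  have sB : summ (fun i => `|B| * v i) by exact: summZ.
  apply: (ccont_csum sB (F := fun i => D i s)) => [i x|i]; last exact: (jD i s).1.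
  by rewrite (le_trans (hB i x))// ler_wpM2r ?ler_norm//; case: sv.
move=> i; have [B0 h0] := bD s; have [B1 h1] := bD (i :: s).
have [B2 h2] := bD (i :: i :: s).
by apply: (cderive_csum sv _ _ h0 h1 h2) => j; exact: (jD j _).2.
Qed.

Lemma cderive_coord (f g : R -> C) i : cderive (1 : R) f g ->
  cderive (basis_vec i) (fun x : Rn => f (x 0 i)) (fun x => g (x 0 i)).
Proof.
move=> fg x; have [h1 h2] := fg (x 0 i).
have E t : (t *: (basis_vec i : Rn) + x) 0 i = t *: (1 : R) + x 0 i.
  by rewrite !mxE !eqxx.
split; apply/is_derive_line; [move/is_derive_line : h1|move/is_derive_line : h2];
  by under [X in _ -> is_derive _ _ X _]eq_fun do rewrite E.
Qed.

Lemma cderive_line0 (v : Rn) (f : Rn -> C) : (forall t x, f (t *: v + x) = f x) ->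
  cderive v f (fun=> 0).
Proof.
move=> h x; split; apply/is_derive_line; under eq_fun do rewrite h; exact: is_derive_cst.
Qed.

(** Each letter of the word differentiates the factor of its own coordinate, the other factors being
    constant in that direction. *)
Lemma cjet_tensor (A : 'I_n -> nat -> R -> C) :
  (forall l p, cderive (1 : R) (A l p) (A l p.+1)) ->
  cjet (fun s x => \prod_l A l (count_mem l s) (x 0 l)).
Proof.
move=> hA s; split.
  apply: ccont_prod => l; have [c1 c2] := cderive_ccont (hA l (count_mem l s)).
  have cc := @coord_continuous R 1 n 0 l.
  by split=> x; [exact: (continuous_comp (cc x) (c1 _))|exact: (continuous_comp (cc x) (c2 _))].
move=> i; pose Q (x : Rn) := \prod_(l | l != i) A l (count_mem l s) (x 0 l).
have dQ : cderive (basis_vec i) Q (fun=> 0).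
  apply: cderive_line0 => t x; apply: eq_bigr => l li.
  by rewrite !mxE (negPf li) andbF mulr0 add0r.
apply: eq_cderive (cderiveM (cderive_coord i (hA i (count_mem i s))) dQ) => x.
  by rewrite [RHS](bigD1 i).
rewrite mulr0 addr0 [RHS](bigD1 i)//= eqxx; congr (_ * _).
by apply: eq_bigr => l /negPf li; rewrite eq_sym li.
Qed.

Lemma cjet_eq0 D (O : set Rn) s : cjet D -> open O -> (forall x, O x -> D [::] x = 0) ->
  forall x, O x -> D s x = 0.
Proof.
move=> jD oO D0; elim: s => [//|i s IH] x Ox.
have z (g g' : Rn -> R) : is_derive x (basis_vec i) g (g' x) -> (forall y, O y -> g y = 0) ->
    g' x = 0.
  move=> /is_derive_epsP h g0; apply/eqP; rewrite -normr_le0; apply/ler_addgt0Pl => e e0.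
  have [d d0 hd] := h e e0; rewrite addr0.
  have : nbhs x O by exact: open_nbhs_nbhs.
  have ct := @continuous_line R Rn (basis_vec i) x.
  move/ct => [d' /= d'0 hd'].
  pose t := Num.min d d' / 2.
  have m0 : 0 < Num.min d d' by rewrite lt_min d0.
  have t0 : 0 < t by rewrite divr_gt0.
  have tm : t < Num.min d d' by rewrite ltr_pdivrMr// ltr_pMr// ltr1n.
  have [td td'] : t < d /\ t < d' by move: tm; rewrite lt_min => /andP[].
  have := hd t; rewrite gtr0_norm// t0 td => /(_ isT).
  have -> : g x = 0 by exact: g0.
  have -> : g (t *: basis_vec i + x) = 0.
    by apply: g0; apply: hd'; rewrite /= sub0r normrN gtr0_norm.
  by rewrite subr0 mul0r sub0r normrN.
have [h1 h2] := (jD s).2 i x.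
apply: complex_ext.
  by apply: (z _ (fun y => complex.Re (D (i :: s) y)) h1) => y /IH ->.
by apply: (z _ (fun y => complex.Im (D (i :: s) y)) h2) => y /IH ->.
Qed.

Definition mi_seq (a : multi_index n) : seq 'I_n :=
  flatten [seq nseq (a i) i | i <- enum 'I_n].

Lemma mi_partialE a phi : mi_partial a phi = partial_jet phi (mi_seq a).
Proof. by []. Qed.

Lemma size_mi_seq a : size (mi_seq a) = mi_size a.
Proof.
rewrite /mi_seq size_flatten /shape -map_comp /mi_size -big_enum sumnE big_map.
by apply: eq_bigr => i _ /=; rewrite size_nseq.
Qed.

Definition mi_pure (q : nat) (i : 'I_n) : multi_index n := [ffun l => if l == i then q else 0%N].

Lemma mi_seq_pure q i : mi_seq (mi_pure q i) = nseq q i.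
Proof.
have h (s : seq 'I_n) : uniq s ->
    flatten [seq nseq (mi_pure q i l) l | l <- s] = if i \in s then nseq q i else [::].
  elim: s => [//|l s IH] /= /andP[ls us]; rewrite IH// inE ffunE eq_sym.
  have [<-|li] := eqVneq l i; last by [].
  by rewrite (negPf ls) cats0.
by rewrite /mi_seq h ?enum_uniq// mem_enum.
Qed.

Lemma mi_size_pure q i : mi_size (mi_pure q i) = q.
Proof. by rewrite -size_mi_seq mi_seq_pure size_nseq. Qed.

End jets.

Lemma cpos_real (R : realType) (z : R[i]) : 0 < z -> z = (complex.Re z)%:C%C /\ 0 < complex.Re z.
Proof.
move=> z0; have E : (complex.Re z)%:C%C = z by apply: RRe_real; exact: gtr0_real.
by split=> //; rewrite -ltcR E.
Qed.

(** * Test functions and ultradistributions *)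

Section test_functions.
Context {R : realType} {n : nat} (c : ultra_class) (M : nat -> R).
Hypothesis M_gt0 : forall p, 0 < M p.
Local Notation C := R[i].
Local Notation Rn := 'rV[R]_n.
Implicit Types (phi psi : Rn -> C^o) (K Om : set Rn) (l A : R).

(** The bound is over the whole space and does not mention a compact set: for a smooth function
    supported in a closed [K] the derivatives are 0 off [K]. *)
Definition tbound phi l A : Prop := forall a x,
  cmod (mi_partial a phi x) <= A * (l ^+ mi_size a * M (mi_size a)).

(* The quantifier over the parameter of the spaces of test functions, dual to
   [for_class_l]. *)
Definition for_class_d (P : R -> Prop) : Prop :=
  match c with
  | Beurling => forall l : R, 0 < l -> P l
  | Roumieu => exists2 l : R, 0 < l & P l
  end.

Definition test_in K phi : Prop :=
  [/\ smooth phi, supported_in K phi & for_class_d (fun l => exists A, tbound phi l A)].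

Lemma tbound_le phi l l' A A' : 0 <= l -> l <= l' -> A <= A' -> 0 <= A' ->
  tbound phi l A -> tbound phi l' A'.
Proof.
move=> l0 ll AA A0 b a x; rewrite (le_trans (b a x))//.
have h : 0 <= l ^+ mi_size a * M (mi_size a) by rewrite mulr_ge0 ?exprn_ge0// ltW.
rewrite (le_trans (ler_wpM2r h AA))// ler_wpM2l// ler_wpM2r ?(ltW (M_gt0 _))//.
by rewrite lerXn2r// nnegrE (le_trans l0).
Qed.

Lemma supported_in_eq0 K phi x : supported_in K phi -> ~ K x -> phi x = 0.
Proof.
move=> sK nKx; apply: contrapT => /eqP h; apply: nKx; apply: sK.
exact: subset_closure.
Qed.

Lemma eq0_supported_in K phi : closed K -> (forall x, ~ K x -> phi x = 0) ->
  supported_in K phi.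
Proof.
move=> cK h; rewrite /supported_in [X in _ `<=` X](closure_id K).1//.
by apply: closureS => x /= px; apply: contrapT => nK; move: px; rewrite h// eqxx.
Qed.

Lemma partial_jet_nil (phi : Rn -> C) : partial_jet phi [::] = phi.
Proof. by apply/funext => x; rewrite /partial_jet /=; case: (phi x). Qed.

Lemma partial_eq0 K phi s x : smooth phi -> closed K -> supported_in K phi -> ~ K x ->
  partial_jet phi s x = 0.
Proof.
move=> sm cK sK nK.
apply: (@cjet_eq0 _ _ (partial_jet phi) (~` K)) => //.
- exact: smooth_cjet.
- exact: closed_openC.
- move=> y nKy; rewrite /partial_jet /=; have := supported_in_eq0 sK nKy.
  by move=> E; rewrite E.
Qed.

Lemma tbound_ultra_norm phi K l A : 0 < l -> tbound phi l A ->
  (ultra_norm M l K phi <= A%:E)%E.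
Proof.
move=> l0 b; apply: ge_ereal_sup => _ [[a x] /= _ <-].
by rewrite lee_fin ler_pdivrMr ?mulr_gt0 ?exprn_gt0//; exact: b.
Qed.

Lemma ultra_norm_tbound phi K l A : 0 < l -> 0 <= A -> smooth phi -> closed K ->
  supported_in K phi -> (ultra_norm M l K phi <= A%:E)%E -> tbound phi l A.
Proof.
move=> l0 A0 sm cK sK h a x.
have h0 : 0 < l ^+ mi_size a * M (mi_size a) by rewrite mulr_gt0 ?exprn_gt0.
have [Kx|nKx] := pselect (K x); last first.
  by rewrite mi_partialE (partial_eq0 _ sm cK sK nKx) cmod0 mulr_ge0// ltW.
rewrite -ler_pdivrMr// -lee_fin; apply: le_trans h; apply: ereal_sup_ubound.
by exists (a, x).
Qed.

Lemma ultra_norm_lty phi K l : 0 < l -> smooth phi -> closed K ->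
  supported_in K phi -> (ultra_norm M l K phi < +oo)%E <-> exists A, tbound phi l A.
Proof.
move=> l0 sm cK sK; split=> [h|[A b]]; last first.
  by rewrite (le_lt_trans (tbound_ultra_norm K l0 b))// ltry.
exists `|fine (ultra_norm M l K phi)|; apply: (@ultra_norm_tbound _ K) => //.
by case: (ultra_norm M l K phi) h => [r| |]//= _; rewrite ?leNye// lee_fin ler_norm.
Qed.

Lemma test_spaceP Om phi : lcs_carrier (test_space c M Om) phi <->
  exists K, [/\ compact K, K `<=` Om & test_in K phi].
Proof.
have cl K : compact K -> closed K by exact: compact_closed.
rewrite /test_space/= /test_in /for_class_d; case: (c) => /=; split.
- move=> [K [cK KO] h]; exists K; split => //.
  have [sm sK _] := h 1 ltr01; split => // l l0; have [_ _ +] := h l l0.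
  by move/(ultra_norm_lty l0 sm (cl _ cK) sK).
- move=> [K [cK KO [sm sK h]]]; exists K => // l l0; split => //.
  by apply/(ultra_norm_lty l0 sm (cl _ cK) sK); exact: h.
- move=> [K [cK KO] [l l0 [sm sK h]]]; exists K; split => //; split => //.
  by exists l => //; apply/(ultra_norm_lty l0 sm (cl _ cK) sK).
- move=> [K [cK KO [sm sK [l l0 h]]]]; exists K => //; exists l => //; split => //.
  by apply/(ultra_norm_lty l0 sm (cl _ cK) sK).
Qed.

Lemma test_in_subset K K' phi : K `<=` K' -> test_in K phi -> test_in K' phi.
Proof. by move=> KK [h1 h2 h3]; split => // x /h2 /KK. Qed.

Lemma partial_lin (a b : C) phi psi s : smooth phi -> smooth psi ->
  partial_jet (a *: phi + b *: psi) s = fun x => a * partial_jet phi s x + b * partial_jet psi s x.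
Proof.
move=> /smooth_cjet j1 /smooth_cjet j2.
rewrite -(cjet_partial s (cjetD (cjetZ a j1) (cjetZ b j2))); congr (partial_jet _ s).
by rewrite !partial_jet_nil.
Qed.

Lemma smooth_lin (a b : C) phi psi : smooth phi -> smooth psi ->
  smooth (a *: phi + b *: psi).
Proof.
move=> /smooth_cjet j1 /smooth_cjet j2.
have := cjet_smooth (cjetD (cjetZ a j1) (cjetZ b j2)); congr (smooth _).
by rewrite !partial_jet_nil.
Qed.

Lemma tbound_lin (a b : C) phi psi l A B : smooth phi -> smooth psi ->
  tbound phi l A -> tbound psi l B ->
  tbound (a *: phi + b *: psi) l (cmod a * A + cmod b * B).
Proof.
move=> s1 s2 b1 b2 al x; rewrite mi_partialE partial_lin//.
rewrite (le_trans (cmodD _ _))// !cmodM mulrDl -!mulrA.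
by apply: lerD; rewrite ler_wpM2l ?cmod_ge0//; [exact: b1|exact: b2].
Qed.

Lemma test_in_lin (a b : C) K phi psi : closed K -> test_in K phi -> test_in K psi ->
  test_in K (a *: phi + b *: psi).
Proof.
move=> cK [s1 k1 h1] [s2 k2 h2]; split; first exact: smooth_lin.
  apply: eq0_supported_in => // x nK.
  by rewrite !fctE (supported_in_eq0 k1 nK) (supported_in_eq0 k2 nK) !scaler0 addr0.
move: h1 h2; rewrite /for_class_d; case: c => [h1 h2 l l0|[l l0 [A h1]] [l' l'0 [B h2]]].
  have [A b1] := h1 l l0; have [B b2] := h2 l l0.
  by exists (cmod a * A + cmod b * B); exact: tbound_lin.
exists (Num.max l l'); first by rewrite lt_max l0.
exists (cmod a * `|A| + cmod b * `|B|); apply: tbound_lin => //.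
  by apply: tbound_le (ltW l0) _ (ler_norm A) _ h1 => //; rewrite le_max lexx.
by apply: tbound_le (ltW l'0) _ (ler_norm B) _ h2 => //; rewrite le_max lexx orbT.
Qed.

Lemma test_space_lin (a b : C) Om phi psi : lcs_carrier (test_space c M Om) phi ->
  lcs_carrier (test_space c M Om) psi -> lcs_carrier (test_space c M Om) (a *: phi + b *: psi).
Proof.
move=> /test_spaceP[K [cK KO h]] /test_spaceP[K' [cK' KO' h']]; apply/test_spaceP.
have cKK : compact (K `|` K') by exact: compactU.
exists (K `|` K'); split => //; first by move=> x [/KO|/KO'].
apply: test_in_lin; first exact: compact_closed.
  by apply: test_in_subset h => x; left.
by apply: test_in_subset h' => x; right.
Qed.

(** One norm suffices to produce a neighbourhood in the projective limit, whereas the inductive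
    limit asks for a ball for each [l]: this is the quantifier of [for_class_l]. *)
Lemma test_nbhs0I Om (V : set (Rn -> C^o)) : absolutely_convex V ->
  (forall K, compact K -> K `<=` Om -> for_class_l c (fun l => exists2 e : R, 0 < e &
     forall phi, test_in K phi -> tbound phi l e -> V phi)) ->
  lcs_nbhs0 (test_space c M Om) V.
Proof.
move=> aV h; exists V; split => // K [cK KO]; have := h K cK KO.
have cl : closed K by exact: compact_closed.
have key l e : 0 < l -> 0 < e -> (forall phi, test_in K phi -> tbound phi l e -> V phi) ->
    forall phi, test_in K phi -> (ultra_norm M l K phi < e%:E)%E -> V phi.
  move=> l0 e0 hV phi tphi hn; apply: hV => //; have [sm sK _] := tphi.
  by apply: (@ultra_norm_tbound _ K); rewrite ?ltW.
have lty l phi : 0 < l -> smooth phi -> supported_in K phi ->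
    (ultra_norm M l K phi < +oo)%E <-> exists A, tbound phi l A.
  by move=> l0 sm sK; exact: ultra_norm_lty.
rewrite /for_class_l /test_in /for_class_d in key *; case: c key => key.
  move=> [l l0 [e e0 hV]].
  exists 1%N, (fun=> l), (fun=> [set phi | [/\ smooth phi, supported_in K phi &
    (ultra_norm M l K phi < +oo)%E] /\ (ultra_norm M l K phi < e%:E)%E]).
  split=> [_|phi [Sphi /(_ ord0 Logic.I)[_ hn]]]; first by split => //; exists e.
  apply: (key l e) => //; have [sm sK _] := Sphi 1 ltr01; split => // l' l'0.
  by have [_ _ /lty] := Sphi l' l'0; exact.
move=> h'; exists V; split => // l l0; have [e e0 hV] := h' l l0; exists e => // phi [[sm sK hn] hne].
by apply: (key l e) => //; split => //; exists l => //; apply/lty.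
Qed.

(** In the Beurling case a neighbourhood comes from finitely many norms; the norm increases as [l]
    decreases, so the smallest [l] with the smallest radius dominates them all. *)
Lemma test_nbhs0E Om U K : lcs_nbhs0 (test_space c M Om) U -> compact K -> K `<=` Om ->
  for_class_l c (fun l => exists2 e : R, 0 < e &
    forall phi, test_in K phi -> tbound phi l e -> U phi).
Proof.
move=> [V [_ VU hV]] cK KO; have {hV} := hV K (conj cK KO).
have cl : closed K by exact: compact_closed.
have lty l phi : 0 < l -> smooth phi -> supported_in K phi ->
    (ultra_norm M l K phi < +oo)%E <-> exists A, tbound phi l A.
  by move=> l0 sm sK; exact: ultra_norm_lty.
rewrite /for_class_l /test_in /for_class_d /=; case: c => /=.
  move=> [m [li [Vi [hVi sub]]]].
  have [L [E [L0 E0 hL]]] : exists L E : R, [/\ 0 < L, 0 < E & forall k : 'I_m, L <= li k /\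
      forall phi, [/\ smooth phi, supported_in K phi & (ultra_norm M (li k) K phi < +oo)%E] ->
        (ultra_norm M (li k) K phi <= E%:E)%E -> Vi k phi].
    have ex (k : 'I_m) : exists e : R, 0 < e /\ forall phi,
        [/\ smooth phi, supported_in K phi & (ultra_norm M (li k) K phi < +oo)%E] ->
        (ultra_norm M (li k) K phi <= e%:E)%E -> Vi k phi.
      have [_ [e e0 he]] := hVi k; exists (e / 2); split; first by rewrite divr_gt0.
      move=> phi h1 h2; apply: he; split => //; apply: le_lt_trans h2 _.
      by rewrite lte_fin ltr_pdivrMr// ltr_pMr// ltr1n.
    have [e he] := choice ex.
    exists (\big[Num.min/1]_k li k), (\big[Num.min/1]_k e k); split.
    - by apply: lt_bigmin => // k _; case: (hVi k).
    - by apply: lt_bigmin => // k _; case: (he k).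
    move=> k; split; first exact: bigmin_le_cond.
    move=> phi h1 h2; apply: (he k).2 => //; apply: le_trans h2 _.
    by rewrite lee_fin; exact: bigmin_le_cond.
  exists L => //; exists E => // phi [sm sK h] b; apply: VU; apply: sub; split.
    move=> l l0 /=; split => //; apply/lty => //; exact: h.
  move=> k _; have [l0 _] := hVi k; have [Lk hk] := hL k; apply: hk.
    split => //; apply/lty => //; exact: h.
  apply: tbound_ultra_norm => //; apply: tbound_le b => //; exact: ltW.
move=> [V' [_ V'V hV']] l l0; have [e e0 he] := hV' l l0.
exists (e / 2); first by rewrite divr_gt0.
move=> phi [sm sK h] b; apply: VU; apply: V'V; apply: he; split.
  by split => //; apply/lty => //; exists (e / 2).
apply: le_lt_trans (tbound_ultra_norm K l0 b) _.
by rewrite lte_fin ltr_pdivrMr// ltr_pMr// ltr1n.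
Qed.

Definition linear_on_tests Om (u : (Rn -> C^o) -> C^o) : Prop := forall (a : C) phi psi,
  lcs_carrier (test_space c M Om) phi -> lcs_carrier (test_space c M Om) psi ->
  u (a *: phi + psi) = a * u phi + u psi.

(** Continuity in quantitative form, one compact set at a time; homogeneity in [A] replaces the
    language of neighbourhoods. *)
Definition dominated Om (u : (Rn -> C^o) -> C^o) : Prop := forall K, compact K -> K `<=` Om ->
  for_class_l c (fun l => exists2 B : R, 0 < B &
    forall phi A, test_in K phi -> 0 < A -> tbound phi l A -> cmod (u phi) <= B * A).

Lemma for_class_l_sub (P Q : R -> Prop) : (forall l, 0 < l -> P l -> Q l) ->
  for_class_l c P -> for_class_l c Q.
Proof.
rewrite /for_class_l; case: c => PQ.
  by move=> [l l0 /(PQ _ l0) ?]; exists l.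
by move=> h l l0; apply: PQ => //; exact: h.
Qed.

Lemma test_nbhs0_sub Om (V U : set (Rn -> C^o)) : V `<=` U ->
  lcs_nbhs0 (test_space c M Om) V -> lcs_nbhs0 (test_space c M Om) U.
Proof. by move=> VU [V' [aV V'V hV]]; exists V'; split => //; exact: subset_trans VU. Qed.

Lemma linear_on_tests0 Om u : linear_on_tests Om u -> u 0 = 0.
Proof.
move=> h; have Z : lcs_carrier (test_space c M Om) (0 : Rn -> C^o).
  apply/test_spaceP; exists set0; split => //; first exact: compact0.
  have E : (0 : Rn -> C^o) = (fun _ _ => 0) ([::] : seq 'I_n) by [].
  split.
  - exact: (cjet_smooth cjet0).
  - by apply: eq0_supported_in; [exact: closed0|].
  - have b l : 0 < l -> tbound 0 l 0.
      move=> l0 a x; rewrite mul0r mi_partialE.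
      by rewrite E (cjet_partial _ cjet0) cmod0.
    rewrite /for_class_d; case: c => [l l0|]; first by exists 0; exact: b.
    by exists 1 => //; exists 0; exact: b.
by have := h 1 _ _ Z Z; rewrite scale1r mul1r addr0 => /eqP; rewrite -subr_eq subrr => /eqP.
Qed.

Lemma linear_on_testsZ Om u (a : C) phi : linear_on_tests Om u ->
  lcs_carrier (test_space c M Om) phi -> u (a *: phi) = a * u phi.
Proof.
move=> h hphi; rewrite -[a *: phi]addr0 -[X in _ + X](scale0r phi).
have h0 : lcs_carrier (test_space c M Om) (0 *: phi).
  by rewrite -[_ *: _]addr0 -[X in _ + X](scale0r phi); exact: test_space_lin.
by rewrite h// scale0r (linear_on_tests0 h) addr0.
Qed.

(** Towards domination, a test function is rescaled by [e / A] to enter the neighbourhood where the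
    functional is below 1. Conversely, a sublevel set is absolutely convex and contains the required
    balls. *)
Lemma functionalP Om u : lcs_carrier (ultradistributions c M Om) u <->
  linear_on_tests Om u /\ dominated Om u.
Proof.
split=> [[lin cont]|[lin dom]].
  split=> // K cK KO.
  have tin phi : test_in K phi -> lcs_carrier (test_space c M Om) phi.
    by move=> h; apply/test_spaceP; exists K.
  have := test_nbhs0E (cont 1 ltr01) cK KO; apply: for_class_l_sub => l l0 [e e0 he].
  exists (1 / e); first by rewrite divr_gt0.
  move=> phi A hphi A0 b.
  have : cmod (u ((e / A)%:C%C *: phi)) < 1.
    rewrite -ltcR -cmodE; apply: he.
      have E : (e / A)%:C%C *: phi = (e / A)%:C%C *: phi + 0 *: phi by rewrite scale0r addr0.
      by rewrite E; apply: test_in_lin => //; exact: compact_closed.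
    have [sm _ _] := hphi.
    have := tbound_lin (e / A)%:C%C 0 sm sm b b.
    rewrite scale0r addr0 cmod0 mul0r addr0 cmod_real gtr0_norm ?divr_gt0//.
    by rewrite divfK// gt_eqF.
  rewrite (linear_on_testsZ _ lin); last exact: tin.
  rewrite cmodM cmod_real gtr0_norm ?divr_gt0// mulrAC ltr_pdivrMr// => h.
  by rewrite mul1r [leRHS]mulrC ler_pdivlMr// [leLHS]mulrC ltW// -[ltRHS]mul1r.
split=> // e /cpos_real[eE e0].
have e2 : 0 < complex.Re e / 2 by rewrite divr_gt0.
(* The carrier is part of the set because [u] is linear only there; the closed condition at half the
   level implies the open one. *)
apply: (@test_nbhs0_sub _ [set phi | lcs_carrier (test_space c M Om) phi /\
    cmod (u phi) <= complex.Re e / 2]).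
  move=> phi [_ h] /=; rewrite eE cmodE ltcR (le_lt_trans h)//.
  by rewrite ltr_pdivrMr// ltr_pMr// ltr1n.
apply: test_nbhs0I.
  move=> x y a b [tx ux] [ty uy] ab; split; first exact: test_space_lin.
  have tby : lcs_carrier (test_space c M Om) (b *: y).
    by rewrite -[_ *: _]addr0 -[X in _ + X](scale0r y); exact: test_space_lin.
  rewrite lin// (linear_on_testsZ _ lin ty) (le_trans (cmodD _ _))// !cmodM.
  move: ab; rewrite !cmodE -rmorphD/= lecR => ab.
  apply: (@le_trans _ _ ((cmod a + cmod b) * (complex.Re e / 2))).
    by rewrite mulrDl; apply: lerD; rewrite ler_wpM2l ?cmod_ge0.
  by rewrite ler_piMl// ltW.
move=> K cK KO; have := dom K cK KO; apply: for_class_l_sub => l l0 [B B0 hB].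
exists (complex.Re e / 2 / B); first by rewrite divr_gt0.
move=> phi tphi b; split; first by apply/test_spaceP; exists K.
rewrite (le_trans (hB _ _ tphi _ b))// ?divr_gt0//.
by rewrite mulrC divfK ?gt_eqF.
Qed.

Lemma linear_on_testsB Om u v : linear_on_tests Om u -> linear_on_tests Om v ->
  linear_on_tests Om (u - v).
Proof. by move=> hu hv a x y tx ty; rewrite !fctE hu// hv//; ring. Qed.

(** In the Beurling case the two properties come with different parameters, and monotonicity allows
    both to be taken at the smaller one. *)
Lemma for_class_l_and (P Q : R -> Prop) :
  (forall l l', 0 < l' -> l' <= l -> P l -> P l') -> (forall l l', 0 < l' -> l' <= l -> Q l -> Q l') ->
  for_class_l c P -> for_class_l c Q -> for_class_l c (fun l => P l /\ Q l).
Proof.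
rewrite /for_class_l; case: c => mP mQ; last by move=> hP hQ l l0; split; [exact: hP|exact: hQ].
move=> [l l0 hP] [l' l'0 hQ].
have m0 : 0 < Num.min l l' by rewrite lt_min l0.
by exists (Num.min l l') => //; split; [apply: mP hP|apply: mQ hQ];
  rewrite // ge_min lexx ?orbT.
Qed.

Lemma dominatedB Om u v : dominated Om u -> dominated Om v -> dominated Om (u - v).
Proof.
move=> hu hv K cK KO.
have mono (w : (Rn -> C^o) -> C^o) (l l' : R) : 0 < l' -> l' <= l -> (exists2 B : R, 0 < B &
    forall phi A, test_in K phi -> 0 < A -> tbound phi l A -> cmod (w phi) <= B * A) ->
    exists2 B : R, 0 < B &
    forall phi A, test_in K phi -> 0 < A -> tbound phi l' A -> cmod (w phi) <= B * A.
  move=> l0 ll [B B0 h]; exists B => // phi A tphi A0 b; apply: h => //.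
  by apply: tbound_le b => //; exact: ltW.
apply: for_class_l_sub (for_class_l_and (mono u) (mono v) (hu K cK KO) (hv K cK KO)).
move=> l l0 [[B B0 h] [B' B'0 h']]; exists (B + B'); first exact: addr_gt0.
move=> phi A tphi A0 b; rewrite !fctE (le_trans (cmodD _ _))// cmodN mulrDl.
by apply: lerD; [exact: h|exact: h'].
Qed.

Lemma functionalB Om u v : lcs_carrier (ultradistributions c M Om) u ->
  lcs_carrier (ultradistributions c M Om) v -> lcs_carrier (ultradistributions c M Om) (u - v).
Proof.
move=> /functionalP[l1 d1] /functionalP[l2 d2]; apply/functionalP.
by split; [exact: linear_on_testsB|exact: dominatedB].
Qed.

Lemma functional0 Om : lcs_carrier (ultradistributions c M Om) 0.
Proof.
apply/functionalP; split=> [a x y _ _|K cK KO]; first by rewrite !fctE mulr0 addr0.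
have h l : 0 < l -> exists2 B : R, 0 < B & forall (phi : Rn -> C^o) A, test_in K phi ->
    0 < A -> tbound phi l A -> cmod ((0 : (Rn -> C^o) -> C^o) phi) <= B * A.
  by move=> l0; exists 1 => // phi A _ A0 _; rewrite cmod0 mul1r ltW.
by rewrite /for_class_l; case: c h => h; [exists 1 => //; exact: h|exact: h].
Qed.

Lemma functional_sum Om (I : Type) (r : seq I) (u : I -> (Rn -> C^o) -> C^o) :
  (forall i, lcs_carrier (ultradistributions c M Om) (u i)) ->
  lcs_carrier (ultradistributions c M Om) (\sum_(i <- r) u i).
Proof.
move=> hu; elim: r => [|i r IH]; first by rewrite big_nil; exact: functional0.
rewrite big_cons -[X in _ + X]opprK; apply: functionalB => //.
by rewrite -sub0r; apply: functionalB => //; exact: functional0.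
Qed.

Lemma functional_restrict Om Om' u : Om `<=` Om' -> lcs_carrier (ultradistributions c M Om') u ->
  lcs_carrier (ultradistributions c M Om) u.
Proof.
move=> OO /functionalP[lin dom]; apply/functionalP; split.
  have sub phi : lcs_carrier (test_space c M Om) phi -> lcs_carrier (test_space c M Om') phi.
    move=> /test_spaceP[K [cK KO h]]; apply/test_spaceP.
    by exists K; split => //; exact: subset_trans OO.
  by move=> a x y /sub tx /sub ty; exact: lin.
by move=> K cK KO; apply: dom => //; exact: subset_trans OO.
Qed.

End test_functions.

(** * Bounded translates *)

Section gliding_hump.
Context {R : realType}.
Local Notation C := R[i].

Let third : R := 3^-1.

Let geo m : \sum_(i < m) third ^+ i = 3 / 2 - 3 / 2 * third ^+ m.
Proof.
elim: m => [|m IH]; first by rewrite big_ord0 expr0 mulr1 subrr.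
rewrite big_ord_recr/= IH exprS; have : 3 * third = 1 by rewrite divff.
by move: (third ^+ m) => t; rewrite /third; lra.
Qed.

Let summ_geo : summ (fun i => third ^+ i).
Proof.
split=> [i|]; first by rewrite exprn_ge0// invr_ge0.
by exists (3 / 2) => m; rewrite geo gerBl mulr_ge0// exprn_ge0// invr_ge0.
Qed.

Let tail_geo m : tail (fun i => third ^+ i) m <= 3 / 2 * third ^+ m.
Proof.
have : tsum (fun i => third ^+ i) <= 3 / 2.
  apply: tsum_le => // m'; rewrite geo gerBl mulr_ge0// exprn_ge0// invr_ge0.
  done.
by rewrite /tail geo; lra.
Qed.

(** The supremum over [i] need not be attained; an index reaching two thirds of it is enough for the
    tail estimate. *)
Let almost_max (t : nat -> C) (B : R) (i : nat) : (forall i, cmod (t i) <= B) -> 0 < cmod (t i) ->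
  exists m, cmod (t i) <= 3 / 2 * cmod (t m) /\ forall i, cmod (t i) <= 3 / 2 * cmod (t m).
Proof.
move=> tB ti; pose E := [set cmod (t i) | i in [set: nat]].
have sE : has_sup E.
  split; first by exists (cmod (t i)); exists i.
  by exists B => _ [j _ <-].
have le j : cmod (t j) <= sup E by apply: sup_upper_bound => //; exists j.
have s0 : 0 < sup E by apply: lt_le_trans (le i).
have [_ [m _ <-] hm] : exists2 e, E e & sup E - sup E / 3 < e.
  by apply: sup_adherent => //; rewrite divr_gt0.
have h j : cmod (t j) <= 3 / 2 * cmod (t m) by have := le j; move: hm; lra.
by exists m; split.
Qed.

(* Sokal's argument: at each step one of the two signs does not decrease the
   size of the partial sum. *)
Lemma gliding_hump (H : Type) (W : set H) (tau : H -> nat -> C) :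
  (forall h, W h -> exists B, forall i, cmod (tau h i) <= B) ->
  (forall B : R, exists h i, W h /\ B < cmod (tau h i)) ->
  exists (a : nat -> R) (m : nat -> nat), (forall j, `|a j| <= third ^+ j) /\
    forall B : R, exists h, W h /\ B < cmod (csum (fun j => (a j)%:C%C * tau h (m j))).
Proof.
move=> bd unb.
(* The [j]-th hump exceeds [4 ^+ j], which outgrows the weight [third ^+ j] it will receive, and it
   nearly dominates the other terms at the same [h]. *)
have step (j : nat) : exists hm : H * nat, W hm.1 /\ 4 ^+ j < cmod (tau hm.1 hm.2) /\
    forall i, cmod (tau hm.1 i) <= 3 / 2 * cmod (tau hm.1 hm.2).
  have [h [i [Wh hi]]] := unb (3 / 2 * 4 ^+ j); have [B hB] := bd h Wh.
  have p4 : 0 < 4 ^+ j :> R by rewrite exprn_gt0.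
  have [m [h1 h2]] := almost_max hB (lt_trans (mulr_gt0 (divr_gt0 (ltr0Sn _ _) (ltr0Sn _ _)) p4) hi).
  by exists (h, m); split => //; split => //=; move: hi h1; lra.
have [hm Hhm] := choice step.
pose h j := (hm j).1; pose m j := (hm j).2.
pose b j (x : nat -> R) := \sum_(i < j) (x i)%:C%C * tau (h j) (m i).
pose t j : C := (third ^+ j)%:C%C * tau (h j) (m j).
(* One of [b + t] and [b - t] has modulus at least that of [t], since their difference is
   [2 * t]. *)
pose sg j x : R := if cmod (t j) <= cmod (b j x + t j) then 1 else -1.
pose x := fix x j := if j is j'.+1 then
  fun i => if i == j' then sg j' (x j') * third ^+ j' else x j' i else (fun=> 0 : R).
pose a j := x j.+1 j.
have xa k i : (i < k)%N -> x k i = a i.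
  elim: k => [//|k IH]; rewrite ltnS leq_eqVlt => /predU1P[->//|ik].
  by rewrite /= (ltn_eqF ik) IH.
exists a, m; split.
  move=> j; rewrite /a /= eqxx normrM (_ : `|sg j (x j)| = 1) ?mul1r.
    by rewrite ger0_norm// exprn_ge0// invr_ge0.
  by rewrite /sg; case: ifP; rewrite ?normrN normr1.
have a_le j : `|a j| <= third ^+ j.
  rewrite /a /= eqxx normrM (_ : `|sg j (x j)| = 1) ?mul1r.
    by rewrite ger0_norm// exprn_ge0// invr_ge0.
  by rewrite /sg; case: ifP; rewrite ?normrN normr1.
have big j : cmod (t j) <= cmod (\sum_(i < j.+1) (a i)%:C%C * tau (h j) (m i)).
  rewrite big_ord_recr/=.
  have -> : \sum_(i < j) (a i)%:C%C * tau (h j) (m i) = b j (x j).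
    by apply: eq_bigr => i _; rewrite xa.
  have -> : (a j)%:C%C * tau (h j) (m j) = (sg j (x j))%:C%C * t j.
    by rewrite /a /= eqxx /t mulrA -rmorphM.
  rewrite /sg; case: (leP (cmod (t j)) (cmod (b j (x j) + t j))) => [hle|hlt].
    by rewrite mul1r.
  rewrite rmorphN rmorph1 mulN1r.
  have := cmodD (b j (x j) + t j) (- (b j (x j) - t j)); rewrite cmodN.
  have -> : b j (x j) + t j + - (b j (x j) - t j) = 2 * t j by ring.
  have -> : cmod (2 * t j) = 2 * cmod (t j).
    by rewrite cmodM -[2 in LHS](rmorph_nat (@real_complex R)) cmod_real normr_nat.
  by move: hlt; lra.
(* The partial sum through [j] is at least [T * third ^+ j], the tail at most three quarters of
   that, and the remaining quarter exceeds [|B|] by Bernoulli's inequality for [(4 / 3) ^+ j]. *)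
move=> B; pose j := (Num.truncn (12 * `|B|)).+1.
exists (h j); have [Wh [h4 hmax]] := Hhm j; split => //.
pose T := cmod (tau (h j) (m j)).
have T0 : 0 <= T by exact: cmod_ge0.
have sv : summ (fun i => 3 / 2 * T * third ^+ i) by apply: summZ => //; rewrite mulr_ge0.
have := @csum_tail _ _ (fun i => (a i)%:C%C * tau (h j) (m i)) j.+1 sv.
have -> : tail (fun i => 3 / 2 * T * third ^+ i) j.+1 = 3 / 2 * T * tail (fun i => third ^+ i) j.+1.
  rewrite /tail mulrBr; congr (_ - _); first by rewrite tsumZ// mulr_ge0.
  by rewrite mulr_sumr.
move=> /(_ _)/le_trans => htail.
have {}htail : cmod (csum (fun i => (a i)%:C%C * tau (h j) (m i)) -
    \sum_(i < j.+1) (a i)%:C%C * tau (h j) (m i)) <= 3 / 4 * (T * third ^+ j).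
  apply: htail => [i|].
    rewrite cmodM cmod_real [leRHS]mulrC; by apply: ler_pM; rewrite ?cmod_ge0.
  apply: (@le_trans _ _ (3 / 2 * T * (3 / 2 * third ^+ j.+1))).
    by rewrite ler_wpM2l ?tail_geo// mulr_ge0.
  by rewrite exprS /third le_eqVlt; apply/orP; left; apply/eqP; field.
have tE : cmod (t j) = T * third ^+ j.
  by rewrite /t cmodM cmod_real mulrC ger0_norm// exprn_ge0// invr_ge0.
have := big j; rewrite tE => hb.
have := cmodD (csum (fun i => (a i)%:C%C * tau (h j) (m i)))
  (- (csum (fun i => (a i)%:C%C * tau (h j) (m i)) - \sum_(i < j.+1) (a i)%:C%C * tau (h j) (m i))).
rewrite cmodN.
have -> : csum (fun i => (a i)%:C%C * tau (h j) (m i)) + - (csum (fun i => (a i)%:C%C * tau (h j) (m i)) -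
  \sum_(i < j.+1) (a i)%:C%C * tau (h j) (m i)) = \sum_(i < j.+1) (a i)%:C%C * tau (h j) (m i) by ring.
have low : 4 * `|B| < T * third ^+ j.
  apply: (@lt_le_trans _ _ ((4 / 3) ^+ j)); last first.
    rewrite exprMn ler_wpM2r ?exprn_ge0 ?invr_ge0//; exact: ltW.
  have bern k : 1 + k%:R / 3 <= (4 / 3) ^+ k :> R.
    elim: k => [|k IH]; first by rewrite mul0r addr0 expr0.
    rewrite exprS -natr1; have : 0 <= k%:R :> R by []; move: IH; lra.
  apply: lt_le_trans (bern j); have : 12 * `|B| < j%:R by exact: truncnS_gt.
  lra.
have := ler_norm B; move: htail hb low; lra.
Qed.

End gliding_hump.

(** * Ultradistributions applied to series of test functions *)

Section series_of_tests.
Context {R : realType} {n : nat} (c : ultra_class) (M : nat -> R).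
Hypothesis M_gt0 : forall p, 0 < M p.
Local Notation C := R[i].
Local Notation Rn := 'rV[R]_n.

Definition jbound (D : seq 'I_n -> Rn -> C) (l A : R) : Prop := forall s x,
  cmod (D s x) <= A * (l ^+ size s * M (size s)).

Lemma jbound_tbound D l A : cjet D -> jbound D l A -> tbound M (D [::]) l A.
Proof. by move=> jD b a x; rewrite mi_partialE cjet_partial// -size_mi_seq. Qed.

Lemma jbound_shift D l A (h : Rn) : jbound D l A -> jbound (fun s x => D s (x + h)) l A.
Proof. by move=> b s x; exact: b. Qed.

Lemma jbound_le D l A A' : 0 <= l -> A <= A' -> jbound D l A -> jbound D l A'.
Proof.
move=> l0 AA b s x; rewrite (le_trans (b s x))// ler_wpM2r// mulr_ge0 ?exprn_ge0//.
exact: ltW.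
Qed.

Lemma jboundZ D l A (z : C) : jbound D l A -> jbound (fun s x => z * D s x) l (cmod z * A).
Proof. by move=> b s x; rewrite cmodM -mulrA ler_wpM2l ?cmod_ge0. Qed.

Lemma for_class_pair (P Q : R -> Prop) : for_class_l c P -> for_class_d c Q ->
  exists l, [/\ 0 < l, P l & Q l].
Proof.
rewrite /for_class_l /for_class_d; case: c.
  by move=> [l l0 hP] hQ; exists l; split => //; exact: hQ.
by move=> hP [l l0 hQ]; exists l; split => //; exact: hP.
Qed.

Lemma test_in_jet D m : cjet D -> (forall x, ~ box m x -> D [::] x = 0) ->
  for_class_d c (fun l => exists A, jbound D l A) -> test_in c M (box m) (D [::]).
Proof.
move=> jD D0 h; split; first exact: cjet_smooth.
  by apply: eq0_supported_in => //; exact: box_closed.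
move: h; rewrite /for_class_d; case: c => [h l l0|[l l0 [A b]]].
  by have [A b] := h l l0; exists A; exact: jbound_tbound.
by exists l => //; exists A; exact: jbound_tbound.
Qed.

Lemma for_class_d_sub (P Q : R -> Prop) : (forall l, 0 < l -> P l -> Q l) ->
  for_class_d c P -> for_class_d c Q.
Proof.
rewrite /for_class_d; case: c => PQ; last by move=> [l l0 /(PQ _ l0) ?]; exists l.
by move=> h l l0; apply: PQ => //; exact: h.
Qed.

Variables (Om : set Rn) (f : (Rn -> C^o) -> C^o).
Hypothesis f_ultra : lcs_carrier (ultradistributions c M Om) f.

Let lin : linear_on_tests c M Om f. Proof. by case/(functionalP c M_gt0) : f_ultra. Qed.
Let dom : dominated c M Om f. Proof. by case/(functionalP c M_gt0) : f_ultra. Qed.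

(** Extends domination to [A = 0], by letting a positive perturbation of [A] tend to 0. *)
Lemma functional_le m : box m `<=` Om -> for_class_l c (fun l => exists2 B : R, 0 < B &
  forall phi A, test_in c M (box m) phi -> 0 <= A -> tbound M phi l A -> cmod (f phi) <= B * A).
Proof.
move=> mO; have := dom (@box_compact R n m) mO; apply: for_class_l_sub => l l0 [B B0 h].
exists B => // phi A tphi A0 b; apply/ler_addgt0Pr => e e0.
have A1 : 0 < A + e / B by rewrite ltr_wpDl// divr_gt0.
rewrite (le_trans (h _ _ tphi A1 _))//.
  by apply: (tbound_le M_gt0 (ltW l0) (lexx l) _ (ltW A1) b); rewrite lerDl ltW// divr_gt0.
by rewrite mulrDr mulrCA divff ?gt_eqF// mulr1.
Qed.

(** The remainder of the series is again a test function supported in the same box, with bound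
    [tail v N]; domination turns it into a null error. *)
Lemma functional_csum (m : R) (D : nat -> seq 'I_n -> Rn -> C) : box m `<=` Om ->
  (forall i, cjet (D i)) -> (forall i x, ~ box m x -> D i [::] x = 0) ->
  for_class_d c (fun l => exists v, summ v /\ forall i, jbound (D i) l (v i)) ->
  let phi := (fun x => csum (fun i => D i [::] x)) : Rn -> C^o in
  [/\ test_in c M (box m) phi, f phi = csum (fun i => f (D i [::])) &
      exists w, summ w /\ forall i, cmod (f (D i [::])) <= w i].
Proof.
move=> mO jD D0 hD phi.
have gbound (l : R) v (l0 : 0 < l) (sv : summ v) (b : forall i, jbound (D i) l (v i)) s :
    forall i x, cmod (D i s x) <= (l ^+ size s * M (size s)) * v i.
  by move=> i x; rewrite mulrC; exact: b.
pose S s x := csum (fun i => D i s x).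
have jS : cjet S.
  have [l [l0 [v [sv b]]]] : exists l, 0 < l /\ exists v, summ v /\ forall i, jbound (D i) l (v i).
    move: hD; rewrite /for_class_d; case: c => [/(_ 1 ltr01) h|[l l0 h]]; first by exists 1.
    by exists l.
  apply: (cjet_csum sv jD) => s; exists (l ^+ size s * M (size s)); exact: gbound b s.
have w0 (l : R) (s : seq 'I_n) : 0 < l -> 0 <= l ^+ size s * M (size s).
  by move=> l0; rewrite mulr_ge0 ?exprn_ge0 ?ltW.
have S_tail (l : R) v (l0 : 0 < l) (sv : summ v) (b : forall i, jbound (D i) l (v i)) N s x :
    cmod (S s x - \sum_(i < N) D i s x) <= tail v N * (l ^+ size s * M (size s)).
  have := csum_tail N (summZ (w0 l s l0) sv) (fun i => gbound l v l0 sv b s i x).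
  rewrite -/(S s x) => h; apply: le_trans h _.
  by rewrite /tail tsumZ ?w0// -mulr_sumr -mulrBr mulrC.
have S0 x : ~ box m x -> S [::] x = 0.
  by move=> nx; rewrite /S -[RHS]csum0; apply: eq_csum => i; exact: D0.
have tS : test_in c M (box m) phi.
  apply: (@test_in_jet S) => //; apply: for_class_d_sub hD => l l0 [v [sv b]].
  exists (tail v 0) => s x; have := S_tail l v l0 sv b 0%N s x.
  by rewrite big_ord0 subr0.
have [l [l0 [B B0 hB] [v [sv b]]]] := for_class_pair (functional_le mO) hD.
have tD i : test_in c M (box m) (D i [::]).
  apply: (@test_in_jet (D i)) => //; first exact: D0.
  by apply: for_class_d_sub hD => l' l'0 [v' [sv' b']]; exists (v' i).
have fD i : cmod (f (D i [::])) <= B * v i.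
  by apply: hB => //; [case: sv|exact: jbound_tbound].
have sw : summ (fun i => B * v i) by apply: summZ => //; exact: ltW.
split=> //; last by exists (fun i => B * v i).
pose rem N : Rn -> C^o := fun x => S [::] x - \sum_(i < N) D i [::] x.
have jrem N : cjet (fun s x => S s x + (-1) * \sum_(i < N) D i s x).
  by apply: cjetD => //; apply: cjetZ; exact: cjet_sum.
have remE N : rem N = (fun s x => S s x + (-1) * \sum_(i < N) D i s x) [::].
  by apply/funext => x; rewrite /rem mulN1r.
have trem N : test_in c M (box m) (rem N).
  rewrite remE; apply: (test_in_jet (jrem N)) => [x nx|].
    by rewrite S0// big1 ?mulr0 ?addr0// => i _; exact: D0.
  apply: for_class_d_sub hD => l' l'0 [v' [sv' b']]; exists (tail v' N) => s x.
  by rewrite mulN1r; exact: S_tail.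
have carr phi' : test_in c M (box m) phi' -> lcs_carrier (test_space c M Om) phi'.
  by move=> h; apply/(test_spaceP c M_gt0); exists (box m); split => //; exact: box_compact.
have frem N : f (rem N) = f phi - \sum_(i < N) f (D i [::]).
  elim: N => [|N IH].
    rewrite big_ord0 subr0; congr f; apply/funext => x.
    by rewrite /rem big_ord0 subr0.
  rewrite big_ord_recr/= opprD addrA -IH.
  have -> : rem N.+1 = (-1 : C) *: (D N [::] : Rn -> C^o) + rem N.
    apply/funext => x; rewrite /rem !fctE big_ord_recr/= scaleN1r; ring.
  rewrite lin; [|exact: carr|exact: carr].
  by rewrite mulN1r addrC.
apply: (@csum_unique _ (fun i => B * v i) _ _ (fun N => B * tail v N)) => //.
  rewrite -[X in _ --> X](mulr0 B); apply: cvgM; first exact: cvg_cst.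
  exact: tail_cvg0.
move=> N; rewrite -frem; apply: hB => //; first exact: tail_ge0.
rewrite remE; apply: jbound_tbound (jrem N) _ => s x.
by rewrite mulN1r; exact: S_tail.
Qed.

End series_of_tests.

Section bounded_translates.
Context {R : realType} {n : nat} (c : ultra_class) (M : nat -> R).
Hypothesis M_gt0 : forall p, 0 < M p.
Local Notation C := R[i].
Local Notation Rn := 'rV[R]_n.
Variables (f : (Rn -> C^o) -> C^o) (W : set Rn) (omega : Rn -> R).
Hypothesis f_ultra : lcs_carrier (ultradistributions c M setT) f.
Hypothesis omega_gt0 : forall x, 0 < omega x.
Hypothesis f_bigO : translate_bigO c M f W omega.

(** Were the family unbounded, the gliding hump would give weights of geometric decay for which the
    series of the [D i] is a single test function contradicting the hypothesis on [f]. For each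
    fixed [h] boundedness comes from the continuity of [f]. *)
Lemma translate_bounded_family (m : R) (D : nat -> seq 'I_n -> Rn -> C) :
  (forall i, cjet (D i)) -> (forall i x, ~ box m x -> D i [::] x = 0) ->
  for_class_d c (fun l => exists A, forall i, jbound M (D i) l A) ->
  exists B, forall h i, W h -> cmod (f (fun x => D i [::] (x - h))) <= B * omega h.
Proof.
move=> jD D0 hD; apply: contrapT => nB.
pose tau h i : C := f (fun x => D i [::] (x - h)) / (omega h)%:C%C.
have tauE h i : cmod (tau h i) = cmod (f (fun x => D i [::] (x - h))) / omega h.
  by rewrite /tau cmodM cmodV cmod_real gtr0_norm.
have Dh0 (h : Rn) i x : ~ box (m + abs_sum (- h)) x -> D i [::] (x - h) = 0.
  by move=> nx; apply: D0 => bx; apply: nx; exact: box_shift bx.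
have jDh (h : Rn) i : cjet (fun s x => D i s (x - h)) by exact: cjet_shift.
have tDh (h : Rn) i : test_in c M (box (m + abs_sum (- h))) (fun x => D i [::] (x - h)).
  apply: (test_in_jet (jDh h i)); first exact: Dh0.
  by apply: for_class_d_sub hD => l' l'0 [A' b']; exists A'; exact: jbound_shift.
have bd h : W h -> exists B, forall i, cmod (tau h i) <= B.
  move=> _; have [l [l0 [B B0 hB] [A b]]] := for_class_pair
    (functional_le M_gt0 f_ultra (m := m + abs_sum (- h)) (@subsetT _ _)) hD.
  exists (B * `|A| / omega h) => i; rewrite tauE ler_pM2r ?invr_gt0//.
  apply: hB => //; last first.
    apply: (jbound_tbound (jDh h i)); apply: jbound_shift.
    exact: (jbound_le M_gt0 (ltW l0) (ler_norm A) (b i)).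
have unb (B : R) : exists h i, W h /\ B < cmod (tau h i).
  apply: contrapT => h; apply: nB; exists B => h' i Wh'.
  rewrite -ler_pdivrMr// -tauE leNgt; apply/negP => hB; apply: h.
  by exists h', i.
have [a [mm [ha hub]]] := gliding_hump bd unb.
pose G i s x := (a i)%:C%C * D (mm i) s x.
have jG i : cjet (G i) by exact: cjetZ.
have G0 i x : ~ box m x -> G i [::] x = 0 by move=> nx; rewrite /G D0// mulr0.
have sgeo : summ (fun i => 3^-1 ^+ i : R).
  split=> [i|]; first by rewrite exprn_ge0// invr_ge0.
  exists 2 => k; have : \sum_(i < k) (3^-1 : R) ^+ i <= 3 / 2 - 3 / 2 * 3^-1 ^+ k.
    elim: k => [|k IH]; first by rewrite big_ord0 expr0 mulr1 subrr.
    rewrite big_ord_recr/= exprS; have : 3 * 3^-1 = 1 :> R by rewrite divff.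
    by move: IH; move: (3^-1 ^+ k) => t; lra.
  have : 0 <= (3^-1 : R) ^+ k by rewrite exprn_ge0// invr_ge0.
  by lra.
have hG : for_class_d c (fun l => exists v, summ v /\ forall i, jbound M (G i) l (v i)).
  apply: for_class_d_sub hD => l l0 [A b].
  exists (fun i => `|A| * 3^-1 ^+ i); split; first exact: summZ.
  move=> i; have h2 := jboundZ (a i)%:C%C (jbound_le M_gt0 (ltW l0) (ler_norm A) (b (mm i))).
  by apply: (jbound_le M_gt0 (ltW l0) _ h2); rewrite cmod_real mulrC ler_wpM2l.
have [tphi _ _] := functional_csum M_gt0 f_ultra (@subsetT _ _) jG G0 hG.
set phi := (fun x => _) in tphi.
have carr : lcs_carrier (test_space c M setT) phi.
  by apply/(test_spaceP c M_gt0); exists (box m); split => //; exact: box_compact.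
have := f_bigO carr; set e := ereal_sup _ => eoo.
have [h [Wh]] := hub (fine e).
have hGh : for_class_d c (fun l => exists v, summ v /\ forall i, jbound M (fun s x => G i s (x - h)) l (v i)).
  apply: for_class_d_sub hG => l l0 [v [sv b]]; exists v; split => // i.
  exact: jbound_shift.
have Gh0 i x : ~ box (m + abs_sum (- h)) x -> G i [::] (x - h) = 0.
  by move=> nx; rewrite /G Dh0// mulr0.
have [_ fE [w [sw hw]]] := functional_csum M_gt0 f_ultra (@subsetT _ _)
  (fun i => cjet_shift (- h) (jG i)) Gh0 hGh.
rewrite ltNge => /negP; apply.
have fGE i : f (fun x => G i [::] (x - h)) = (a i)%:C%C * f (fun x => D (mm i) [::] (x - h)).
  have /(functionalP c M_gt0)[lin _] := f_ultra.
  rewrite -(linear_on_testsZ M_gt0 _ lin)//.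
  apply/(test_spaceP c M_gt0); exists (box (m + abs_sum (- h))); split => //.
    exact: box_compact.
have -> : csum (fun j => (a j)%:C%C * tau h (mm j)) = f (fun x => phi (x - h)) / (omega h)%:C%C.
  rewrite fE -(csumZr _ sw hw); apply: eq_csum => i.
  by rewrite fGE /tau mulrA.
rewrite cmodM cmodV cmod_real gtr0_norm//.
have : ((cmod (f (fun x => phi (x - h))) / omega h)%:E <= e)%E.
  by apply: ereal_sup_ubound; exists h.
by case: (e) eoo => [r| |] //=; rewrite lee_fin.
Qed.

End bounded_translates.

(** * Atoms and their growth *)

Section cutoff_functions.
Context {R : realType} (M : nat -> R).
Hypothesis M_gt0 : forall p, 0 < M p.
Hypothesis HM3 : M3' M.
Local Notation C := R[i].

(** The bounds hold for every [l], so that the same function serves both classes. *)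
Definition smooth_step (b : R) (Phi : nat -> R -> R) : Prop :=
  [/\ 0 <= b, step_like b (Phi 0%N), forall p (x : R), is_derive x 1 (Phi p) (Phi p.+1 x) &
    forall l : R, 0 < l -> exists2 B : R, 0 < B & forall p x, `|Phi p x| <= B * l ^+ p * M p].

Lemma smooth_step_exists : exists b Phi, smooth_step b Phi.
Proof.
have [a [a0 sa ha]] := mollifier_steps M_gt0 HM3.
have [Phi hP hPhi] := infinite_convolution a0 sa.
exists (tsum a), Phi; split => //; first exact: tsum_ge0.
  by move=> p x; case: (hPhi p x).
move=> l l0; have [B B0 hB] := ha l l0; exists B => // p x.
by rewrite (le_trans (hPhi p x).2).
Qed.

Variables (b : R) (Phi : nat -> R -> R).
Hypothesis step : smooth_step b Phi.

Let near_const (p : nat) (x e z : R) : 0 < e -> (forall y, `|y - x| < e -> Phi p y = z) ->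
  Phi p.+1 x = 0.
Proof.
move=> e0 h; have [_ _ d _] := step; have dx := d p x.
have dc : is_derive x (1 : R) (Phi p) 0.
  apply: (@near_eq_is_derive _ _ _ (fun=> z : R) _ x 1 0).
  exists e => //= y /=; rewrite distrC => /h ->; done.
by have := @derive_val _ _ _ _ _ _ _ dx; rewrite (@derive_val _ _ _ _ _ _ _ dc).
Qed.

Let Phi_left p x : x < - b -> Phi p x = 0.
Proof.
elim: p x => [|p IH] x xb; first by have [_ [_ _ h _] _ _] := step; rewrite h// ltW.
apply: (@near_const p x (- b - x) 0); first by rewrite subr_gt0.
by move=> y; rewrite ltr_norml => /andP[_ h]; apply: IH; move: h; lra.
Qed.

Let Phi_right p x : 1 < x -> Phi p x = if p is 0%N then 1 else 0.
Proof.
elim: p x => [|p IH] x x1; first by have [_ [_ _ _ h] _ _] := step; rewrite h// ltW.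
apply: (@near_const p x (x - 1) (if p is 0%N then 1 else 0)); first by rewrite subr_gt0.
by move=> y; rewrite ltr_norml => /andP[h _]; apply: IH; move: h; lra.
Qed.

(** When [0 <= u + v] and [p = 0], it equals 1 on [[1 - u, v - b]] and 0 off [[- u - b, v + 1]].
    Sums of consecutive integer translates of [bump 1 0] telescope. *)
Definition bump (u v : R) (p : nat) (t : R) : R := Phi p (t + u) - Phi p (t - v).

Lemma bump_eq0 u v S p t : 0 <= u + v -> u + b <= S -> v + 1 <= S -> S < `|t| ->
  bump u v p t = 0.
Proof.
move=> uv uS vS; have [b0 _ _ _] := step; rewrite /bump ltr_normr => /orP[St|St].
  by rewrite !Phi_right ?subrr//; move: St uv vS; lra.
by rewrite !Phi_left ?subrr//; move: St uv uS; lra.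
Qed.

Lemma bump_eq1 u v t : 1 <= t + u -> t - v <= - b -> bump u v 0 t = 1.
Proof. by move=> h1 h2; have [_ [_ _ l r] _ _] := step; rewrite /bump (l _ h2) (r _ h1) subr0. Qed.

Lemma bump_le1 u v t : `|bump u v 0 t| <= 1.
Proof.
have [_ [_ h _ _] _ _] := step; rewrite /bump ler_norml.
have /andP[? ?] := h (t + u); have /andP[? ?] := h (t - v); apply/andP; split; lra.
Qed.

Lemma bump_le (l : R) : 0 < l -> exists2 B : R, 0 < B &
  forall u v p t, `|bump u v p t| <= B * l ^+ p * M p.
Proof.
move=> l0; have [_ _ _ h] := step; have [B B0 hB] := h l l0.
exists (2 * B); first by rewrite mulr_gt0.
move=> u v p t; rewrite /bump (le_trans (ler_normB _ _))//.
by have := hB p (t + u); have := hB p (t - v); lra.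
Qed.

Lemma cderive_bump u v p :
  cderive (1 : R) (fun t => (bump u v p t)%:C%C) (fun t => (bump u v p.+1 t)%:C%C).
Proof.
have [_ _ d _] := step; move=> t; split=> /=; last exact: is_derive_cst.
apply: is_deriveB; first exact: (is_derive_comp_shift (k := Phi p.+1)).
exact: (is_derive_comp_shift (a := - v) (k := Phi p.+1)).
Qed.

End cutoff_functions.

Section atoms.
Context {R : realType} {n : nat} (c : ultra_class) (M : nat -> R).
Hypothesis M_gt0 : forall p, 0 < M p.
Hypothesis HM1 : M1 M.
Hypothesis HM2 : M2' M.
Hypothesis HM3 : M3' M.
Local Notation C := R[i].
Local Notation Rn := 'rV[R]_n.
Local Notation Zn := {ffun 'I_n -> int}.
Local Notation E := (assoc_fun M).
Variables (b : R) (Phi : nat -> R -> R).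
Hypothesis step : smooth_step M b Phi.
Variables (i0 : 'I_n) (N : nat).

(** The coordinate along which integration by parts will be performed; [i0] witnesses that there is
    one. *)
Definition top_coord (k : Zn) : 'I_n := [arg max_(i > i0) `|freq N (k i) : R|]%O.

Definition fradius (k : Zn) : R := `|freq N (k (top_coord k))|.

Lemma freq_le (k : Zn) l : `|freq N (k l)| <= fradius k.
Proof. by rewrite /fradius /top_coord; case: arg_maxP => // i _; apply. Qed.

Lemma fradius_ge0 (k : Zn) : 0 <= fradius k.
Proof. exact: normr_ge0. Qed.

(** Replaces a Leibniz sum by its largest term, so that a product of sums over the coordinates
    becomes a product of single terms. *)
Let sum_bin_max p (a : nat -> R) : exists2 q, (q <= p)%N &
  \sum_(q < p.+1) 'C(p, q)%:R * a q <= 2 ^+ p * a q.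
Proof.
have [i _ hi] := @arg_maxP _ _ _ (ord0 : 'I_p.+1) xpredT (fun i : 'I_p.+1 => a i) isT.
exists i; first by rewrite -ltnS.
apply: (@le_trans _ _ (\sum_(q < p.+1) 'C(p, q)%:R * a i)).
  by apply: ler_sum => q _; rewrite ler_wpM2l//; exact: hi.
rewrite -mulr_suml (_ : 2 = 1 + 1)// exprDn.
by under [in leRHS]eq_bigr => q _ do rewrite !expr1n mul1r.
Qed.

Let weight_prod (q : 'I_n -> nat) : M 0%N * \prod_l M (q l) <= M 0%N ^+ n * M (\sum_l q l)%N.
Proof.
case: (n) q => [|m] q; first by rewrite !big_ord0 mulr1 expr0 mul1r.
by rewrite exprS -mulrA ler_pM2l//; exact: weight_prod_le.
Qed.

(** The shifts [m + 1] and [m + b] make the cutoff equal to 1 on [[- m, m]], with support in the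
    symmetric interval of half-length [m + b + 1]. *)
Definition atom1 (m : R) (k : Zn) l : nat -> R -> C :=
  leibniz (fun j t => (bump Phi (m + 1) (m + b) j t)%:C%C)
    (fun q t => Complex 0 (freq N (k l)) ^+ q * cis (freq N (k l) * t)).

Definition atom (m : R) (k : Zn) (s : seq 'I_n) (x : Rn) : C :=
  \prod_l atom1 m k l (count_mem l s) (x 0 l).

Lemma cjet_atom m k : cjet (atom m k).
Proof.
apply: cjet_tensor => l p; apply: cderive_leibniz => q.
  exact: (cderive_bump step).
apply: eq_cderive (cderiveZ (Complex 0 (freq N (k l)) ^+ q) (cderive_cis _)) => t //.
by rewrite exprSr mulrA.
Qed.

Let atom1_0 m k l t : atom1 m k l 0 t = (bump Phi (m + 1) (m + b) 0 t)%:C%C * cis (freq N (k l) * t).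
Proof. by rewrite /atom1 /leibniz big_ord_recl big_ord0 /= !mul1r addr0. Qed.

Lemma atomE m k (x : Rn) : atom m k [::] x =
  (\prod_l bump Phi (m + 1) (m + b) 0 (x 0 l))%:C%C * echar N k x.
Proof. by rewrite /atom rmorph_prod -big_split; apply: eq_bigr => l _; rewrite atom1_0. Qed.

Lemma atom_box m k (x : Rn) : box m x -> atom m k [::] x = echar N k x.
Proof.
move=> bx; rewrite atomE big1 ?mul1r// => l _; have := bx l.
by rewrite ler_norml => /andP[h1 h2]; apply: (bump_eq1 step); move: h1 h2; lra.
Qed.

Lemma atom_eq0 m k (x : Rn) : 0 <= m -> ~ box (m + b + 1) x -> atom m k [::] x = 0.
Proof.
move=> m0 /existsNP[l /negP]; rewrite -ltNge => h; rewrite /atom (bigD1 l)//=.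
have [b0 _ _ _] := step.
rewrite atom1_0 (@bump_eq0 _ _ _ _ step _ _ (m + b + 1)) ?mul0r//; lra.
Qed.

(** Of the derivatives in [s], [J] fall on the cutoff and [Q] on the character; [r ^+ Q] is at most
    [l ^+ Q * M Q * E (r / l)], and [M J * M Q] recombines by (M.1). The binomial coefficients turn
    [l] into [2 * l]. *)
Lemma atom_jbound (m l : R) : 0 < l -> exists2 B : R, 0 < B &
  forall k, jbound M (atom m k) (2 * l) (B * E (fradius k / l)).
Proof.
move=> l0; have [B B0 hB] := bump_le step l0.
have M0 := M_gt0 0; have BM : 0 < B * M 0%N by rewrite mulr_gt0.
exists ((B * M 0%N) ^+ n); first by rewrite exprn_gt0.
move=> k s x; pose r := fradius k; have r0 : 0 <= r by exact: fradius_ge0.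
have rl : 0 <= r / l by rewrite divr_ge0// ltW.
have key i : exists q : nat, (q <= count_mem i s)%N /\
    cmod (atom1 m k i (count_mem i s) (x 0 i)) <=
    2 ^+ (count_mem i s) * (B * l ^+ (count_mem i s - q) * M (count_mem i s - q)%N * r ^+ q).
  set p := count_mem i s; have [q qp hq] := sum_bin_max p
    (fun q => B * l ^+ (p - q) * M (p - q)%N * r ^+ q).
  exists q; split => //; apply: le_trans hq; apply: le_trans (cmod_sum _ _ _) _.
  apply: ler_sum => j _; rewrite cmodM.
  have -> : cmod ('C(p, j)%:R : C) = 'C(p, j)%:R.
    by rewrite -(rmorph_nat (@real_complex R)) cmod_real normr_nat.
  rewrite ler_wpM2l// !cmodM cmod_real cmod_cis mulr1 cmodX.
  have -> : cmod (Complex 0 (freq N (k i) : R)) = `|freq N (k i)|.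
    by rewrite /cmod /Normc.normc expr0n add0r sqrtr_sqr.
  have fr : `|freq N (k i)| ^+ j <= r ^+ j by rewrite lerXn2r// ?nnegrE// freq_le.
  by apply: ler_pM => //; exact: exprn_ge0.
have [q hq] := choice key.
pose p i := count_mem i s.
have psum : (\sum_i p i)%N = size s.
  rewrite /p; elim: (s) => [|a t IH] /=; first by rewrite big1.
  rewrite big_split/= IH (bigD1 a)//= eqxx big1 ?addn0 ?add1n// => i ia.
  by rewrite eq_sym (negPf ia).
pose J := (\sum_i (p i - q i))%N; pose Q := (\sum_i q i)%N.
have JQ : (J + Q)%N = size s.
  rewrite -psum /J /Q -big_split/=; apply: eq_bigr => i _; rewrite subnK//.
  by case: (hq i).
have prodX (y : R) (e : 'I_n -> nat) : \prod_i y ^+ e i = y ^+ (\sum_i e i)%N.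
  by rewrite -(big_morph _ (exprD y) (expr0 y)).
have h1 : cmod (atom m k s x) <= 2 ^+ size s * (B ^+ n * l ^+ J * (\prod_i M (p i - q i)%N) * r ^+ Q).
  rewrite /atom cmod_prod.
  apply: (@le_trans _ _ (\prod_i (2 ^+ p i * (B * l ^+ (p i - q i) * M (p i - q i)%N * r ^+ q i)))).
    by apply: ler_prod => i _; rewrite cmod_ge0/=; case: (hq i).
  rewrite !big_split/= !prodX psum -/J -/Q prodr_const card_ord.
  by rewrite !mulrA.
have rQ : r ^+ Q <= l ^+ Q * (M Q * E (r / l)).
  have -> : r ^+ Q = l ^+ Q * (r / l) ^+ Q by rewrite -exprMn mulrC divfK// gt_eqF.
  by rewrite ler_pM2l ?exprn_gt0//; exact: assoc_ge.
have E0 : 0 < E (r / l) by exact: assoc_gt0.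
have P0 : 0 <= \prod_i M (p i - q i)%N by apply: prodr_ge0 => i _; exact: ltW.
rewrite -(ler_pM2l M0).
apply: (@le_trans _ _ (M 0%N * (2 ^+ size s * (B ^+ n * l ^+ J * (\prod_i M (p i - q i)%N) *
   (l ^+ Q * (M Q * E (r / l))))))).
  rewrite ler_pM2l// (le_trans h1)// ler_pM2l ?exprn_gt0// ler_wpM2l//.
  by do ?[exact: ltW|apply: exprn_ge0|apply: mulr_ge0].
have -> : M 0%N * (2 ^+ size s * (B ^+ n * l ^+ J * (\prod_i M (p i - q i)%N) *
   (l ^+ Q * (M Q * E (r / l))))) =
  2 ^+ size s * (l ^+ J * l ^+ Q) * B ^+ n * E (r / l) * M Q * (M 0%N * \prod_i M (p i - q i)%N) by ring.
rewrite -exprD JQ.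
apply: (@le_trans _ _ (2 ^+ size s * l ^+ size s * B ^+ n * E (r / l) * M Q * (M 0%N ^+ n * M J))).
  apply: ler_wpM2l; last exact: (weight_prod (fun i => (p i - q i)%N)).
  by do ?[exact: ltW|apply: exprn_ge0|apply: mulr_ge0].
have -> : 2 ^+ size s * l ^+ size s * B ^+ n * E (r / l) * M Q * (M 0%N ^+ n * M J) =
  (2 * l) ^+ size s * (B * M 0%N) ^+ n * E (r / l) * (M J * M Q) by rewrite !exprMn; ring.
have -> : M 0%N * ((B * M 0%N) ^+ n * E (r / l) * ((2 * l) ^+ size s * M (size s))) =
  (2 * l) ^+ size s * (B * M 0%N) ^+ n * E (r / l) * (M 0%N * M (size s)) by ring.
rewrite -JQ; apply: ler_wpM2l; last exact: weight_superM.
by do ?[exact: ltW|apply: exprn_ge0|apply: mulr_ge0].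
Qed.

End atoms.

(** * Sums over lattice points and over multi-indices *)

Section lattice_sums.
Context {R : realType} {n : nat}.

Lemma uniq_sum_le (T : eqType) (s t : seq T) (F : T -> R) : uniq s -> uniq t ->
  {subset s <= t} -> (forall x, 0 <= F x) -> \sum_(x <- s) F x <= \sum_(x <- t) F x.
Proof.
move=> us ut st F0; have p : perm_eq s [seq x <- t | x \in s].
  apply: uniq_perm => //; first exact: filter_uniq.
  move=> x; rewrite mem_filter; apply/idP/andP => [xs|[]//]; split => //; exact: st.
rewrite (perm_big _ p)/= big_filter [leRHS](bigID (fun x => x \in s))/= lerDl.
by apply: sumr_ge0.
Qed.

(** The values are encoded in a finite type, where distributivity identifies the power of a sum with
    a sum over all functions. *)
Lemma sum_prod_le (T : eqType) (t0 : T) (s : seq {ffun 'I_n -> T}) (S : seq T) (g : T -> R) :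
  uniq s -> (forall k, k \in s -> forall l, k l \in S) -> (forall x, 0 <= g x) ->
  \sum_(k <- s) \prod_l g (k l) <= (\sum_(x <- S) g x) ^+ n.
Proof.
move=> us sS g0; set J := size S.
pose phi (k : {ffun 'I_n -> T}) : {ffun 'I_n -> 'I_J.+1} := [ffun l => inord (index (k l) S)].
pose G (j : 'I_J.+1) : R := if (j < J)%N then g (nth t0 S j) else 0.
have G0 j : 0 <= G j by rewrite /G; case: ifP.
have phiE k l : k \in s -> G (phi k l) = g (k l).
  move=> /sS/(_ l) kS; rewrite /G ffunE inordK; last by rewrite ltnS index_size.
  by rewrite index_mem kS nth_index.
have uphi : uniq (map phi s).
  rewrite map_inj_in_uniq// => k k' ks ks' /ffunP E; apply/ffunP => l.
  have := E l; rewrite !ffunE => /(congr1 val); rewrite /= !inordK ?ltnS ?index_size// => h.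
  by rewrite -(nth_index t0 (sS k ks l)) -(nth_index t0 (sS k' ks' l)) h.
have -> : \sum_(k <- s) \prod_l g (k l) = \sum_(h <- map phi s) \prod_l G (h l).
  rewrite big_map; apply: eq_big_seq => k ks.
  by apply: eq_bigr => l _; rewrite phiE.
apply: (@le_trans _ _ (\sum_(h <- enum {: {ffun 'I_n -> 'I_J.+1}}) \prod_l G (h l))).
  apply: uniq_sum_le => //; first exact: enum_uniq.
    by move=> h _; rewrite mem_enum.
  by move=> h; apply: prodr_ge0.
rewrite big_enum/= -(bigA_distr_bigA (fun (_ : 'I_n) j => G j)) prodr_const card_ord.
suff -> : \sum_j G j = \sum_(x <- S) g x by [].
rewrite big_ord_recr/= {2}/G ltnn addr0 (big_nth t0) big_mkord.
by apply: eq_bigr => j _; rewrite /G /= ltn_ord.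
Qed.

(** Comparison with the telescoping terms [1 / y - 1 / (1 + y)]. *)
Let sq_sum J : \sum_(j < J) ((1 + j%:R) ^+ 2)^-1 <= 2 :> R.
Proof.
case: J => [|J]; first by rewrite big_ord0.
suff : \sum_(j < J.+1) ((1 + j%:R) ^+ 2)^-1 <= 2 - (1 + J%:R)^-1 :> R.
  by move=> /le_trans; apply; rewrite gerBl invr_ge0 addr_ge0.
elim: J => [|J IH]; first by rewrite big_ord1 addr0 expr1n invr1; lra.
rewrite big_ord_recr/= -[J.+1%:R]natr1; set y : R := 1 + J%:R in IH *.
have y1 : 1 <= y by rewrite lerDl.
have -> : 1 + (J%:R + 1) = 1 + y by rewrite /y; ring.
suff : (((1 + y) ^+ 2)^-1 : R) <= y^-1 - (1 + y)^-1 by move: IH; lra.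
have -> : y^-1 - (1 + y)^-1 = (y * (1 + y))^-1 by field; rewrite !gt_eqF//; lra.
by rewrite lef_pV2 ?posrE ?exprn_gt0 ?mulr_gt0 //; try lra; rewrite expr2 ler_pM2r; lra.
Qed.

Definition lattice_weight (k : {ffun 'I_n -> int}) : R := \prod_l ((1 + `|k l|%:R) ^+ 2)^-1.

Lemma lattice_weight_ge0 k : 0 <= lattice_weight k.
Proof. by apply: prodr_ge0 => l _; rewrite invr_ge0 exprn_ge0// addr_ge0. Qed.

(** Each coordinate contributes at most 2 for the nonnegative integers and 2 for the negative
    ones. *)
Lemma lattice_weight_sum (s : seq {ffun 'I_n -> int}) : uniq s ->
  \sum_(k <- s) lattice_weight k <= 4 ^+ n.
Proof.
move=> us; have [J hJ] : exists J : nat, forall k, k \in s -> forall l, (`|k l| < J)%N.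
  exists (\sum_(k <- s) \sum_l `|k l|%N).+1 => k ks l.
  by rewrite ltnS (big_rem _ ks)/= (bigD1 l)//= -addnA leq_addr.
pose S := [seq Posz j | j <- iota 0 J] ++ [seq Negz j | j <- iota 0 J].
pose g (x : int) : R := ((1 + `|x|%:R) ^+ 2)^-1.
have g0 x : 0 <= g x by rewrite invr_ge0 exprn_ge0// addr_ge0.
apply: le_trans (sum_prod_le 0 (S := S) us _ g0) _.
  move=> k ks l; have := hJ k ks l.
  rewrite mem_cat; case: (k l) => j; rewrite ?absz_nat => jJ; apply/orP; [left|right];
    apply/mapP; exists j; rewrite // mem_iota add0n//.
  by apply: leq_trans jJ; rewrite NegzE abszN absz_nat.
rewrite lerXn2r ?nnegrE//; first by apply: sumr_ge0.
have iE : iota 0 J = index_iota 0 J by rewrite /index_iota subn0.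
rewrite big_cat !big_map iE !big_mkord.
have h1 : \sum_(j < J) g (Posz j) <= 2 by exact: sq_sum.
have h2 : \sum_(j < J) g (Negz j) <= 2.
  apply: le_trans (sq_sum J); apply: ler_sum => j _.
  rewrite /g NegzE abszN absz_nat lef_pV2 ?posrE ?exprn_gt0 ?ltr_wpDr//.
  by rewrite lerXn2r ?nnegrE ?addr_ge0// lerD2l ler_nat.
rewrite (_ : 4 = 2 + 2); last by ring.
exact: lerD h1 h2.
Qed.

Lemma geometric_weight_sum (s : seq (multi_index n)) : uniq s ->
  \sum_(a <- s) 2^-1 ^+ mi_size a <= 2 ^+ n :> R.
Proof.
move=> us; have [J hJ] : exists J : nat, forall k, k \in s -> forall l, (k l < J)%N.
  exists (\sum_(k <- s) mi_size k).+1 => k ks l.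
  by rewrite ltnS (big_rem _ ks)/= /mi_size (bigD1 l)//= -addnA leq_addr.
have g0 (x : nat) : 0 <= (2^-1 : R) ^+ x by rewrite exprn_ge0// invr_ge0.
have -> : \sum_(a <- s) 2^-1 ^+ mi_size a = \sum_(a <- s) \prod_l (2^-1 : R) ^+ (a l).
  by apply: eq_bigr => a _; rewrite -(big_morph _ (exprD _) (expr0 _)).
apply: le_trans (sum_prod_le 0%N (S := iota 0 J) us _ g0) _.
  by move=> k ks l; rewrite mem_iota add0n hJ.
rewrite lerXn2r ?nnegrE//; first by apply: sumr_ge0.
have iE : iota 0 J = index_iota 0 J by rewrite /index_iota subn0.
rewrite iE big_mkord.
suff -> : \sum_(i < J) (2^-1 : R) ^+ i = 2 - 2 * 2^-1 ^+ J.
  by rewrite gerBl mulr_ge0.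
elim: (J) => [|j IH]; first by rewrite big_ord0 expr0 mulr1 subrr.
rewrite big_ord_recr/= IH exprS; have : 2 * 2^-1 = 1 :> R by rewrite divff.
by move: (2^-1 ^+ j) => t; lra.
Qed.

(** The index [i0] makes the lattice infinite, so that it is enumerated by [nat] without
    repetition. *)
Lemma lattice_enum (i0 : 'I_n) : exists kap : nat -> {ffun 'I_n -> int},
  injective kap /\ forall k, exists i, kap i = k.
Proof.
have inf : infinite_set [set: {ffun 'I_n -> int}].
  move=> /finite_seqP[s hs].
  pose iot (j : nat) : {ffun 'I_n -> int} := [ffun=> Posz j].
  have : (size (map iot (iota 0 (size s).+1)) <= size s)%N.
    apply: uniq_leq_size.
      rewrite map_inj_uniq ?iota_uniq// => i j /ffunP/(_ i0).
      by rewrite !ffunE => -[].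
    move=> x _; have : [set: {ffun 'I_n -> int}] x by [].
    by rewrite hs.
  by rewrite size_map size_iota ltnn.
have /card_set_bijP[g [_ gI gS]] := eq_card_nat (countableP [set: {ffun 'I_n -> int}]) inf.
have ex (j : nat) : exists k, g k = j by have [k _ <-] := gS j Logic.I; exists k.
have [kap hkap] := choice ex.
exists kap; split=> [i j E|k]; first by rewrite -(hkap i) E hkap.
exists (g k); have := hkap (g k); apply: gI; rewrite inE; done.
Qed.

End lattice_sums.

(** * Choice of the order of integration by parts *)

Section growth_of_coefficients.
Context {R : realType} (c : ultra_class) (M : nat -> R).
Hypothesis M_gt0 : forall p, 0 < M p.
Hypothesis HM2 : M2' M.
Hypothesis HM3 : M3' M.
Local Notation E := (assoc_fun M).

Lemma pmax0 : pmax M 0 = 0%N.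
Proof.
have := assoc_ge M_gt0 HM3 0 (lexx (0 : R)); rewrite expr0 /assoc_fun.
by case: (pmax M 0) => // p; rewrite expr0n mul0r mulr0 ler10.
Qed.

(** The dilation [H] does not depend on [l], only [B] does; the choice of orders in the Roumieu case
    relies on this. *)
Lemma assoc_poly_scale (D : nat) : exists2 H : R, 1 <= H & forall l : R, 0 < l ->
  exists2 B : R, 0 < B & forall y, 0 <= y -> (1 + y) ^+ D * E (l * y) <= B * E (H * l * y).
Proof.
have [B [H [B0 H1 h]]] := assoc_polyM M_gt0 HM2 HM3 D; exists H => // l l0.
have K0 : 0 < 1 + l^-1 by rewrite addr_gt0// invr_gt0.
exists ((1 + l^-1) ^+ D * B); first by rewrite mulr_gt0// exprn_gt0.
move=> y y0; have ly0 : 0 <= l * y by rewrite mulr_ge0// ltW.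
have E0 : 0 < E (l * y) by exact: assoc_gt0.
rewrite -(mulrA H) -mulrA; apply: le_trans (_ : (1 + l^-1) ^+ D * ((1 + l * y) ^+ D * E (l * y)) <= _).
  have le1 : 1 + y <= (1 + l^-1) * (1 + l * y).
    rewrite mulrDl mul1r mulrDr mulr1 mulrA mulVf ?gt_eqF// mul1r.
    have : 0 < l^-1 by rewrite invr_gt0.
    by move: ly0; lra.
  have y1 : 0 <= 1 + y by rewrite addr_ge0.
  rewrite [leRHS]mulrA -exprMn ler_pM2r// lerXn2r// nnegrE//.
  exact: le_trans le1.
by rewrite ler_wpM2l ?h// exprn_ge0 ?(ltW K0).
Qed.

(* [p k] plays the role of the number of integrations by parts in the [k]-th
   Fourier coefficient; in the Roumieu case it must serve all [l] at once. *)
Lemma order_choice (I : Type) (r g : I -> R) (D : nat) : (forall k, 0 <= r k) ->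
  (forall k, 0 <= g k) ->
  for_class_l c (fun l => exists2 B : R, 0 < B & forall k, g k <= B * E (l * r k)) ->
  exists p : I -> nat, (forall k, r k = 0 -> p k = 0%N) /\
    for_class_l c (fun l => exists2 B : R, 0 < B & forall k,
      g k * M (p k) * (1 + r k) ^+ D <= B * (l * r k) ^+ p k).
Proof.
move=> r0 g0; have EM (y : R) : E y * M (pmax M y) = y ^+ pmax M y.
  by rewrite /assoc_fun divfK// gt_eqF.
rewrite /for_class_l; case: c => [[l l0 [B B0 h]]|h].
  have [H H1 hH] := assoc_poly_scale D; have [B' B'0 hB'] := hH l l0.
  have Hl0 : 0 < H * l by rewrite mulr_gt0// (lt_le_trans ltr01).
  (* The maximising order at the dilated radius [y], for which [E y * M p = y ^+ p]. *)
  exists (fun k => pmax M (H * l * r k)); split => [k ->|].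
    by rewrite mulr0 pmax0.
  exists (H * l) => //; exists (B * B'); first exact: mulr_gt0.
  move=> k; rewrite -EM mulrAC mulrA ler_wpM2r ?(ltW (M_gt0 _))//.
  rewrite mulrC -mulrA (@le_trans _ _ (B * ((1 + r k) ^+ D * E (l * r k))))//.
    by rewrite mulrCA ler_wpM2l// exprn_ge0// addr_ge0.
  by rewrite ler_pM2l// hB'.
have [H H1 hH] := assoc_poly_scale D.+1.
have H0 : 0 < H by rewrite (lt_le_trans ltr01).
have ex (m : nat) : exists B : R, 0 < B /\
    forall k, (1 + r k) ^+ D.+1 * g k <= B * E (r k / m.+1%:R).
  (* Scaled so that the dilation by [H] leaves the argument [r k / m.+1]. *)
  have l0 : 0 < (H * m.+1%:R)^-1 by rewrite invr_gt0 mulr_gt0.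
  have [B B0 hB] := h _ l0; have [B' B'0 hB'] := hH _ l0.
  exists (B * B'); split; first exact: mulr_gt0.
  move=> k; apply: (@le_trans _ _ (B * ((1 + r k) ^+ D.+1 * E ((H * m.+1%:R)^-1 * r k)))).
    by rewrite mulrCA ler_wpM2l// exprn_ge0// addr_ge0.
  rewrite -mulrA ler_pM2l// (le_trans (hB' _ (r0 k)))//.
  suff -> : H / (H * m.+1%:R) * r k = r k / m.+1%:R by [].
  by field; rewrite ?gt_eqF// pnatr_eq0.
have [Bm hBm] := choice ex.
(* The largest [m] up to [r k] whose constant is at most [1 + r k]: it tends to infinity with [r k],
   and the extra power in [D.+1] pays for the constant. *)
pose sel k := (\max_(m < (Num.truncn (r k)).+1 | (Bm m <= 1 + r k)%R) m)%N.
have sel_ge k m : m%:R <= r k -> Bm m <= 1 + r k -> (m <= sel k)%N.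
  move=> mr bm; have mt : (m < (Num.truncn (r k)).+1)%N by rewrite ltnS truncn_ge_nat.
  exact: (@leq_bigmax_cond _ (fun m : 'I_(Num.truncn (r k)).+1 => Bm m <= 1 + r k)
    (fun m => val m) (Ordinal mt)).
have selB k : Bm (sel k) <= (1 + Bm 0%N) * (1 + r k).
  have [B0 _] := hBm 0%N; have rk := r0 k.
  suff [->|h2] : sel k = 0%N \/ Bm (sel k) <= 1 + r k.
  - have : Bm 0%N <= Bm 0%N * (1 + r k) by rewrite ler_peMr ?(ltW B0)// lerDl.
    by rewrite mulrDl; move: rk; lra.
  - by rewrite (le_trans h2)// ler_peMl ?lerDl ?(ltW B0)// addr_ge0.
  rewrite /sel; elim/big_ind : _ => [|x y hx hy|m hm]; [by left| |by right].
  by rewrite /maxn; case: ifP.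
pose y k := r k / (sel k).+1%:R.
have y0 k : 0 <= y k by rewrite divr_ge0.
exists (fun k => pmax M (y k)); split=> [k rk|]; first by rewrite /y rk mul0r pmax0.
have A0 : 0 < 1 + Bm 0%N by rewrite addr_gt0//; case: (hBm 0%N).
have main k : g k * M (pmax M (y k)) * (1 + r k) ^+ D <= (1 + Bm 0%N) * y k ^+ pmax M (y k).
  have r1 : 0 < 1 + r k by rewrite ltr_wpDr.
  rewrite -(ler_pM2l r1) -EM.
  have -> : (1 + r k) * (g k * M (pmax M (y k)) * (1 + r k) ^+ D) =
     ((1 + r k) ^+ D.+1 * g k) * M (pmax M (y k)) by rewrite exprS; ring.
  have e0 : 0 < E (y k) by exact: assoc_gt0.
  have hb := (hBm (sel k)).2 k; rewrite -/(y k) in hb.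
  move: (E (y k)) e0 hb => e e0 hb.
  have -> : (1 + r k) * ((1 + Bm 0%N) * (e * M (pmax M (y k)))) =
     ((1 + Bm 0%N) * (1 + r k) * e) * M (pmax M (y k)) by ring.
  rewrite ler_pM2r// (le_trans hb)// ler_pM2r//; exact: selB.
(* From radius [r1] on, [sel k] is at least [m] and therefore [y k <= l * r k]; smaller radii go
   into the constant. *)
move=> l l0; pose m := (Num.truncn l^-1).+1.
have lm : l^-1 < m%:R by exact: truncnS_gt.
have [Bm0 _] := hBm m.
pose r1 := m%:R + Bm m; have r10 : 0 < r1 by rewrite ltr_wpDl.
have El : 0 < E (r1 / l) by apply: assoc_gt0 => //; rewrite divr_ge0 ?ltW.
exists ((1 + Bm 0%N) * (1 + M 0%N * E (r1 / l))).
  by rewrite mulr_gt0// addr_gt0// mulr_gt0.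
move=> k; rewrite (le_trans (main k))// -mulrA ler_pM2l//.
have rk := r0 k.
have lr0 : 0 <= (l * r k) ^+ pmax M (y k) by rewrite exprn_ge0// mulr_ge0// ltW.
have [rbig|rsmall] := leP r1 (r k).
  apply: (@le_trans _ _ ((l * r k) ^+ pmax M (y k))); last first.
    by rewrite ler_peMl// lerDl mulr_ge0// ltW.
  rewrite lerXn2r ?nnegrE ?mulr_ge0// ?(ltW l0)//.
  have ms : (m <= sel k)%N.
    apply: sel_ge; first by apply: le_trans rbig; rewrite lerDl ltW.
    apply: (@le_trans _ _ r1); first by rewrite lerDr.
    by rewrite (le_trans rbig)// lerDr.
  rewrite /y mulrC ler_wpM2r// invf_ple ?posrE//.
  by rewrite (le_trans (ltW lm))// ler_nat; exact: leqW.
(* There may be infinitely many [k] of radius below [r1], but the chosen order satisfies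
   [M p <= M 0 * r1 ^+ p], which bounds the inverse of [l ^+ p] independently of [k]. *)
apply: (@le_trans _ _ (M 0%N * E (r1 / l) * (l * r k) ^+ pmax M (y k))); last first.
  by rewrite ler_wpM2r// lerDr.
set p := pmax M (y k).
have yr : y k ^+ p <= r k ^+ p.
  by rewrite lerXn2r ?nnegrE// ler_pdivrMr// ler_peMr// ler1n.
have Mp : M p <= M 0%N * r1 ^+ p.
  have h1 : 1 <= M 0%N * E (y k) by have := assoc_ge M_gt0 HM3 0 (y0 k); rewrite expr0.
  have h2 : M p <= M 0%N * y k ^+ p by rewrite -EM mulrA ler_peMl ?(ltW (M_gt0 _)).
  rewrite (le_trans h2)// ler_pM2l// (le_trans yr)// lerXn2r ?nnegrE ?(ltW r10) ?(ltW rsmall)//.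
have aE : (r1 / l) ^+ p <= M p * E (r1 / l) by apply: assoc_ge => //; rewrite divr_ge0 ?ltW.
apply: (le_trans yr); move: (E (r1 / l)) El aE => e e0 aE.
have lp : (l ^+ p)^-1 <= M 0%N * e.
  rewrite -(ler_pM2l (exprn_gt0 p r10)) -exprVn -exprMn (le_trans aE)//.
  by rewrite mulrCA mulrA ler_pM2r.
have -> : r k ^+ p = (l ^+ p)^-1 * (l * r k) ^+ p.
  by rewrite exprMn mulrA mulVf ?mul1r// expf_neq0// gt_eqF.
by rewrite ler_wpM2r.
Qed.

End growth_of_coefficients.

Section translated_atoms.
Context {R : realType} {n : nat} (c : ultra_class) (M : nat -> R).
Hypothesis M_gt0 : forall p, 0 < M p.
Hypothesis HM1 : M1 M.
Hypothesis HM2 : M2' M.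
Hypothesis HM3 : M3' M.
Local Notation C := R[i].
Local Notation Rn := 'rV[R]_n.
Local Notation Zn := {ffun 'I_n -> int}.
Local Notation E := (assoc_fun M).
Variables (b : R) (Phi : nat -> R -> R).
Hypothesis step : smooth_step M b Phi.
Variables (i0 : 'I_n) (N : nat).
Hypothesis N_gt0 : (0 < N)%N.
Variables (f : (Rn -> C^o) -> C^o) (W : set Rn) (omega : Rn -> R).
Hypothesis f_ultra : lcs_carrier (ultradistributions c M setT) f.
Hypothesis omega_gt0 : forall x, 0 < omega x.
Hypothesis f_bigO : translate_bigO c M f W omega.
Local Notation rho := (fradius (R := R) i0 N).

(** Violations of the estimate at [h i] and [k i] with constants tending to infinity are collected
    into one family of atoms divided by [E (s i * rho (k i))]; its bounds are uniform, and the
    boundedness of its translates is contradicted. *)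
Let escape (m : R) (s : nat -> R) (h : nat -> Rn) (k : nat -> Zn) : 0 <= m ->
  (forall i, 0 <= s i) -> (forall i, W (h i)) ->
  (forall i, i.+1%:R * omega (h i) * E (s i * rho (k i)) <
     cmod (f (fun x => atom b Phi N m (k i) [::] (x - h i)))) ->
  for_class_d c (fun l => exists A, forall i, E (rho (k i) / (l / 2)) <= A * E (s i * rho (k i))) ->
  False.
Proof.
move=> m0 s0 Wh hbig hE.
have e0 i : 0 < E (s i * rho (k i)) by apply: assoc_gt0 => //; rewrite mulr_ge0// fradius_ge0.
pose D i sq x := ((E (s i * rho (k i)))^-1)%:C%C * atom b Phi N m (k i) sq x.
have jA i := cjet_atom step N m (k i).
have [|i x nx||B hB] := translate_bounded_family M_gt0 f_ultra omega_gt0 f_bigO (m := m + b + 1) (D := D).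
- by move=> i; apply: cjetZ; exact: jA.
- by rewrite /D (atom_eq0 step N)// mulr0.
- apply: for_class_d_sub hE => l l0 [A hA].
  have l2 : 0 < l / 2 by rewrite divr_gt0.
  have l2E : 2 * (l / 2) = l by rewrite mulrC divfK.
  have [B B0 hB] := atom_jbound M_gt0 HM1 HM3 step i0 N m l2; rewrite l2E in hB.
  exists (B * A) => i; have := jboundZ ((E (s i * rho (k i)))^-1)%:C%C (hB (k i)).
  apply: jbound_le => //; first exact: ltW.
  rewrite cmod_real gtr0_norm ?invr_gt0// mulrCA ler_pM2l// ler_pdivrMl//.
  by rewrite [leRHS]mulrC.
pose i := Num.truncn B.
have := hB (h i) i (Wh i); apply/negP; rewrite -ltNge.
have /(functionalP c M_gt0)[lin _] := f_ultra.
have -> : f (fun x => D i [::] (x - h i)) = ((E (s i * rho (k i)))^-1)%:C%C *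
    f (fun x => atom b Phi N m (k i) [::] (x - h i)).
  rewrite -(linear_on_testsZ M_gt0 _ lin)//.
  apply/(test_spaceP c M_gt0); exists (box ((m + b + 1) + abs_sum (- h i))); split => //.
    exact: box_compact.
  apply: (test_in_jet (cjet_shift (- h i) (jA i))).
    by move=> x nx; apply: (atom_eq0 step N) => // bx; apply: nx; exact: box_shift bx.
  have P l : 0 < l -> exists A, jbound M (fun sq x => atom b Phi N m (k i) sq (x - h i)) l A.
    move=> l0; have l2 : 0 < l / 2 by rewrite divr_gt0.
    have l2E : 2 * (l / 2) = l by rewrite mulrC divfK.
    have [B' B'0 hB'] := atom_jbound M_gt0 HM1 HM3 step i0 N m l2; rewrite l2E in hB'.
    exists (B' * E (rho (k i) / (l / 2))); exact: jbound_shift.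
  rewrite /for_class_d; case: (c) => [l l0|]; first exact: P.
  by exists 1 => //; exact: P.
rewrite cmodM cmod_real gtr0_norm ?invr_gt0// ltr_pdivlMl//.
apply: le_lt_trans (hbig i); rewrite [leRHS]mulrC ler_pM2l// ler_pM2r// ltW//.
exact: truncnS_gt.
Qed.

Lemma translated_atoms (m : R) : 0 <= m ->
  for_class_l c (fun l => exists2 B : R, 0 < B & forall h k, W h ->
    cmod (f (fun x => atom b Phi N m k [::] (x - h))) <= B * omega h * E (l * rho k)).
Proof.
move=> m0.
have pick (s : nat -> R) : (forall i, 0 <= s i) ->
    (forall i, ~ forall h k, W h -> cmod (f (fun x => atom b Phi N m k [::] (x - h))) <=
       i.+1%:R * omega h * E (s i * rho k)) ->
    ~ for_class_d c (fun l => exists A, forall (k : nat -> Zn) i,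
        E (rho (k i) / (l / 2)) <= A k * E (s i * rho (k i))).
  move=> s0 hn hd.
  have ex i : exists hk : Rn * Zn, W hk.1 /\ i.+1%:R * omega hk.1 * E (s i * rho hk.2) <
      cmod (f (fun x => atom b Phi N m hk.2 [::] (x - hk.1))).
    have /existsNP[h /existsNP[k /not_implyP[Wh /negP]]] := hn i.
    by rewrite -ltNge => hlt; exists (h, k).
  have [hk Hhk] := choice ex.
  apply: (@escape m s (fun i => (hk i).1) (fun i => (hk i).2)) => //.
  - by move=> i; case: (Hhk i).
  - by move=> i; case: (Hhk i).
  by apply: for_class_d_sub hd => l l0 [A hA]; exists (A (fun i => (hk i).2)) => i; exact: (hA (fun i => (hk i).2)).
apply: contrapT; rewrite /for_class_l /for_class_d in pick *; case: (c) pick => pick hn.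
  (* Beurling case: every [l] fails, in particular [l = i + 1] with constant [i + 1]. *)
  apply: (pick (fun i => i.+1%:R)) => // [i hi|l l0].
    by apply: hn; exists i.+1%:R => //; exists i.+1%:R.
  pose T := Num.truncn (2 / l).
  pose q (k : nat -> Zn) i := E (rho (k i) / (l / 2)) / E (i.+1%:R * rho (k i)).
  have e0 (k : Zn) (s : R) : 0 <= s -> 0 < E (s * rho k).
    by move=> s0; apply: assoc_gt0 => //; rewrite mulr_ge0// fradius_ge0.
  have lE (k : Zn) : rho k / (l / 2) = (2 / l) * rho k by field; rewrite gt_eqF.
  have q0 k i : 0 <= q k i.
    by rewrite divr_ge0// ?lE ltW// e0// divr_ge0// ltW.
  (* Only for the finitely many [i < T] can the quotient exceed 1; their sum is added to the
     constant. *)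
  exists (fun k => 1 + \sum_(i < T) q k i) => k i.
  rewrite -ler_pdivrMr ?e0// -/(q k i).
  have [iT|Ti] := ltnP i T.
    rewrite (bigD1 (Ordinal iT))//= addrCA lerDl addr_ge0// sumr_ge0//.
  apply: (@le_trans _ _ 1); last by rewrite lerDl sumr_ge0.
  have l2 : 0 <= 2 / l by rewrite divr_ge0// ltW.
  have li : 2 / l <= i.+1%:R.
    by apply: ltW; apply: lt_le_trans (truncnS_gt _) _; rewrite ler_nat ltnS.
  rewrite ler_pdivrMr ?e0// mul1r lE; apply: assoc_le => //.
    by rewrite mulr_ge0 ?fradius_ge0.
  by rewrite ler_wpM2r ?fradius_ge0.
(* Roumieu case: a single [l] fails for all constants, and the class parameter [2 / l] matches it
   exactly. *)
move: hn => /existsNP[l /not_implyP[l0 hn]].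
apply: (pick (fun=> l)) => // [i|i hi|].
- exact: ltW.
- by apply: hn; exists i.+1%:R.
exists (2 / l); first by rewrite divr_gt0.
exists (fun=> 1) => k i; rewrite mul1r.
suff -> : rho (k i) / (2 / l / 2) = l * rho (k i) by [].
by field; rewrite gt_eqF.
Qed.

(** The power [2 * n] leaves an inverse square for each of the [n] coordinates, which is summable
    over the integers. *)
Definition lattice_decay (k : Zn) : R := ((1 + rho k) ^+ (n * 2))^-1.

Lemma lattice_decay_le k : lattice_decay k <= (N%:R ^+ 2) ^+ n * lattice_weight k.
Proof.
have r0 : 0 <= rho k by exact: fradius_ge0.
have N1 : 1 <= N%:R :> R by rewrite ler1n.
have NR : 0 < N%:R :> R by rewrite ltr0n.
have r1 : 0 < 1 + rho k by rewrite ltr_wpDr.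
have -> : lattice_decay k = \prod_(l < n) ((1 + rho k) ^+ 2)^-1.
  by rewrite prodr_const card_ord /lattice_decay mulnC exprM exprVn.
rewrite -[X in _ <= _ ^+ X * _](card_ord n) -prodr_const /lattice_weight -big_split/=.
apply: ler_prod => l _; rewrite invr_ge0 exprn_ge0 ?(ltW r1)//=.
have kl : `|k l|%:R <= N%:R * rho k.
  have := freq_le (R := R) i0 N k l; rewrite /freq normrM normfV (gtr0_norm NR) ler_pdivrMr//.
  by rewrite [leRHS]mulrC -intr_norm -abszE.
have k1 : 0 < 1 + `|k l|%:R :> R by rewrite ltr_wpDr.
rewrite -[X in X <= _]mul1r ler_pdivrMr ?exprn_gt0// mulrAC ler_pdivlMr ?exprn_gt0//.
rewrite mul1r -exprMn lerXn2r ?nnegrE ?(ltW k1)// ?mulr_ge0 ?(ltW NR) ?(ltW r1)//.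
by rewrite mulrDr mulr1; apply: lerD.
Qed.

Lemma lattice_decay_summ (kap : nat -> Zn) : injective kap ->
  summ (fun i => lattice_decay (kap i)).
Proof.
move=> kI; apply: (@le_summ _ _ (fun i => (N%:R ^+ 2) ^+ n * lattice_weight (kap i))).
  apply: summZ; first by rewrite !exprn_ge0.
  split=> [i|]; first exact: lattice_weight_ge0.
  exists (4 ^+ n) => j; rewrite -(big_mkord xpredT (fun i => lattice_weight (kap i))).
  rewrite /index_iota subn0 -(big_map kap xpredT (fun k => lattice_weight k)).
  by apply: lattice_weight_sum; rewrite map_inj_uniq ?iota_uniq.
move=> i; rewrite lattice_decay_le andbT invr_ge0 exprn_ge0// addr_ge0// fradius_ge0//.
Qed.

End translated_atoms.

(** * Sufficiency *)

Section compact_boxes.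
Context {R : realType} {n : nat}.
Local Notation Rn := 'rV[R]_n.

Lemma compact_sub_box (K : set Rn) : compact K -> exists2 m : R, 0 < m & K `<=` box m.
Proof.
move=> /compact_bounded[m [_ hm]]; exists (`|m| + 1); first by rewrite ltr_wpDl.
move=> x Kx i; have : `|x| <= `|m| + 1.
  by apply: hm => //; rewrite (le_lt_trans (ler_norm m))// ltrDl.
apply: le_trans; rewrite /Num.norm/= mx_normrE.
exact: (@le_bigmax _ _ _ 0 (fun ij => `|x ij.1 ij.2|) (0, i)).
Qed.

End compact_boxes.

Section omega_translation.
Context {R : realType} {n : nat}.
Local Notation Rn := 'rV[R]_n.
Local Notation row := (@row_of_tuple R n).
Variable omega : Rn -> R.
Hypothesis omega_gt0 : forall x, 0 < omega x.
Hypothesis omega_sup : Linfty_loc (fun y : Rn =>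
  ereal_sup [set (omega (y + x) / omega x)%:E | x in [set: Rn]]).

(* The bound only holds almost everywhere, so [y] is written as a sum of two
   points where it does. *)
Lemma omega_translate (m : R) : 0 < m -> exists2 B : R, 0 < B &
  forall x y : Rn, box m y -> omega (y + x) <= B * omega x.
Proof.
(* The doubled box contains [y - t] for [y] and [t] in the box [m]. *)
move=> m0; have [_ /(_ (box (m + m)) (@box_compact R n _))[B [A [mA A0 hA]]]] := omega_sup.
have good t : ~ A t -> box (m + m) (row t) -> forall x, omega (row t + x) <= B * omega x.
  move=> nA bt x; rewrite -ler_pdivrMr// -lee_fin.
  have : (`|ereal_sup [set (omega (row t + x) / omega x)%:E | x in [set: Rn]]| <= B%:E)%E.
    by apply: contrapT => h; apply: nA; apply: hA => h'; apply: h; exact: h'.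
  apply: le_trans; apply: le_trans (lee_abs _); apply: ereal_sup_ubound.
  by exists x.
have mm : m <= m + m by rewrite lerDl ltW.
(* This is [y - t], so that [y + x] is the sum of [y - t] and [t + x]. *)
pose S (y : Rn) := @affine_tuple R true (fun i => if insub i is Some j then y 0 j else 0) n.
have rowS y t : row (S y t) = y - row t.
  apply/rowP => i; rewrite !mxE tnth_mktuple /affine1 expr1 mulN1r [LHS]addrC.
  by congr (_ + _); rewrite insubT// => ilt; congr (y 0 _); exact/val_inj.
have mBox := measurable_box (R := R) (n := n) m.
have key (y : Rn) : box m y -> exists t, [/\ box m (row t), ~ A t & ~ A (S y t)].
  move=> by_; apply: contrapT => h.
  have mS : measurable (S y @^-1` A).
    by rewrite -[X in measurable X]setTI; exact: measurable_affine_tuple.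
  (* If no suitable [t] existed, two null sets would cover a box of positive volume. *)
  have sub : row @^-1` box m `<=` A `|` S y @^-1` A.
    move=> t bt; apply: contrapT => /not_orP[h1 h2]; apply: h.
    by exists t; split.
  have le0 : (lebesgue_tuple n (row @^-1` box m) <= 0)%E.
    apply: le_trans (le_measure (lebesgue_tuple n) _ _ sub) _; rewrite ?inE//.
      exact: measurableU.
    apply: le_trans (measureU2 _ mA mS) _.
    have E0 : (lebesgue_tuple n (S y @^-1` A) = 0 :> \bar R)%E.
      by rewrite -[RHS]A0; exact: lebesgue_affine_tuple.
    by rewrite (_ : (_ + _ = 0)%E)// [X in (X + _)%E]A0 [X in (_ + X)%E]E0 adde0.
  have := @vol_gt0 R n m m0; apply/negP; rewrite -leNgt /vol /Rint.
  have E : (fun t => \1_(box m) (row t)) = \1_(row @^-1` box m) :> (_ -> R).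
    by apply/funext => t; rewrite !indicE.
  rewrite E /Rintegral integral_indic// setIT.
  by apply: fine_le0; exact: le0.
have B0 : 0 < B.
  have [t [bt nA _]] := key 0 (fun i => ltac:(rewrite mxE normr0; exact: ltW)).
  have := good t nA (sub_box mm bt) 0 => h; rewrite -(pmulr_lgt0 _ (omega_gt0 0)).
  exact: lt_le_trans h.
exists (B * B); first exact: mulr_gt0.
move=> x y by_; have [t [bt nA nS]] := key y by_.
have := good (S y t) nS; rewrite rowS => /(_ _ (row t + x)) h1.
rewrite addrA subrK in h1; apply: le_trans (h1 _) _.
  move=> i; rewrite !mxE (le_trans (ler_normB _ _))//.
  by apply: lerD; [exact: by_|have := bt i; rewrite mxE].
by rewrite -mulrA ler_pM2l//; apply: good => //; exact: sub_box bt.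
Qed.

End omega_translation.

(** * Derivatives of continuous functions as ultradistributions *)

Section derivatives_of_functions.
Context {R : realType} {n : nat}.
Local Notation C := R[i].
Local Notation Rn := 'rV[R]_n.
Local Notation row := (@row_of_tuple R n).
Local Notation cI := (@integral_Rn R n setT).

Lemma continuous_Re_Im (T : topologicalType) (F : T -> C^o) (x : T) : {for x, continuous F} ->
  {for x, continuous (fun y => complex.Re (F y))} /\
  {for x, continuous (fun y => complex.Im (F y))}.
Proof.
move=> cF; have h (e : R) : 0 < e -> \forall y \near x, cmod (F x - F y) <= e.
  move=> e0; have e0C : (0 : C) < e%:C%C by rewrite ltcR.
  move/cvgrPdist_le/(_ _ e0C) : (cF); apply: filterS => y /=.
  by rewrite cmodE lecR.
split; apply/cvgrPdist_le => e /h; apply: filterS => y hy.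
  by rewrite -cReN -cReD (le_trans (Re_le_cmod _)).
by rewrite -cImN -cImD (le_trans (Im_le_cmod _)).
Qed.

Let meas_restrict (Om K : set Rn) (g : Rn -> R) : open Om -> closed K -> K `<=` Om ->
  {in Om, continuous g} -> meas (fun x => if x \in K then g x else 0).
Proof.
move=> oO cK KO cg; have mK := measurable_row_closed cK.
have mO := measurable_row_open oO.
have := measurable_row_within oO cg.
move/(measurable_funS mO (preimage_subset KO)).
move/(measurable_restrictT _ mK); apply: eq_measurable_fun => t _.
by rewrite patchE /=; congr (if _ then _ else _); apply/idP/idP; rewrite !inE.
Qed.

(** As [F] is continuous on [Om] only, measurability is obtained for its truncation to [K], which
    has the same product with a function vanishing off [K]. *)
Lemma cbs_integrand (Om K : set Rn) (m BF B : R) (F psi : Rn -> C^o) :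
  open Om -> {within Om, continuous F} -> closed K -> K `<=` Om -> K `<=` box m ->
  0 <= BF -> (forall x, K x -> cmod (F x) <= BF) ->
  ccont psi -> (forall x, ~ K x -> psi x = 0) -> (forall x, cmod (psi x) <= B) ->
  cbs m (B * BF) (fun x => F x * psi x) /\
  integral_Rn Om (fun x => F x * psi x) = cI (fun x => F x * psi x).
Proof.
move=> oO cF cK KO Km BF0 FB cpsi psi0 psiB.
have {}cF : {in Om, continuous F} by rewrite -continuous_open_subspace.
split; last first.
  by apply: integral_Rn_supp => x nOx; rewrite psi0 ?mulr0// => /KO.
have bp : cbs m B psi by apply: cbs_cont => // x nx; apply: psi0 => /Km.
pose G x : C := if x \in K then F x else 0.
have -> : (fun x => F x * psi x) = fun x => psi x * G x.
  apply/funext => x; rewrite /G mulrC; case: ifPn => // /negP; rewrite inE => nK.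
  by rewrite psi0// !mul0r.
apply: (cbsM bp).
- have h : {in Om, continuous (fun y => complex.Re (F y))}.
    by move=> x Ox; have [] := continuous_Re_Im (cF x Ox).
  have := meas_restrict oO cK KO h; congr (meas _); apply/funext => x.
  by rewrite /G; case: ifP.
- have h : {in Om, continuous (fun y => complex.Im (F y))}.
    by move=> x Ox; have [] := continuous_Re_Im (cF x Ox).
  have := meas_restrict oO cK KO h; congr (meas _); apply/funext => x.
  by rewrite /G; case: ifP.
- by move=> x; rewrite /G; case: ifPn => [|_]; rewrite ?cmod0// inE; exact: FB.
Qed.

Lemma ultra_derivative_functional (c : ultra_class) (M : nat -> R) (Om : set Rn)
    (a : multi_index n) (F : Rn -> C^o) : (forall p, 0 < M p) -> open Om ->
  {within Om, continuous F} ->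
  (forall m, exists B, forall x, Om x -> box m x -> cmod (F x) <= B) ->
  lcs_carrier (ultradistributions c M Om) (ultra_derivative Om a F).
Proof.
move=> M_gt0 oO cF FB; apply/(functionalP c M_gt0).
have data K : compact K -> K `<=` Om -> exists m BF, forall phi A,
    smooth phi -> supported_in K phi -> (forall x, cmod (mi_partial a phi x) <= A) ->
    cbs m (A * BF) (fun x => F x * mi_partial a phi x) /\
    integral_Rn Om (fun x => F x * mi_partial a phi x : C) = cI (fun x => F x * mi_partial a phi x).
  move=> cK KO; have [m m0 Km] := compact_sub_box cK; have [B hB] := FB m.
  exists m, `|B| => phi A sm sK b; apply: (cbs_integrand (K := K)) => //.
  - exact: compact_closed.
  - by move=> x Kx; rewrite (le_trans (hB _ (KO _ Kx) (Km _ Kx)))// ler_norm.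
  - by have [+ _] := smooth_cjet sm (mi_seq a).
  - move=> x nK; rewrite mi_partialE; apply: partial_eq0 nK => //; exact: compact_closed.
have bd phi : (exists l A, tbound M phi l A) -> exists A, forall x, cmod (mi_partial a phi x) <= A.
  by move=> [l [A hA]]; exists (A * (l ^+ mi_size a * M (mi_size a))) => x; exact: hA.
have test_bd (K : set Rn) (phi : Rn -> C^o) : test_in c M K phi -> exists l A, tbound M phi l A.
  move=> [_ _]; rewrite /for_class_d; case: (c); last by move=> [l _ [A h]]; exists l, A.
  by move=> /(_ 1 ltr01)[A h]; exists 1, A.
split.
  move=> z x y /(test_spaceP c M_gt0)[K [cK KO hx]] /(test_spaceP c M_gt0)[K' [cK' KO' hy]].
  have cKK : compact (K `|` K') by exact: compactU.
  have KKO : K `|` K' `<=` Om by move=> t [/KO|/KO'].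
  have clKK := compact_closed (@norm_hausdorff _ _) cKK.
  have hx' : test_in c M (K `|` K') x by apply: test_in_subset hx => t; left.
  have hy' : test_in c M (K `|` K') y by apply: test_in_subset hy => t; right.
  have hz := test_in_lin M_gt0 z 1 clKK hx' hy'.
  rewrite scale1r in hz.
  have [m [BF hD]] := data _ cKK KKO.
  have [sx kx _] := hx'; have [sy ky _] := hy'; have [sz kz _] := hz.
  have [Ax bx] := bd _ (test_bd _ _ hx'); have [Ay b_y] := bd _ (test_bd _ _ hy').
  have [Az bz] := bd _ (test_bd _ _ hz).
  have [cx ix] := hD _ _ sx kx bx; have [cy iy] := hD _ _ sy ky b_y.
  have [_ iz] := hD _ _ sz kz bz.
  rewrite /ultra_derivative ix iy iz mulrCA -mulrDr -(cIZ z cx) -(cID (cbsZ z cx) cy).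
  congr (_ * cI _); apply/funext => t.
  have := partial_lin z 1 (mi_seq a) sx sy; rewrite scale1r => /(congr1 (@^~ t)).
  by rewrite -!mi_partialE => ->; ring.
move=> K cK KO; have [m [BF hD]] := data K cK KO.
have h l : 0 < l -> exists2 B : R, 0 < B &
    forall phi A, test_in c M K phi -> 0 < A -> tbound M phi l A ->
    cmod (ultra_derivative Om a F phi) <= B * A.
  move=> l0; have w0 : 0 < l ^+ mi_size a * M (mi_size a) by rewrite mulr_gt0 ?exprn_gt0.
  pose Q := 2 * vol (n := n) m * (l ^+ mi_size a * M (mi_size a)) * BF.
  exists (`|Q| + 1); first by rewrite ltr_wpDl.
  move=> phi A [sm sK _] A0 b.
  have [cb ib] := hD phi (A * (l ^+ mi_size a * M (mi_size a))) sm sK (b a).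
  rewrite /ultra_derivative ib cmodM.
  have -> : cmod ((-1) ^+ mi_size a : C) = 1 by rewrite cmodX cmodN cmod1 expr1n.
  rewrite mul1r (le_trans (cI_bound cb))//.
  have -> : 2 * vol (n := n) m * (A * (l ^+ mi_size a * M (mi_size a)) * BF) = Q * A by rewrite /Q; ring.
  by rewrite ler_pM2r// (le_trans (ler_norm Q))// lerDl.
by rewrite /for_class_l; case: (c) h => h; [exists 1 => //; exact: h|exact: h].
Qed.

End derivatives_of_functions.

Section open_neighborhoods.
Context {R : realType} {n : nat}.
Local Notation Rn := 'rV[R]_n.

Lemma coord_le_eucl_norm (x : Rn) i : `|x 0 i| <= eucl_norm x.
Proof.
rewrite /eucl_norm -sqrtr_sqr ler_wsqrtr// (bigD1 i)//= lerDl.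
by apply: sumr_ge0 => j _; exact: sqr_ge0.
Qed.

Lemma eucl_norm_lt (x : Rn) (m r : R) : 0 < m -> n%:R * m ^+ 2 < r ^+ 2 -> 0 < r ->
  box m x -> eucl_norm x < r.
Proof.
move=> m0 mr r0 bx; rewrite /eucl_norm.
have -> : r = Num.sqrt (r ^+ 2) by rewrite sqrtr_sqr gtr0_norm.
rewrite ltr_sqrt ?exprn_gt0//; apply: le_lt_trans mr.
apply: (@le_trans _ _ (\sum_(i < n) m ^+ 2)); last first.
  by rewrite sumr_const card_ord mulr_natl.
by apply: ler_sum => i _; rewrite -real_normK ?num_real// lerXn2r ?nnegrE// ltW.
Qed.

Lemma eucl_continuous : continuous (eucl_norm : Rn -> R).
Proof.
move=> x; apply: (@continuous_comp _ _ _ (fun x : Rn => \sum_(i < n) x 0 i ^+ 2) Num.sqrt);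
  last exact: sqrt_continuous.
have h (r : seq 'I_n) (T : topologicalType) (g : 'I_n -> T -> R) :
    (forall i, continuous (g i)) -> continuous (fun z => \sum_(i <- r) g i z ^+ 2).
  move=> hg; elim: r => [|i r IH].
    by under eq_fun do rewrite big_nil; move=> z; exact: cvg_cst.
  under eq_fun do rewrite big_cons; move=> z; apply: cvgD; last exact: IH.
  exact: (continuous_comp (hg i z) (@exprn_continuous _ 2 _)).
by apply: h => i; exact: coord_continuous.
Qed.

Lemma nbhd_of_open (W : set Rn) (r : R) : open (nbhd_of W r).
Proof.
have -> : nbhd_of W r = \bigcup_(w in W) ((fun x : Rn => eucl_norm (x - w)) @^-1` [set t : R | t < r]).
  apply/seteqP; split=> x.
    by move=> [w Ww [y yr <-]]; exists w => //=; rewrite addrC addKr.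
  by move=> [w Ww /= h]; exists w => //; exists (x - w) => //; rewrite addrC subrK.
apply: bigcup_open => w Ww; apply: open_comp; last exact: open_lt.
move=> x _; apply: (@continuous_comp _ _ _ (fun x : Rn => x - w) (eucl_norm : Rn -> R)).
  exact: (@continuous_addr R Rn (- w)).
exact: eucl_continuous.
Qed.

End open_neighborhoods.

Section unconditional_sums.
Context {R : realType}.

Lemma partial_sum_seq (V : zmodType) (I : choiceType) (x : I -> V) (A : {fset I}) :
  exists s : seq I, [/\ uniq s, forall i, (i \in s) = (i \in A) &
    summability.partial_sum x A = \sum_(i <- s) x i].
Proof.
exists [seq val i | i : A]; split.
- by rewrite map_inj_uniq ?enum_uniq//; exact: val_inj.
- move=> i; apply/mapP/idP => [[j _ ->]|iA]; first exact: valP.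
  by exists (FSetSub iA); rewrite ?mem_enum.
- by rewrite /summability.partial_sum big_map big_enum.
Qed.

Lemma sum_functions (T : Type) (V : zmodType) (I : Type) (s : seq I) (u : I -> T -> V) x :
  (\sum_(i <- s) u i) x = \sum_(i <- s) u i x.
Proof.
by elim: s => [|i s IH]; rewrite ?big_nil// !big_cons fctE IH.
Qed.

End unconditional_sums.

Section class_parameters.
Context {R : realType} (c : ultra_class).

(** The class decides which of the two parameters is given and which is free; the free one is
    adjusted. Prescribing the product makes the terms of a series geometric. *)
Lemma for_class_prod (q : R) (P Q : R -> Prop) : 0 < q -> for_class_l c P -> for_class_d c Q ->
  exists l l', [/\ 0 < l, 0 < l', l * l' = q & P l /\ Q l'].
Proof.
rewrite /for_class_l /for_class_d; case: c => q0.
  move=> [l l0 Pl] hQ; have ql : 0 < q / l by rewrite divr_gt0.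
  exists l, (q / l); split => //; first by rewrite mulrC divfK ?gt_eqF.
  by split=> //; exact: hQ.
move=> hP [l l0 Ql]; have ql : 0 < q / l by rewrite divr_gt0.
exists (q / l), l; split => //; first by rewrite divfK ?gt_eqF.
by split=> //; exact: hP.
Qed.

End class_parameters.

Section translates_of_tests.
Context {R : realType} {n : nat} (c : ultra_class) (M : nat -> R).
Hypothesis M_gt0 : forall p, 0 < M p.
Local Notation C := R[i].
Local Notation Rn := 'rV[R]_n.

Lemma partial_shift (phi : Rn -> C^o) s (h : Rn) : smooth phi ->
  partial_jet (fun x => phi (x + h)) s = fun x => partial_jet phi s (x + h).
Proof.
move=> /smooth_cjet/(cjet_shift h)/(cjet_partial s) <-; congr (partial_jet _ s).
by apply/funext => x; rewrite partial_jet_nil.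
Qed.

Lemma smooth_shift (phi : Rn -> C^o) (h : Rn) : smooth phi -> smooth (fun x => phi (x + h)).
Proof.
move=> /smooth_cjet/(cjet_shift h)/cjet_smooth; congr (smooth _).
by apply/funext => x; rewrite partial_jet_nil.
Qed.

Definition translate_set (K : set Rn) (h : Rn) : set Rn := (fun x => x + h) @` K.

Lemma translate_set_compact K h : compact K -> compact (translate_set K h).
Proof.
move=> cK; apply: continuous_compact => //.
by apply: continuous_subspaceT; exact: (@continuous_addr R Rn h).
Qed.

Lemma translate_setP K h (x : Rn) : translate_set K h x <-> K (x - h).
Proof.
split=> [[y Ky <-]|Kx]; first by rewrite addrK.
by exists (x - h) => //; rewrite subrK.
Qed.

Lemma test_in_shift K (phi : Rn -> C^o) (h : Rn) : compact K -> test_in c M K phi ->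
  test_in c M (translate_set K h) (fun x => phi (x - h)).
Proof.
move=> cK [sm sK hb]; split; first exact: smooth_shift.
  apply: eq0_supported_in => [|x nx].
    by apply: compact_closed; [exact: norm_hausdorff|exact: translate_set_compact].
  by apply: (supported_in_eq0 sK) => /translate_setP.
apply: for_class_d_sub hb => l l0 [A b]; exists A => a x.
by rewrite mi_partialE partial_shift//; exact: b.
Qed.

(** Lets convergence in the strong dual be tested on one function. *)
Lemma test_singleton_bounded Om (phi : Rn -> C^o) : lcs_carrier (test_space c M Om) phi ->
  lcs_bounded (test_space c M Om) [set phi].
Proof.
move=> tphi; split=> [_ -> //|U hU].
have /(test_spaceP c M_gt0)[K [cK KO tK]] := tphi; have [sm sK hd] := tK.
have [l [l0 [e e0 he] [A b]]] := for_class_pair (test_nbhs0E M_gt0 hU cK KO) hd.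
pose t := (`|A| + 1) / e; have A1 : 0 < `|A| + 1 by rewrite ltr_wpDl.
have t0 : 0 < t by rewrite divr_gt0.
exists t%:C%C; first by rewrite ltcR.
move=> _ ->; exists (t^-1%:C%C *: phi); last first.
  by rewrite scalerA -rmorphM/= divff ?scale1r// gt_eqF.
have cl : closed K by apply: compact_closed => //; exact: norm_hausdorff.
have E : t^-1%:C%C *: phi = t^-1%:C%C *: phi + 0 *: phi by rewrite scale0r addr0.
apply: he; first by rewrite E; exact: test_in_lin.
have := tbound_lin t^-1%:C%C 0 sm sm b b; rewrite -E cmod0 mul0r addr0 cmod_real.
rewrite gtr0_norm ?invr_gt0//; apply: (tbound_le M_gt0 (ltW l0) (lexx l) _ (ltW e0)).
rewrite /t invf_div mulrAC ler_pdivrMr// ler_pM2l// (le_trans (ler_norm A))//.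
by rewrite lerDl.
Qed.

End translates_of_tests.

Section growth_from_representation.
Context {R : realType} {n : nat} (c : ultra_class) (M : nat -> R).
Hypothesis M_gt0 : forall p, 0 < M p.
Local Notation C := R[i].
Local Notation Rn := 'rV[R]_n.
Local Notation cI := (@integral_Rn R n setT).
Variables (W : set Rn) (omega : Rn -> R) (f : (Rn -> C^o) -> C^o).
Hypothesis omega_gt0 : forall x, 0 < omega x.
Hypothesis omega_sup : Linfty_loc (fun y : Rn =>
  ereal_sup [set (omega (y + x) / omega x)%:E | x in [set: Rn]]).

Lemma representation_bigO :
  (forall r : R, 0 < r ->
    exists F : multi_index n -> Rn -> C^o,
      [/\ forall a, {within nbhd_of W r, continuous (F a)},
          for_class_l c (fun l => exists2 B : R, 0 < B &
            forall (x : Rn) (a : multi_index n), nbhd_of W r x ->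
              cmod (F a x) <= B * (l ^+ mi_size a / M (mi_size a)) * omega x) &
          lcs_sums_to (ultradistributions c M (nbhd_of W r))
            (fun a => ultra_derivative (nbhd_of W r) a (F a)) f]) ->
  translate_bigO c M f W omega.
Proof.
move=> hyp phi /(test_spaceP c M_gt0)[K [cK _ tK]].
have [m m0 Km] := compact_sub_box cK.
(* Since [r >= 1], also [n * m ^+ 2 < r <= r ^+ 2]: the box [m], which contains the support, lies in
   the ball of radius [r]. *)
pose r : R := n%:R * m ^+ 2 + 1.
have nm0 : 0 <= n%:R * m ^+ 2 :> R by rewrite mulr_ge0// sqr_ge0.
have r0 : 0 < r by rewrite ltr_wpDl.
have mr : n%:R * m ^+ 2 < r ^+ 2.
  apply: (@lt_le_trans _ _ r); first by rewrite ltrDl.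
  by rewrite expr2 ler_peMr ?(ltW r0)// lerDr.
have [F [cF hF [_ _ sums]]] := hyp r r0.
have [sm sK hd] := tK.
(* With [l * l' = 1 / 2] the values of [M] cancel and the term of index [a] is of relative size
   [2^-1 ^+ mi_size a]. *)
have half : 0 < 2^-1 :> R by rewrite invr_gt0.
have [l [l' [l0 l'0 ll [[B B0 hB] [A b]]]]] := for_class_prod half hF hd.
have [B' B'0 hB'] := omega_translate omega_gt0 omega_sup m0.
have clK : closed K by apply: compact_closed => //; exact: norm_hausdorff.
pose Om := nbhd_of W r; have oO : open Om by exact: nbhd_of_open.
pose Q := 2 * vol (n := n) m * (`|A| * (B * B')).
have Q0 : 0 <= Q by rewrite !mulr_ge0 ?vol_ge0// ltW.
have inO h : W h -> translate_set K h `<=` Om.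
  move=> Wh _ [y Ky <-]; exists h => //; exists y; last by rewrite addrC.
  by apply: eucl_norm_lt mr r0 (Km _ Ky).
have term h a : W h -> cmod (ultra_derivative Om a (F a) (fun x => phi (x - h))) <=
    Q * omega h * 2^-1 ^+ mi_size a.
  move=> Wh; have cT : compact (translate_set K h) by exact: translate_set_compact.
  have clT : closed (translate_set K h) by apply: compact_closed => //; exact: norm_hausdorff.
  have psiE : mi_partial a (fun x => phi (x - h)) = fun x => mi_partial a phi (x - h).
    by rewrite !mi_partialE partial_shift.
  have Tm : translate_set K h `<=` box (m + abs_sum (- h)).
    by move=> x /translate_setP/Km; exact: box_shift.
  pose la := l ^+ mi_size a / M (mi_size a).
  have la0 : 0 < la by rewrite divr_gt0// exprn_gt0.
  have FB x : translate_set K h x -> cmod (F a x) <= B * la * (B' * omega h).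
    move=> Tx; rewrite (le_trans (hB x a (inO h Wh x Tx)))// (ler_pM2l (mulr_gt0 B0 la0)).
    rewrite -[x in omega x](subrK h); apply: hB'.
    by apply: Km; apply/translate_setP.
  pose ma := `|A| * (l' ^+ mi_size a * M (mi_size a)).
  have w0 : 0 < l' ^+ mi_size a * M (mi_size a) by rewrite mulr_gt0// exprn_gt0.
  have psiB x : cmod (mi_partial a phi x) <= ma.
    by rewrite (le_trans (b a x))// ler_pM2r// ler_norm.
  have cpsi : ccont (fun x : Rn => mi_partial a phi (x - h)).
    by apply: ccont_shift; have [] := smooth_cjet sm (mi_seq a).
  have psi0 x : ~ translate_set K h x -> mi_partial a phi (x - h) = 0.
    move=> nT; rewrite mi_partialE; apply: (partial_eq0 _ sm clK sK) => Kx.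
    by apply: nT; apply/translate_setP.
  have Bp : 0 <= B * la * (B' * omega h) by do ?[exact: ltW|apply: mulr_ge0].
  have [cb ib] := cbs_integrand oO (cF a) clT (inO h Wh) Tm Bp FB cpsi psi0
    (fun x => psiB (x - h)).
  rewrite /ultra_derivative psiE ib cmodM.
  have -> : cmod ((-1) ^+ mi_size a : C) = 1 by rewrite cmodX cmodN cmod1 expr1n.
  (* Translating back puts the integrand in the box [m], so that the constant does not depend on
     [h]. *)
  rewrite mul1r -(cI_shift h cb).
  have [g1 g2 _ _] := cbs_shift h cb.
  have cb' : cbs m (ma * (B * la * (B' * omega h)))
      (fun x => F a (x + h) * mi_partial a phi (x + h - h)).
    split=> // [x|x nx].
      have [_ _ h3 _] := cb; exact: h3.
    rewrite psi0 ?mulr0// => /translate_setP; rewrite addrK => /Km; exact: nx.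
  rewrite (le_trans (cI_bound cb'))//.
  have -> : 2 * vol (n := n) m * (ma * (B * la * (B' * omega h))) =
      Q * omega h * (l * l') ^+ mi_size a.
    by rewrite exprMn /Q /ma /la; field; rewrite gt_eqF.
  by rewrite ll.
have bound h : W h -> cmod (f (fun x => phi (x - h))) <= (Q * 2 ^+ n + 1) * omega h.
  move=> Wh; pose ps : Rn -> C^o := fun x => phi (x - h).
  have tps : lcs_carrier (test_space c M Om) ps.
    apply/(test_spaceP c M_gt0); exists (translate_set K h); split.
    - exact: translate_set_compact.
    - exact: inO.
    - exact: test_in_shift.
  (* With tolerance [omega h], a finite partial sum is close enough to [f]; this accounts for the 1
     in the bound. *)
  pose U := [set u : (Rn -> C^o) -> C^o | continuous_functional (test_space c M Om) u /\
    forall x, [set ps] x -> `|u x| <= (omega h)%:C%C].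
  have hU : lcs_nbhs0 (ultradistributions c M Om) U.
    exists [set ps], (omega h)%:C%C; split => //; first exact: test_singleton_bounded.
    by rewrite ltcR.
  have [S [_ /(_ ps erefl)]] := @filter_ex _ _ summability.totally_filter _ (sums U hU).
  rewrite cmodE lecR fctE => hS.
  have [s [us _ sE]] := partial_sum_seq (fun a => ultra_derivative Om a (F a)) S.
  rewrite sE in hS.
  have -> : f (fun x => phi (x - h)) = (f ps - (\sum_(a <- s) ultra_derivative Om a (F a)) ps) +
      (\sum_(a <- s) ultra_derivative Om a (F a)) ps by rewrite subrK.
  rewrite (le_trans (cmodD _ _))// mulrDl mul1r addrC; apply: lerD => //.
  rewrite sum_functions (le_trans (cmod_sum _ _ _))//.
  apply: (@le_trans _ _ (\sum_(a <- s) Q * omega h * 2^-1 ^+ mi_size a)).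
    by apply: ler_sum => a _; exact: term.
  rewrite -mulr_sumr [leRHS]mulrAC; apply: ler_wpM2l; last exact: geometric_weight_sum.
  by rewrite mulr_ge0// ltW.
apply: (@le_lt_trans _ _ (Q * 2 ^+ n + 1)%:E); last exact: ltry.
apply: ge_ereal_sup => _ [h Wh <-]; rewrite lee_fin ler_pdivrMr//.
exact: bound.
Qed.

End growth_from_representation.

(** * Localization and Fourier expansion *)

Section integration_by_parts.
Context {R : realType} {n : nat}.
Local Notation C := R[i].
Local Notation Rn := 'rV[R]_n.
Local Notation cI := (@integral_Rn R n setT).

(** The derivative of [U p * e] along [v] integrates to 0 and equals
    [U p.+1 * e - kappa * (U p * e)]. *)
Lemma iterated_parts (v : Rn) (U : nat -> Rn -> C) (e : Rn -> C) (kappa : C) (m : R) (B : nat -> R) :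
  (forall p, cderive v (U p) (U p.+1)) -> (forall p, ccont (U p)) ->
  (forall p x, cmod (U p x) <= B p) -> (forall p x, ~ box m x -> U p x = 0) ->
  ccont e -> (forall x, cmod (e x) = 1) -> cderive v e (fun x => - kappa * e x) ->
  forall p, cI (fun x => U p x * e x) = kappa ^+ p * cI (fun x => U 0%N x * e x).
Proof.
move=> dU cU UB U0 ce e1 de; elim=> [|p IH]; first by rewrite expr0 mul1r.
have cb q : cbs m (B q) (fun x => U q x * e x).
  apply: cbs_cont => [|x|x nx]; first exact: ccontM.
    by rewrite cmodM e1 mulr1.
  by rewrite U0// mul0r.
have d1 q : cderive v (fun x => U q x * e x) (fun x => U q.+1 x * e x + - kappa * (U q x * e x)).
  apply: eq_cderive (cderiveM (dU q) de) => x //; ring.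
have d2 := cderiveD (d1 p.+1) (cderiveZ (- kappa) (d1 p)).
have b1 := cbsD (cb p.+1) (cbsZ (- kappa) (cb p)).
have : cI (fun x => U p.+1 x * e x + - kappa * (U p x * e x)) = 0.
  apply: (cI_derive0 (d1 p) d2 _ (cb p) b1) => x.
  apply: (@le_trans _ _ (B p.+2 + cmod (- kappa) * B p.+1 + cmod (- kappa) * (B p.+1 + cmod (- kappa) * B p))).
    have h q : cmod (U q x * e x) <= B q by rewrite cmodM e1 mulr1.
    have h1 q : cmod (U q.+1 x * e x + - kappa * (U q x * e x)) <= B q.+1 + cmod (- kappa) * B q.
      rewrite (le_trans (cmodD _ _))//; apply: lerD => //.
      by rewrite cmodM ler_wpM2l ?cmod_ge0.
    rewrite (le_trans (cmodD _ _))//; apply: lerD; first exact: h1.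
    by rewrite cmodM ler_wpM2l ?cmod_ge0//; exact: h1.
  exact: lexx.
rewrite (cID (cb p.+1) (cbsZ (- kappa) (cb p))) (cIZ (- kappa) (cb p)) mulNr.
by move/eqP; rewrite subr_eq0 => /eqP ->; rewrite IH exprS mulrA.
Qed.

Lemma cderive_echar (N : nat) (k : {ffun 'I_n -> int}) (h : Rn) i :
  cderive (basis_vec i) (fun y => echar N k (y - h))
    (fun y => Complex 0 (freq N (k i)) * echar N k (y - h)).
Proof.
pose A l q t : C := Complex 0 (freq N (k l)) ^+ q * cis (freq N (k l) * t).
have jA : cjet (fun s x => \prod_l A l (count_mem l s) (x 0 l)).
  apply: cjet_tensor => l q.
  apply: eq_cderive (cderiveZ (Complex 0 (freq N (k l)) ^+ q) (cderive_cis _)) => t //.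
  by rewrite /A exprSr mulrA.
have := cderive_shift (- h) ((jA [::]).2 i); apply: eq_cderive => y.
  by rewrite /echar; apply: eq_bigr => l _; rewrite /A /= expr0 mul1r.
rewrite /echar [in RHS](bigD1 i)//= [LHS](bigD1 i)//= {1}/A eqxx addn0 expr1 -!mulrA.
congr (_ * (_ * _)); apply: eq_bigr => l li.
by rewrite /A eq_sym (negPf li) expr0 mul1r.
Qed.

End integration_by_parts.

(** * A partition of unity over the integer lattice *)

Section lattice_partition.
Context {R : realType} {n : nat} (M : nat -> R).
Hypothesis M_gt0 : forall p, 0 < M p.
Local Notation C := R[i].
Local Notation Rn := 'rV[R]_n.
Local Notation Zn := {ffun 'I_n -> int}.
Variables (b : R) (Phi : nat -> R -> R).
Hypothesis step : smooth_step M b Phi.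

Definition chi (k : Zn) (s : seq 'I_n) (x : Rn) : C :=
  \prod_l (bump Phi (1 - (k l)%:~R) (k l)%:~R (count_mem l s) (x 0 l))%:C%C.

Lemma cjet_chi k : cjet (chi k).
Proof.
apply: (@cjet_tensor _ _ (fun l p t => (bump Phi (1 - (k l)%:~R) (k l)%:~R p t)%:C%C)) => l p.
exact: (cderive_bump step).
Qed.

Let bump_center (a : R) p t : bump Phi (1 - a) a p t = bump Phi 1 0 p (t - a).
Proof. by rewrite /bump subr0; congr (Phi p _ - _); ring. Qed.

Let b_ge0 : 0 <= b. Proof. by case: step. Qed.

Lemma chi_eq0 (k : Zn) s (x : Rn) l : b + 1 < `|x 0 l - (k l)%:~R| -> chi k s x = 0.
Proof.
move=> h; rewrite /chi (bigD1 l)//= bump_center (@bump_eq0 _ _ _ _ step _ _ (b + 1)) ?mul0r//.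
- by rewrite addrC.
- by rewrite add0r lerDr.
Qed.

Lemma chi_supp (k : Zn) s (x : Rn) : chi k s x != 0 -> forall l, `|x 0 l - (k l)%:~R| <= b + 1.
Proof. by move=> h l; rewrite leNgt; apply: contraNN h => /chi_eq0 ->. Qed.

(** For a derivative along one axis a single factor is differentiated and the others are at most 1,
    so the one-dimensional constant suffices. *)
Lemma chi_bound (l : R) : 0 < l -> exists2 B : R, 0 < B &
  forall k a i x, cmod (chi k (nseq a i) x) <= B * l ^+ a * M a.
Proof.
move=> l0; have [B B0 hB] := bump_le step l0; exists B => // k a i x.
have -> : cmod (chi k (nseq a i) x) =
    \prod_l `|bump Phi (1 - (k l)%:~R) (k l)%:~R (count_mem l (nseq a i)) (x 0 l)|.
  by rewrite /chi cmod_prod; apply: eq_bigr => j _; exact: cmod_real.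
rewrite (bigD1 i)//= -[leRHS]mulr1; apply: ler_pM => //.
- exact: prodr_ge0.
- by rewrite count_nseq /= eqxx mul1n; exact: hB.
apply: prodr_ile1 => j ji; rewrite normr_ge0/= count_nseq /= eq_sym (negPf ji) mul0n.
by rewrite bump_center; exact: (bump_le1 step).
Qed.

Lemma uniq_sum_eq (T : eqType) (s t : seq T) (F : T -> C) : uniq s -> uniq t ->
  {subset t <= s} -> (forall x, x \in s -> x \notin t -> F x = 0) ->
  \sum_(x <- s) F x = \sum_(x <- t) F x.
Proof.
move=> us ut ts F0; rewrite (bigID (fun x => x \in t))/=.
have -> : \sum_(x <- s | x \notin t) F x = 0.
  by rewrite big_seq_cond big1// => x /andP[]; exact: F0.
rewrite addr0 -big_filter; apply: perm_big; apply: uniq_perm => //; first exact: filter_uniq.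
move=> x; rewrite mem_filter; apply/andP/idP => [[]//|xt]; split => //; exact: ts.
Qed.

(** The list only has to contain every cell active at [x], so it may be exchanged for a cube of
    lattice points, where the sum factors into telescoping sums over the coordinates. *)
Lemma chi_partition (s : seq Zn) (x : Rn) : uniq s ->
  (forall k, k \notin s -> exists l, b + 1 < `|x 0 l - (k l)%:~R|) ->
  \sum_(k <- s) chi k [::] x = 1.
Proof.
move=> us hs.
have [J hJ] : exists J : nat, forall l, `|x 0 l| + b + 1 < J%:R.
  exists (Num.truncn (abs_sum x + b + 1)).+1 => l.
  apply: le_lt_trans (truncnS_gt _); rewrite !lerD2r; exact: coord_le_abs_sum.
pose pt (j : 'I_(J + J)) : int := Posz j - Posz J.
pose toZ (g : {ffun 'I_n -> 'I_(J + J)}) : Zn := [ffun l => pt (g l)].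
pose cube := [seq toZ g | g <- enum {: {ffun 'I_n -> 'I_(J + J)}}].
have pt_inj : injective pt.
  by move=> i j /addIr [] h; exact: val_inj.
have ucube : uniq cube.
  rewrite map_inj_uniq ?enum_uniq// => g g' /ffunP E; apply/ffunP => l.
  by have := E l; rewrite !ffunE => /pt_inj.
have cube_out k : k \notin cube -> exists l, b + 1 < `|x 0 l - (k l)%:~R|.
  move=> kc; apply: contrapT => h.
  have near l : `|x 0 l - (k l)%:~R| <= b + 1.
    by rewrite leNgt; apply/negP => hl; apply: h; exists l.
  move/negP : kc; apply.
  have rng l : exists j : 'I_(J + J), pt j = k l.
    have [h1 h2] : (- J%:R : R) < (k l)%:~R /\ ((k l)%:~R : R) < J%:R.
      have := near l; have := hJ l; have := ler_norm (x 0 l); have := ler_norm (- x 0 l).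
      by rewrite normrN ler_norml => ? ? ? /andP[? ?]; split; lra.
    have g1 : - Posz J < k l by rewrite -(ltr_int R) intrN.
    have g2 : k l < Posz J by rewrite -(ltr_int R).
    have g3 : (absz (k l + Posz J)%R < J + J)%N by lia.
    exists (Ordinal g3); rewrite /pt /= gez0_abs ?addrK//.
    by rewrite -lerBlDr sub0r ltW.
  have [g hg] := choice rng.
  apply/mapP; exists [ffun l => g l]; rewrite ?mem_enum//.
  by apply/ffunP => l; rewrite !ffunE hg.
have zero (k : Zn) : (exists l, b + 1 < `|x 0 l - (k l)%:~R|) -> chi k [::] x = 0.
  by move=> [l]; exact: chi_eq0.
(* Both lists are compared with their union, where the extra terms are 0. *)
pose t := undup (s ++ cube).
have ut : uniq t by exact: undup_uniq.
rewrite -(@uniq_sum_eq _ t s (fun k => chi k [::] x))//; last 2 first.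
- by move=> k ks; rewrite mem_undup mem_cat ks.
- by move=> k _ /hs/zero.
rewrite (@uniq_sum_eq _ t cube (fun k => chi k [::] x))//; last 2 first.
- by move=> k kc; rewrite mem_undup mem_cat kc orbT.
- by move=> k _ /cube_out/zero.
rewrite big_map big_enum/=.
pose c (l : 'I_n) (j : 'I_(J + J)) : C := (bump Phi 1 0 0 (x 0 l - (pt j)%:~R))%:C%C.
transitivity (\sum_(g : {ffun 'I_n -> 'I_(J + J)}) \prod_l c l (g l)).
  by apply: eq_bigr => g _; apply: eq_bigr => l _; rewrite ffunE bump_center.
rewrite -(bigA_distr_bigA c) big1// => l _.
rewrite /c -rmorph_sum/=; congr (_%:C)%C.
have [_ [_ _ P0 P1] _ _] := step.
pose y := x 0 l + J%:R.
transitivity (\sum_(j < J + J) (Phi 0%N (y - j%:R + 1) - Phi 0%N (y - j%:R))).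
  apply: eq_bigr => j _; rewrite /bump subr0 /pt intrB /y.
  by congr (Phi 0%N _ - Phi 0%N _); rewrite -!pmulrn; ring.
have tele m : \sum_(j < m) (Phi 0%N (y - j%:R + 1) - Phi 0%N (y - j%:R)) =
    Phi 0%N (y + 1) - Phi 0%N (y + 1 - m%:R).
  elim: m => [|m IH]; first by rewrite big_ord0 subr0 subrr.
  rewrite big_ord_recr/= IH -natr1.
  have -> : y - m%:R + 1 = y + 1 - m%:R by ring.
  have -> : y + 1 - (m%:R + 1) = y - m%:R by ring.
  by ring.
have Jl := hJ l; have n1 := ler_norm (x 0 l); have n2 := ler_norm (- x 0 l).
rewrite normrN in n2.
have y1 : 1 <= y + 1 by rewrite /y; move: b_ge0; lra.
have y2 : y + 1 - (J + J)%:R <= - b by rewrite /y natrD; lra.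
by rewrite tele (P1 _ y1) (P0 _ y2) subr0.
Qed.

End lattice_partition.

Section class_rescaling.
Context {R : realType} (c : ultra_class).

Lemma for_class_d_scale (P Q : R -> Prop) (s : R) : 0 < s ->
  (forall l, 0 < l -> P l -> Q (s * l)) -> for_class_d c P -> for_class_d c Q.
Proof.
rewrite /for_class_d; case: c => s0 PQ.
  move=> h l l0; have sl : 0 < l / s by rewrite divr_gt0.
  by have := PQ _ sl (h _ sl); rewrite mulrC divfK// gt_eqF.
by move=> [l l0 h]; exists (s * l); [exact: mulr_gt0|exact: PQ].
Qed.

Lemma for_class_l_inv (P Q : R -> Prop) (q : R) : 0 < q ->
  (forall l, 0 < l -> P l -> Q (q / l)) -> for_class_l c P -> for_class_l c Q.
Proof.
rewrite /for_class_l; case: c => q0 PQ.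
  by move=> [l l0 h]; exists (q / l); [exact: divr_gt0|exact: PQ].
move=> h l l0; have ql : 0 < q / l by rewrite divr_gt0.
by have := PQ _ ql (h _ ql); rewrite invf_div mulrCA divff ?mulr1// gt_eqF.
Qed.

End class_rescaling.

Section localized_coefficients.
Context {R : realType} {n : nat} (c : ultra_class) (M : nat -> R).
Hypothesis M_gt0 : forall p, 0 < M p.
Hypothesis HM1 : M1 M.
Hypothesis HM2 : M2' M.
Hypothesis HM3 : M3' M.
Local Notation C := R[i].
Local Notation Rn := 'rV[R]_n.
Local Notation Zn := {ffun 'I_n -> int}.
Local Notation E := (assoc_fun M).
Local Notation cI := (@integral_Rn R n setT).
Variables (b : R) (Phi : nat -> R -> R).
Hypothesis step : smooth_step M b Phi.
Variables (i0 : 'I_n) (N : nat).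
Hypothesis N_gt0 : (0 < N)%N.
Local Notation rho := (fradius (R := R) i0 N).
Local Notation top := (top_coord (R := R) i0 N).
Local Notation L := (pi * N%:R : R).

Definition cube_volume : R := (2 * L) ^+ n.

Lemma cube_volume_gt0 : 0 < cube_volume.
Proof. by rewrite exprn_gt0// !mulr_gt0 ?pi_gt0// ltr0n. Qed.

(** The factor produced by one integration by parts along the largest coordinate. *)
Definition symbol (k : Zn) : C := Complex 0 (freq N (k (top k)) : R).

Lemma cmod_symbol k : cmod (symbol k) = rho k.
Proof. by rewrite /symbol /cmod /Normc.normc expr0n add0r sqrtr_sqr. Qed.

Section window.
Variables (k0 : Zn) (h : Rn) (psi : Rn -> C^o) (K : set Rn) (mK : R).
Hypothesis sm : smooth psi.
Hypothesis clK : closed K.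
Hypothesis sK : supported_in K psi.
Hypothesis KmK : K `<=` box mK.

Definition wavelet (k : Zn) (y : Rn) : C := echar N (- k) (y - h).

(** The derivatives of [chi * psi] along the axis [i], already expanded so that the pure derivatives
    of [psi] are visible. *)
Definition windowed (i : 'I_n) : nat -> Rn -> C :=
  leibniz (fun a => chi Phi k0 (nseq a i)) (fun q => partial_jet psi (nseq q i)).

Definition windowed_coef (k : Zn) : C :=
  fourier_coef N (fun x => chi Phi k0 [::] (x + h) * psi (x + h)) k.

Lemma windowed0 i y : windowed i 0 y = chi Phi k0 [::] y * psi y.
Proof. by rewrite /windowed /leibniz big_ord1 bin0 mul1r /= partial_jet_nil. Qed.

Lemma ccont_wavelet k : ccont (wavelet k).
Proof. exact: (ccont_shift (- h) (ccont_echar N (- k))). Qed.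

Lemma cmod_wavelet k y : cmod (wavelet k y) = 1.
Proof. exact: cmod_echar. Qed.

Let ccont_windowed i p : ccont (windowed i p).
Proof.
apply: ccont_sum => q; apply: ccontM; first exact: ccont_cst.
by apply: ccontM; [exact: (cjet_chi step k0 _).1|exact: (smooth_cjet sm _).1].
Qed.

Let windowed_eq0 i p x : ~ box mK x -> windowed i p x = 0.
Proof.
move=> nx; rewrite /windowed /leibniz big1// => q _.
by rewrite (partial_eq0 _ sm clK sK) ?mulr0// => /KmK.
Qed.

Let windowed_bound (l A : R) : 0 < l -> 0 <= A -> tbound M psi l A ->
  exists2 B : R, 0 <= B & forall i p x, cmod (windowed i p x) <= B * ((2 * l) ^+ p * M p).
Proof.
move=> l0 A0 hA; have [B B0 hB] := chi_bound (n := n) step l0.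
exists (B * A * M 0%N); first by rewrite !mulr_ge0// ltW.
move=> i p x; apply: (le_trans (cmod_sum _ _ _)).
apply: (@le_trans _ _ (\sum_(q < p.+1) 'C(p, q)%:R * (B * A * M 0%N * (l ^+ p * M p)))).
  apply: ler_sum => q _; rewrite cmodM.
  have -> : cmod ('C(p, q)%:R : C) = 'C(p, q)%:R.
    by rewrite -(rmorph_nat (@real_complex R)) cmod_real normr_nat.
  rewrite ler_wpM2l// cmodM.
  have h1 : cmod (partial_jet psi (nseq q i) x) <= A * (l ^+ q * M q).
    by have := hA (mi_pure q i) x; rewrite mi_partialE mi_seq_pure mi_size_pure.
  apply: le_trans (ler_pM _ _ (hB k0 (p - q)%N i x) h1) _; try exact: cmod_ge0.
  have qp : (q <= p)%N by rewrite -ltnS.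
  have -> : B * l ^+ (p - q) * M (p - q)%N * (A * (l ^+ q * M q)) =
     B * A * (l ^+ (p - q) * l ^+ q) * (M (p - q)%N * M q) by ring.
  rewrite -exprD subnK//.
  have -> : B * A * M 0%N * (l ^+ p * M p) = B * A * l ^+ p * (M 0%N * M p) by ring.
  apply: ler_wpM2l; first by rewrite !mulr_ge0 ?exprn_ge0// ltW.
  by have := weight_superM M_gt0 HM1 (p - q) q; rewrite subnK.
rewrite -mulr_suml exprMn.
have -> : \sum_(q < p.+1) 'C(p, q)%:R = 2 ^+ p :> R.
  rewrite (_ : 2 = 1 + 1 :> R)// exprDn.
  by apply: eq_bigr => q _; rewrite !expr1n mul1r.
by rewrite le_eqVlt; apply/orP; left; apply/eqP; ring.
Qed.

Lemma integrate_by_parts (l A : R) k p : 0 < l -> 0 <= A -> tbound M psi l A ->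
  cI (fun y => windowed (top k) p y * wavelet k y) =
  symbol k ^+ p * cI (fun y => windowed (top k) 0 y * wavelet k y).
Proof.
move=> l0 A0 hA; have [B B0 hB] := windowed_bound l0 A0 hA.
have d q : cderive (basis_vec (top k)) (windowed (top k) q) (windowed (top k) q.+1).
  apply: cderive_leibniz => a; first exact: (cjet_chi step k0 _).2.
  exact: (smooth_cjet sm _).2.
apply: (@iterated_parts _ _ (basis_vec (top k)) _ (wavelet k) (symbol k) mK
  (fun p => B * ((2 * l) ^+ p * M p)) d) => //.
- by move=> q x; exact: windowed_eq0.
- exact: ccont_wavelet.
- exact: cmod_wavelet.
apply: eq_cderive (cderive_echar N (- k) h (top k)) => y //.
rewrite /symbol /wavelet ffunE /freq mulrNz mulNr; congr (_ * _).
by apply: complex_ext => /=; rewrite ?oppr0.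
Qed.

Lemma windowed_coefE (l A : R) k : 0 < l -> 0 <= A -> tbound M psi l A ->
  windowed_coef k = (cube_volume^-1)%:C%C * cI (fun y => windowed (top k) 0 y * wavelet k y).
Proof.
move=> l0 A0 hA; have [B B0 hB] := windowed_bound l0 A0 hA.
rewrite /windowed_coef /fourier_coef; congr (_ * _).
have cb : cbs mK (B * ((2 * l) ^+ 0 * M 0%N) * 1) (fun y => windowed (top k) 0 y * wavelet k y).
  apply: cbs_cont => [|x|x nx].
  - by apply: ccontM; [exact: ccont_windowed|exact: ccont_wavelet].
  - by rewrite cmodM cmod_wavelet !mulr1; have := hB (top k) 0%N x; rewrite ?mulr1.
  - by rewrite windowed_eq0// mul0r.
rewrite -(cI_shift h cb); congr cI; apply/funext => x.
by rewrite windowed0 /wavelet addrK.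
Qed.

(** Integration by parts is available to every order; the one that is maximising at
    [(2 * l)^-1 * rho k] gives the factor [E]. *)
Lemma windowed_coef_le (l A : R) : 0 < l -> 0 <= A -> tbound M psi l A ->
  exists2 B : R, 0 <= B & forall k, cmod (windowed_coef k) * E ((2 * l)^-1 * rho k) <= B.
Proof.
move=> l0 A0 hA; have [B B0 hB] := windowed_bound l0 A0 hA.
have V0 := cube_volume_gt0; have vm := vol_ge0 (R := R) (n := n) mK.
exists (cube_volume^-1 * (2 * vol (n := n) mK * B)).
  by rewrite !mulr_ge0// invr_ge0 ltW.
move=> k; have l2 : 0 < 2 * l by rewrite mulr_gt0.
pose p := pmax M ((2 * l)^-1 * rho k).
have rp : cmod (windowed_coef k) * rho k ^+ p <=
    cube_volume^-1 * (2 * vol (n := n) mK * (B * ((2 * l) ^+ p * M p))).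
  rewrite -cmod_symbol -cmodX -cmodM (windowed_coefE k l0 A0 hA) -mulrA.
  rewrite [X in _ * X]mulrC -(integrate_by_parts k p l0 A0 hA) cmodM cmod_real.
  rewrite gtr0_norm ?invr_gt0// ler_pM2l ?invr_gt0//.
  apply: (@cI_bound _ _ mK); apply: cbs_cont => [|x|x nx].
  - by apply: ccontM; [exact: ccont_windowed|exact: ccont_wavelet].
  - by rewrite cmodM cmod_wavelet mulr1.
  - by rewrite windowed_eq0// mul0r.
rewrite /assoc_fun -/p mulrA ler_pdivrMr// exprMn exprVn.
rewrite [X in _ * X]mulrC mulrA ler_pdivrMr ?exprn_gt0// (le_trans rp)//.
by move: (M p) ((2 * l) ^+ p) => x y; rewrite le_eqVlt; apply/orP; left; apply/eqP; ring.
Qed.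

(** The factor [E] stays inside the sum because the bounds of the atoms have that size; the decay
    that makes the series converge is bought with the dilation [H]. *)
Lemma windowed_coef_summ (kap : nat -> Zn) : injective kap ->
  for_class_d c (fun l => exists A, tbound M psi l A) ->
  for_class_d c (fun l => exists v, summ v /\
    forall i, cmod (windowed_coef (kap i)) * E (l^-1 * rho (kap i)) <= v i).
Proof.
move=> kI; have [H H1 hH] := assoc_poly_scale M_gt0 HM2 HM3 (n * 2).
have H0 : 0 < H by apply: lt_le_trans H1.
apply: (@for_class_d_scale _ _ _ _ (2 * H)); first by rewrite mulr_gt0.
move=> l l0 [A hA].
have hA' : tbound M psi l `|A| by apply: tbound_le hA; rewrite ?ler_norm// ltW.
have [B B0 hB] := windowed_coef_le l0 (normr_ge0 A) hA'.
have s0 : 0 < (2 * H * l)^-1 by rewrite invr_gt0 !mulr_gt0.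
have [B' B'0 hB'] := hH _ s0.
exists (fun i => B' * B * lattice_decay (R := R) i0 N (kap i)); split.
  by apply: summZ; [rewrite mulr_ge0// ltW|exact: lattice_decay_summ].
move=> i; have r0 := fradius_ge0 (R := R) i0 N (kap i); set k := kap i in r0 *.
have d0 : 0 < (1 + rho k) ^+ (n * 2) by rewrite exprn_gt0// ltr_wpDr.
rewrite /lattice_decay ler_pdivlMr// -[leLHS]mulrA [X in _ * X <= _]mulrC.
apply: (@le_trans _ _ (cmod (windowed_coef k) * (B' * E (H * (2 * H * l)^-1 * rho k)))).
  by rewrite ler_wpM2l ?cmod_ge0// hB'.
have -> : H * (2 * H * l)^-1 = (2 * l)^-1 by field; rewrite !gt_eqF.
by rewrite mulrCA ler_pM2l// hB.
Qed.

End window.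

End localized_coefficients.

Section synthesis.
Context {R : realType} {n : nat} (c : ultra_class) (M : nat -> R).
Hypothesis M_gt0 : forall p, 0 < M p.
Hypothesis HM1 : M1 M.
Hypothesis HM2 : M2' M.
Hypothesis HM3 : M3' M.
Local Notation C := R[i].
Local Notation Rn := 'rV[R]_n.
Local Notation Zn := {ffun 'I_n -> int}.
Local Notation E := (assoc_fun M).
Local Notation cI := (@integral_Rn R n setT).
Variables (b : R) (Phi : nat -> R -> R).
Hypothesis step : smooth_step M b Phi.
Variable i0 : 'I_n.
Variables (f : (Rn -> C^o) -> C^o) (W : set Rn) (omega : Rn -> R).
Hypothesis f_ultra : lcs_carrier (ultradistributions c M setT) f.
Hypothesis omega_gt0 : forall x, 0 < omega x.
Hypothesis f_bigO : translate_bigO c M f W omega.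
Hypothesis W_neq0 : W !=set0.
Variable kap : nat -> Zn.
Hypothesis kap_inj : injective kap.
Hypothesis kap_surj : forall k, exists i, kap i = k.
Variable r : R.
Hypothesis r_gt0 : 0 < r.

Let lin : linear_on_tests c M setT f. Proof. by case/(functionalP c M_gt0) : f_ultra. Qed.

(** The sum of [b + 1], the half-width of a cell, and of [r + b + 1], which bounds each coordinate
    of the vector from the chosen point of [W] to the lattice point. *)
Definition window : R := r + b + b + 2.
(** Exceeds [window + b + 1], so that the supports of the atoms lie in the interior of the cube of
    half-side [pi * N]. *)
Definition freq_scale : nat := (Num.truncn (window + b + 1)).+1.

Local Notation m := window.
Local Notation N := freq_scale.
Local Notation rho := (fradius (R := R) i0 N).
Local Notation top := (top_coord (R := R) i0 N).
Local Notation decay := (lattice_decay (R := R) i0 N).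
Local Notation L := (pi * N%:R : R).
Local Notation symb := (symbol (R := R) i0 N).
Local Notation atomN := (atom b Phi N m).

Let b_ge0 : 0 <= b. Proof. by case: step. Qed.
Let m_ge0 : 0 <= m. Proof. by rewrite /window; move: b_ge0 r_gt0; lra. Qed.
Let mL : m + b + 1 < L.
Proof.
have h : m + b + 1 < N%:R by exact: truncnS_gt.
apply: lt_le_trans h _; rewrite ler_peMl//.
by apply: le_trans (pi_ge2 R); rewrite ler1n.
Qed.

(** The supremum over [W] for each [k] gives one function [G] independent of [l], as the choice of
    the orders requires. *)
Lemma atom_growth : exists G : Zn -> R, [/\ forall k, 0 <= G k,
  forall h k, W h -> cmod (f (fun x => atomN k [::] (x - h))) <= G k * omega h &
  for_class_l c (fun l => exists2 B : R, 0 < B & forall k, G k <= B * E (l * rho k))].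
Proof.
have ta := translated_atoms M_gt0 HM1 HM3 step i0 N f_ultra omega_gt0 f_bigO m_ge0.
pose S k := [set cmod (f (fun x => atomN k [::] (x - h))) / omega h | h in W].
have ub (l B : R) : (forall h k, W h -> cmod (f (fun x => atomN k [::] (x - h))) <=
    B * omega h * E (l * rho k)) -> forall k, ubound (S k) (B * E (l * rho k)).
  move=> hB k _ [h Wh <-]; rewrite ler_pdivrMr// mulrAC.
  exact: hB.
have [l [B hB]] : exists l B : R, forall h k, W h ->
    cmod (f (fun x => atomN k [::] (x - h))) <= B * omega h * E (l * rho k).
  move: ta; rewrite /for_class_l; case: c => [[l _ [B _ hB]]|/(_ 1 ltr01)[B _ hB]].
    by exists l, B.
  by exists 1, B.
have [w Ww] := W_neq0.
have hs k : has_sup (S k).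
  split; first by exists (cmod (f (fun x => atomN k [::] (x - w))) / omega w); exists w.
  by exists (B * E (l * rho k)); exact: ub.
have mem h k : W h -> cmod (f (fun x => atomN k [::] (x - h))) / omega h <= sup (S k).
  by move=> Wh; apply: sup_upper_bound => //; exists h.
exists (fun k => sup (S k)); split.
- by move=> k; apply: le_trans (mem w k Ww); rewrite divr_ge0 ?cmod_ge0// ltW.
- by move=> h k Wh; rewrite -ler_pdivrMr//; exact: mem.
apply: for_class_l_sub ta => l' l'0 [B' B'0 hB']; exists B' => // k.
by apply: ge_sup; [case: (hs k)|exact: ub].
Qed.

Definition lattice_point (k : Zn) : Rn := \row_l (k l)%:~R.

(** Holds for every cell meeting [nbhd_of W r]: [r] accounts for the neighbourhood and [b + 1] for
    the cell. *)
Definition near_W (k : Zn) : Prop := exists h, W h /\ box (r + b + 1) (lattice_point k - h).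

Lemma centers_exist : exists hz : Zn -> Rn, forall k, near_W k ->
  W (hz k) /\ box (r + b + 1) (lattice_point k - hz k).
Proof.
have ex k : exists h, near_W k -> W h /\ box (r + b + 1) (lattice_point k - h).
  by have [[h hh]|nk] := pselect (near_W k); [exists h|exists 0].
by have [hz hhz] := choice ex; exists hz.
Qed.

Variables (G : Zn -> R) (p : Zn -> nat) (hz : Zn -> Rn).
Hypothesis G_ge0 : forall k, 0 <= G k.
Hypothesis G_le : forall h k, W h -> cmod (f (fun x => atomN k [::] (x - h))) <= G k * omega h.
Hypothesis p0 : forall k, rho k = 0 -> p k = 0%N.
Hypothesis G_p : for_class_l c (fun l => exists2 B : R, 0 < B & forall k,
  G k * M (p k) * (1 + rho k) ^+ (n * 2) <= B * (l * rho k) ^+ p k).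
Hypothesis hzP : forall k, near_W k -> W (hz k) /\ box (r + b + 1) (lattice_point k - hz k).

(** Set to 0 for cells away from [W], where [hz] carries no information. *)
Definition atom_value (k0 k : Zn) : C :=
  if `[< near_W k0 >] then f (fun x => atomN k [::] (x - hz k0)) else 0.

(** What multiplies the pure derivative of [psi] of order [q] after [p k] integrations by parts in
    the coefficient of frequency [k], the value of [f] on the atom included. *)
Definition piece (k0 k : Zn) (q : nat) (y : Rn) : C :=
  ((cube_volume (R := R) (n := n) N)^-1)%:C%C * (symb k)^-1 ^+ p k * 'C(p k, q)%:R * atom_value k0 k *
    (chi Phi k0 (nseq (p k - q) (top k)) y * wavelet N (hz k0) k y).

Lemma ccont_piece k0 k q : ccont (piece k0 k q).
Proof.
apply: ccontM; first exact: ccont_cst.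
by apply: ccontM; [exact: (cjet_chi step k0 _).1|exact: ccont_wavelet].
Qed.

Lemma piece_eq0 k0 k q (y : Rn) : ~ (near_W k0 /\ box (b + 1) (y - lattice_point k0)) ->
  piece k0 k q y = 0.
Proof.
move=> h; rewrite /piece /atom_value; case: asboolP => [g|_]; last by rewrite mulr0 mul0r.
have [l hl] : exists l, ~ `|(y - lattice_point k0) 0 l| <= b + 1.
  by apply/existsNP => hb; apply: h.
rewrite (chi_eq0 step _ (l := l)) ?mul0r ?mulr0//.
by move/negP : hl; rewrite -ltNge !mxE.
Qed.

Let binR_le (j q : nat) : (q <= j)%N -> 'C(j, q)%:R <= 2 ^+ j :> R.
Proof.
move=> qj; rewrite (_ : 2 = 1 + 1 :> R)// exprDn.
have hq : (q < j.+1)%N by [].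
by rewrite (bigD1 (Ordinal hq))//= !expr1n mul1r lerDl sumr_ge0.
Qed.

Lemma piece_bound : for_class_l c (fun l => exists2 B : R, 0 < B & forall k0 k q y,
  (q <= p k)%N -> cmod (piece k0 k q y) <= B * (l ^+ q / M q) * decay k * omega (hz k0)).
Proof.
(* The binomial coefficients double [l], which is harmless for both classes. *)
suff key (l B : R) : 0 < l -> 0 < B -> (forall k,
    G k * M (p k) * (1 + rho k) ^+ (n * 2) <= B * (l * rho k) ^+ p k) ->
    exists2 B : R, 0 < B & forall k0 k q y,
    (q <= p k)%N -> cmod (piece k0 k q y) <= B * ((2 * l) ^+ q / M q) * decay k * omega (hz k0).
  move: G_p; rewrite /for_class_l; case: c => [[l l0 [B B0 hB]]|h l l0].
    by exists (2 * l); [rewrite mulr_gt0|exact: key hB].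
  have l2 : 0 < l / 2 by rewrite divr_gt0.
  have [B B0 hB] := h _ l2; have := key _ _ l2 B0 hB.
  by rewrite (_ : 2 * (l / 2) = l)// mulrC divfK.
(* The cell functions obey bounds with every parameter; this one will compensate
   [(2 * l) ^+ p k]. *)
move=> l0 B0 hB; have mu0 : 0 < (2 * l)^-1 by rewrite invr_gt0 mulr_gt0.
have [Bm Bm0 hBm] := chi_bound (n := n) step mu0.
have V0 : 0 < cube_volume (R := R) (n := n) N by exact: cube_volume_gt0.
set V := cube_volume N in V0 *; have Vi : 0 < V^-1 by rewrite invr_gt0.
have M0 := M_gt0 0.
exists (V^-1 * Bm * M 0%N * B); first by rewrite !mulr_gt0.
move=> k0 k q y qp; have r0 := fradius_ge0 (R := R) i0 N k; set s := p k in qp *.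
have d1 : 0 < (1 + rho k) ^+ (n * 2) by rewrite exprn_gt0// ltr_wpDr.
have d0 : 0 < decay k by rewrite invr_gt0.
have om := omega_gt0 (hz k0).
have Tb : cmod (atom_value k0 k) <= G k * omega (hz k0).
  rewrite /atom_value; case: asboolP => [/hzP[Wh _]|_]; first exact: G_le.
  by rewrite cmod0 mulr_ge0// ltW.
have l2 : 0 < 2 * l by rewrite mulr_gt0.
rewrite !(mulrA, mulrAC _ (M q)^-1) ler_pdivlMr//.
rewrite /piece !cmodM cmod_wavelet mulr1 cmod_real (gtr0_norm Vi) cmodX cmodV cmod_symbol.
have -> : cmod ('C(s, q)%:R : C) = 'C(s, q)%:R.
  by rewrite -(rmorph_nat (@real_complex R)) cmod_real normr_nat.
have ri : 0 <= (rho k)^-1 ^+ s by rewrite exprn_ge0// invr_ge0.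
have chi0 := cmod_ge0 (chi Phi k0 (nseq (s - q) (top k)) y).
have T0 := cmod_ge0 (atom_value k0 k).
have cb := hBm k0 (s - q)%N (top k) y.
have mu1 : 0 < (2 * l)^-1 ^+ (s - q) by rewrite exprn_gt0.
(* [M (s - q) * M q <= M 0 * M s], and [(2 l)^-1] makes [2 ^ s * l ^ s * (2 l)^(q - s)]
   collapse to [(2 l) ^ q] *)
apply: (@le_trans _ _ (V^-1 * (rho k)^-1 ^+ s * 2 ^+ s * (G k * omega (hz k0)) *
    (Bm * (2 * l)^-1 ^+ (s - q) * M (s - q)%N) * M q)).
  rewrite ler_pM2r// -!mulrA ler_pM2l// ler_wpM2l//.
  apply: ler_pM => //; first exact: mulr_ge0.
    exact: binR_le.
  by rewrite (mulrA (G k)); apply: ler_pM => //; rewrite mulrA; exact: cb.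
have gm : G k * M s <= B * (l * rho k) ^+ s * decay k.
  by rewrite /lattice_decay ler_pdivlMr.
have ws := weight_superM M_gt0 HM1 (s - q) q; rewrite subnK// in ws.
(* Only an inequality, because at [rho k = 0] the inverse is 0 by convention. *)
have rr : (rho k)^-1 ^+ s * rho k ^+ s <= 1.
  rewrite -exprMn; have [->|rn] := eqVneq (rho k) 0; last by rewrite mulVf// expr1n.
  by rewrite mulr0; case: (s) => [|j]; rewrite ?expr0// expr0n.
apply: (@le_trans _ _ (V^-1 * (rho k)^-1 ^+ s * 2 ^+ s * omega (hz k0) *
    Bm * (2 * l)^-1 ^+ (s - q) * M 0%N * (B * (l * rho k) ^+ s * decay k))).
  have -> : V^-1 * (rho k)^-1 ^+ s * 2 ^+ s * (G k * omega (hz k0)) *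
    (Bm * (2 * l)^-1 ^+ (s - q) * M (s - q)%N) * M q =
    (V^-1 * (rho k)^-1 ^+ s * 2 ^+ s * omega (hz k0) * Bm * (2 * l)^-1 ^+ (s - q)) *
    (G k * (M (s - q)%N * M q)).
    move: ((rho k)^-1 ^+ s) (2 ^+ s) ((2 * l)^-1 ^+ (s - q)) => x1 x2 x3; ring.
  rewrite -[leRHS]mulrA; apply: ler_wpM2l.
    by do ?[exact: ri|exact: ltW|apply: exprn_ge0|apply: mulr_ge0].
  apply: (@le_trans _ _ (G k * (M 0%N * M s))); first by rewrite ler_wpM2l.
  by rewrite mulrCA ler_pM2l.
have E1 : 2 ^+ s * (2 * l)^-1 ^+ (s - q) * l ^+ s = (2 * l) ^+ q.
  rewrite mulrAC -exprMn -[in X in X * _](subnK qp) exprD mulrAC -exprMn.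
  by rewrite divff ?expr1n ?mul1r// gt_eqF.
have -> : V^-1 * (rho k)^-1 ^+ s * 2 ^+ s * omega (hz k0) * Bm * (2 * l)^-1 ^+ (s - q) * M 0%N *
    (B * (l * rho k) ^+ s * decay k) =
  (V^-1 * Bm * M 0%N * B * (2 * l) ^+ q * decay k * omega (hz k0)) * ((rho k)^-1 ^+ s * rho k ^+ s).
  rewrite -E1 exprMn.
  move: ((rho k)^-1 ^+ s) (2 ^+ s) ((2 * l)^-1 ^+ (s - q)) (rho k ^+ s) (l ^+ s) => x1 x2 x3 x4 x5.
  by ring.
rewrite -[leRHS]mulr1; apply: ler_wpM2l => //.
by do ?[exact: ltW|apply: exprn_ge0|apply: mulr_ge0].
Qed.

Section expansion.
Variables (psi : Rn -> C^o) (K : set Rn) (mK : R).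
Hypothesis psi_test : test_in c M K psi.
Hypothesis cK : compact K.
Hypothesis KW : K `<=` nbhd_of W r.
Hypothesis KmK : K `<=` box mK.

Let sm : smooth psi. Proof. by case: psi_test. Qed.
Let sK : supported_in K psi. Proof. by case: psi_test. Qed.
Let clK : closed K. Proof. by apply: compact_closed => //; exact: norm_hausdorff. Qed.

Let psi_bound : exists l A, [/\ 0 < l, 0 <= A & tbound M psi l A].
Proof.
have [_ _] := psi_test; rewrite /for_class_d; case: (c) => [/(_ 1 ltr01)[A h]|[l l0 [A h]]].
  by exists 1, `|A|; split => //; apply: tbound_le h; rewrite ?ler_norm.
by exists l, `|A|; split => //; exact: (tbound_le M_gt0 (ltW l0) (lexx l) (ler_norm A) _ h).
Qed.

Local Notation coef k0 := (windowed_coef Phi N k0 (hz k0) psi).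

Lemma coef_pieces k0 k : coef k0 k * atom_value k0 k =
  \sum_(q < (p k).+1) cI (fun y => piece k0 k q y * partial_jet psi (nseq q (top k)) y).
Proof.
have [l [A [l0 A0 hA]]] := psi_bound.
rewrite (windowed_coefE M_gt0 HM1 step i0 N k0 (hz k0) sm clK sK KmK k l0 A0 hA).
have parts := integrate_by_parts M_gt0 HM1 step i0 N k0 (hz k0) sm clK sK KmK k (p k) l0 A0 hA.
set I0 := cI (fun y => windowed Phi k0 psi (top k) 0 y * _) in parts *.
have -> : I0 = (symb k)^-1 ^+ p k *
    cI (fun y => windowed Phi k0 psi (top k) (p k) y * wavelet N (hz k0) k y).
  (* Where the symbol vanishes so does the radius, and [p0] makes the order 0. *)
  rewrite parts mulrA -exprMn; have [s0|sn] := eqVneq (symb k) 0.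
    by rewrite p0 ?expr0 ?mul1r// -(cmod_symbol (R := R)) s0 cmod0.
  by rewrite mulVf// expr1n mul1r.
have [Bc Bc0 hBc] := chi_bound (n := n) step ltr01.
pose P q y := chi Phi k0 (nseq (p k - q) (top k)) y * wavelet N (hz k0) k y * partial_jet psi (nseq q (top k)) y.
have cbP q : cbs mK (Bc * 1 ^+ (p k - q) * M (p k - q)%N * (A * (l ^+ q * M q))) (P q).
  apply: cbs_cont => [|y|y ny].
  - apply: ccontM; last exact: (smooth_cjet sm _).1.
    by apply: ccontM; [exact: (cjet_chi step k0 _).1|exact: ccont_wavelet].
  - rewrite /P !cmodM cmod_wavelet mulr1; apply: ler_pM; rewrite ?cmod_ge0//.
    by have := hA (mi_pure q (top k)) y; rewrite mi_partialE mi_seq_pure mi_size_pure.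
  - by rewrite /P (partial_eq0 _ sm clK sK) ?mulr0// => /KmK.
have -> : cI (fun y => windowed Phi k0 psi (top k) (p k) y * wavelet N (hz k0) k y) =
    \sum_(q < (p k).+1) 'C(p k, q)%:R * cI (P q).
  transitivity (cI (fun y => \sum_(q < (p k).+1) 'C(p k, q)%:R * P q y)).
    congr cI; apply/funext => y; rewrite /windowed /leibniz mulr_suml.
    by apply: eq_bigr => q _; rewrite /P; ring.
  rewrite (cI_sum _ (fun q : 'I_(p k).+1 => cbsZ ('C(p k, q)%:R : C) (cbP q))).
  by apply: eq_bigr => q _; exact: cIZ (cbP q).
rewrite !mulr_sumr mulr_suml; apply: eq_bigr => q _.
have -> : (fun y => piece k0 k q y * partial_jet psi (nseq q (top k)) y) = fun y =>
   (((cube_volume (R := R) (n := n) N)^-1)%:C%C * (symb k)^-1 ^+ p k * 'C(p k, q)%:R * atom_value k0 k) * P q y.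
  by apply/funext => y; rewrite /piece /P; ring.
by rewrite (cIZ _ (cbP q)); ring.
Qed.

Let psi_near k0 y : chi Phi k0 [::] y * psi y != 0 -> near_W k0.
Proof.
move=> h; have chin : chi Phi k0 [::] y != 0 by apply: contraNN h => /eqP ->; rewrite mul0r.
have psin : psi y <> 0 by move=> E; move: h; rewrite E mulr0 eqxx.
have Ky : K y by apply: contrapT => nK; apply: psin; exact: (supported_in_eq0 sK).
have [w Ww [v vr wv]] := KW Ky.
exists w; split => // l; have h1 := chi_supp step chin l.
have h2 : `|v 0 l| <= r by rewrite (le_trans (coord_le_eucl_norm v l))// ltW.
rewrite !mxE; have -> : (k0 l)%:~R - w 0 l = v 0 l - (y 0 l - (k0 l)%:~R).
  by rewrite -wv !mxE; ring.
by rewrite (le_trans (ler_normB _ _))// -addrA; apply: lerD.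
Qed.

(** The Fourier series of the recentred cell, multiplied by the cutoff, is a series of test
    functions on which [f] acts term by term. For a cell away from [W] the product [chi * psi] is
    0. *)
Lemma chi_psi_functional k0 :
  lcs_carrier (test_space c M setT) (fun y => chi Phi k0 [::] y * psi y : C^o) /\
  f (fun y => chi Phi k0 [::] y * psi y) = csum (fun i => coef k0 (kap i) * atom_value k0 (kap i)).
Proof.
have [gk|nk] := pselect (near_W k0); last first.
  have -> : (fun y => chi Phi k0 [::] y * psi y) = 0.
    by apply/funext => y; apply/eqP; apply: contrapT => /negP/psi_near.
  have carr0 : lcs_carrier (test_space c M setT) (0 : Rn -> C^o).
    have tpsi : lcs_carrier (test_space c M setT) psi by apply/(test_spaceP c M_gt0); exists K.
    by have := test_space_lin M_gt0 0 0 tpsi tpsi; rewrite !scale0r addr0.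
  split => //; rewrite (linear_on_tests0 M_gt0 lin) -[LHS](csum0 (R := R)); apply: eq_csum => i.
  by rewrite /atom_value asboolF// mulr0.
set h := hz k0; have [Wh bh] := hzP gk.
have [_ _ hd] := psi_test.
have summ_d := windowed_coef_summ M_gt0 HM1 HM2 HM3 step i0 (ltn0Sn _ : (0 < N)%N) k0 h sm clK sK KmK kap_inj hd.
pose u x := chi Phi k0 [::] (x + h) * psi (x + h).
have u_supp x : ~ box m x -> u x = 0.
  move=> nx; apply/eqP; apply: contrapT => /negP un; apply: nx => l.
  have chin : chi Phi k0 [::] (x + h) != 0.
    by apply: contraNN un => /eqP E; rewrite /u E mul0r.
  have := chi_supp step chin l; have := bh l; rewrite !mxE => h1 h2.
  have -> : x 0 l = (x 0 l + h 0 l - (k0 l)%:~R) + ((k0 l)%:~R - h 0 l) by ring.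
  rewrite (le_trans (ler_normD _ _))//.
  have -> : m = (b + 1) + (r + b + 1) by rewrite /window; ring.
  exact: lerD.
have cu : ccont u.
  apply: (ccont_shift h (f := fun x => chi Phi k0 [::] x * psi x)); apply: ccontM.
    exact: (cjet_chi step k0 _).1.
  by have := (smooth_cjet sm [::]).1; rewrite partial_jet_nil.
have [Bu uB] : exists B, forall x, cmod (u x) <= B.
  have [l [A [l0 A0 hA]]] := psi_bound; have [Bc Bc0 hBc] := chi_bound (n := n) step ltr01.
  exists (Bc * 1 ^+ 0 * M 0%N * (A * (l ^+ 0 * M 0%N))) => x; rewrite cmodM.
  apply: ler_pM; rewrite ?cmod_ge0//; first exact: (hBc k0 0%N i0).
  have := hA (mi_pure 0 i0) (x + h); rewrite mi_partialE mi_seq_pure mi_size_pure.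
  by rewrite (_ : nseq 0 i0 = [::])// partial_jet_nil.
have [v [sv hv]] : exists v, summ v /\ forall i, cmod (fourier_coef N u (kap i)) <= v i.
  have [l [v [l0 sv hv]]] : exists l v, [/\ 0 < l, summ v &
      forall i, cmod (coef k0 (kap i)) * E (l^-1 * rho (kap i)) <= v i].
    move: summ_d; rewrite /for_class_d; case: (c) => [/(_ 1 ltr01)[v [sv hv]]|[l l0 [v [sv hv]]]].
      by exists 1, v.
    by exists l, v.
  exists (fun i => M 0%N * v i); split; first by apply: summZ => //; exact: ltW.
  move=> i; apply: (@le_trans _ _ (M 0%N * (cmod (coef k0 (kap i)) * E (l^-1 * rho (kap i))))); last first.
    by rewrite ler_pM2l.
  have rl : 0 <= l^-1 * rho (kap i) by rewrite mulr_ge0 ?fradius_ge0// invr_ge0 ltW.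
  have := assoc_ge M_gt0 HM3 0 rl; rewrite expr0 => h1.
  by rewrite mulrCA ler_peMr ?cmod_ge0.
(* Three zones around [h]: on the box [m] the cutoff is 1; in the rest of the open cube the series
   sums to 0, whatever the cutoff; elsewhere both sides vanish. *)
have pt x : chi Phi k0 [::] x * psi x = csum (fun i => coef k0 (kap i) * atomN (kap i) [::] (x - h)).
  have uE : u (x - h) = chi Phi k0 [::] x * psi x by rewrite /u subrK.
  rewrite -uE; have [inL|outL] := pselect (forall l, `|(x - h) 0 l| < L).
    have finv := fourier_inversion (ltn0Sn _ : (0 < N)%N) kap_inj kap_surj cu uB u_supp
      (_ : m <= L) sv hv inL.
    have {}finv := finv (ltW (le_lt_trans _ mL)); rewrite finv; last by rewrite -addrA lerDl addr_ge0.
    have [bm|nbm] := pselect (box m (x - h)).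
      by apply: eq_csum => i; rewrite (atom_box step N (kap i) bm).
    pose Th : C := (\prod_l bump Phi (m + 1) (m + b) 0 ((x - h) 0 l))%:C%C.
    have -> : csum (fun i => coef k0 (kap i) * atomN (kap i) [::] (x - h)) =
        csum (fun i => Th * (coef k0 (kap i) * echar N (kap i) (x - h))).
      by apply: eq_csum => i; rewrite atomE; ring.
    have bnd i : cmod (coef k0 (kap i) * echar N (kap i) (x - h)) <= v i.
      by rewrite cmodM cmod_echar mulr1; exact: hv.
    rewrite (csumZ Th sv bnd).
    have <- : u (x - h) = csum (fun i => coef k0 (kap i) * echar N (kap i) (x - h)).
      by apply: finv; rewrite -addrA lerDl addr_ge0.
    by rewrite u_supp// mulr0.
  have [l hl] : exists l, ~ (`|(x - h) 0 l| < L) by exact/existsNP.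
  have big : L <= `|(x - h) 0 l| by rewrite leNgt; apply/negP.
  rewrite u_supp; last first.
    by move=> /(_ l) hm; move: (le_trans big hm) mL b_ge0; lra.
  rewrite -(csum0 (R := R)); apply: eq_csum => i.
  rewrite (atom_eq0 step N (kap i) m_ge0) ?mulr0// => /(_ l) hm.
  by move: (le_lt_trans (le_trans big hm) mL); rewrite ltxx.
have jD i : cjet (fun s x => coef k0 (kap i) * atomN (kap i) s (x - h)).
  by apply: cjetZ; exact: (cjet_shift (- h) (cjet_atom step N m (kap i))).
have D0 i x : ~ box ((m + b + 1) + abs_sum (- h)) x -> coef k0 (kap i) * atomN (kap i) [::] (x - h) = 0.
  move=> nx; rewrite (atom_eq0 step N (kap i) m_ge0) ?mulr0// => bx; apply: nx.
  exact: box_shift bx.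
(* The bounds [E (rho k / l)] of the atoms are absorbed by the factor [E] kept in the sum of the
   coefficients. *)
have hD : for_class_d c (fun l => exists v, summ v /\
    forall i, jbound M (fun s x => coef k0 (kap i) * atomN (kap i) s (x - h)) l (v i)).
  apply: (@for_class_d_scale _ _ _ _ 2) summ_d => // l l0 [v' [sv' hv']].
  have [B B0 hB] := atom_jbound M_gt0 HM1 HM3 step i0 N m l0.
  exists (fun i => B * v' i); split; first by apply: summZ => //; exact: ltW.
  move=> i; have := jbound_shift (- h) (jboundZ (coef k0 (kap i)) (hB (kap i))).
  apply: jbound_le => //; first by rewrite mulr_ge0// ltW.
  by rewrite mulrCA ler_pM2l// [rho _ / l]mulrC; exact: hv'.
have [tphi fE _] := functional_csum M_gt0 f_ultra (@subsetT _ _) jD D0 hD.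
have -> : (fun y => chi Phi k0 [::] y * psi y) =
    fun x => csum (fun i => coef k0 (kap i) * atomN (kap i) [::] (x - h)).
  by apply/funext => x; exact: pt.
split.
  by apply/(test_spaceP c M_gt0); exists (box (m + b + 1 + abs_sum (- h))); split => //; exact: box_compact.
rewrite fE; apply: eq_csum => i; rewrite /atom_value asboolT//.
rewrite -(linear_on_testsZ M_gt0 _ lin)//.
apply/(test_spaceP c M_gt0); exists (box (m + b + 1 + abs_sum (- h))); split => //.
  exact: box_compact.
apply: (test_in_jet (cjet_shift (- h) (cjet_atom step N m (kap i)))).
  move=> x nx; apply: (atom_eq0 step N (kap i) m_ge0) => bx; apply: nx; exact: box_shift bx.
have P l : 0 < l -> exists A, jbound M (fun s x => atomN (kap i) s (x - h)) l A.
  move=> l0; have l2 : 0 < l / 2 by rewrite divr_gt0.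
  have l2E : 2 * (l / 2) = l by rewrite mulrC divfK.
  have [B' B'0 hB'] := atom_jbound M_gt0 HM1 HM3 step i0 N m l2; rewrite l2E in hB'.
  by exists (B' * E (rho (kap i) / (l / 2))); exact: jbound_shift.
rewrite /for_class_d; case: (c) => [l l0|]; first exact: P.
by exists 1 => //; exact: P.
Qed.

Lemma linear_on_tests_sum (I : Type) (s : seq I) (g : I -> Rn -> C^o) :
  (forall i, lcs_carrier (test_space c M setT) (g i)) ->
  lcs_carrier (test_space c M setT) (\sum_(i <- s) g i) /\
  f (\sum_(i <- s) g i) = \sum_(i <- s) f (g i).
Proof.
move=> hg; elim: s => [|i s [IH1 IH2]].
  rewrite !big_nil (linear_on_tests0 M_gt0 lin); split => //.
  have tpsi : lcs_carrier (test_space c M setT) psi by apply/(test_spaceP c M_gt0); exists K.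
  by have := test_space_lin M_gt0 0 0 tpsi tpsi; rewrite !scale0r addr0.
rewrite !big_cons; split.
  by have := test_space_lin M_gt0 1 1 (hg i) IH1; rewrite !scale1r.
by have := lin 1 (hg i) IH1; rewrite scale1r mul1r IH2.
Qed.

(** The first [T] cells include all those meeting [K], so the partition sums to 1 there and [psi] is
    a finite sum of localised functions. *)
Lemma functional_pieces (T : nat) :
  (forall j y, (T <= j)%N -> K y -> exists l, b + 1 < `|y 0 l - (kap j l)%:~R|) ->
  f psi = \sum_(j < T) csum (fun i => \sum_(q < (p (kap i)).+1)
    cI (fun y => piece (kap j) (kap i) q y * partial_jet psi (nseq q (top (kap i))) y)).
Proof.
move=> hT.
have psiE : psi = \sum_(j < T) (fun y => chi Phi (kap j) [::] y * psi y : C^o).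
  apply/funext => y; rewrite sum_functions -mulr_suml.
  have [Ky|nK] := pselect (K y); last by rewrite (supported_in_eq0 sK nK) mulr0.
  have := @chi_partition R n M b Phi step (map kap (iota 0 T)) y.
  have iE : iota 0 T = index_iota 0 T by rewrite /index_iota subn0.
  rewrite big_map [X in \sum_(_ <- X) _]iE big_mkord => ->; rewrite ?mul1r//.
    by rewrite map_inj_uniq ?iota_uniq.
  move=> k kn; have [j jk] := kap_surj k; rewrite -jk; apply: hT => //.
  rewrite leqNgt; apply: contra kn => jT; rewrite -jk; apply/mapP; exists j => //.
  by rewrite mem_iota.
rewrite [LHS](congr1 f psiE).
have [_ ->] := linear_on_tests_sum (index_enum 'I_T) (fun j => (chi_psi_functional (kap (val j))).1).
apply: eq_bigr => j _; rewrite (chi_psi_functional (kap j)).2; apply: eq_csum => i.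
exact: coef_pieces.
Qed.

End expansion.

End synthesis.

(** * The densities *)

Section finite_csum.
Context {R : realType}.
Local Notation C := R[i].

Lemma csum_finite (a : nat -> C) T : (forall j, (T <= j)%N -> a j = 0) -> csum a = \sum_(j < T) a j.
Proof.
move=> a0; pose v j := cmod (a j).
have hv m : \sum_(j < m) v j <= \sum_(j < T) v j.
  have [mT|Tm] := leqP m T.
    by rewrite -(subnKC mT) big_split_ord/= lerDl sumr_ge0// => i _; exact: cmod_ge0.
  rewrite -(subnKC (ltnW Tm)) big_split_ord/= gerDl big1// => i _.
  by rewrite /v a0 ?cmod0// leq_addr.
have sv : summ v by split=> [j|]; [exact: cmod_ge0|exists (\sum_(j < T) v j)].
apply/eqP; rewrite -subr_eq0; apply/eqP; apply: cmod_eq0; apply/eqP.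
rewrite eq_le cmod_ge0 andbT (le_trans (csum_tail T sv (fun i => lexx _)))//.
by rewrite /tail subr_le0; exact: tsum_le.
Qed.

Lemma ccont_local (T : topologicalType) (f : T -> C) :
  (forall x : T, exists g, ccont g /\ \forall y \near x, f y = g y) -> ccont f.
Proof.
move=> h; apply/ccont_cmodP => x e e0; have [g [/ccont_cmodP cg fg]] := h x.
have fx : f x = g x by exact: nbhs_singleton fg.
by apply: filterS2 (cg x e e0) fg => y h1 ->; rewrite fx.
Qed.

Lemma sum_indicator (I : eqType) (s : seq I) (x : I) (z : C) : uniq s ->
  \sum_(y <- s) (if y == x then z else 0) = if x \in s then z else 0.
Proof.
move=> us; case: ifPn => xs.
  rewrite (bigD1_seq x)//= eqxx big1 ?addr0// => y /negPf -> //.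
rewrite big_seq big1// => y ys; case: eqP => // yx; by rewrite yx (negPf xs) in ys.
Qed.

End finite_csum.

Section representation.
Context {R : realType} {n : nat} (c : ultra_class) (M : nat -> R).
Hypothesis M_gt0 : forall p, 0 < M p.
Local Notation C := R[i].
Local Notation Rn := 'rV[R]_n.
Local Notation Zn := {ffun 'I_n -> int}.
Local Notation cI := (@integral_Rn R n setT).
Variables (f : (Rn -> C^o) -> C^o) (W : set Rn) (omega : Rn -> R).
Hypothesis f_ultra : lcs_carrier (ultradistributions c M setT) f.
Hypothesis omega_gt0 : forall x, 0 < omega x.
Hypothesis omega_sup : Linfty_loc (fun y : Rn =>
  ereal_sup [set (omega (y + x) / omega x)%:E | x in [set: Rn]]).
Variable i0 : 'I_n.
Variable kap : nat -> Zn.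
Hypothesis kap_inj : injective kap.
Variables (r b : R).
Hypothesis r_gt0 : 0 < r.
Hypothesis b_ge0 : 0 <= b.
Local Notation Om := (nbhd_of W r).
Variables (top : Zn -> 'I_n) (p : Zn -> nat) (decay : Zn -> R) (hz : Zn -> Rn) (near : Zn -> Prop).
Hypothesis decay_summ : summ (fun i => decay (kap i)).
Hypothesis hz_near : forall k, near k -> box (r + b + 1) (lattice_point k - hz k).
Variable P : Zn -> Zn -> nat -> Rn -> C.
Hypothesis ccont_P : forall k0 k q, ccont (P k0 k q).
Hypothesis P_eq0 : forall k0 k q y, ~ (near k0 /\ box (b + 1) (y - lattice_point k0)) ->
  P k0 k q y = 0.
Hypothesis P_bound : for_class_l c (fun l => exists2 B : R, 0 < B & forall k0 k q y,
  (q <= p k)%N -> cmod (P k0 k q y) <= B * (l ^+ q / M q) * decay k * omega (hz k0)).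
Hypothesis f_P : forall psi K (mK : R), test_in c M K psi -> compact K -> K `<=` Om -> K `<=` box mK ->
  forall T, (forall j y, (T <= j)%N -> K y -> exists l, b + 1 < `|y 0 l - (kap j l)%:~R|) ->
  f psi = \sum_(j < T) csum (fun i => \sum_(q < (p (kap i)).+1)
    cI (fun y => P (kap j) (kap i) q y * partial_jet psi (nseq q (top (kap i))) y)).

(** At most one [q] contributes, namely [mi_size a] when [a] is pure along the axis of [k]. The sign
    cancels the one in [ultra_derivative]. *)
Definition selected (a : multi_index n) (k0 k : Zn) (y : Rn) : C :=
  \sum_(q < (p k).+1) (if a == mi_pure q (top k) then (-1) ^+ q * P k0 k q y else 0).

Definition cell_part a k0 (y : Rn) : C := csum (fun i => selected a k0 (kap i) y).

(** The series over frequencies inside each term converges absolutely; this outer one over cells is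
    locally a finite sum. *)
Definition density a (y : Rn) : C := csum (fun j => cell_part a (kap j) y).

Let W0 : R := tsum (fun i => decay (kap i)).

Let W0_ge0 : 0 <= W0. Proof. exact: tsum_ge0. Qed.

Let selected_bound (l B : R) : 0 < l -> 0 < B -> (forall k0 k q y, (q <= p k)%N ->
    cmod (P k0 k q y) <= B * (l ^+ q / M q) * decay k * omega (hz k0)) ->
  forall a k0 i y, cmod (selected a k0 (kap i) y) <=
    (B * (l ^+ mi_size a / M (mi_size a)) * omega (hz k0)) * decay (kap i).
Proof.
move=> l0 B0 hB a k0 i y; set k := kap i.
have d0 : 0 <= decay k by case: decay_summ => h _; exact: h.
set X := _ * decay k.
have X0 : 0 <= X.
  by rewrite mulr_ge0// ltW// !mulr_gt0 ?invr_gt0 ?exprn_gt0.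
apply: le_trans (cmod_sum _ _ _) _.
apply: (@le_trans _ _ (\sum_(q < (p k).+1) (if val q == mi_size a then X else 0))).
  apply: ler_sum => q _; case: eqP => [aE|_]; last by rewrite cmod0; case: ifP.
  have -> : mi_size a = q by rewrite aE mi_size_pure.
  rewrite eqxx cmodM cmodX cmodN cmod1 expr1n mul1r (le_trans (hB k0 k q y _))//.
    by rewrite -ltnS.
  by rewrite /X aE mi_size_pure mulrAC.
have [ap|pa] := ltnP (mi_size a) (p k).+1.
  rewrite (bigD1 (Ordinal ap))//= eqxx big1 ?addr0// => q.
  by rewrite -val_eqE /= => /negPf ->.
rewrite big1// => q _; case: eqP => // qa.
by have := ltn_ord q; rewrite qa ltnNge pa.
Qed.

Let some_bound : exists l B : R, [/\ 0 < l, 0 < B & forall k0 k q y, (q <= p k)%N ->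
    cmod (P k0 k q y) <= B * (l ^+ q / M q) * decay k * omega (hz k0)].
Proof.
move: P_bound; rewrite /for_class_l; case: c => [[l l0 [B B0 h]]|/(_ 1 ltr01)[B B0 h]].
  by exists l, B.
by exists 1, B.
Qed.

Let ccont_selected a k0 k : ccont (selected a k0 k).
Proof.
apply: ccont_sum => q; case: (a == _); last exact: ccont_cst.
by apply: ccontM; [exact: ccont_cst|exact: ccont_P].
Qed.

Let ccont_cell a k0 : ccont (cell_part a k0).
Proof.
have [l [B [l0 B0 hB]]] := some_bound.
set X := B * (l ^+ mi_size a / M (mi_size a)) * omega (hz k0).
have X0 : 0 <= X by rewrite ltW// !mulr_gt0 ?invr_gt0 ?exprn_gt0.
apply: (ccont_csum (summZ X0 decay_summ)) => i; last exact: ccont_selected.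
by move=> x; exact: (selected_bound l0 B0 hB).
Qed.

Let selected_eq0 a k0 k (y : Rn) : ~ (near k0 /\ box (b + 1) (y - lattice_point k0)) ->
  selected a k0 k y = 0.
Proof. by move=> h; apply: big1 => q _; case: ifP => // _; rewrite P_eq0// mulr0. Qed.

Let cell_eq0 a k0 (y : Rn) : ~ (near k0 /\ box (b + 1) (y - lattice_point k0)) ->
  cell_part a k0 y = 0.
Proof. by move=> h; rewrite -[RHS](csum0 (R := R)); apply: eq_csum => i; exact: selected_eq0. Qed.

(** A cell reaching the box has lattice weight at least [w], while the weights are summable along
    the enumeration. *)
Lemma cells_finite (m : R) : exists T, forall j (y : Rn), (T <= j)%N -> box m y ->
  exists l, b + 1 < `|y 0 l - (kap j l)%:~R|.
Proof.
have sw : summ (fun j => lattice_weight (R := R) (kap j)).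
  split=> [i|]; first exact: lattice_weight_ge0.
  exists (4 ^+ n) => j; rewrite -(big_mkord xpredT (fun i => lattice_weight (kap i))).
  rewrite /index_iota subn0 -(big_map kap xpredT (fun k => lattice_weight k)).
  by apply: lattice_weight_sum; rewrite map_inj_uniq ?iota_uniq.
pose Q := `|m| + b + 1.
have Q1 : 0 <= Q by rewrite /Q -addrA addr_ge0// addr_ge0.
have Q0 : 0 < 1 + Q by rewrite ltr_pwDl.
pose w : R := (((1 + Q) ^+ 2)^-1) ^+ n.
have w0 : 0 < w by rewrite exprn_gt0// invr_gt0 exprn_gt0.
have w2 : 0 < w / 2 by rewrite divr_gt0.
move/cvgr0Pnorm_le/(_ _ w2) : (tail_cvg0 sw) => [T _ hT].
exists T => j y Tj my; apply: contrapT => nl.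
have close l : `|y 0 l - (kap j l)%:~R| <= b + 1.
  by rewrite leNgt; apply/negP => h; apply: nl; exists l.
have wj : w <= lattice_weight (R := R) (kap j).
  rewrite /w -[n in _ ^+ n](card_ord n) -prodr_const; apply: ler_prod => l _.
  rewrite invr_ge0 exprn_ge0 ?(ltW Q0)//= lef_pV2 ?posrE ?exprn_gt0 ?ltr_wpDr//.
  rewrite lerXn2r ?nnegrE ?(ltW Q0) ?addr_ge0// lerD2l.
  have -> : (absz (kap j l))%:R = `|(kap j l)%:~R| :> R by rewrite -intr_norm -abszE.
  have -> : (kap j l)%:~R = y 0 l - (y 0 l - (kap j l)%:~R) :> R by ring.
  rewrite (le_trans (ler_normB _ _))// /Q -addrA; apply: lerD => //.
  by rewrite (le_trans (my l))// ler_norm.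
have := hT j Tj; rewrite tailS => /(le_trans (ler_norm _)).
have := tail_ge0 j.+1 sw; move: wj w0; move: (tail _ j.+1) => t; lra.
Qed.

Let density_finite (m : R) T : (forall j (y : Rn), (T <= j)%N -> box m y ->
    exists l, b + 1 < `|y 0 l - (kap j l)%:~R|) ->
  forall a y, box m y -> density a y = \sum_(j < T) cell_part a (kap j) y.
Proof.
move=> hT a y my; apply: csum_finite => j Tj; apply: cell_eq0 => -[_ near_y].
have [l] := hT j y Tj my; rewrite ltNge => /negP; apply.
by have := near_y l; rewrite !mxE.
Qed.

Lemma ccont_density a : ccont (density a).
Proof.
apply: ccont_local => x; pose m := abs_sum x + 1; have [T hT] := cells_finite m.
exists (fun y => \sum_(j < T) cell_part a (kap j) y); split.
  by apply: ccont_sum => j; exact: ccont_cell.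
apply/nbhs_boxP; exists 1 => // y hy; apply: (density_finite hT) => l.
have -> : y 0 l = x 0 l + (y 0 l - x 0 l) by ring.
by rewrite (le_trans (ler_normD _ _))// lerD// coord_le_abs_sum.
Qed.

(** Recentred at the integer part of [y], each cell reaching [y] has lattice weight at least the
    inverse of [((b + 3) ^+ 2) ^+ n], and the total weight is at most [4 ^+ n]. *)
Let count_cells : exists2 Q : R, 0 < Q & forall T (y : Rn),
  \sum_(j < T) (if `[< box (b + 1) (y - lattice_point (kap j)) >] then 1 else 0) <= Q.
Proof.
exists (((b + 3) ^+ 2) ^+ n * 4 ^+ n).
  by rewrite mulr_gt0// !exprn_gt0//; move: b_ge0; lra.
move=> T y; pose z0 : Zn := [ffun l => Num.floor (y 0 l)].
have b3 : 0 <= b + 3 by move: b_ge0; lra.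
apply: (@le_trans _ _ (\sum_(j < T) ((b + 3) ^+ 2) ^+ n * lattice_weight (R := R) (kap j - z0))).
  apply: ler_sum => j _; case: asboolP => [near_y|_]; last first.
    by rewrite mulr_ge0 ?lattice_weight_ge0// !exprn_ge0.
  rewrite -[n in _ ^+ n * _](card_ord n) -prodr_const /lattice_weight -big_split/=.
  rewrite -[leLHS](@big1_eq _ 1 *%R 'I_n (index_enum 'I_n) (mem 'I_n)).
  apply: ler_prod => l _; rewrite ler01/= ler_pdivlMr ?exprn_gt0 ?ltr_wpDr// mul1r.
  rewrite lerXn2r ?nnegrE ?addr_ge0//.
  have -> : (absz ((kap j - z0)%R l))%:R = `|((kap j - z0) l)%:~R| :> R by rewrite -intr_norm -abszE.
  have -> : ((kap j - z0) l)%:~R = (y 0 l - (z0 l)%:~R) - (y 0 l - (kap j l)%:~R) :> R.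
    by rewrite !ffunE intrB; ring.
  have h1 := near_y l; rewrite !mxE in h1.
  have h2 : `|y 0 l - (z0 l)%:~R| <= 1.
    rewrite ffunE; have := floor_itv (y 0 l); move=> /andP[h2 h3].
    by rewrite ger0_norm ?subr_ge0// lerBlDr addrC -[1]/(1%:~R) -intrD ltW.
  have := le_trans (ler_normB _ _) (lerD h2 h1); lra.
rewrite -mulr_sumr ler_pM2l; last by rewrite !exprn_gt0//; move: b_ge0; lra.
rewrite -(big_mkord xpredT (fun j => lattice_weight (kap j - z0))).
rewrite /index_iota subn0 -(big_map (fun j => kap j - z0) xpredT (fun k => lattice_weight k)).
by apply: lattice_weight_sum; rewrite map_inj_uniq ?iota_uniq// => i j /addIr /kap_inj.
Qed.

(** The frequencies of one cell contribute the total decay [W0], the number of active cells is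
    bounded, and [omega] at [hz] is compared with [omega x] through a box of half-side
    [(b + 1) + (r + b + 1)]. *)
Lemma density_bound : for_class_l c (fun l => exists2 B : R, 0 < B & forall (x : Rn) a,
  cmod (density a x) <= B * (l ^+ mi_size a / M (mi_size a)) * omega x).
Proof.
apply: for_class_l_sub P_bound => l l0 [B B0 hB].
have rb : 0 < (b + 1) + (r + b + 1) by move: b_ge0 r_gt0; lra.
have [D D0 hD] := omega_translate omega_gt0 omega_sup rb.
have [Q Q0 hQ] := count_cells.
have W1 : 0 < W0 + 1 by rewrite ltr_wpDl.
exists (B * (W0 + 1) * D * Q); first by rewrite !mulr_gt0.
move=> x a; have [T hT] := cells_finite (abs_sum x).
rewrite (density_finite hT a (fun l => coord_le_abs_sum x l)).
pose la := l ^+ mi_size a / M (mi_size a).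
have la0 : 0 < la by rewrite divr_gt0// exprn_gt0.
have om := omega_gt0 x.
have V0 : 0 <= B * (W0 + 1) * D * la * omega x by apply/ltW; do 4 apply: mulr_gt0 => //.
apply: le_trans (cmod_sum _ _ _) _.
apply: (@le_trans _ _ (\sum_(j < T) B * (W0 + 1) * D * la * omega x *
   (if `[< box (b + 1) (x - lattice_point (kap j)) >] then 1 else 0))); last first.
  rewrite -mulr_sumr -/la.
  have -> : B * (W0 + 1) * D * Q * la * omega x = B * (W0 + 1) * D * la * omega x * Q by ring.
  by apply: ler_wpM2l => //; exact: hQ.
apply: ler_sum => j _.
have [[nj bj]|nn] := pselect (near (kap j) /\ box (b + 1) (x - lattice_point (kap j))); last first.
  rewrite cell_eq0// cmod0; case: ifP => _; last by rewrite mulr0.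
  by rewrite mulr1.
rewrite asboolT// mulr1.
have X0 : 0 <= B * la * omega (hz (kap j)).
  by apply: mulr_ge0; [apply: mulr_ge0; apply: ltW|apply: ltW].
apply: le_trans (csum_bound (summZ X0 decay_summ) (fun i => selected_bound l0 B0 hB a (kap j) i x)) _.
rewrite tsumZ// -/W0.
have oj : omega (hz (kap j)) <= D * omega x.
  rewrite -[hz (kap j)](subrK x); apply: hD => i; rewrite !mxE.
  have h1 := bj i; have h2 := hz_near nj i; rewrite !mxE in h1 h2.
  have -> : hz (kap j) 0 i - x 0 i = - (x 0 i - (kap j i)%:~R) - ((kap j i)%:~R - hz (kap j) 0 i) by ring.
  by rewrite (le_trans (ler_normB _ _))// normrN lerD.
apply: (@le_trans _ _ (B * la * (D * omega x) * W0)).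
  by apply: ler_wpM2r => //; apply: ler_wpM2l => //; apply: mulr_ge0; apply: ltW.
have -> : B * (W0 + 1) * D * la * omega x = B * la * (D * omega x) * (W0 + 1) by ring.
apply: ler_wpM2l; last by rewrite lerDl.
by do ?[exact: ltW|apply: mulr_ge0].
Qed.

Section on_test_functions.
Variables (psi : Rn -> C^o) (K : set Rn) (mK : R) (T : nat).
Hypothesis tpsi : test_in c M K psi.
Hypothesis cK : compact K.
Hypothesis KO : K `<=` Om.
Hypothesis KmK : K `<=` box mK.
Hypothesis hT : forall j y, (T <= j)%N -> box mK y -> exists l, b + 1 < `|y 0 l - (kap j l)%:~R|.
Variables (l l' B A : R).
Hypothesis l_gt0 : 0 < l.
Hypothesis l'_gt0 : 0 < l'.
Hypothesis ll' : l * l' = 4^-1.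
Hypothesis B_gt0 : 0 < B.
Hypothesis hB : forall k0 k q y, (q <= p k)%N ->
  cmod (P k0 k q y) <= B * (l ^+ q / M q) * decay k * omega (hz k0).
Hypothesis A_gt0 : 0 < A.
Hypothesis hA : tbound M psi l' A.

Let sm : smooth psi. Proof. by case: tpsi. Qed.
Let sK : supported_in K psi. Proof. by case: tpsi. Qed.
Let clK : closed K. Proof. by apply: compact_closed => //; exact: norm_hausdorff. Qed.

Let decay_ge0 i : 0 <= decay (kap i). Proof. by case: decay_summ => h _; exact: h. Qed.

Let jet a := partial_jet psi (mi_seq a).

Let ccont_jet a : ccont (jet a). Proof. exact: (smooth_cjet sm _).1. Qed.

Let jet_eq0 a x : ~ K x -> jet a x = 0. Proof. exact: partial_eq0. Qed.

Let jet_bound a x : cmod (jet a x) <= A * (l' ^+ mi_size a * M (mi_size a)).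
Proof. exact: hA. Qed.

Let cbs_jet a (F : Rn -> C) (D : R) : ccont F -> (forall x, cmod (F x) <= D) ->
  cbs mK (D * (A * (l' ^+ mi_size a * M (mi_size a)))) (fun x => F x * jet a x).
Proof.
move=> cF FD; apply: cbs_cont; first by apply: ccontM.
  by move=> x; rewrite cmodM ler_pM ?cmod_ge0.
by move=> x nx; rewrite jet_eq0 ?mulr0// => /KmK.
Qed.

Let moment j i q := cI (fun y => P (kap j) (kap i) q y * partial_jet psi (nseq q (top (kap i))) y).

Let jet_pure q i : partial_jet psi (nseq q i) = jet (mi_pure q i).
Proof. by rewrite /jet mi_seq_pure. Qed.

Let V j : R := 2 * vol (n := n) mK * (B * omega (hz (kap j))).

Let V_ge0 j : 0 <= V j.
Proof. by rewrite /V !mulr_ge0 ?vol_ge0// ltW. Qed.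

(** Since [l * l' = 1 / 4], the values of [M] cancel and leave [4^-1 ^+ q]: one factor [2^-1 ^+ q]
    ensures summation over [q], the other smallness beyond the order [Q]. *)
Let moment_bound j i q : (q <= p (kap i))%N ->
  cmod (moment j i q) <= V j * A * decay (kap i) * 4^-1 ^+ q.
Proof.
move=> qp; rewrite /moment jet_pure.
have := cI_bound (cbs_jet (mi_pure q (top (kap i))) (ccont_P (kap j) (kap i) q)
  (fun y => hB (kap j) y qp)).
rewrite mi_size_pure => /le_trans; apply.
rewrite -ll' exprMn /V le_eqVlt; apply/orP; left; apply/eqP.
have Mq : M q != 0 by rewrite gt_eqF.
by field.
Qed.

Let partial_moments (S : pred nat) j i : cmod (\sum_(q < (p (kap i)).+1 | S q) moment j i q) <=
  V j * A * decay (kap i) * \sum_(q < (p (kap i)).+1 | S q) 4^-1 ^+ q.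
Proof.
rewrite mulr_sumr; apply: le_trans (cmod_sum _ _ _) _.
by apply: ler_sum => q _; apply: moment_bound; rewrite -ltnS.
Qed.

Let quarter_sum (Q N : nat) : \sum_(q < N | (Q < q)%N) 4^-1 ^+ q <= 2 * 2^-1 ^+ Q :> R.
Proof.
have h2 (m : nat) : \sum_(q < m) 2^-1 ^+ q = 2 - 2 * 2^-1 ^+ m :> R.
  elim: m => [|m IH]; first by rewrite big_ord0 expr0 mulr1 subrr.
  by rewrite big_ord_recr/= IH exprS; field.
apply: (@le_trans _ _ (\sum_(q < N) 2^-1 ^+ Q * 2^-1 ^+ q)).
  rewrite big_mkcond; apply: ler_sum => q _; case: ifPn => [Qq|_]; last by rewrite mulr_ge0.
  have -> : 4^-1 = 2^-1 * 2^-1 :> R by field.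
  rewrite exprMn; apply: ler_wpM2r => //; apply: ler_wiXn2l => //; last exact: ltnW.
  by rewrite invf_le1// ler1n.
rewrite -mulr_sumr h2 mulrC; apply: ler_wpM2r; first by rewrite exprn_ge0.
by rewrite gerBl mulr_ge0.
Qed.

Let quarter_sum_le2 (S : pred nat) N : \sum_(q < N | S q) 4^-1 ^+ q <= 3 :> R.
Proof.
apply: (@le_trans _ _ (\sum_(q < N) 4^-1 ^+ q)).
  by rewrite big_mkcond; apply: ler_sum => q _; case: ifP => // _; rewrite exprn_ge0.
case: N => [|N]; first by rewrite big_ord0.
rewrite big_ord_recl expr0.
have := quarter_sum 0 N.+1; rewrite expr0 mulr1 big_mkcond big_ord_recl/= add0r => h.
have -> : 3 = 1 + 2 :> R by ring.
by rewrite lerD2l.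
Qed.

(** Both sums commute with the integral: the one over cells is finite on [K], the one over
    frequencies is absolutely convergent. *)
Lemma derivative_formula a : ultra_derivative Om a (density a) psi =
  \sum_(j < T) csum (fun i => \sum_(q < (p (kap i)).+1 | a == mi_pure q (top (kap i))) moment j i q).
Proof.
rewrite /ultra_derivative integral_Rn_supp; last first.
  by move=> x nO; rewrite mi_partialE [partial_jet _ _ _]jet_eq0 ?mulr0// => /KO.
have -> : (fun x => density a x * mi_partial a psi x) =
    fun x => \sum_(j < T) (cell_part a (kap j) x * jet a x).
  apply/funext => x; rewrite mi_partialE -/(jet a x) -mulr_suml.
  have [Kx|nK] := pselect (K x); last by rewrite jet_eq0// !mulr0.
  by rewrite (density_finite hT)//; exact: KmK.
pose la := l ^+ mi_size a / M (mi_size a).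
pose D j : R := B * la * omega (hz (kap j)).
have D0 j : 0 <= D j.
  by rewrite /D /la !mulr_ge0 ?invr_ge0 ?exprn_ge0// ltW.
have sel j i y : cmod (selected a (kap j) (kap i) y) <= D j * decay (kap i).
  exact: (selected_bound l_gt0 B_gt0 hB).
have sD j : summ (fun i => D j * decay (kap i)) by apply: summZ.
have cell j y : cmod (cell_part a (kap j) y) <= D j * W0.
  by rewrite /W0 -tsumZ//; apply: csum_bound => // i; exact: sel.
rewrite (cI_sum _ (fun j : 'I_T => cbs_jet a (ccont_cell a (kap j)) (cell j))) mulr_sumr.
apply: eq_bigr => j _.
pose g := A * (l' ^+ mi_size a * M (mi_size a)).
have g0 : 0 <= g by rewrite /g !mulr_ge0 ?exprn_ge0// ltW.
have E : (fun x => cell_part a (kap j) x * jet a x) =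
    fun x => csum (fun i => selected a (kap j) (kap i) x * jet a x).
  by apply/funext => x; rewrite (csumZr _ (sD j)).
have cbE := cbs_jet a (ccont_cell a (kap j)) (cell j).
rewrite E in cbE *; have [m1 m2 _ _] := cbE.
have sg : summ (fun i => D j * decay (kap i) * g).
  by under eq_fun do rewrite mulrC; exact: summZ.
have cb i := cbs_jet a (ccont_selected a (kap j) (kap i)) (sel j i).
have v0 : 0 <= 2 * vol (n := n) mK by rewrite mulr_ge0 ?vol_ge0.
rewrite (cI_csum sg cb)//.
apply: etrans (esym (csumZ ((-1) ^+ mi_size a) (summZ v0 sg) (fun i => cI_bound (cb i)))) _.
apply: eq_csum => i; set k := kap i.
have -> : (fun x => selected a (kap j) k x * jet a x) =
    fun x => \sum_(q < (p k).+1) ((if a == mi_pure q (top k) then (-1) ^+ q * P (kap j) k q x else 0)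
      * jet a x).
  by apply/funext => x; rewrite mulr_suml.
have cq (q : 'I_(p k).+1) : cbs mK (B * (l ^+ q / M q) * decay k * omega (hz (kap j)) * g)
    (fun x => (if a == mi_pure q (top k) then (-1) ^+ q * P (kap j) k q x else 0) * jet a x).
  have qp : (q <= p k)%N by rewrite -ltnS.
  apply: cbs_jet.
    by case: (a == _); [apply: ccontM; [exact: ccont_cst|exact: ccont_P]|exact: ccont_cst].
  move=> x; apply: le_trans (hB (kap j) x qp); case: ifP => _; last by rewrite cmod0 cmod_ge0.
  by rewrite cmodM cmodX cmodN cmod1 expr1n mul1r.
rewrite (cI_sum _ cq) mulr_sumr [RHS]big_mkcond; apply: eq_bigr => q _.
case: eqP => [aE|_]; last first.
  by under [X in cI X]eq_fun do rewrite mul0r; rewrite cI0 mulr0.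
have qp : (q <= p k)%N by rewrite -ltnS.
under [X in cI X]eq_fun do rewrite -mulrA.
rewrite (cIZ _ (cbs_jet a (ccont_P (kap j) k q) (fun y => hB (kap j) y qp))).
by rewrite mulrA aE mi_size_pure -exprMn mulrNN mulr1 expr1n mul1r /moment jet_pure.
Qed.

(** Each moment belongs to exactly one pure multi-index; as [s] contains all those of order at most
    [Q], only moments of order greater than [Q] survive. *)
Lemma remainder_bound Q (s : seq (multi_index n)) : uniq s ->
  (forall q i, (q <= Q)%N -> mi_pure q i \in s) ->
  cmod (f psi - \sum_(a <- s) ultra_derivative Om a (density a) psi) <=
  (\sum_(j < T) V j) * (2 * W0) * A * 2^-1 ^+ Q.
Proof.
move=> us hs.
rewrite (f_P tpsi cK KO KmK (fun j y Tj Ky => hT Tj (KmK Ky))).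
under [X in _ - X]eq_bigr do rewrite derivative_formula.
rewrite exchange_big/= -sumrB.
apply: le_trans (cmod_sum _ _ _) _; rewrite !mulr_suml; apply: ler_sum => j _.
have VA : 0 <= V j * A by rewrite mulr_ge0// ltW.
have s3 : summ (fun i => V j * A * 3 * decay (kap i)) by apply: summZ => //; rewrite mulr_ge0.
have b3 (S : nat -> pred nat) i :
    cmod (\sum_(q < (p (kap i)).+1 | S i q) moment j i q) <= V j * A * 3 * decay (kap i).
  apply: le_trans (partial_moments _ _ _) _; rewrite [leRHS]mulrAC.
  by apply: ler_wpM2l; [exact: mulr_ge0|exact: quarter_sum_le2].
rewrite -(csum_sum _ (v := fun=> fun i => V j * A * 3 * decay (kap i)))//; last first.
  by move=> a i; exact: (b3 (fun i q => a == mi_pure q (top (kap i)))).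
pose Z i := \sum_(q < (p (kap i)).+1 | mi_pure q (top (kap i)) \notin s) moment j i q.
have in_s i : \sum_(a <- s) \sum_(q < (p (kap i)).+1 | a == mi_pure q (top (kap i))) moment j i q =
    \sum_(q < (p (kap i)).+1 | mi_pure q (top (kap i)) \in s) moment j i q.
  under eq_bigr do rewrite big_mkcond.
  rewrite exchange_big [RHS]big_mkcond /=; apply: eq_bigr => q _; exact: sum_indicator.
rewrite -(csumB s3 s3); last first.
- by move=> i; rewrite in_s; exact: (b3 (fun i q => mi_pure q (top (kap i)) \in s)).
- by move=> i; exact: (b3 (fun _ _ => true)).
have -> : V j * (2 * W0) * A * 2^-1 ^+ Q = tsum (fun i => V j * A * (2 * 2^-1 ^+ Q) * decay (kap i)).
  rewrite tsumZ -/W0//; last by rewrite mulr_ge0// mulr_ge0// exprn_ge0.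
  by ring.
apply: csum_bound.
  by apply: summZ => //; rewrite mulr_ge0// mulr_ge0// exprn_ge0.
move=> i; rewrite in_s.
rewrite [X in cmod (X - _)](bigID (fun q : 'I__ => mi_pure q (top (kap i)) \in s))/= addrAC subrr add0r.
apply: le_trans (partial_moments (fun q => mi_pure q (top (kap i)) \notin s) _ _) _.
rewrite [leRHS]mulrAC; apply: ler_wpM2l; first exact: mulr_ge0.
apply: le_trans (quarter_sum Q (p (kap i)).+1).
rewrite big_mkcond [leRHS]big_mkcond; apply: ler_sum => q _.
case: ifPn => [ns|_]; last by case: ifP => // _; rewrite exprn_ge0.
by case: ltnP => // /hs h; rewrite h in ns.
Qed.

End on_test_functions.

Let u a := ultra_derivative Om a (density a).

Let Om_open : open Om. Proof. exact: nbhd_of_open. Qed.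

Let u_functional a : lcs_carrier (ultradistributions c M Om) (u a).
Proof.
apply: ultra_derivative_functional => //.
  by apply: continuous_subspaceT; apply: ccont_continuous; exact: ccont_density.
move=> m; have [l [B [l0 B0 hB]]] : exists l B : R, [/\ 0 < l, 0 < B & forall (x : Rn) a,
    cmod (density a x) <= B * (l ^+ mi_size a / M (mi_size a)) * omega x].
  move: density_bound; rewrite /for_class_l; case: c => [[l l0 [B B0 h]]|/(_ 1 ltr01)[B B0 h]].
    by exists l, B.
  by exists 1, B.
have m1 : 0 < `|m| + 1 by rewrite ltr_wpDl.
have [D D0 hD] := omega_translate omega_gt0 omega_sup m1.
exists (B * (l ^+ mi_size a / M (mi_size a)) * (D * omega 0)) => x _ mx.
apply: le_trans (hB x a) _; apply: ler_wpM2l.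
  by rewrite !mulr_ge0 ?invr_ge0 ?exprn_ge0// ltW.
rewrite -[x in omega x]addr0; apply: hD => i.
by rewrite (le_trans (mx i))// (le_trans (ler_norm m))// lerDl.
Qed.

Let f_functional : lcs_carrier (ultradistributions c M Om) f.
Proof. exact: functional_restrict f_ultra. Qed.

Let remainder (s : seq (multi_index n)) := f - \sum_(a <- s) u a.

Let remainder_functional s : lcs_carrier (ultradistributions c M Om) (remainder s).
Proof. by apply: functionalB => //; exact: functional_sum. Qed.

(* The remainder estimate is homogeneous in the test function, so that the
   polar of all the rescaled remainders is a neighbourhood of the origin, and
   it absorbs the bounded sets: hence the uniform convergence. *)
Let V := [set psi | lcs_carrier (test_space c M Om) psi /\ forall Q s, uniq s ->
  (forall q i, (q <= Q)%N -> mi_pure q i \in s) -> cmod (remainder s psi) <= 2^-1 ^+ Q].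

Let V_convex : absolutely_convex V.
Proof.
move=> x y a d [tx hx] [ty hy] ad; split; first exact: test_space_lin.
move=> Q s us hs; have /(functionalP c M_gt0)[lin _] := remainder_functional s.
have tdy : lcs_carrier (test_space c M Om) (d *: y).
  by rewrite -[_ *: _]addr0 -[X in _ + X](scale0r y); exact: test_space_lin.
rewrite lin// (linear_on_testsZ M_gt0 _ lin ty) (le_trans (cmodD _ _))// !cmodM.
move: ad; rewrite !cmodE -rmorphD/= lecR => ad.
apply: (@le_trans _ _ ((cmod a + cmod d) * 2^-1 ^+ Q)).
  by rewrite mulrDl; apply: lerD; rewrite ler_wpM2l ?cmod_ge0 ?hx ?hy.
by rewrite ler_piMl// exprn_ge0.
Qed.

Let V_nbhs : lcs_nbhs0 (test_space c M Om) V.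
Proof.
apply: (test_nbhs0I M_gt0 V_convex) => K cK KO.
have [mK _ KmK] := compact_sub_box cK; have [T hT] := cells_finite mK.
have q0 : 0 < 4^-1 :> R by rewrite invr_gt0.
(* The parameter [l] of the pieces and the parameter [4^-1 / l] of the test functions correspond to
   each other in both classes. *)
apply: (for_class_l_inv q0) P_bound => l l0 [B B0 hB].
have l'0 : 0 < 4^-1 / l :> R by rewrite divr_gt0.
have ll : l * (4^-1 / l) = 4^-1 by rewrite mulrC divfK// gt_eqF.
pose S := (\sum_(j < T) 2 * vol (n := n) mK * (B * omega (hz (kap j)))) * (2 * W0).
have S0 : 0 <= S.
  rewrite /S mulr_ge0 ?mulr_ge0// sumr_ge0// => j _.
  by rewrite !mulr_ge0 ?vol_ge0// ltW.
have S1 : 0 < S + 1 by rewrite ltr_wpDl.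
have e0 : 0 < (S + 1)^-1 by rewrite invr_gt0.
exists (S + 1)^-1 => // psi tpsi bpsi; split; first by apply/(test_spaceP c M_gt0); exists K.
move=> Q s us hs.
have := remainder_bound tpsi cK KO KmK hT l0 l'0 ll B0 hB e0 bpsi us hs.
rewrite /remainder !fctE sum_functions => /le_trans; apply.
rewrite -/S ler_piMl ?exprn_ge0//.
by rewrite ler_pdivrMr// mul1r lerDl.
Qed.

Lemma density_sums : lcs_sums_to (ultradistributions c M Om) u f.
Proof.
split => // U [Bd [e [[Bdc hBd] /cpos_real[eE e0] sub]]].
have [t /cpos_real[tE t0] hV] := hBd V V_nbhs.
(* Chosen so that [t / e <= Q <= 2 ^+ Q]. *)
pose Q := (Num.truncn (complex.Re t / complex.Re e)).+1.
have hQ : complex.Re t * 2^-1 ^+ Q <= complex.Re e.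
  rewrite exprVn ler_pdivrMr ?exprn_gt0// mulrC -ler_pdivrMr//.
  apply: (@le_trans _ _ Q%:R); first by rewrite ltW// truncnS_gt.
  by rewrite -natrX ler_nat ltnW// ltn_expl.
(* The pure multi-indices of order at most [Q]; every finite set containing them has the same
   remainder estimate, which is unconditional convergence. *)
pose A0 : {fset multi_index n} :=
  seq_fset tt [seq mi_pure q i | q <- iota 0 Q.+1, i <- enum 'I_n].
exists A0 => //= A A0A; apply: sub.
have [s [us sA ->]] := partial_sum_seq u A.
split; first exact: remainder_functional.
move=> x Bx; have [y [ty hy] xE] := hV x Bx.
have pure_s q i : (q <= Q)%N -> mi_pure q i \in s.
  move=> qQ; rewrite sA; apply: (fsubsetP A0A).
  rewrite seq_fsetE; apply/allpairsP; exists (q, i).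
  by rewrite mem_iota mem_enum; split.
have /(functionalP c M_gt0)[lin _] := remainder_functional s.
rewrite -/(remainder s) -xE (linear_on_testsZ M_gt0 _ lin ty).
rewrite eE cmodE lecR cmodM tE cmod_real gtr0_norm//.
apply: le_trans hQ; apply: ler_wpM2l; first exact: ltW.
exact: hy.
Qed.

End representation.

Section unbounded_sets.
Context {R : realType} {n : nat} (W : set 'rV[R]_n).
Hypothesis W_unbounded : ~ bounded_set W.

Lemma unbounded_nonempty : W !=set0.
Proof.
apply/set0P/eqP => W0; apply: W_unbounded; exists 0; split => // x _ y.
by rewrite /= W0.
Qed.

(** In dimension 0 every set is bounded. The index obtained is the default of [top_coord]. *)
Lemma unbounded_dim : 'I_n.
Proof.
have n0 : (0 < n)%N.
  rewrite lt0n; apply/eqP => n0; apply: W_unbounded; exists 0; split => // x x0 y _ /=.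
  have -> : y = 0 by apply/rowP => -[j jn]; exfalso; rewrite n0 in jn.
  by rewrite normr0 ltW.
exact: Ordinal n0.
Qed.

End unbounded_sets.

Theorem theorem1 (R : realType) (n : nat) (c : ultra_class) (M : nat -> R)
  (W : set 'rV[R]_n) (omega : 'rV[R]_n -> R)
  (f : ('rV[R]_n -> R[i]^o) -> R[i]^o)
  (M_gt0 : forall p, 0 < M p) (HM1 : M1 M) (HM2 : M2' M) (HM3 : M3' M)
  (W_unbounded : ~ bounded_set W)
  (omega_gt0 : forall x, 0 < omega x)
  (omega_meas : lebesgue_measurable_fun (fun x => (omega x)%:E))
  (omega_sup : Linfty_loc (fun y : 'rV[R]_n =>
     ereal_sup [set (omega (y + x) / omega x)%:E | x in [set: 'rV[R]_n]]))
  (f_ultra : lcs_carrier (ultradistributions c M setT) f) :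
  translate_bigO c M f W omega <->
  forall r : R, 0 < r ->
    exists F : multi_index n -> 'rV[R]_n -> R[i]^o,
      [/\ forall a, {within nbhd_of W r, continuous (F a)},
          for_class_l c (fun l => exists2 C : R, 0 < C &
            forall (x : 'rV[R]_n) (a : multi_index n), nbhd_of W r x ->
              cmod (F a x) <= C * (l ^+ mi_size a / M (mi_size a)) * omega x) &
          lcs_sums_to (ultradistributions c M (nbhd_of W r))
            (fun a => ultra_derivative (nbhd_of W r) a (F a)) f].
Proof.
split; last exact: representation_bigO.
move=> f_bigO r r0.
pose i0 := unbounded_dim W_unbounded.
have W0 := unbounded_nonempty W_unbounded.
have [b [Phi step]] := smooth_step_exists M_gt0 HM3.
have b0 : 0 <= b by case: step.
have [kap [kap_inj kap_surj]] := lattice_enum i0.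
pose N := freq_scale b r.
have [G [G0 G_le G_growth]] := atom_growth M_gt0 HM1 HM3 step i0 f_ultra omega_gt0 f_bigO W0 r0.
have rho0 k : 0 <= fradius i0 N k :> R by exact: fradius_ge0.
(* The exponent [n * 2] is the one of [lattice_decay], which makes the pieces summable over the
   frequencies. *)
have [p [p0 G_p]] := order_choice M_gt0 HM2 HM3 (n * 2) rho0 G0 G_growth.
have [hz hzP] := centers_exist b W r.
have sdecay := lattice_decay_summ (R := R) i0 (isT : (0 < N)%N) kap_inj.
have P_eq0 := piece_eq0 step i0 f (W := W) (r := r) p hz.
have P_cont := ccont_piece step i0 f W r p hz.
have P_bound := piece_bound M_gt0 HM1 step omega_gt0 G0 G_le G_p hzP.
have hz_near k (nk : near_W b W r k) := (hzP k nk).2.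
have f_P := functional_pieces M_gt0 HM1 HM2 HM3 step f_ultra kap_inj kap_surj r0 p0 hzP.
exists (density kap (top_coord (R := R) i0 N) p (piece b Phi i0 f W r p hz)); split.
(* The densities are continuous and bounded as required on the whole space, so the restriction to
   the neighbourhood is immediate. *)
- move=> a; apply: continuous_subspaceT; apply: ccont_continuous.
  exact: (ccont_density M_gt0 omega_gt0 kap_inj b0 _ sdecay P_cont P_eq0 P_bound).
- have hb := density_bound M_gt0 omega_gt0 omega_sup kap_inj r0 b0
    (top_coord (R := R) i0 N) sdecay hz_near P_eq0 P_bound.
  by apply: for_class_l_sub hb => l l0 [B B0 hB]; exists B => // x a _.
- exact: (density_sums M_gt0 f_ultra omega_gt0 omega_sup kap_inj r0 b0 sdecay hz_near
    P_cont P_eq0 P_bound f_P).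
Qed.
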